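(* Let $\mathcal{C}$ be a cofibrantly generated simplicial symmetric monoidal model category such that all of its objects are small relative to the whole category. Let $\mathcal{S}$ be a set of homotopy classes of maps in $\mathcal{C}$ such that the $\mathcal{S}$-equivalences are tensor-closed. Suppose that the colored operads $\mathscr{O}$ and $\mathscr{P}$ in $\mathcal{C}$ (whose algebras are, respectively, the one-colored operads in $\mathcal{C}$ and the pairs consisting of a one-colored operad in $\mathcal{C}$ and an algebra over it) are strongly admissible. Let $(\mathcal{O},A)\in\mathrm{Pairs}(\mathcal{C})$ be cofibrant, and suppose that $A\otimes^{\mathbf{L}}-$ preserves $\mathcal{S}$-equivalences and that $\mathrm{Mod}(A)$ has a good $\mathrm{Env}_{\mathcal{O}}(A)\otimes^{\mathbf{L}}\mathcal{S}$-localization. If $M\to M'$ is an $\mathrm{Env}_{\mathcal{O}}(A)\otimes^{\mathbf{L}}\mathcal{S}$-localization of $M\in\mathrm{Mod}(A)$, then $U(M)\to U(M')$ is an $\mathcal{S}$-localization in $\mathcal{C}$, where $U\colon\mathrm{Mod}(A)\to\mathcal{C}$ is the forgetful functor.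
   Context: Model categories. In a cofibrantly generated model category the (co)domains of the generating (trivial) cofibrations are assumed small relative to the cellular maps they generate. A simplicial symmetric monoidal model category is a (cocomplete, closed) symmetric monoidal model category $\mathcal{C}$, with tensor $\otimes$, unit $I$ and internal hom $\mathrm{Hom}$, equipped with a monoidal Quillen adjunction $i\colon s\mathrm{Sets}\rightleftarrows\mathcal{C}\colon r$ (so $i$ preserves tensor, unit and cofibrations); it is simplicial via $K\otimes X=i(K)\otimes X$, $\mathrm{Map}(X,Y)=r\,\mathrm{Hom}(X,Y)$, $X^K=\mathrm{Hom}(i(K),X)$. Colored operads. For a set $C$ of colors, a $C$-colored collection $\mathcal{L}$ consists of objects $\mathcal{L}(c_1,\dots,c_n;c)$ of $\mathcal{C}$ ($n\ge0$) with right symmetric group actions permuting the inputs; it is pointed if equipped with maps $I\to\mathcal{L}(c;c)$. (Pointed) collections carry the model structure with objectwise weak equivalences and fibrations. A $C$-colored operad is a pointed collection with associative, unital, equivariant composition products; an algebra over it is a family $(X(c))_{c\in C}$ with associative, unital, equivariant structure maps $\mathcal{L}(c_1,\dots,c_n;c)\otimes X(c_1)\otimes\cdots\otimes X(c_n)\to X(c)$. It is admissible if the product model structure on $\mathcal{C}^C$ transfers to a cofibrantly generated model structure on algebras (weak equivalences and fibrations detected in $\mathcal{C}^C$). It is strongly admissible if it receives a weak equivalence $\varphi$ of admissible $C$-colored operads from some $\mathcal{L}'$, inducing a Quillen equivalence $(\varphi_!,\varphi^* )$ on categories of algebras, such that either (i) $\mathcal{L}'$ has an underlying cofibrant $C$-colored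 collection, or (ii) $\mathcal{L}'$ has an underlying cofibrant pointed $C$-colored collection and $\mathcal{C}$ has an additional cofibrantly generated symmetric monoidal model structure with the same weak equivalences and cofibrant unit. Standing assumption: for each set of colors, colored operads in $\mathcal{C}$ have a cofibrantly generated model structure with weak equivalences and fibrations those of underlying collections. The colored operads $\mathscr{O}$ and $\mathscr{P}$. Let $\mathscr{O}^s$ be the $\mathbb{N}$-colored operad in sets with $\mathscr{O}^s(n_1,\dots,n_k;n)$ the set of isomorphism classes of planar connected directed trees in which every vertex has exactly one outgoing edge, there is one root, $k$ vertices numbered by $1,\dots,k$, the vertex numbered $i$ has $n_i$ (ordered) input edges, and $n$ leaves numbered by $1,\dots,n$ (for $k=0$, $n=1$ the tree with one edge and no vertex is allowed); symmetric groups renumber vertices and composition substitutes trees into vertices. $\mathscr{O}$ is its image in $\mathcal{C}$ under $S\mapsto\coprod_S I$. $\mathscr{P}$ has colors $\mathbb{N}\cup\{a\}$: for $n\in\mathbb{N}$, $\mathscr{P}(c_1,\dots,c_k;n)=\mathscr{O}(c_1,\dots,c_k;n)$ if all $c_i\in\mathbb{N}$ and is the initial object otherwise; $\mathscr{P}(c_1,\dots,c_k;a)=\mathscr{O}(c_1',\dots,c_k';0)$ with $c_i'=c_i$ if $c_i\in\mathbb{N}$ and $c_i'=0$ if $c_i=a$; units and composition come from $\mathscr{O}$. $\mathscr{O}$-algebras form the category $\mathrm{Oper}(\mathcal{C})$ of one-colored operads in $\mathcal{C}$, and $\mathscr{P}$-algebras form the category $\mathrm{Pairs}(\mathcal{C})$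 of pairs $(\mathcal{O},A)$ with $\mathcal{O}\in\mathrm{Oper}(\mathcal{C})$ and $A\in\mathrm{Alg}_{\mathcal{O}}(\mathcal{C})$. Cofibrancy in $\mathrm{Pairs}(\mathcal{C})$ refers to the transferred model structure. Modules. For an algebra $A$ over a one-colored operad $\mathcal{O}$, an $A$-module is an object $M$ with equivariant, associative and unital maps $\mathcal{O}(n)\otimes A^{\otimes(k-1)}\otimes M\otimes A^{\otimes(n-k)}\to M$ for $n\ge1$, $1\le k\le n$. The enveloping algebra $\mathrm{Env}_{\mathcal{O}}(A)$ is the monoid in $\mathcal{C}$ with $\mathrm{Mod}(A)\simeq\mathrm{Mod}(\mathrm{Env}_{\mathcal{O}}(A))$ compatibly with the forgetful functors to $\mathcal{C}$. $\mathrm{Mod}(A)$ has the model structure with weak equivalences and fibrations detected in $\mathcal{C}$. $\mathrm{Env}_{\mathcal{O}}(A)\otimes^{\mathbf{L}}\mathcal{S}$ is the image of $\mathcal{S}$ under the left derived functor of $X\mapsto\mathrm{Env}_{\mathcal{O}}(A)\otimes X$, $\mathcal{C}\to\mathrm{Mod}(A)$. ''$A\otimes^{\mathbf{L}}-$ preserves $\mathcal{S}$-equivalences'' means that the derived tensor product in $\mathcal{C}$ of (the underlying object of) $A$ with any $\mathcal{S}$-equivalence is an $\mathcal{S}$-equivalence. Localization. For a simplicial model category $\mathcal{D}$, $\mathrm{map}(X,Y)\simeq\mathrm{Map}(QX,RY)$ is the derived mapping space. Let $\mathcal{S}$ be a set of homotopy classes of maps in $\mathcal{D}$. An object $Z$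 is $\mathcal{S}$-local if $f^*\colon\mathrm{map}(Y,Z)\to\mathrm{map}(X,Z)$ is an isomorphism in $\mathrm{Ho}(s\mathrm{Sets})$ for every representative $f\colon X\to Y$ of an element of $\mathcal{S}$. A map $g\colon X\to Y$ is an $\mathcal{S}$-(local) equivalence if $g^*\colon\mathrm{map}(Y,Z)\to\mathrm{map}(X,Z)$ is an isomorphism in $\mathrm{Ho}(s\mathrm{Sets})$ for every $\mathcal{S}$-local $Z$. An $\mathcal{S}$-localization of $X$ is an $\mathcal{S}$-equivalence $X\to X'$ with $X'$ $\mathcal{S}$-local. $\mathcal{D}$ has a good $\mathcal{S}$-localization if the cofibrations of $\mathcal{D}$ and the $\mathcal{S}$-equivalences define a model structure on $\mathcal{D}$. The $\mathcal{S}$-equivalences (for $\mathcal{D}=\mathcal{C}$) are tensor-closed if they are closed under the derived tensor product. *)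

(* Defs.v *)
From mathcomp Require Import all_boot all_order boolp.

Set Implicit Arguments.
Unset Strict Implicit.
Unset Printing Implicit Defensive.

(** The universe of small sets.  It is a single fixed universe: hom-sets, sets of
    colours, generating sets, cardinals and ordinals are elements of it, while the
    objects of a category may form a larger type. *)
Definition SmallSet := Type.

Declare Scope cat_scope.
Local Open Scope cat_scope.

Record Category := {
  Ob :> Type;
  Hom : Ob -> Ob -> SmallSet;
  idm : forall X, Hom X X;
  compm : forall X Y Z, Hom Y Z -> Hom X Y -> Hom X Z;
  comp1m : forall X Y (f : Hom X Y), compm (idm Y) f = f;
  compm1 : forall X Y (f : Hom X Y), compm f (idm X) = f;
  compmA : forall X Y Z W (h : Hom Z W) (g : Hom Y Z) (f : Hom X Y),
    compm h (compm g f) = compm (compm h g) f }.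
Arguments Hom {c} _ _.
Arguments idm {c} _.
Arguments compm {c X Y Z} _ _.
Notation "g ∘ f" := (compm g f) (at level 40, left associativity) : cat_scope.

Record Functor (C D : Category) := {
  fob :> C -> D;
  fmap : forall X Y, Hom X Y -> Hom (fob X) (fob Y);
  fmap1 : forall X, fmap (idm X) = idm (fob X);
  fmapM : forall X Y Z (g : Hom Y Z) (f : Hom X Y), fmap (g ∘ f) = fmap g ∘ fmap f }.
Arguments fmap {C D} _ {X Y} _.

Definition is_iso (C : Category) (X Y : C) (f : Hom X Y) : Prop :=
  exists g : Hom Y X, g ∘ f = idm X /\ f ∘ g = idm Y.

Definition eqhom (C : Category) (X Y : C) (e : X = Y) : Hom X Y :=
  match e in _ = Y return Hom X Y with erefl => idm X end.

Record Adjunction (C D : Category) (F : Functor C D) (G : Functor D C) := {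
  transp : forall X Y, Hom (F X) Y -> Hom X (G Y);
  untransp : forall X Y, Hom X (G Y) -> Hom (F X) Y;
  transpK : forall X Y (f : Hom (F X) Y), untransp (transp f) = f;
  untranspK : forall X Y (f : Hom X (G Y)), transp (untransp f) = f;
  transp_nat : forall X' X Y Y' (a : Hom X' X) (f : Hom (F X) Y) (b : Hom Y Y'),
    transp (b ∘ f ∘ fmap F a) = fmap G b ∘ transp f ∘ a }.

Definition fully_faithful (C D : Category) (F : Functor C D) : Prop :=
  forall (X Y : C) (g : Hom (F X) (F Y)), exists! f : Hom X Y, fmap F f = g.

Definition essentially_surjective (C D : Category) (F : Functor C D) : Prop :=
  forall Y : D, exists (X : C) (f : Hom (F X) Y), is_iso f.

Definition is_initial (C : Category) (Z : C) : Prop :=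
  forall X : C, exists! _ : Hom Z X, True.
Definition is_terminal (C : Category) (Z : C) : Prop :=
  forall X : C, exists! _ : Hom X Z, True.

Definition is_pushout (C : Category) (A B X P : C) (f : Hom A B) (g : Hom A X)
    (u : Hom B P) (v : Hom X P) : Prop :=
  u ∘ f = v ∘ g /\
  forall (Q : C) (u' : Hom B Q) (v' : Hom X Q), u' ∘ f = v' ∘ g ->
    exists! h : Hom P Q, h ∘ u = u' /\ h ∘ v = v'.

(** Diagrams are indexed by small graphs; a diagram on a small category is a
    diagram on its underlying graph with the same cones and cocones. *)
Record Diagram (C : Category) := {
  dvert : SmallSet;
  dedge : dvert -> dvert -> SmallSet;
  dob : dvert -> C;
  dmap : forall i j, dedge i j -> Hom (dob i) (dob j) }.
Arguments dedge {C} d i j.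
Arguments dob {C} d i.
Arguments dmap {C d i j} _.

Definition is_colimit (C : Category) (D : Diagram C) (Z : C)
    (c : forall i, Hom (dob D i) Z) : Prop :=
  (forall i j (e : dedge D i j), c j ∘ dmap e = c i) /\
  forall (W : C) (w : forall i, Hom (dob D i) W),
    (forall i j (e : dedge D i j), w j ∘ dmap e = w i) ->
    exists! h : Hom Z W, forall i, h ∘ c i = w i.

Definition is_limit (C : Category) (D : Diagram C) (Z : C)
    (c : forall i, Hom Z (dob D i)) : Prop :=
  (forall i j (e : dedge D i j), dmap e ∘ c i = c j) /\
  forall (W : C) (w : forall i, Hom W (dob D i)),
    (forall i j (e : dedge D i j), dmap e ∘ w i = w j) ->
    exists! h : Hom W Z, forall i, c i ∘ h = w i.

Definition cocomplete (C : Category) : Prop :=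
  forall D : Diagram C, exists Z (c : forall i, Hom (dob D i) Z), is_colimit c.
Definition complete (C : Category) : Prop :=
  forall D : Diagram C, exists Z (c : forall i, Hom Z (dob D i)), is_limit c.

Definition MorClass (C : Category) := forall X Y : C, Hom X Y -> Prop.

(** Ordinals are represented by small well-ordered sets. *)
Record WellOrder := {
  wo_car : SmallSet;
  wlt : wo_car -> wo_car -> Prop;
  wlt_wf : well_founded wlt;
  wlt_trans : forall r s t, wlt r s -> wlt s t -> wlt r t;
  wlt_total : forall s t, wlt s t \/ s = t \/ wlt t s }.

Section WellOrders.
Variable T : WellOrder.
Definition wle (s t : wo_car T) : Prop := wlt s t \/ s = t.
Definition wo_min (t : wo_car T) : Prop := forall s, ~ wlt s t.
Definition wo_succ (s t : wo_car T) : Prop := wlt s t /\ ~ exists u, wlt s u /\ wlt u t.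
Definition wo_limit (t : wo_car T) : Prop := ~ wo_min t /\ ~ exists s, wo_succ s t.

(** [T] is a limit ordinal, and it is [K]-filtered: every subset of cardinality at
    most that of [K] has supremum smaller than [T]. *)
Definition wo_filtered (K : SmallSet) : Prop :=
  inhabited (wo_car T) /\ (forall s : wo_car T, exists t, wlt s t) /\
  forall a : K -> wo_car T, exists t, forall k, wlt (a k) t.
End WellOrders.

Section Transfinite.
Variable C : Category.

Definition chain_diagram (T : WellOrder) (P : wo_car T -> Prop) (X : wo_car T -> C)
    (x : forall s t, wle s t -> Hom (X s) (X t)) : Diagram C :=
  {| dvert := {t : wo_car T | P t};
     dedge := fun s t => wle (sval s) (sval t);
     dob := fun t => X (sval t);
     dmap := fun s t e => x (sval s) (sval t) e |}.

(** A [T]-sequence: a functor on the ordinal [T] that preserves colimits at limit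
    stages. *)
Record Sequence (T : WellOrder) := {
  seq_ob :> wo_car T -> C;
  seq_map : forall s t, wle s t -> Hom (seq_ob s) (seq_ob t);
  seq_id : forall t (e : wle t t), seq_map e = idm (seq_ob t);
  seq_comp : forall r s t (e : wle r s) (e' : wle s t) (e'' : wle r t),
    seq_map e'' = seq_map e' ∘ seq_map e;
  seq_cont : forall t, wo_limit t ->
    is_colimit (D := chain_diagram (fun s => wlt s t) seq_map)
      (fun s => seq_map (or_introl (proj2_sig s))) }.

Definition seq_cocone (T : WellOrder) (X : Sequence T) (Z : C)
    (c : forall t, Hom (X t) Z) : Prop :=
  is_colimit (D := chain_diagram (fun _ => True) (@seq_map T X))
    (fun s => c (sval s)).

Definition steps_in (T : WellOrder) (X : Sequence T) (cls : MorClass C) : Prop :=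
  forall s t (e : wle s t), wo_succ s t -> cls _ _ (seq_map X e).

(** [A] is small relative to [cls]: for some cardinal [K], and for all [K]-filtered
    ordinals [T] and [T]-sequences [X] with steps in [cls], the map
    [colim Hom(A, X_t) -> Hom(A, colim X_t)] is bijective. *)
Definition small_relative (cls : MorClass C) (A : C) : Prop :=
  exists K : SmallSet, forall T : WellOrder, wo_filtered T K ->
  forall X : Sequence T, steps_in X cls ->
  forall (Z : C) (c : forall t, Hom (X t) Z), seq_cocone c ->
    (forall g : Hom A Z, exists t (u : Hom A (X t)), g = c t ∘ u) /\
    (forall s t (u : Hom A (X s)) (v : Hom A (X t)), c s ∘ u = c t ∘ v ->
       exists r (e : wle s r) (e' : wle t r), seq_map X e ∘ u = seq_map X e' ∘ v).

Definition small_object (A : C) : Prop := small_relative (fun _ _ _ => True) A.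

Record MapSet := {
  ms_idx : SmallSet;
  ms_src : ms_idx -> C;
  ms_tgt : ms_idx -> C;
  ms_map : forall i, Hom (ms_src i) (ms_tgt i) }.

(** Relative cell complexes: transfinite compositions of pushouts of elements of
    [I]. *)
Inductive cellular (I : MapSet) : MorClass C :=
  Cellular (T : WellOrder) (X : Sequence T) (b : wo_car T) (Z : C)
    (c : forall t, Hom (X t) Z) :
    wo_min b -> seq_cocone c ->
    steps_in X (fun A B f => exists (i : ms_idx I) (u : Hom (ms_src i) A)
                               (v : Hom (ms_tgt i) B), is_pushout (ms_map i) u v f) ->
    cellular I (c b).

End Transfinite.

Record ModelData (D : Category) := {
  WE : MorClass D;
  Cof : MorClass D;
  Fib : MorClass D }.

Definition lifts (D : Category) (A B X Y : D) (f : Hom A B) (g : Hom X Y) : Prop :=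
  forall (u : Hom A X) (v : Hom B Y), v ∘ f = g ∘ u ->
    exists h : Hom B X, h ∘ f = u /\ g ∘ h = v.

Definition is_retract (D : Category) (A B X Y : D) (f : Hom A B) (g : Hom X Y) : Prop :=
  exists (i : Hom A X) (i' : Hom B Y) (r : Hom X A) (r' : Hom Y B),
    [/\ r ∘ i = idm A, r' ∘ i' = idm B, i' ∘ f = g ∘ i & r' ∘ g = f ∘ r].

Section Model.
Variables (D : Category) (M : ModelData D).

Definition TrivCof : MorClass D := fun X Y f => Cof M f /\ WE M f.
Definition TrivFib : MorClass D := fun X Y f => Fib M f /\ WE M f.

Definition retract_closed (cls : MorClass D) : Prop :=
  forall (A B X Y : D) (f : Hom A B) (g : Hom X Y), is_retract f g -> cls _ _ g -> cls _ _ f.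

Record is_model_category : Prop := {
  mc_complete : complete D;
  mc_cocomplete : cocomplete D;
  mc_WE_comp : forall X Y Z (f : Hom X Y) (g : Hom Y Z),
    WE M f -> WE M g -> WE M (g ∘ f);
  mc_WE_left : forall X Y Z (f : Hom X Y) (g : Hom Y Z),
    WE M g -> WE M (g ∘ f) -> WE M f;
  mc_WE_right : forall X Y Z (f : Hom X Y) (g : Hom Y Z),
    WE M f -> WE M (g ∘ f) -> WE M g;
  mc_WE_retract : retract_closed (@WE D M);
  mc_Cof_retract : retract_closed (@Cof D M);
  mc_Fib_retract : retract_closed (@Fib D M);
  mc_lift_TrivCof : forall A B X Y (f : Hom A B) (g : Hom X Y),
    TrivCof f -> Fib M g -> lifts f g;
  mc_lift_TrivFib : forall A B X Y (f : Hom A B) (g : Hom X Y),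
    Cof M f -> TrivFib g -> lifts f g;
  mc_factor_TrivFib : forall X Y (f : Hom X Y),
    exists Z (i : Hom X Z) (p : Hom Z Y), [/\ Cof M i, TrivFib p & p ∘ i = f];
  mc_factor_TrivCof : forall X Y (f : Hom X Y),
    exists Z (i : Hom X Z) (p : Hom Z Y), [/\ TrivCof i, Fib M p & p ∘ i = f] }.

Definition cofibrantly_generated : Prop :=
  exists I J : MapSet D,
    [/\ forall i : ms_idx I, small_relative (cellular I) (ms_src i) /\
                             small_relative (cellular I) (ms_tgt i),
        forall j : ms_idx J, small_relative (cellular J) (ms_src j) /\
                             small_relative (cellular J) (ms_tgt j),
        forall X Y (g : Hom X Y), Fib M g <-> forall j : ms_idx J, lifts (ms_map j) g
      & forall X Y (g : Hom X Y), TrivFib g <-> forall i : ms_idx I, lifts (ms_map i) g].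

Definition cofibrant (X : D) : Prop :=
  forall (Z : D) (u : Hom Z X), is_initial Z -> Cof M u.
Definition fibrant (X : D) : Prop :=
  forall (Z : D) (u : Hom X Z), is_terminal Z -> Fib M u.

Definition cofibrant_replacement (X Q : D) (q : Hom Q X) : Prop :=
  cofibrant Q /\ TrivFib q.
Definition fibrant_replacement (X R : D) (r : Hom X R) : Prop :=
  fibrant R /\ TrivCof r.

(** [f' : QX -> QY] is a cofibrant replacement of the map [f : X -> Y]. *)
Definition cofibrant_replacement_map (X Y QX QY : D) (f : Hom X Y) (f' : Hom QX QY) :
    Prop :=
  exists (q : Hom QX X) (q' : Hom QY Y),
    [/\ cofibrant_replacement q, cofibrant_replacement q' & q' ∘ f' = f ∘ q].

Definition left_homotopic (X Y : D) (f g : Hom X Y) : Prop :=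
  exists (Cyl : D) (i0 i1 : Hom X Cyl) (p : Hom Cyl X) (H : Hom Cyl Y),
    [/\ WE M p, p ∘ i0 = idm X, p ∘ i1 = idm X, H ∘ i0 = f & H ∘ i1 = g].

(** [f] and [g] define the same morphism of the homotopy category. *)
Definition homotopic (X Y : D) (f g : Hom X Y) : Prop :=
  exists (Q R : D) (q : Hom Q X) (r : Hom Y R),
    [/\ cofibrant_replacement q, fibrant_replacement r
      & left_homotopic (r ∘ f ∘ q) (r ∘ g ∘ q)].

(** A set of homotopy classes of maps is given by a small family of maps; the
    following are all the representatives of its elements. *)
Inductive representative (S : MapSet D) : MorClass D :=
  Representative (i : ms_idx S) (g : Hom (ms_src i) (ms_tgt i)) :
    homotopic (ms_map i) g -> representative S g.

End Model.

(** The only candidate model structure with given weak equivalences and fibrations. *)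
Definition model_of_WE_Fib (D : Category) (we fib : MorClass D) : ModelData D :=
  {| WE := we;
     Cof := fun A B f => forall X Y (g : Hom X Y), fib _ _ g -> we _ _ g -> lifts f g;
     Fib := fib |}.

(** The only candidate model structure with given weak equivalences and cofibrations. *)
Definition model_of_WE_Cof (D : Category) (we cof : MorClass D) : ModelData D :=
  {| WE := we;
     Cof := cof;
     Fib := fun X Y g => forall A B (f : Hom A B), cof _ _ f -> we _ _ f -> lifts f g |}.

Section Quillen.
Variables (C D : Category) (MC : ModelData C) (MD : ModelData D).
Variables (F : Functor C D) (G : Functor D C) (adj : Adjunction F G).

Definition is_Quillen_adjunction : Prop :=
  (forall X Y (f : Hom X Y), Cof MC f -> Cof MD (fmap F f)) /\
  (forall X Y (f : Hom X Y), TrivCof MC f -> TrivCof MD (fmap F f)).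

Definition is_Quillen_equivalence : Prop :=
  is_Quillen_adjunction /\
  forall (X : C) (Y : D) (f : Hom (F X) Y), cofibrant MC X -> fibrant MD Y ->
    (WE MD f <-> WE MC (transp adj f)).
End Quillen.

Record MonCat := {
  mon_cat :> Category;
  tens : mon_cat -> mon_cat -> mon_cat;
  tensm : forall X X' Y Y' : mon_cat, Hom X X' -> Hom Y Y' -> Hom (tens X Y) (tens X' Y');
  unitI : mon_cat;
  assoc : forall X Y Z, Hom (tens (tens X Y) Z) (tens X (tens Y Z));
  assocV : forall X Y Z, Hom (tens X (tens Y Z)) (tens (tens X Y) Z);
  lunit : forall X, Hom (tens unitI X) X;
  lunitV : forall X, Hom X (tens unitI X);
  runit : forall X, Hom (tens X unitI) X;
  runitV : forall X, Hom X (tens X unitI);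
  tensm1 : forall X Y, tensm (idm X) (idm Y) = idm (tens X Y);
  tensmM : forall X X' X'' Y Y' Y'' (f' : Hom X' X'') (f : Hom X X')
      (g' : Hom Y' Y'') (g : Hom Y Y'),
    tensm (f' ∘ f) (g' ∘ g) = tensm f' g' ∘ tensm f g;
  assocK : forall X Y Z, assocV X Y Z ∘ assoc X Y Z = idm _;
  assocVK : forall X Y Z, assoc X Y Z ∘ assocV X Y Z = idm _;
  lunitK : forall X, lunitV X ∘ lunit X = idm _;
  lunitVK : forall X, lunit X ∘ lunitV X = idm _;
  runitK : forall X, runitV X ∘ runit X = idm _;
  runitVK : forall X, runit X ∘ runitV X = idm _;
  assoc_nat : forall X X' Y Y' Z Z' (f : Hom X X') (g : Hom Y Y') (h : Hom Z Z'),
    assoc _ _ _ ∘ tensm (tensm f g) h = tensm f (tensm g h) ∘ assoc _ _ _;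
  lunit_nat : forall X Y (f : Hom X Y), lunit Y ∘ tensm (idm unitI) f = f ∘ lunit X;
  runit_nat : forall X Y (f : Hom X Y), runit Y ∘ tensm f (idm unitI) = f ∘ runit X;
  pentagon : forall X Y Z W,
    tensm (idm X) (assoc Y Z W) ∘ assoc X (tens Y Z) W ∘ tensm (assoc X Y Z) (idm W)
    = assoc X Y (tens Z W) ∘ assoc (tens X Y) Z W;
  triangle : forall X Y,
    tensm (idm X) (lunit Y) ∘ assoc X unitI Y = tensm (runit X) (idm Y) }.
Arguments tens {m} _ _.
Arguments tensm {m X X' Y Y'} _ _.
Arguments unitI {m}.
Arguments assoc {m} X Y Z.
Arguments assocV {m} X Y Z.
Arguments lunit {m} X.
Arguments lunitV {m} X.
Arguments runit {m} X.
Arguments runitV {m} X.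
Notation "X ⊗ Y" := (tens X Y) (at level 36, right associativity) : cat_scope.
Notation "f ⊗m g" := (tensm f g) (at level 36, right associativity) : cat_scope.

Record SymMonCat := {
  sym_mon :> MonCat;
  braid : forall X Y : sym_mon, Hom (X ⊗ Y) (Y ⊗ X);
  braidK : forall X Y, braid Y X ∘ braid X Y = idm _;
  braid_nat : forall X X' Y Y' (f : Hom X X') (g : Hom Y Y'),
    braid _ _ ∘ (f ⊗m g) = (g ⊗m f) ∘ braid _ _;
  hexagon : forall X Y Z,
    assoc Y Z X ∘ braid X (Y ⊗ Z) ∘ assoc X Y Z
    = (idm Y ⊗m braid X Z) ∘ assoc Y X Z ∘ (braid X Y ⊗m idm Z) }.
Arguments braid {s} X Y.

Record ClosedSymMonCat := {
  csm_sym :> SymMonCat;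
  ihom : csm_sym -> csm_sym -> csm_sym;
  curry : forall X Y Z : csm_sym, Hom (X ⊗ Y) Z -> Hom X (ihom Y Z);
  uncurry : forall X Y Z : csm_sym, Hom X (ihom Y Z) -> Hom (X ⊗ Y) Z;
  curryK : forall X Y Z (f : Hom (X ⊗ Y) Z), uncurry (curry f) = f;
  uncurryK : forall X Y Z (f : Hom X (ihom Y Z)), curry (uncurry f) = f;
  curry_nat : forall X' X Y Z (a : Hom X' X) (f : Hom (X ⊗ Y) Z),
    curry (f ∘ (a ⊗m idm Y)) = curry f ∘ a }.
Arguments ihom {c} _ _.

Definition ihom_pre (V : ClosedSymMonCat) (X Y Z : V) (f : Hom X Y) :
    Hom (ihom Y Z) (ihom X Z) :=
  curry (uncurry (idm (ihom Y Z)) ∘ (idm (ihom Y Z) ⊗m f)).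

Record StrongMonoidal (V W : MonCat) (F : Functor V W) := {
  smon_tens : forall X Y : V, Hom (F X ⊗ F Y) (F (X ⊗ Y));
  smon_unit : Hom unitI (F unitI);
  smon_tens_iso : forall X Y, is_iso (smon_tens X Y);
  smon_unit_iso : is_iso smon_unit;
  smon_nat : forall X X' Y Y' (f : Hom X X') (g : Hom Y Y'),
    smon_tens X' Y' ∘ (fmap F f ⊗m fmap F g) = fmap F (f ⊗m g) ∘ smon_tens X Y;
  smon_assoc : forall X Y Z,
    fmap F (assoc X Y Z) ∘ smon_tens (X ⊗ Y) Z ∘ (smon_tens X Y ⊗m idm (F Z))
    = smon_tens X (Y ⊗ Z) ∘ (idm (F X) ⊗m smon_tens Y Z) ∘ assoc (F X) (F Y) (F Z);
  smon_lunit : forall X,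
    fmap F (lunit X) ∘ smon_tens unitI X ∘ (smon_unit ⊗m idm (F X)) = lunit (F X);
  smon_runit : forall X,
    fmap F (runit X) ∘ smon_tens X unitI ∘ (idm (F X) ⊗m smon_unit) = runit (F X) }.

(** The model structure [M] on [V] is a symmetric monoidal one: the pushout-product
    axiom and the unit axiom. *)
Definition is_monoidal_model (V : SymMonCat) (M : ModelData V) : Prop :=
  (forall (A B X Y P : V) (f : Hom A B) (g : Hom X Y)
      (u : Hom (A ⊗ Y) P) (v : Hom (B ⊗ X) P) (h : Hom P (B ⊗ Y)),
     is_pushout (idm A ⊗m g) (f ⊗m idm X) u v ->
     h ∘ u = f ⊗m idm Y -> h ∘ v = idm B ⊗m g ->
     Cof M f -> Cof M g -> Cof M h /\ (WE M f \/ WE M g -> WE M h)) /\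
  (forall (Q : V) (q : Hom Q unitI) (X : V),
     cofibrant_replacement M q -> cofibrant M X -> WE M (q ⊗m idm X)).

Definition is_monotone (m n : nat) (f : 'I_m.+1 -> 'I_n.+1) : Prop :=
  forall i j : 'I_m.+1, i <= j -> f i <= f j.
Definition monotone (m n : nat) := {f : 'I_m.+1 -> 'I_n.+1 | is_monotone f}.
Definition mono_id n : monotone n n := exist (@is_monotone n n) id (fun _ _ h => h).
Definition mono_comp m n k (g : monotone n k) (f : monotone m n) : monotone m k :=
  exist (@is_monotone m k) (fun i => sval g (sval f i))
    (fun i j h => svalP g _ _ (svalP f _ _ h)).

Lemma sig_ext (T : Type) (P : T -> Prop) (x y : {t | P t}) : sval x = sval y -> x = y.
Proof. by case: x y => [x p] [y q] /= e; apply: eq_exist. Qed.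

Record SSet := {
  sx :> nat -> SmallSet;
  sact : forall m n, monotone m n -> sx n -> sx m;
  sact_id : forall n (x : sx n), sact (mono_id n) x = x;
  sact_comp : forall m n k (g : monotone n k) (f : monotone m n) (x : sx k),
    sact (mono_comp g f) x = sact f (sact g x) }.
Arguments sact {s m n} _ _.

Definition is_simplicial (X Y : SSet) (f : forall n, X n -> Y n) : Prop :=
  forall m n (a : monotone m n) (x : X n), f m (sact a x) = sact a (f n x).
Definition SMap (X Y : SSet) := {f : forall n, X n -> Y n | is_simplicial f}.

Definition smap_id X : SMap X X :=
  exist (@is_simplicial X X) (fun _ x => x) (fun _ _ _ _ => erefl).
Definition smap_comp X Y Z (g : SMap Y Z) (f : SMap X Y) : SMap X Z.
Proof.
exists (fun n x => sval g n (sval f n x)) => m n a x.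
by rewrite (svalP f) (svalP g).
Defined.

Lemma smap_ext X Y (f g : SMap X Y) : (forall n x, sval f n x = sval g n x) -> f = g.
Proof. by move=> e; apply/sig_ext/functional_extensionality_dep => n; apply: funext. Qed.

Definition sSets : Category.
Proof.
refine {| Ob := SSet; Hom := SMap; idm := smap_id; compm := smap_comp |};
  by move=> *; apply: smap_ext.
Defined.

Definition sprod (X Y : SSet) : SSet.
Proof.
refine {| sx := fun n => (X n * Y n)%type;
          sact := fun m n a z => (sact a z.1, sact a z.2) |}.
- by move=> n [x y] /=; rewrite !sact_id.
- by move=> m n k g f [x y] /=; rewrite !sact_comp.
Defined.

Definition spoint : SSet.
Proof.
by refine {| sx := fun _ => unit; sact := fun _ _ _ z => z |}.
Defined.

Definition sprodm (X X' Y Y' : SSet) (f : SMap X X') (g : SMap Y Y') :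
  SMap (sprod X Y) (sprod X' Y').
Proof.
exists (fun n (z : sprod X Y n) => (sval f n z.1, sval g n z.2)) => m n a z /=.
by rewrite (svalP f) (svalP g).
Defined.

Definition sSets_mon : MonCat.
Proof.
unshelve refine {| mon_cat := sSets; tens := sprod; tensm := sprodm; unitI := spoint |}.
- move=> X Y Z; by exists (fun n (z : sprod (sprod X Y) Z n) => (z.1.1, (z.1.2, z.2))).
- move=> X Y Z; by exists (fun n (z : sprod X (sprod Y Z) n) => ((z.1, z.2.1), z.2.2)).
- move=> X; by exists (fun n (z : sprod spoint X n) => z.2).
- move=> X; by exists (fun n (z : X n) => (tt, z)).
- move=> X; by exists (fun n (z : sprod X spoint n) => z.1).
- move=> X; by exists (fun n (z : X n) => (z, tt)).
- by move=> *; apply: smap_ext => n [].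
- by move=> *; apply: smap_ext => n [].
- by move=> *; apply: smap_ext => n [[]].
- by move=> *; apply: smap_ext => n [? []].
- by move=> *; apply: smap_ext => n [[]].
- by move=> *; apply: smap_ext => n.
- by move=> *; apply: smap_ext => n [? []].
- by move=> *; apply: smap_ext => n.
- by move=> *; apply: smap_ext => n [[]].
- by move=> *; apply: smap_ext => n [].
- by move=> *; apply: smap_ext => n [].
- by move=> *; apply: smap_ext => n [[[]]].
- by move=> *; apply: smap_ext => n [[]].
Defined.

Lemma mono_ext m n (f g : monotone m n) : (forall i, sval f i = sval g i) -> f = g.
Proof. by move=> e; apply/sig_ext/funext. Qed.

Definition simplex (n : nat) : SSet.
Proof.
refine {| sx := fun m => monotone m n; sact := fun _ _ a x => mono_comp x a |};
  by move=> *; apply: mono_ext.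
Defined.

Definition simplex_map m n (a : monotone m n) : SMap (simplex m) (simplex n).
Proof.
exists (fun k (x : simplex m k) => mono_comp a x : simplex n k).
by move=> *; apply: mono_ext.
Defined.

(** The horn [Lambda^k[n]]: the simplices of [Delta[n]] that miss a vertex other
    than [k]. *)
Definition horn (n : nat) (k : 'I_n.+1) : SSet.
Proof.
unshelve refine {| sx := fun m => {x : simplex n m |
                     exists2 j : 'I_n.+1, j <> k & forall i, sval x i <> j} |}.
- move=> m m' a x; exists (sact a (sval x)).
  by case: (svalP x) => j jk xj; exists j => // i; apply: xj.
- by move=> m x; apply: sig_ext; apply: mono_ext.
- by move=> m m' m'' g f x; apply: sig_ext; apply: mono_ext.
Defined.

Definition horn_incl (n : nat) (k : 'I_n.+1) : SMap (horn k) (simplex n) :=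
  exist (@is_simplicial (horn k) (simplex n)) (fun m x => sval x) (fun _ _ _ _ => erefl).

Definition Kan_fibration : MorClass sSets := fun X Y g =>
  forall (n : nat) (k : 'I_n.+2), lifts (horn_incl k : Hom (_ : sSets) _) g.

Definition Kan_complex (X : sSets) : Prop :=
  forall (Z : sSets) (u : Hom X Z), is_terminal Z -> Kan_fibration u.

Definition endpoint (b : 'I_2) : SMap spoint (simplex 1).
Proof.
exists (fun m _ => exist (@is_monotone m 1) (fun _ => b) (fun _ _ _ => leqnn b)).
by move=> *; apply: mono_ext.
Defined.

Definition simplicially_homotopic (X K : sSets_mon) (u v : Hom X K) : Prop :=
  exists H : Hom (X ⊗ (simplex 1 : sSets_mon)) K,
    H ∘ (idm X ⊗m (endpoint ord0 : Hom (_ : sSets_mon) _)) ∘ runitV X = u /\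
    H ∘ (idm X ⊗m (endpoint ord_max : Hom (_ : sSets_mon) _)) ∘ runitV X = v.

(** [f] becomes an isomorphism in [Ho(sSets)]: for all Kan complexes [K] it induces
    a bijection [[Y,K] -> [X,K]] on simplicial homotopy classes of maps. *)
Definition Kan_WE : MorClass sSets := fun X Y f =>
  forall K : sSets, Kan_complex K ->
    (forall u : Hom X K, exists v : Hom Y K, simplicially_homotopic (v ∘ f) u) /\
    (forall v v' : Hom Y K, simplicially_homotopic (v ∘ f) (v' ∘ f) ->
       simplicially_homotopic v v').

Definition sSets_model : ModelData sSets :=
  {| WE := Kan_WE;
     Cof := fun X Y f => forall n, injective (sval f n);
     Fib := Kan_fibration |}.

Record SimplicialSymMonModelCat := {
  ssm_cat :> ClosedSymMonCat;
  ssm_model : ModelData ssm_cat;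
  ssm_is_model : is_model_category ssm_model;
  ssm_is_monoidal : is_monoidal_model ssm_model;
  ssm_i : Functor sSets_mon ssm_cat;
  ssm_r : Functor ssm_cat sSets_mon;
  ssm_adj : Adjunction ssm_i ssm_r;
  ssm_smon : StrongMonoidal ssm_i;
  ssm_Quillen : is_Quillen_adjunction sSets_model ssm_model ssm_i }.

(** The mapping spaces of a simplicial category, with their contravariant
    functoriality. *)
Record MappingSpaces (D : Category) := {
  Map : D -> D -> sSets;
  Map_pre : forall (X Y Z : D), Hom X Y -> Hom (Map Y Z) (Map X Z) }.
Arguments Map {D} _ _ _.
Arguments Map_pre {D} _ {X Y} Z _.

Section Localization.
Variables (D : Category) (M : ModelData D) (m : MappingSpaces D).

(** [f^* : map(Y,Z) -> map(X,Z)] is an isomorphism in [Ho(sSets)], where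
    [map(X,Z) = Map(QX,RZ)]. *)
Definition derived_pre_iso (X Y : D) (f : Hom X Y) (Z : D) : Prop :=
  forall (QX QY RZ : D) (f' : Hom QX QY) (r : Hom Z RZ),
    cofibrant_replacement_map M f f' -> fibrant_replacement M r ->
    Kan_WE (Map_pre m RZ f').

(** [S] is here the class of all representatives of the elements of a set of
    homotopy classes. *)
Variable S : MorClass D.

Definition local_object (Z : D) : Prop :=
  forall (X Y : D) (f : Hom X Y), S f -> derived_pre_iso f Z.

Definition local_equivalence : MorClass D := fun X Y g =>
  forall Z : D, local_object Z -> derived_pre_iso g Z.

Definition is_localization (X X' : D) (f : Hom X X') : Prop :=
  local_equivalence f /\ local_object X'.

Definition has_good_localization : Prop :=
  is_model_category (model_of_WE_Cof local_equivalence (@Cof D M)).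
End Localization.

Section SSMLocalization.
Variable V : SimplicialSymMonModelCat.

Definition ssm_maps : MappingSpaces V :=
  {| Map := fun X Y => ssm_r V (ihom X Y);
     Map_pre := fun X Y Z f => fmap (ssm_r V) (ihom_pre Z f) |}.

Definition derived_tensor_closed (cls : MorClass V) : Prop :=
  forall (X Y X' Y' : V) (f : Hom X Y) (f' : Hom X' Y'), cls _ _ f -> cls _ _ f' ->
  forall (QX QY QX' QY' : V) (g : Hom QX QY) (g' : Hom QX' QY'),
    cofibrant_replacement_map (ssm_model V) f g ->
    cofibrant_replacement_map (ssm_model V) f' g' ->
    cls _ _ (g ⊗m g').

Definition derived_tensor_preserves (A : V) (cls : MorClass V) : Prop :=
  forall (X Y : V) (f : Hom X Y), cls _ _ f ->
  forall (QA QX QY : V) (q : Hom QA A) (g : Hom QX QY),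
    cofibrant_replacement (ssm_model V) q ->
    cofibrant_replacement_map (ssm_model V) f g ->
    cls _ _ (idm QA ⊗m g).
End SSMLocalization.
Fixpoint ords (n : nat) : seq 'I_n :=
  if n is n'.+1 then ord0 :: map (lift ord0) (ords n') else [::].

Lemma ords_enum n : ords n = enum 'I_n.
Proof.
by elim: n => [|n IH] /=; [rewrite enum_ord0 | rewrite enum_ordSl IH].
Qed.

Lemma perm_map_ords (T : eqType) (n : nat) (s : 'I_n -> T) (l : seq T) :
  injective s -> uniq l -> (forall x, x \in l -> exists i, s i = x) ->
  (forall i, s i \in l) -> perm_eq (map s (ords n)) l.
Proof.
move=> s_inj ul sl ls; rewrite ords_enum.
apply: uniq_perm => //; first by rewrite map_inj_uniq ?enum_uniq.
move=> x; apply/mapP/idP => [[i _ ->] //|/sl[i <-]].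
by exists i => //; rewrite mem_enum.
Qed.

Lemma perm_ords m n (s : 'I_m -> 'I_n) : bijective s -> perm_eq (map s (ords m)) (ords n).
Proof.
move=> [t st ts]; rewrite (ords_enum n); apply: perm_map_ords.
- exact: can_inj st.
- exact: enum_uniq.
- by move=> j _; exists (t j).
- by move=> i; rewrite mem_enum.
Qed.

Definition sig_seq n (k : 'I_n -> nat) (l : seq 'I_n) : seq {i : 'I_n & 'I_(k i)} :=
  flatten (map (fun i => map (Tagged (fun i => 'I_(k i))) (ords (k i))) l).

Lemma perm_sig_seq n (k : 'I_n -> nat) :
  perm_eq (sig_seq k (ords n)) (map (@tagnat.sig n k) (ords (\sum_i k i))).
Proof.
rewrite perm_sym; apply: perm_map_ords.
- exact: tagnat.sig_inj.
- apply: allpairs_uniq_dep => [|i _|]; rewrite ?ords_enum ?enum_uniq //.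
  by move=> [i j] [i' j'] _ _ /= ->.
- by move=> x _; exists (tagnat.rank x); rewrite tagnat.rankK.
move=> i; case: (tagnat.sig i) => a b.
apply/flattenP; exists (map (Tagged (fun i => 'I_(k i))) (ords (k a))).
  by apply/mapP; exists a; rewrite // ords_enum mem_enum.
by apply/mapP; exists b; rewrite // ords_enum mem_enum.
Qed.

Section Tensors.
Variable V : SymMonCat.

(** [x_1 ⊗ (x_2 ⊗ ... (x_k ⊗ I))] *)
Fixpoint bt (T : Type) (X : T -> V) (l : seq T) : V :=
  if l is t :: l' then X t ⊗ bt X l' else unitI.

Definition ntens (n : nat) (X : 'I_n -> V) : V := bt X (ords n).

Fixpoint bt_map (T : Type) (X Y : T -> V) (f : forall t, Hom (X t) (Y t)) (l : seq T) :
    Hom (bt X l) (bt Y l) :=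
  match l with
  | [::] => idm _
  | t :: l' => f t ⊗m bt_map f l'
  end.

Definition ntens_map (n : nat) (X Y : 'I_n -> V) (f : forall i, Hom (X i) (Y i)) :
  Hom (ntens X) (ntens Y) := bt_map f (ords n).

(** The remaining maps in this section are the coherence isomorphisms of the
    symmetric monoidal category. *)

Definition left_swap (X Y Z : V) : Hom (X ⊗ (Y ⊗ Z)) (Y ⊗ (X ⊗ Z)) :=
  assoc Y X Z ∘ (braid X Y ⊗m idm Z) ∘ assocV X Y Z.

Definition interchange (A B C D : V) : Hom ((A ⊗ B) ⊗ (C ⊗ D)) ((A ⊗ C) ⊗ (B ⊗ D)) :=
  assocV A C (B ⊗ D) ∘ (idm A ⊗m left_swap B C D) ∘ assoc A B (C ⊗ D).

Fixpoint bt_units (T : Type) (l : seq T) : Hom (bt (fun _ => unitI) l) unitI :=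
  match l with
  | [::] => idm _
  | t :: l' => lunit unitI ∘ (idm unitI ⊗m bt_units l')
  end.

Definition ntens_units (n : nat) : Hom (ntens (fun _ : 'I_n => unitI)) unitI :=
  bt_units (ords n).

Fixpoint bt_unzip (T : Type) (X Y : T -> V) (l : seq T) :
    Hom (bt (fun t => X t ⊗ Y t) l) (bt X l ⊗ bt Y l) :=
  match l with
  | [::] => lunitV unitI
  | t :: l' => interchange _ _ _ _ ∘ (idm _ ⊗m bt_unzip X Y l')
  end.

Definition ntens_unzip (P : V) (n : nat) (X Y : 'I_n -> V) :
    Hom (P ⊗ ntens (fun i => X i ⊗ Y i)) ((P ⊗ ntens X) ⊗ ntens Y) :=
  assocV _ _ _ ∘ (idm P ⊗m bt_unzip X Y (ords n)).

Fixpoint bt_cat (T : Type) (X : T -> V) (l l' : seq T) :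
    Hom (bt X l ⊗ bt X l') (bt X (l ++ l')) :=
  match l with
  | [::] => lunit _
  | t :: l1 => (idm _ ⊗m bt_cat X l1 l') ∘ assoc _ _ _
  end.

Fixpoint bt_flatten (S T : Type) (X : T -> V) (a : S -> seq T) (l : seq S) :
    Hom (bt (fun s => bt X (a s)) l) (bt X (flatten (map a l))) :=
  match l with
  | [::] => idm _
  | s :: l' => bt_cat X (a s) (flatten (map a l')) ∘ (idm _ ⊗m bt_flatten X a l')
  end.

Fixpoint bt_to_map (S T : Type) (X : S -> V) (Y : T -> V) (f : S -> T)
    (e : forall s, X s = Y (f s)) (l : seq S) : Hom (bt X l) (bt Y (map f l)) :=
  match l with
  | [::] => idm _
  | s :: l' => eqhom (e s) ⊗m bt_to_map e l'
  end.

Fixpoint bt_of_map (S T : Type) (Y : T -> V) (f : S -> T) (l : seq S) :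
    Hom (bt Y (map f l)) (bt (fun s => Y (f s)) l) :=
  match l with
  | [::] => idm _
  | s :: l' => idm _ ⊗m bt_of_map Y f l'
  end.

Section Shuffle.
Variables (T : eqType) (X : T -> V).

Lemma mem_tail (x y : T) (l : seq T) : x \in y :: l -> y <> x -> x \in l.
Proof. by rewrite inE => /orP[/eqP->|]. Qed.

Fixpoint bt_pull (x : T) (l : seq T) : x \in l -> Hom (bt X l) (X x ⊗ bt X (rem x l)) :=
  match l with
  | [::] => fun h => match notF h with end
  | y :: l' => fun h =>
      match @eqP _ y x in reflect _ b
        return Hom (X y ⊗ bt X l') (X x ⊗ bt X (if b then l' else y :: rem x l')) with
      | ReflectT e => eqhom (congr1 X e) ⊗m idm _
      | ReflectF ne => left_swap _ _ _ ∘ (idm _ ⊗m bt_pull (mem_tail h ne))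
      end
  end.

Lemma perm_nilE (l : seq T) : perm_eq l [::] -> l = [::].
Proof. by move/perm_nilP. Qed.
Lemma perm_head (x : T) (l t : seq T) : perm_eq l (x :: t) -> x \in l.
Proof. by move/perm_mem->; exact: mem_head. Qed.
Lemma perm_behead (x : T) (l t : seq T) : perm_eq l (x :: t) -> perm_eq (rem x l) t.
Proof.
move=> h; rewrite -(perm_cons x); apply: (perm_trans _ h).
by rewrite perm_sym; apply: perm_to_rem; apply: perm_head h.
Qed.

(** Reordering of the factors (applied below to duplicate-free lists). *)
Fixpoint bt_shuffle (l' l : seq T) : perm_eq l l' -> Hom (bt X l) (bt X l') :=
  match l' with
  | [::] => fun h => eqhom (congr1 (bt X) (perm_nilE h))
  | x :: t => fun h => (idm _ ⊗m bt_shuffle (perm_behead h)) ∘ bt_pull (perm_head h)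
  end.
End Shuffle.

(** [⊗_i X_i -> ⊗_j Y_j], matching the factor [X_i] with [Y_(s i)]. *)
Definition ntens_reindex (m n : nat) (X : 'I_m -> V) (Y : 'I_n -> V) (s : 'I_m -> 'I_n)
    (bs : bijective s) (e : forall i, X i = Y (s i)) : Hom (ntens X) (ntens Y) :=
  bt_shuffle Y (perm_ords bs) ∘ bt_to_map e (ords m).

(** [⊗_i ⊗_j X_ij -> ⊗_(i,j) X_ij], pairs being ordered lexicographically. *)
Definition ntens_flat (n : nat) (k : 'I_n -> nat) (X : forall i, 'I_(k i) -> V) :
    Hom (ntens (fun i => ntens (X i)))
        (ntens (fun m : 'I_(\sum_i k i) => X (tagnat.sig1 m) (tagnat.sig2 m))) :=
  let Y (z : {i : 'I_n & 'I_(k i)}) := X (tag z) (tagged z) in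
  bt_of_map Y (@tagnat.sig n k) (ords (\sum_i k i))
  ∘ bt_shuffle Y (perm_sig_seq k)
  ∘ bt_flatten Y (fun i => map (Tagged (fun i => 'I_(k i))) (ords (k i))) (ords n)
  ∘ bt_map (fun i => @bt_to_map _ _ (X i) Y (Tagged (fun i => 'I_(k i))) (fun j => erefl)
                       (ords (k i))) (ords n).

End Tensors.

#[local] Set Primitive Projections.
Record Profile (K : SmallSet) := Prof { len : nat; col : 'I_len -> K }.
#[local] Unset Primitive Projections.
Arguments Prof {K} len col.
Arguments len {K} p.
Arguments col {K} p _.

(** The permutations [s] with [(c'_1, ..., c'_n) = (c_s(1), ..., c_s(n))]. *)
Record ProfPerm (K : SmallSet) (p' p : Profile K) := {
  pperm :> 'I_(len p') -> 'I_(len p);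
  pperm_bij : bijective pperm;
  pperm_col : forall i, col p' i = col p (pperm i) }.

Definition prof1 (K : SmallSet) (c : K) : Profile K := Prof 1 (fun _ => c).

Definition concat (K : SmallSet) (n : nat) (q : 'I_n -> Profile K) : Profile K :=
  Prof (\sum_i len (q i)) (fun m => col (q (tagnat.sig1 m)) (tagnat.sig2 m)).

Definition prof_map (K K' : SmallSet) (f : K -> K') (p : Profile K) : Profile K' :=
  Prof (len p) (fun i => f (col p i)).

Definition pperm_map (K K' : SmallSet) (f : K -> K') (p' p : Profile K)
    (s : ProfPerm p' p) : ProfPerm (prof_map f p') (prof_map f p) :=
  {| pperm := (s : 'I_(len (prof_map f p')) -> 'I_(len (prof_map f p)));
     pperm_bij := pperm_bij s;
     pperm_col := fun i => congr1 f (pperm_col s i) |}.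

Section Operads.
Variable V : SymMonCat.

Record Collection (K : SmallSet) := {
  cob :> Profile K -> K -> V;
  cact : forall p' p d, ProfPerm p' p -> Hom (cob p d) (cob p' d);
  cact_id : forall p d (s : ProfPerm p p), (forall i, s i = i) -> cact d s = idm _;
  cact_comp : forall p'' p' p d (s : ProfPerm p' p) (t : ProfPerm p'' p')
      (u : ProfPerm p'' p), (forall i, u i = s (t i)) -> cact d u = cact d t ∘ cact d s }.
Arguments cact {K} c {p' p} d s.

Record PointedCollection (K : SmallSet) := {
  pcoll :> Collection K;
  pt : forall c, Hom unitI (pcoll (prof1 c) c) }.

Record Operad (K : SmallSet) := {
  opcoll :> Collection K;
  opunit : forall c, Hom unitI (opcoll (prof1 c) c);
  (* L(c_1..c_n;d) ⊗ L(q_1;c_1) ⊗ ... ⊗ L(q_n;c_n) -> L(q_1...q_n;d) *)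
  opcomp : forall (p : Profile K) (q : 'I_(len p) -> Profile K) (d : K),
    Hom (opcoll p d ⊗ ntens (fun i => opcoll (q i) (col p i))) (opcoll (concat q) d);
  op_equivariant : forall (p' p : Profile K) (s : ProfPerm p' p)
      (q' : 'I_(len p') -> Profile K) (q : 'I_(len p) -> Profile K)
      (t : forall i, ProfPerm (q' i) (q (s i))) (d : K)
      (u : ProfPerm (concat q') (concat q)),
    (forall m, u m = tagnat.Rank (s (tagnat.sig1 m)) (t _ (tagnat.sig2 m))) ->
    opcomp q' d ∘ (cact opcoll d s ⊗m ntens_map (fun i => cact opcoll (col p' i) (t i)))
    = cact opcoll d u ∘ opcomp q d
      ∘ (idm _ ⊗m ntens_reindex (Y := fun i => opcoll (q i) (col p i)) (pperm_bij s)
                    (fun i => congr1 (opcoll (q (s i))) (pperm_col s i)));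
  op_unit_left : forall (q : Profile K) (d : K)
      (u : ProfPerm q (concat (fun _ : 'I_(len (prof1 d)) => q))),
    (forall i, u i = i :> nat) ->
    cact opcoll d u ∘ opcomp (p := prof1 d) (fun _ => q) d ∘ (opunit d ⊗m runitV _)
      ∘ lunitV (opcoll q d) = idm _;
  op_unit_right : forall (p : Profile K) (d : K)
      (u : ProfPerm p (concat (fun i => prof1 (col p i)))),
    (forall i, u i = i :> nat) ->
    cact opcoll d u ∘ opcomp (fun i => prof1 (col p i)) d
      ∘ (idm _ ⊗m ntens_map (fun i => opunit (col p i)))
    = runit (opcoll p d) ∘ (idm _ ⊗m ntens_units V (len p));
  op_assoc : forall (p : Profile K) (q : 'I_(len p) -> Profile K)
      (r : forall i, 'I_(len (q i)) -> Profile K) (d : K)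
      (u : ProfPerm (concat (fun i => concat (r i)))
                    (concat (fun m : 'I_(len (concat q)) =>
                               r (tagnat.sig1 m) (tagnat.sig2 m)))),
    (forall i, u i = i :> nat) ->
    opcomp (fun i => concat (r i)) d
      ∘ (idm _ ⊗m ntens_map (fun i => opcomp (r i) (col p i)))
    = cact opcoll d u
      ∘ opcomp (p := concat q) (fun m => r (tagnat.sig1 m) (tagnat.sig2 m)) d
      ∘ (opcomp q d ⊗m ntens_flat (fun i j => opcoll (r i j) (col (q i) j)))
      ∘ ntens_unzip _ _ _ }.

Definition op_pointed (K : SmallSet) (L : Operad K) : PointedCollection K :=
  {| pcoll := L; pt := opunit L |}.

End Operads.
Definition fam_cat (C : Category) (I : SmallSet) : Category.
Proof.
refine {| Ob := I -> C; Hom := fun X Y => forall i, Hom (X i) (Y i);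
          idm := fun X i => idm (X i); compm := fun X Y Z g f i => g i ∘ f i |}.
- by move=> X Y f; apply: functional_extensionality_dep => i; rewrite comp1m.
- by move=> X Y f; apply: functional_extensionality_dep => i; rewrite compm1.
- by move=> X Y Z W h g f; apply: functional_extensionality_dep => i; rewrite compmA.
Defined.

(** Objects of [B] with additional structure; the maps are those of [B] that
    respect the structure. *)
Section Structured.
Variables (B : Category) (T : Type) (u : T -> B).
Variable P : forall X Y : T, Hom (u X) (u Y) -> Prop.
Hypothesis P1 : forall X, P (idm (u X)).
Hypothesis PM : forall X Y Z (g : Hom (u Y) (u Z)) (f : Hom (u X) (u Y)),
  P g -> P f -> P (g ∘ f).

Definition structured_cat : Category.
Proof.
refine {| Ob := T; Hom := fun X Y => {f : Hom (u X) (u Y) | P f};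
          idm := fun X => exist (@P X X) (idm (u X)) (P1 X);
          compm := fun X Y Z g f =>
            exist (@P X Z) (sval g ∘ sval f) (PM (svalP g) (svalP f)) |}.
- by move=> X Y f; apply: sig_ext; rewrite /= comp1m.
- by move=> X Y f; apply: sig_ext; rewrite /= compm1.
- by move=> X Y Z W h g f; apply: sig_ext; rewrite /= compmA.
Defined.
End Structured.

Definition objectwise_model (V : Category) (M : ModelData V) (I : SmallSet) (T : Type)
    (u : T -> fam_cat V I) P P1 PM : ModelData (@structured_cat (fam_cat V I) T u P P1 PM) :=
  model_of_WE_Fib (D := structured_cat P1 PM)
    (fun X Y f => forall i, WE M (sval f i)) (fun X Y f => forall i, Fib M (sval f i)).

Section TensorLemmas.
Variable V : SymMonCat.

Lemma tensm_l (X X' Y Y' : V) (f : Hom X X') (g : Hom Y Y') :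
  (f ⊗m idm Y') ∘ (idm X ⊗m g) = f ⊗m g.
Proof. by rewrite -tensmM compm1 comp1m. Qed.
Lemma tensm_r (X X' Y Y' : V) (f : Hom X X') (g : Hom Y Y') :
  (idm X' ⊗m g) ∘ (f ⊗m idm Y) = f ⊗m g.
Proof. by rewrite -tensmM compm1 comp1m. Qed.

Lemma bt_map1 (T : Type) (X : T -> V) l : bt_map (fun t => idm (X t)) l = idm (bt X l).
Proof. by elim: l => //= t l ->; rewrite tensm1. Qed.
Lemma bt_mapM (T : Type) (X Y Z : T -> V) (g : forall t, Hom (Y t) (Z t))
    (f : forall t, Hom (X t) (Y t)) l :
  bt_map (fun t => g t ∘ f t) l = bt_map g l ∘ bt_map f l.
Proof. by elim: l => [|t l IH] /=; rewrite ?comp1m // IH tensmM. Qed.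
Lemma ntens_map1 n (X : 'I_n -> V) : ntens_map (fun i => idm (X i)) = idm (ntens X).
Proof. exact: bt_map1. Qed.
Lemma ntens_mapM n (X Y Z : 'I_n -> V) (g : forall t, Hom (Y t) (Z t))
    (f : forall t, Hom (X t) (Y t)) :
  ntens_map (fun t => g t ∘ f t) = ntens_map g ∘ ntens_map f.
Proof. exact: bt_mapM. Qed.

Lemma assocV_nat (X X' Y Y' Z Z' : V) (f : Hom X X') (g : Hom Y Y') (h : Hom Z Z') :
  assocV _ _ _ ∘ (f ⊗m (g ⊗m h)) = ((f ⊗m g) ⊗m h) ∘ assocV _ _ _.
Proof.
rewrite -[LHS]compm1 -(assocVK X Y Z) !compmA -(compmA (assocV _ _ _)) -assoc_nat.
by rewrite compmA assocK comp1m.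
Qed.

Lemma lunitV_nat (X Y : V) (f : Hom X Y) : lunitV Y ∘ f = (idm unitI ⊗m f) ∘ lunitV X.
Proof.
by rewrite -[LHS]compm1 -(lunitVK X) compmA -(compmA (lunitV Y)) -lunit_nat compmA lunitK comp1m.
Qed.

Lemma left_swap_nat (X X' Y Y' Z Z' : V) (f : Hom X X') (g : Hom Y Y') (h : Hom Z Z') :
  left_swap _ _ _ ∘ (f ⊗m (g ⊗m h)) = (g ⊗m (f ⊗m h)) ∘ left_swap _ _ _.
Proof.
rewrite /left_swap -(compmA _ (assocV _ _ _)) assocV_nat !compmA -assoc_nat.
congr (_ ∘ _); rewrite -!compmA; congr (_ ∘ _).
by rewrite -!tensmM braid_nat comp1m compm1.
Qed.

Lemma interchange_nat (A B C D A' B' C' D' : V) (a : Hom A A') (b : Hom B B')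
    (c : Hom C C') (d : Hom D D') :
  interchange _ _ _ _ ∘ ((a ⊗m b) ⊗m (c ⊗m d))
  = ((a ⊗m c) ⊗m (b ⊗m d)) ∘ interchange _ _ _ _.
Proof.
rewrite /interchange -(compmA _ (assoc _ _ _)) assoc_nat !compmA -assocV_nat.
congr (_ ∘ _); rewrite -!compmA; congr (_ ∘ _).
by rewrite -!tensmM left_swap_nat comp1m compm1.
Qed.

Lemma bt_unzip_nat (T : Type) (X Y X' Y' : T -> V) (f : forall t, Hom (X t) (X' t))
    (g : forall t, Hom (Y t) (Y' t)) l :
  bt_unzip X' Y' l ∘ bt_map (fun t => f t ⊗m g t) l
  = (bt_map f l ⊗m bt_map g l) ∘ bt_unzip X Y l.
Proof.
elim: l => [|t l IH] /=; first by rewrite compm1 tensm1 comp1m.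
rewrite -compmA -tensmM comp1m IH -[f t ⊗m g t]compm1 tensmM compmA interchange_nat.
by rewrite !compmA.
Qed.

Lemma ntens_unzip_nat (P P' : V) (p : Hom P P') n (X Y X' Y' : 'I_n -> V)
    (f : forall t, Hom (X t) (X' t)) (g : forall t, Hom (Y t) (Y' t)) :
  ntens_unzip P' X' Y' ∘ (p ⊗m ntens_map (fun i => f i ⊗m g i))
  = ((p ⊗m ntens_map f) ⊗m ntens_map g) ∘ ntens_unzip P X Y.
Proof.
rewrite /ntens_unzip -compmA -tensmM bt_unzip_nat comp1m -[p]compm1 tensmM !compmA.
by rewrite assocV_nat compm1.
Qed.
End TensorLemmas.

Section OperadCategories.
Variables (V : SymMonCat) (K : SmallSet).

Definition coll_fam (L : Collection V K) : fam_cat V (Profile K * K)%type :=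
  fun z => L z.1 z.2.

Definition is_coll_map (L L' : Collection V K) (f : Hom (coll_fam L) (coll_fam L')) : Prop :=
  forall p' p d (s : ProfPerm p' p),
    f (p', d) ∘ cact L d s = cact L' d s ∘ f (p, d).

Definition is_pcoll_map (L L' : PointedCollection V K)
    (f : Hom (coll_fam L) (coll_fam L')) : Prop :=
  is_coll_map f /\ forall c, f (prof1 c, c) ∘ pt L c = pt L' c.

Definition is_operad_map (L L' : Operad V K) (f : Hom (coll_fam L) (coll_fam L')) : Prop :=
  [/\ is_coll_map f,
      forall c, f (prof1 c, c) ∘ opunit L c = opunit L' c
    & forall p (q : 'I_(len p) -> Profile K) d,
        f (concat q, d) ∘ opcomp L q d
        = opcomp L' q d ∘ (f (p, d) ⊗m ntens_map (fun i => f (q i, col p i)))].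

Lemma coll_map1 (L : Collection V K) : is_coll_map (idm (coll_fam L)).
Proof. by move=> *; rewrite /= comp1m compm1. Qed.
Lemma coll_mapM (L L' L'' : Collection V K) (g : Hom (coll_fam L') (coll_fam L''))
    (f : Hom (coll_fam L) (coll_fam L')) :
  is_coll_map g -> is_coll_map f -> is_coll_map (g ∘ f).
Proof. by move=> hg hf p' p d s /=; rewrite -compmA hf compmA hg compmA. Qed.

Lemma pcoll_map1 (L : PointedCollection V K) : is_pcoll_map (idm (coll_fam L)).
Proof. by split=> [|c] /=; [exact: coll_map1 | rewrite comp1m]. Qed.
Lemma pcoll_mapM (L L' L'' : PointedCollection V K) (g : Hom (coll_fam L') (coll_fam L''))
    (f : Hom (coll_fam L) (coll_fam L')) :
  is_pcoll_map g -> is_pcoll_map f -> is_pcoll_map (g ∘ f).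
Proof.
move=> [g1 g2] [f1 f2]; split=> [|c] /=; first exact: coll_mapM.
by rewrite -compmA f2 g2.
Qed.

Lemma operad_map1 (L : Operad V K) : is_operad_map (idm (coll_fam L)).
Proof.
split=> [|c|p q d] /=; [exact: coll_map1 | by rewrite comp1m |].
by rewrite ntens_map1 tensm1 comp1m compm1.
Qed.
Lemma operad_mapM (L L' L'' : Operad V K) (g : Hom (coll_fam L') (coll_fam L''))
    (f : Hom (coll_fam L) (coll_fam L')) :
  is_operad_map g -> is_operad_map f -> is_operad_map (g ∘ f).
Proof.
move=> [g1 g2 g3] [f1 f2 f3]; split=> [|c|p q d] /=; first exact: coll_mapM.
  by rewrite -compmA f2 g2.
by rewrite -compmA f3 compmA g3 ntens_mapM tensmM compmA.
Qed.

Definition coll_cat : Category := structured_cat coll_map1 coll_mapM.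
Definition pcoll_cat : Category := structured_cat pcoll_map1 pcoll_mapM.
Definition operad_cat : Category := structured_cat operad_map1 operad_mapM.

Variable M : ModelData V.
Definition coll_model : ModelData coll_cat := objectwise_model M coll_map1 coll_mapM.
Definition pcoll_model : ModelData pcoll_cat := objectwise_model M pcoll_map1 pcoll_mapM.
Definition operad_model : ModelData operad_cat :=
  objectwise_model M operad_map1 operad_mapM.

End OperadCategories.

(** The axioms for an action of a [K]-coloured operad [L] on a family [X] of objects
    indexed by a set [S] of sorts, where the sort [s] is regarded as having the
    colour [c s], and only the operations whose sorts satisfy [ok] act. *)
Section Actions.
Variables (V : SymMonCat) (K : SmallSet) (L : Operad V K).
Variables (S : SmallSet) (c : S -> K) (ok : Profile S -> S -> Prop) (X : S -> V).
Variable act : forall p d, ok p d ->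
  Hom (L (prof_map c p) (c d) ⊗ ntens (fun i => X (col p i))) (X d).

Record is_action : Prop := {
  act_equivariant : forall p' p (s : ProfPerm p' p) d (h' : ok p' d) (h : ok p d),
    act h' ∘ (cact L (c d) (pperm_map c s) ⊗m idm _)
    = act h ∘ (idm _ ⊗m ntens_reindex (Y := fun i => X (col p i)) (pperm_bij s)
                          (fun i => congr1 X (pperm_col s i)));
  act_unit : forall d (h : ok (prof1 d) d),
    act h ∘ (opunit L (c d) ⊗m runitV _) ∘ lunitV (X d) = idm _;
  act_assoc : forall (p : Profile S) (q : 'I_(len p) -> Profile S) d (h : ok p d)
      (hq : forall i, ok (q i) (col p i)) (h' : ok (concat q) d),
    act h ∘ (idm _ ⊗m ntens_map (fun i => act (hq i)))
    = act h'
      ∘ (opcomp L (p := prof_map c p) (fun i => prof_map c (q i)) (c d)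
           ⊗m ntens_flat (fun i j => X (col (q i) j)))
      ∘ ntens_unzip _ _ _ }.
End Actions.

Section Algebras.
Variables (V : SymMonCat) (K : SmallSet).

Record Algebra (L : Operad V K) := {
  alg_ob :> K -> V;
  alg_act : forall p d, Hom (L p d ⊗ ntens (fun i => alg_ob (col p i))) (alg_ob d);
  alg_law : is_action (L := L) (c := id) (ok := fun _ _ => True) (X := alg_ob)
              (fun p d _ => alg_act p d) }.
Arguments alg_act {L} a p d.

Definition alg_fam (L : Operad V K) (X : Algebra L) : fam_cat V K := X.

Definition is_alg_map (L : Operad V K) (X Y : Algebra L) (f : Hom (alg_fam X) (alg_fam Y)) :
    Prop :=
  forall p d, f d ∘ alg_act X p d
    = alg_act Y p d ∘ (idm _ ⊗m ntens_map (fun i => f (col p i))).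

Lemma alg_map1 L (X : Algebra L) : is_alg_map (idm (alg_fam X)).
Proof. by move=> p d /=; rewrite ntens_map1 tensm1 comp1m compm1. Qed.
Lemma alg_mapM L (X Y Z : Algebra L) (g : Hom (alg_fam Y) (alg_fam Z))
    (f : Hom (alg_fam X) (alg_fam Y)) :
  is_alg_map g -> is_alg_map f -> is_alg_map (g ∘ f).
Proof.
move=> hg hf p d /=; rewrite -compmA hf compmA hg -compmA -tensmM comp1m.
by rewrite -ntens_mapM.
Qed.

Definition alg_cat (L : Operad V K) : Category :=
  structured_cat (@alg_map1 L) (@alg_mapM L).
Definition alg_model (M : ModelData V) (L : Operad V K) : ModelData (alg_cat L) :=
  objectwise_model M (@alg_map1 L) (@alg_mapM L).

Section Pullback.
Variables (L' L : Operad V K) (phi : @Hom (operad_cat V K) L' L).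

Lemma pullback_action (X : Algebra L) :
  is_action (L := L') (c := id) (ok := fun _ _ => True) (X := alg_ob X)
    (fun p d _ => alg_act X p d ∘ (sval phi (p, d) ⊗m idm _)).
Proof.
case: phi => f [f1 f2 f3] /=; case: (alg_law X) => x1 x2 x3; split.
- move=> p' p s d _ _; rewrite -compmA -tensmM comp1m.
  have e := f1 _ _ d (pperm_map id s).
  etransitivity; first exact: (congr1 (fun z => alg_act X p' d ∘ (z ⊗m idm _)) e).
  rewrite -[idm _]comp1m tensmM compmA; have /= e1 := x1 p' p s d I I.
  etransitivity; first exact: (congr1 (fun z => z ∘ (f (p, d) ⊗m idm _)) e1).
  by rewrite -!compmA tensm_l tensm_r.
- move=> d _.
  change (alg_act X (prof1 d) d ∘ (f (prof1 d, d) ⊗m idm _)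
          ∘ (opunit L' d ⊗m runitV _) ∘ lunitV (X d) = idm _).
  by rewrite -(compmA _ (_ ⊗m idm _)) -tensmM comp1m f2; exact: (x2 d I).
- move=> p q d _ _ _.
  change (alg_act X p d ∘ (f (p, d) ⊗m idm _)
    ∘ (idm _ ⊗m ntens_map (fun i => alg_act X (q i) (col p i)
                                     ∘ (f (q i, col p i) ⊗m idm _)))
    = alg_act X (concat q) d ∘ (f (concat q, d) ⊗m idm _)
    ∘ (opcomp L' q d ⊗m ntens_flat (fun i j => X (col (q i) j))) ∘ ntens_unzip _ _ _).
  have e : alg_act X p d ∘ (idm _ ⊗m ntens_map (fun i => alg_act X (q i) (col p i)))
    = alg_act X (concat q) d
    ∘ (opcomp L q d ⊗m ntens_flat (fun i j => X (col (q i) j))) ∘ ntens_unzip _ _ _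
    by exact: (x3 p q d I (fun _ => I) I).
  rewrite ntens_mapM -(compmA _ (_ ⊗m idm _)) tensm_l -[f (p, d)]comp1m tensmM compmA e.
  rewrite -(compmA _ (ntens_unzip _ _ _)) ntens_unzip_nat compmA ntens_map1.
  congr (_ ∘ _); rewrite -!compmA; congr (_ ∘ _).
  by rewrite -!tensmM f3 compm1 comp1m.
Qed.

Definition pullback_alg (X : Algebra L) : Algebra L' :=
  {| alg_ob := alg_ob X;
     alg_act := fun p d => alg_act X p d ∘ (sval phi (p, d) ⊗m idm _);
     alg_law := pullback_action X |}.

Definition pullback : Functor (alg_cat L) (alg_cat L').
Proof.
unshelve refine {| fob := pullback_alg : alg_cat L -> alg_cat L';
  fmap := fun X Y f => exist (@is_alg_map L' (pullback_alg X) (pullback_alg Y)) (sval f) _ |}.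
- case: f => f hf p d /=; rewrite compmA hf -!compmA; congr (_ ∘ _).
  by rewrite tensm_l tensm_r.
- by move=> X; apply: sig_ext.
- by move=> X Y Z g f; apply: sig_ext.
Defined.
End Pullback.
End Algebras.
Section Admissible.
Variables (V : SymMonCat) (M : ModelData V) (K : SmallSet).

Definition admissible (L : Operad V K) : Prop :=
  is_model_category (alg_model M L) /\ cofibrantly_generated (alg_model M L).

Definition has_cofibrant_unit_model : Prop :=
  exists M' : ModelData V,
    (forall X Y (f : Hom X Y), WE M' f <-> WE M f) /\
    [/\ is_model_category M', cofibrantly_generated M', is_monoidal_model M'
      & cofibrant M' unitI].

Definition strongly_admissible (L : Operad V K) : Prop :=
  exists (L' : Operad V K) (phi : @Hom (operad_cat V K) L' L),
    [/\ admissible L, admissible L', WE (operad_model K M) phi,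
        exists (F : Functor (alg_cat L') (alg_cat L)) (adj : Adjunction F (pullback phi)),
          is_Quillen_equivalence (alg_model M L') (alg_model M L) adj
      & cofibrant (coll_model K M) (opcoll L') \/
        (cofibrant (pcoll_model K M) (op_pointed L') /\ has_cofibrant_unit_model)].
End Admissible.

(** Planar trees whose vertices carry labels [v : 'I_n], a vertex labelled [v]
    having [ar v] ordered inputs, and whose leaves carry labels in [L].  [Leaf] is
    the tree with one edge and no vertex; [Node v ch] has root vertex [v], and [ch i]
    is grafted onto its [i]-th input.  Such trees have no non-trivial isomorphism. *)
Inductive tree (n : nat) (ar : 'I_n -> nat) (L : Type) :=
| Leaf (l : L)
| Node (v : 'I_n) (ch : 'I_(ar v) -> tree ar L).
Arguments Leaf {n ar L} l.
Arguments Node {n ar L} v ch.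

Section Trees.
Variables (n : nat) (ar : 'I_n -> nat) (L : Type).

Fixpoint vertices (t : tree ar L) : seq 'I_n :=
  match t with
  | Leaf _ => [::]
  | Node v ch => v :: flatten (map (fun i => vertices (ch i)) (enum 'I_(ar v)))
  end.

Fixpoint leaves (t : tree ar L) : seq L :=
  match t with
  | Leaf l => [:: l]
  | Node v ch => flatten (map (fun i => leaves (ch i)) (enum 'I_(ar v)))
  end.
End Trees.

(** Every label in ['I_n] is the number of exactly one vertex, and every label in
    ['I_m] that of exactly one leaf. *)
Definition numbered (n : nat) (ar : 'I_n -> nat) (m : nat) (t : tree ar 'I_m) : bool :=
  perm_eq (vertices t) (enum 'I_n) && perm_eq (leaves t) (enum 'I_m).

Lemma map_cast_enum m n (e : m = n) : map (cast_ord e) (enum 'I_m) = enum 'I_n.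
Proof. by case: _ / e; rewrite -[RHS]map_id; apply: eq_map => i; rewrite cast_ord_id. Qed.

Lemma flatten_map_flatten (S T : Type) (f : S -> seq T) ss :
  flatten (map f (flatten ss)) = flatten (map (fun s => flatten (map f s)) ss).
Proof. by elim: ss => //= s ss <-; rewrite map_cat flatten_cat. Qed.

Lemma perm_flatten_map (T : eqType) (S : Type) (f g : S -> seq T) l :
  (forall s, perm_eq (f s) (g s)) -> perm_eq (flatten (map f l)) (flatten (map g l)).
Proof. by move=> h; elim: l => //= s l IH; apply: perm_cat. Qed.

Lemma perm_flatten_cat (T : eqType) (S : Type) (f g : S -> seq T) l :
  perm_eq (flatten (map (fun s => f s ++ g s) l))
          (flatten (map f l) ++ flatten (map g l)).
Proof.
elim: l => //= s l IH; rewrite -!catA perm_cat2l.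
by apply: (perm_trans (perm_cat (perm_refl _) IH)); rewrite perm_catCA.
Qed.

Section TreeOperad.
(** A vertex, or a tree, of colour [c] has [a c] inputs. *)
Variables (K : SmallSet) (a : K -> nat) (ok : Profile K -> K -> Prop).

Definition arities (p : Profile K) (i : 'I_(len p)) : nat := a (col p i).
Definition ptree (p : Profile K) (m : nat) := tree (@arities p) 'I_m.

(** [O^s(p;d)], restricted to the pairs [(p,d)] satisfying [ok]. *)
Definition tree_op (p : Profile K) (d : K) := {t : ptree p (a d) | numbered t /\ ok p d}.

(** The vertex numbered [i] in the argument is numbered [s i] in the result. *)
Fixpoint renumber (p' p : Profile K) (s : ProfPerm p' p) (m : nat) (t : ptree p' m) :
    ptree p m :=
  match t with
  | Leaf l => Leaf l
  | Node v ch => Node (ar := @arities p) (s v)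
      (fun i => renumber s (ch (cast_ord (congr1 a (esym (pperm_col s v))) i)))
  end.

Definition corolla (d : K) : ptree (prof1 d) (a d) :=
  Node (ar := @arities (prof1 d)) ord0 (fun i => Leaf i).

Lemma arity_Rank (p : Profile K) (q : 'I_(len p) -> Profile K) v (w : 'I_(len (q v))) :
  arities (p := concat q) (tagnat.Rank v w) = arities w.
Proof. by rewrite /arities /= /tagnat.sig1 /tagnat.sig2 /tagnat.Rank tagnat.rankK. Qed.

(** [graft t k]: the vertex [w] of [t] gets the number of [(v,w)], and [k l] is
    grafted onto the leaf [l] of [t]. *)
Fixpoint graft (p : Profile K) (q : 'I_(len p) -> Profile K) (v : 'I_(len p))
    (L L' : Type) (t : tree (@arities (q v)) L) (k : L -> tree (@arities (concat q)) L') :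
    tree (@arities (concat q)) L' :=
  match t with
  | Leaf l => k l
  | Node w ch => Node (ar := @arities (concat q)) (tagnat.Rank v w)
      (fun i => graft (ch (cast_ord (arity_Rank w) i)) k)
  end.

(** Substitution of the tree [t' v] into the vertex [v] of [t], for all [v]. *)
Fixpoint substitute (p : Profile K) (q : 'I_(len p) -> Profile K) (m : nat)
    (t : ptree p m) (t' : forall v, ptree (q v) (arities v)) : ptree (concat q) m :=
  match t with
  | Leaf l => Leaf l
  | Node v ch => graft (t' v) (fun i => substitute (ch i) t')
  end.

Section Graft.
Variables (p : Profile K) (q : 'I_(len p) -> Profile K) (v : 'I_(len p)) (L L' : Type).
Variables (t : tree (@arities (q v)) L) (k : L -> tree (@arities (concat q)) L').

Lemma leaves_graft : leaves (graft t k) = flatten (map (fun l => leaves (k l)) (leaves t)).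
Proof.
elim: t => [l|w ch IH] /=; first by rewrite cats0.
rewrite -(map_cast_enum (@arity_Rank p q v w)) -!map_comp flatten_map_flatten.
by congr flatten; rewrite -map_comp; apply: eq_map => i /=; rewrite IH.
Qed.

Lemma vertices_graft :
  perm_eq (vertices (graft t k))
    (map (tagnat.Rank v) (vertices t) ++ flatten (map (fun l => vertices (k l)) (leaves t))).
Proof.
elim: t => [l|w ch IH] /=; first by rewrite cats0.
rewrite perm_cons.
rewrite -(map_cast_enum (@arity_Rank p q v w)) -!map_comp flatten_map_flatten.
apply: (perm_trans (perm_flatten_map _ (fun i => IH _))).
rewrite map_flatten -!map_comp; exact: perm_flatten_cat.
Qed.
End Graft.

Lemma perm_map_flatten (S : eqType) (T : eqType) (f : S -> seq T) l l' :
  perm_eq l l' -> perm_eq (flatten (map f l)) (flatten (map f l')).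
Proof. by move=> h; apply/perm_flatten/perm_map. Qed.

Section Subst.
Variables (p : Profile K) (q : 'I_(len p) -> Profile K) (m : nat).
Variables (t' : forall v, ptree (q v) (arities v)).
Hypothesis nt' : forall v, numbered (t' v).

Lemma leaves_substitute (t : ptree p m) : perm_eq (leaves (substitute t t')) (leaves t).
Proof.
elim: t => [l|v ch IH] //=; rewrite leaves_graft.
have /andP[_ h] := nt' v.
apply: (perm_trans (perm_map_flatten _ h)); exact: perm_flatten_map.
Qed.

Lemma vertices_substitute (t : ptree p m) :
  perm_eq (vertices (substitute t t'))
    (flatten (map (fun v => map (tagnat.Rank v) (vertices (t' v))) (vertices t))).
Proof.
elim: t => [l|v ch IH] //=.
apply: (perm_trans (vertices_graft _ _)); rewrite perm_cat2l.
have /andP[_ h] := nt' v.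
apply: (perm_trans (perm_map_flatten _ h)); rewrite flatten_map_flatten -map_comp.
exact: perm_flatten_map.
Qed.

Lemma numbered_substitute (t : ptree p m) : numbered t -> numbered (substitute t t').
Proof.
move=> /andP[h1 h2]; apply/andP; split; last first.
  exact: perm_trans (leaves_substitute _) h2.
apply: (perm_trans (vertices_substitute _)).
apply: (perm_trans (perm_map_flatten _ h1)).
pose R v := @tagnat.Rank _ (fun v => len (q v)) v.
have h v : perm_eq (map (R v) (vertices (t' v))) (map (R v) (enum 'I_(len (q v)))).
  by apply: perm_map; case/andP: (nt' v).
apply: (perm_trans (perm_flatten_map _ h)).
have := perm_map tagnat.rank (perm_sig_seq (fun v => len (q v))).
have e : tagnat.rank \o @tagnat.sig _ (fun v => len (q v)) =1 id.
  by move=> i /=; rewrite tagnat.sigK.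
rewrite -map_comp (eq_map e) map_id ords_enum /sig_seq map_flatten -map_comp ords_enum.
have e2 : map tagnat.rank
      \o (fun i => map (Tagged (fun i => 'I_(len (q i)))) (ords (len (q i))))
    =1 (fun v => map (R v) (enum 'I_(len (q v)))).
  by move=> i /=; rewrite -map_comp ords_enum.
by rewrite (eq_map e2).
Qed.
End Subst.
Lemma numbered_corolla d : numbered (corolla d).
Proof.
apply/andP; split => /=.
  rewrite -!ords_enum (_ : flatten _ = [::]) //.
  by rewrite ords_enum; elim: (enum _).
by elim: (enum _) => //= i l IH; rewrite perm_cons.
Qed.

Definition tree_unit (d : K) (h : ok (prof1 d) d) : tree_op (prof1 d) d :=
  exist _ (corolla d) (conj (numbered_corolla d) h).

Definition tree_comp (p : Profile K) (q : 'I_(len p) -> Profile K) (d : K)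
    (t : tree_op p d) (t' : forall i, tree_op (q i) (col p i)) (h : ok (concat q) d) :
    tree_op (concat q) d :=
  exist _ (substitute (sval t) (fun i => sval (t' i)))
    (conj (numbered_substitute (fun i => proj1 (svalP (t' i))) (proj1 (svalP t))) h).

(** [L] is the image under [S |-> \coprod_S I] of the operad [tree_op] in sets:
    [L(p;d)] is the coproduct of copies of [I] indexed by [tree_op p d], with the
    symmetric group actions, units and composition products of [tree_op]. *)
Record is_tree_operad (V : SymMonCat) (L : Operad V K) := {
  tinj : forall p d, tree_op p d -> Hom unitI (L p d);
  tinj_coproduct : forall p d (Z : V) (z : tree_op p d -> Hom unitI Z),
    exists! h : Hom (L p d) Z, forall t, h ∘ tinj t = z t;
  tinj_perm : forall p' p d (s : ProfPerm p' p) (t : tree_op p d) (t' : tree_op p' d),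
    renumber s (sval t') = sval t -> cact L d s ∘ tinj t = tinj t';
  tinj_unit : forall d (h : ok (prof1 d) d), tinj (tree_unit h) = opunit L d;
  tinj_comp : forall p (q : 'I_(len p) -> Profile K) d (t : tree_op p d)
      (t' : forall i, tree_op (q i) (col p i)) (h : ok (concat q) d),
    opcomp L q d ∘ (tinj t ⊗m ntens_map (fun i => tinj (t' i)))
    = tinj (tree_comp t t' h) ∘ lunit _ ∘ (idm _ ⊗m ntens_units V (len p)) }.
End TreeOperad.

Definition is_operad_O (V : SymMonCat) (L : Operad V nat) :=
  is_tree_operad id (fun _ _ => True) L.

(** The operad for pairs of a one-coloured operad and an algebra over it; the colour
    [a] is [None], treated as the colour [0] in the trees.  No operation has an
    input of colour [a] and an output of colour in [nat]. *)
Definition pair_arity (c : option nat) : nat := odflt 0 c.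
Definition pair_ok (p : Profile (option nat)) (d : option nat) : Prop :=
  d <> None -> forall i, col p i <> None.
Definition is_operad_P (V : SymMonCat) (L : Operad V (option nat)) :=
  is_tree_operad pair_arity pair_ok L.

Section Pairs.
Variable V : SymMonCat.

Record OperadPair := { pair_op : Operad V unit; pair_alg : Algebra pair_op }.

Definition pair_fam (X : OperadPair) :
    fam_cat V (Profile unit * unit + unit)%type := fun z =>
  match z with inl z => pair_op X z.1 z.2 | inr c => pair_alg X c end.

(** A map of operads [phi : O -> O'] and a map of [O]-algebras [A -> phi^* A']. *)
Definition is_pair_map (X Y : OperadPair) (f : Hom (pair_fam X) (pair_fam Y)) : Prop :=
  is_operad_map (L := pair_op X) (L' := pair_op Y) (fun z => f (inl z)) /\
  forall p d, f (inr d) ∘ alg_act (pair_alg X) p d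
    = alg_act (pair_alg Y) p d ∘ (f (inl (p, d)) ⊗m ntens_map (fun i => f (inr (col p i)))).

Lemma pair_map1 (X : OperadPair) : is_pair_map (idm (pair_fam X)).
Proof.
split=> [|p d] /=; first exact: operad_map1.
by rewrite ntens_map1 tensm1 comp1m compm1.
Qed.
Lemma pair_mapM (X Y Z : OperadPair) (g : Hom (pair_fam Y) (pair_fam Z))
    (f : Hom (pair_fam X) (pair_fam Y)) :
  is_pair_map g -> is_pair_map f -> is_pair_map (g ∘ f).
Proof.
move=> [g1 g2] [f1 f2]; split=> [|p d] /=; first exact: (operad_mapM g1 f1).
by rewrite -compmA f2 compmA g2 -compmA -tensmM -ntens_mapM.
Qed.

Definition pairs_cat : Category := structured_cat pair_map1 pair_mapM.
Definition pairs_model (M : ModelData V) : ModelData pairs_cat :=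
  objectwise_model M pair_map1 pair_mapM.
End Pairs.

Section Modules.
Variables (V : SymMonCat) (O : Operad V unit) (A : Algebra O).

(** [p] has exactly one input marked [true] if [d = true], and none otherwise. *)
Definition linear (p : Profile bool) (d : bool) : Prop := count id (map (col p) (ords _)) = d.

Definition mod_sort (X : V) (b : bool) : V := if b then X else A tt.

(** For a profile [p] of length [n] whose only marked input is the [k]-th one,
    [mod_act p true] is the map [O(n) ⊗ A^(k-1) ⊗ M ⊗ A^(n-k) -> M]; for a profile
    without marked inputs it is the structure map [O(n) ⊗ A^n -> A] of [A]. *)
Record Module := {
  mod_ob : V;
  mod_act : forall p d, linear p d ->
    Hom (O (prof_map (fun _ => tt) p) tt ⊗ ntens (fun i => mod_sort mod_ob (col p i)))
        (mod_sort mod_ob d);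
  mod_act_alg : forall p (h : linear p false) (e : forall i, mod_sort mod_ob (col p i) = A tt),
    mod_act h = alg_act A (prof_map (fun _ => tt) p) tt
                ∘ (idm _ ⊗m ntens_map (fun i => eqhom (e i)));
  mod_law : is_action (L := O) (c := fun _ => tt) mod_act }.

Definition mod_sort_map (X Y : V) (f : Hom X Y) (b : bool) :
    Hom (mod_sort X b) (mod_sort Y b) :=
  if b return Hom (mod_sort X b) (mod_sort Y b) then f else idm (A tt).

Definition is_mod_map (X Y : Module) (f : Hom (mod_ob X) (mod_ob Y)) : Prop :=
  forall p (h : linear p true),
    f ∘ mod_act X h
    = mod_act Y h ∘ (idm _ ⊗m ntens_map (fun i => mod_sort_map f (col p i))).

Lemma mod_map1 (X : Module) : is_mod_map (idm (mod_ob X)).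
Proof.
move=> p h; rewrite (_ : (fun i => _) = fun i => idm (mod_sort (mod_ob X) (col p i))).
  by rewrite ntens_map1 tensm1 comp1m compm1.
by apply: functional_extensionality_dep => i; rewrite /mod_sort_map /mod_sort; case: (col p i).
Qed.
Lemma mod_mapM (X Y Z : Module) (g : Hom (mod_ob Y) (mod_ob Z))
    (f : Hom (mod_ob X) (mod_ob Y)) :
  is_mod_map g -> is_mod_map f -> is_mod_map (g ∘ f).
Proof.
move=> hg hf p h; rewrite -compmA hf compmA hg -compmA -tensmM comp1m -ntens_mapM.
congr (_ ∘ (_ ⊗m ntens_map _)); apply: functional_extensionality_dep => i.
by rewrite /mod_sort_map /mod_sort; case: (col p i); rewrite ?comp1m.
Qed.

Definition mod_cat : Category := structured_cat mod_map1 mod_mapM.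

Variable M : ModelData V.
Definition mod_model : ModelData mod_cat :=
  model_of_WE_Fib (D := mod_cat)
    (fun X Y f => WE M (sval f)) (fun X Y f => Fib M (sval f)).
End Modules.

Section Monoids.
Variable V : SymMonCat.

Record Monoid := {
  mon_ob : V;
  mon_mul : Hom (mon_ob ⊗ mon_ob) mon_ob;
  mon_one : Hom unitI mon_ob;
  mon_assoc : mon_mul ∘ (mon_mul ⊗m idm _) = mon_mul ∘ (idm _ ⊗m mon_mul) ∘ assoc _ _ _;
  mon_lunit : mon_mul ∘ (mon_one ⊗m idm _) = lunit _;
  mon_runit : mon_mul ∘ (idm _ ⊗m mon_one) = runit _ }.

Variable E : Monoid.

Record LModule := {
  lmod_ob : V;
  lmod_act : Hom (mon_ob E ⊗ lmod_ob) lmod_ob;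
  lmod_assoc : lmod_act ∘ (mon_mul E ⊗m idm _)
               = lmod_act ∘ (idm _ ⊗m lmod_act) ∘ assoc _ _ _;
  lmod_unit : lmod_act ∘ (mon_one E ⊗m idm _) = lunit _ }.

Definition is_lmod_map (X Y : LModule) (f : Hom (lmod_ob X) (lmod_ob Y)) : Prop :=
  f ∘ lmod_act X = lmod_act Y ∘ (idm _ ⊗m f).

Lemma lmod_map1 (X : LModule) : is_lmod_map (idm (lmod_ob X)).
Proof. by rewrite /is_lmod_map tensm1 comp1m compm1. Qed.
Lemma lmod_mapM (X Y Z : LModule) (g : Hom (lmod_ob Y) (lmod_ob Z))
    (f : Hom (lmod_ob X) (lmod_ob Y)) :
  is_lmod_map g -> is_lmod_map f -> is_lmod_map (g ∘ f).
Proof.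
by move=> hg hf; rewrite /is_lmod_map -compmA hf compmA hg -compmA -tensmM comp1m.
Qed.

Definition lmod_cat : Category := structured_cat lmod_map1 lmod_mapM.

Lemma lunit_tens (X Y : V) : lunit (X ⊗ Y) ∘ assoc unitI X Y = lunit X ⊗m idm Y.
Proof.
have faithful A B (f g : Hom A B) : idm (unitI : V) ⊗m f = idm _ ⊗m g -> f = g.
  move=> e; rewrite -[f]compm1 -[g]compm1 -(lunitVK A) !compmA -!lunit_nat.
  by rewrite e.
apply: faithful.
have epi A (f g : Hom (unitI ⊗ ((unitI ⊗ X) ⊗ Y)) A) :
    f ∘ assoc _ _ _ ∘ (assoc unitI unitI X ⊗m idm Y)
    = g ∘ assoc _ _ _ ∘ (assoc unitI unitI X ⊗m idm Y) -> f = g.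
  move=> e; have := congr1 (fun h => h ∘ (assocV _ _ _ ⊗m idm Y) ∘ assocV _ _ _) e.
  by rewrite /= -!(compmA _ _ (_ ⊗m _)) -!tensmM !assocVK !comp1m tensm1 !compm1
     -!compmA assocVK !compm1.
apply: epi.
rewrite -[idm unitI]comp1m tensmM -!(compmA (_ ⊗m lunit _)) !comp1m.
rewrite pentagon compmA triangle -tensm1 -assoc_nat -assoc_nat -compmA -tensmM.
by rewrite triangle comp1m.
Qed.

Lemma free_assoc (X : V) :
  let act := (mon_mul E ⊗m idm X) ∘ assocV _ _ _ in
  act ∘ (mon_mul E ⊗m idm _) = act ∘ (idm _ ⊗m act) ∘ assoc _ _ _.
Proof.
have pent (A B C D : V) : (assoc A B C ⊗m idm D) ∘ assocV (A ⊗ B) C D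
    = assocV A (B ⊗ C) D ∘ (idm A ⊗m assocV B C D) ∘ assoc A B (C ⊗ D).
  rewrite -[RHS]compm1 -(assocVK (A ⊗ B) C D) !compmA; congr (_ ∘ _).
  rewrite -!compmA -pentagon !compmA -(compmA (assocV _ _ _)) -tensmM assocK !comp1m.
  by rewrite tensm1 compm1 assocK comp1m.
rewrite /= -tensm1 -compmA assocV_nat compmA -tensmM mon_assoc comp1m.
have dup A B C (g : Hom B C) (f : Hom A B) :
    (g ∘ f) ⊗m idm X = (g ⊗m idm X) ∘ (f ⊗m idm X) by rewrite -tensmM comp1m.
rewrite !dup -!compmA pent; congr (_ ∘ _).
have dup' A B C (g : Hom B C) (f : Hom A B) :
    idm (mon_ob E) ⊗m (g ∘ f) = (idm _ ⊗m g) ∘ (idm _ ⊗m f) by rewrite -tensmM comp1m.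
by rewrite dup' !compmA assocV_nat.
Qed.

Lemma free_unit (X : V) :
  ((mon_mul E ⊗m idm X) ∘ assocV _ _ _) ∘ (mon_one E ⊗m idm _) = lunit _.
Proof.
rewrite -tensm1 -compmA assocV_nat compmA -tensmM mon_lunit comp1m -lunit_tens.
by rewrite -compmA assocVK compm1.
Qed.

Definition free_lmod (X : V) : LModule :=
  {| lmod_ob := mon_ob E ⊗ X;
     lmod_act := (mon_mul E ⊗m idm X) ∘ assocV _ _ _;
     lmod_assoc := free_assoc X;
     lmod_unit := free_unit X |}.

Lemma free_map (X Y : V) (f : Hom X Y) :
  is_lmod_map (X := free_lmod X) (Y := free_lmod Y) (idm _ ⊗m f).
Proof.
rewrite /is_lmod_map /= compmA -tensmM -[RHS]compmA assocV_nat [RHS]compmA -tensmM.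
by rewrite tensm1 !compm1 !comp1m.
Qed.

Definition free_lmod_map (X Y : V) (f : Hom X Y) :
    @Hom lmod_cat (free_lmod X) (free_lmod Y) :=
  exist (@is_lmod_map (free_lmod X) (free_lmod Y)) _ (free_map f).

(** A map [h : Y ⊗ X -> X'] is linear in the variable [X]. *)
Definition lmod_linear (Y : V) (X X' : LModule) (h : Hom (Y ⊗ lmod_ob X) (lmod_ob X')) :
    Prop :=
  h ∘ (idm Y ⊗m lmod_act X)
  = lmod_act X' ∘ (idm (mon_ob E) ⊗m h) ∘ left_swap Y (mon_ob E) (lmod_ob X).

End Monoids.

Section EModMaps.
Variables (V : SimplicialSymMonModelCat) (E : Monoid V).

Lemma lmod_linear_l (Y Y' : V) (X X' : LModule E) (g : Hom Y' Y)
    (h : Hom (Y ⊗ lmod_ob X) (lmod_ob X')) :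
  lmod_linear h -> lmod_linear (h ∘ (g ⊗m idm _)).
Proof.
rewrite /lmod_linear => hh; rewrite -compmA tensm_l -tensm_r compmA hh.
rewrite -tensm1 -[LHS]compmA left_swap_nat [LHS]compmA; congr (_ ∘ _).
by rewrite -[LHS]compmA -tensmM comp1m.
Qed.

Lemma lmod_linear_r (Y : V) (X'' X X' : LModule E) (f : @Hom (lmod_cat E) X'' X)
    (h : Hom (Y ⊗ lmod_ob X) (lmod_ob X')) :
  lmod_linear h -> lmod_linear (h ∘ (idm _ ⊗m sval f)).
Proof.
rewrite /lmod_linear => hh; rewrite -compmA -tensmM comp1m.
rewrite (svalP f : sval f ∘ _ = _) -[idm Y]comp1m tensmM compmA comp1m hh.
rewrite -compmA left_swap_nat [LHS]compmA; congr (_ ∘ _).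
by rewrite -[LHS]compmA -tensmM comp1m.
Qed.

(** [Map(X,X')]: its [n]-simplices are the maps of modules
    [i(Delta[n]) ⊗ X -> X']. *)
Definition lmod_Map (X X' : LModule E) : SSet.
Proof.
unshelve refine {|
  sx := fun n => {h : Hom (ssm_i V (simplex n : sSets_mon) ⊗ lmod_ob X) (lmod_ob X')
                   | lmod_linear h};
  sact := fun m n a h =>
    exist (@lmod_linear _ E _ X X')
      (sval h ∘ (fmap (ssm_i V) (simplex_map a : @Hom sSets_mon _ _) ⊗m idm _))
      (lmod_linear_l _ (svalP h)) |}.
- move=> n h; apply: sig_ext => /=.
  rewrite (_ : simplex_map _ = idm (simplex n : sSets_mon)).
    by rewrite fmap1 tensm1 compm1.
  by apply: smap_ext => k x; apply: mono_ext.
- move=> m n k g f h; apply: sig_ext => /=; rewrite -compmA -tensmM comp1m -fmapM.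
  congr (_ ∘ (fmap _ _ ⊗m _)).
  by apply: smap_ext => l x; apply: mono_ext.
Defined.

Definition lmod_Map_pre (X Y Z : LModule E) (f : @Hom (lmod_cat E) X Y) :
  SMap (lmod_Map Y Z) (lmod_Map X Z).
Proof.
exists (fun n (h : lmod_Map Y Z n) => exist (@lmod_linear _ E _ X Z)
          (sval h ∘ (idm _ ⊗m sval f)) (lmod_linear_r f (svalP h)) : lmod_Map X Z n).
move=> m n a h; apply: sig_ext; rewrite /= -!compmA; congr (_ ∘ _).
by rewrite tensm_l tensm_r.
Defined.

Definition lmod_maps : MappingSpaces (lmod_cat E) :=
  {| Map := lmod_Map : lmod_cat E -> lmod_cat E -> sSets; Map_pre := lmod_Map_pre |}.
End EModMaps.

Section Enveloping.
Variables (V : SimplicialSymMonModelCat) (O : Operad V unit) (A : Algebra O).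

Record EnvelopingAlgebra := {
  env_mon :> Monoid V;
  env_equiv : Functor (mod_cat A) (lmod_cat env_mon);
  env_ff : fully_faithful env_equiv;
  env_eso : essentially_surjective env_equiv;
  env_forget : forall X : mod_cat A, Hom (lmod_ob (env_equiv X)) (mod_ob X);
  env_forget_iso : forall X, is_iso (env_forget X);
  env_forget_nat : forall (X Y : mod_cat A) (f : Hom X Y),
    env_forget Y ∘ sval (fmap env_equiv f) = sval f ∘ env_forget X }.

Variable E : EnvelopingAlgebra.

Definition mod_maps : MappingSpaces (mod_cat A) :=
  {| Map := fun X Y => Map (lmod_maps E) (env_equiv E X) (env_equiv E Y);
     Map_pre := fun X Y Z f => Map_pre (lmod_maps E) (env_equiv E Z) (fmap (env_equiv E) f) |}.

(** The representatives of the elements of [Env(A) ⊗^L S]: maps of [A]-modules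
    homotopic to a map corresponding to [Env(A) ⊗ Qf], for a representative [f] of an
    element of [S]. *)
Inductive env_tensor (S : MorClass V) : MorClass (mod_cat A) :=
  EnvTensor (X Y QX QY : V) (f : Hom X Y) (f' : Hom QX QY) (N N' : mod_cat A)
      (a : Hom (env_equiv E N) (free_lmod E QX : lmod_cat E))
      (b : Hom (env_equiv E N') (free_lmod E QY : lmod_cat E)) (g h : Hom N N') :
    S _ _ f -> cofibrant_replacement_map (ssm_model V) f f' ->
    is_iso a -> is_iso b -> b ∘ fmap (env_equiv E) g = free_lmod_map E f' ∘ a ->
    homotopic (mod_model A (ssm_model V)) g h ->
    env_tensor S h.

End Enveloping.

(* Main.v *)
Require Import Defs.
From mathcomp Require Import all_boot all_order boolp zify.
From mathcomp Require classical_sets.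
Import Defs.

Set Implicit Arguments.
Unset Strict Implicit.
Unset Printing Implicit Defensive.
Local Open Scope cat_scope.

(** Let an operad [O] act on objects [X_s], and let [q_s : Y_s -> X_s] be maps.  There is a
    universal operad [W] over [O] that acts on the [Y_s] compatibly with the [q_s]; if the
    [q_s] are trivial fibrations and the [Y_s] are cofibrant, then [W -> O] is a trivial
    fibration in every arity.  If [(O, A)] is cofibrant, the resulting trivial fibration of
    pairs has a section.  Applied to a cofibrant replacement of [A], this shows that [A] is
    cofibrant in [C]; applied to the pair of colours [A, N] for an [A]-module [N], it gives
    every cofibrant replacement of the object [N] a module structure.  Hence the enveloping
    algebra [E] is cofibrant: it is a retract of such a replacement.

    Since [E] is cofibrant, the forgetful functor [U] preserves cofibrant objects, and both
    [E ⊗ -] and the cofree module functor [Hom(E, -)] are homotopically well behaved.  From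
    [Map(E ⊗ X, M) = Map(X, UM)] local modules have local underlying objects.  For a local
    and fibrant [R] the cofree module [Hom(E, R)] is local, because [E ⊗ f] is an
    [S]-equivalence for [f] in [S]; so [Map(M, Hom(E, R)) = Map(UM, R)] shows that [U]
    preserves local equivalences.  The homotopy theory of simplicial sets enters through the
    homotopy extension property of Kan complexes, which makes homotopy an equivalence
    relation on maps into a Kan complex. *)

(* Unlike [rewrite !compmA], these do not unfold composites hidden in definitions. *)
Ltac lassoc := repeat match goal with
  |- context [@compm ?C ?X ?Z ?W ?h (@compm _ _ ?Y _ ?g ?f)] =>
    rewrite (@compmA C X Y Z W h g f) end.
Ltac rassoc := repeat match goal with
  |- context [@compm ?C ?X ?Y ?W (@compm _ _ ?Z _ ?h ?g) ?f] =>
    rewrite -(@compmA C X Y Z W h g f) end.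

(** * Symmetric monoidal coherence *)

(** The operad over [O] represents operations with chosen lifts. In arity [n] it is the fibre
    product of [O(n)] with all [Hom(Y_x, Y_e)] over the corresponding [Hom(Y_x, X_e)], where [Y_x]
    is a tensor product of objects [Y_s]; if these are cofibrant, each
    [Hom(Y_x, Y_e) -> Hom(Y_x, X_e)] is a trivial fibration. The empty product [Y_x] is the unit,
    which is cofibrant as the image of the point under a strong monoidal left Quillen functor.

    The obstacle is that the operad axioms for this fibre product are identities between long
    composites of structural isomorphisms. They come from a coherence theorem: once the factors
    carry distinct labels, a structural map is determined by what it does to the labels.

    Cofibrancy of a pair speaks of maps out of an initial pair, so one has to be constructed; the
    lifting construction provides it, with the initial operad acting on the initial object. Local
    objects and local equivalences quantify over all replacements; cancellation properties and Ken
    Brown's lemma reduce such statements to one convenient choice. *)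

Section CategoryLemmas.
Variable C : Category.

Lemma rwc (X Y Z W : C) (g : Hom Y Z) (f : Hom X Y) (h : Hom X Z) (k : Hom Z W) :
  g ∘ f = h -> k ∘ g ∘ f = k ∘ h.
Proof. by move=> <-; rewrite compmA. Qed.

Lemma rwc2 (X Y Y' Z W : C) (g : Hom Y Z) (f : Hom X Y) (g' : Hom Y' Z) (f' : Hom X Y')
    (k : Hom Z W) :
  g ∘ f = g' ∘ f' -> k ∘ g ∘ f = k ∘ g' ∘ f'.
Proof. by move=> e; rewrite -!compmA e. Qed.

Lemma rwc3 (X Y Z W U : C) (h : Hom Z W) (g : Hom Y Z) (f : Hom X Y) (x : Hom X W)
    (k : Hom W U) :
  h ∘ g ∘ f = x -> k ∘ h ∘ g ∘ f = k ∘ x.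
Proof. by move=> <-; rewrite !compmA. Qed.

Lemma rwc32 (X Y Z Y' W U : C) (h : Hom Z W) (g : Hom Y Z) (f : Hom X Y) (g' : Hom Y' W)
    (f' : Hom X Y') (k : Hom W U) :
  h ∘ g ∘ f = g' ∘ f' -> k ∘ h ∘ g ∘ f = k ∘ g' ∘ f'.
Proof. by move=> e; rewrite -[RHS]compmA -e !compmA. Qed.

Lemma iso_epi (X Y Z : C) (i : Hom X Y) (f g : Hom Y Z) : is_iso i -> f ∘ i = g ∘ i -> f = g.
Proof.
move=> [j [_ ij]] e; rewrite -[f]compm1 -[g]compm1 -ij !compmA; congr (_ ∘ _).
exact: e.
Qed.

Lemma iso_mono (X Y Z : C) (i : Hom Y Z) (f g : Hom X Y) : is_iso i -> i ∘ f = i ∘ g -> f = g.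
Proof.
by move=> [j [ji _]] e; rewrite -[f]comp1m -[g]comp1m -ji -!compmA e.
Qed.

Lemma iso_id (X : C) : is_iso (idm X).
Proof. by exists (idm X); rewrite comp1m. Qed.

Lemma iso_comp (X Y Z : C) (g : Hom Y Z) (f : Hom X Y) : is_iso g -> is_iso f -> is_iso (g ∘ f).
Proof.
move=> [g' [g1 g2]] [f' [f1 f2]]; exists (f' ∘ g'); split.
  by rewrite !compmA (rwc _ g1) compm1.
by rewrite !compmA (rwc _ f2) compm1.
Qed.

Lemma eqhom_iso (X Y : C) (e : X = Y) : is_iso (eqhom e).
Proof. by case: Y / e; exact: iso_id. Qed.

Lemma eqhom_id (X : C) (e : X = X) : eqhom e = idm X.
Proof. by rewrite (Prop_irrelevance e erefl). Qed.

End CategoryLemmas.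

Lemma tens_compl (V : MonCat) (X X' X'' Y : V) (g : Hom X' X'') (f : Hom X X') :
  (g ∘ f) ⊗m idm Y = (g ⊗m idm Y) ∘ (f ⊗m idm Y).
Proof. by rewrite -tensmM comp1m. Qed.
Lemma tens_compr (V : MonCat) (X Y Y' Y'' : V) (g : Hom Y' Y'') (f : Hom Y Y') :
  idm X ⊗m (g ∘ f) = (idm X ⊗m g) ∘ (idm X ⊗m f).
Proof. by rewrite -tensmM comp1m. Qed.

Ltac tcompr := repeat match goal with
  |- context [@tensm ?V ?X ?X ?Y ?Z (@idm _ ?X) (@compm _ _ ?Y' _ ?g ?f)] =>
    rewrite (@tens_compr V X Y Y' Z g f) end.
Ltac tcompl := repeat match goal with
  |- context [@tensm ?V ?Y ?Z ?X ?X (@compm _ _ ?Y' _ ?g ?f) (@idm _ ?X)] =>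
    rewrite (@tens_compl V Y Y' Z X g f) end.

Section SymmetricMonoidal.
Variable V : SymMonCat.
Implicit Types X Y Z W : V.

Lemma tensm_iso X X' Y Y' (f : Hom X X') (g : Hom Y Y') :
  is_iso f -> is_iso g -> is_iso (f ⊗m g).
Proof.
move=> [f' [f1 f2]] [g' [g1 g2]]; exists (f' ⊗m g').
by rewrite -!tensmM f1 f2 g1 g2 !tensm1.
Qed.

Lemma assoc_iso X Y Z : is_iso (assoc X Y Z).
Proof. by exists (assocV X Y Z); rewrite assocK assocVK. Qed.
Lemma assocV_iso X Y Z : is_iso (assocV X Y Z).
Proof. by exists (assoc X Y Z); rewrite assocK assocVK. Qed.
Lemma lunit_iso X : is_iso (lunit X).
Proof. by exists (lunitV X); rewrite lunitK lunitVK. Qed.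
Lemma lunitV_iso X : is_iso (lunitV X).
Proof. by exists (lunit X); rewrite lunitK lunitVK. Qed.
Lemma runit_iso X : is_iso (runit X).
Proof. by exists (runitV X); rewrite runitK runitVK. Qed.
Lemma runitV_iso X : is_iso (runitV X).
Proof. by exists (runit X); rewrite runitK runitVK. Qed.
Lemma braid_iso X Y : is_iso (braid X Y).
Proof. by exists (braid Y X); rewrite !braidK. Qed.

Lemma tensI_faithful X Y (f g : Hom X Y) : f ⊗m idm (unitI : V) = g ⊗m idm _ -> f = g.
Proof.
move=> e; apply: (iso_epi (runit_iso X)).
by rewrite -!runit_nat e.
Qed.

Lemma runitV_nat X Y (f : Hom X Y) : runitV Y ∘ f = (f ⊗m idm unitI) ∘ runitV X.
Proof.
apply: (iso_mono (runit_iso Y)); rewrite !compmA runitVK comp1m runit_nat.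
by rewrite -compmA runitVK compm1.
Qed.

(** Kelly's argument: tensoring with the unit is faithful, and after tensoring the pentagon and the
    triangle apply. *)
Lemma runit_tens X Y : runit (X ⊗ Y) = (idm X ⊗m runit Y) ∘ assoc X Y unitI.
Proof.
apply: tensI_faithful; apply: (iso_mono (assoc_iso X Y unitI)).
rewrite -triangle compmA -tensm1 assoc_nat -[LHS]compmA -pentagon.
rewrite !compmA -tensmM triangle comp1m.
by rewrite tens_compl compmA assoc_nat.
Qed.

Lemma lunit_runit_I : lunit (unitI : V) = runit unitI.
Proof.
have h : lunit (unitI ⊗ unitI : V) = idm unitI ⊗m lunit unitI.
  by apply: (iso_mono (lunit_iso unitI)); rewrite lunit_nat.
apply: tensI_faithful; rewrite -lunit_tens h.
exact: triangle.
Qed.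

(** The axioms of a symmetric monoidal category relate the braiding and the associator only;
    compatibility with the units has to be extracted from the hexagon, again after tensoring with
    the unit. *)
Lemma lunit_braid X : lunit X ∘ braid X unitI = runit X.
Proof.
apply: tensI_faithful; apply: (iso_mono (braid_iso X unitI)).
rewrite -[in RHS]triangle [RHS]compmA [in RHS]braid_nat -lunit_tens.
rewrite -2![RHS]compmA (compmA (assoc _ _ _)) hexagon.
by rewrite !compmA lunit_nat tens_compl -!compmA; congr (_ ∘ _); rewrite !compmA lunit_tens.
Qed.

Lemma runit_braid X : runit X ∘ braid unitI X = lunit X.
Proof. by rewrite -lunit_braid -compmA braidK compm1. Qed.

Lemma left_swapE X Y Z :
  left_swap X Y Z = assoc Y X Z ∘ (braid X Y ⊗m idm Z) ∘ assocV X Y Z.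
Proof. by []. Qed.

Lemma left_swapK X Y Z : left_swap Y X Z ∘ left_swap X Y Z = idm _.
Proof.
rewrite !left_swapE !compmA (rwc _ (assocK Y X Z)) compm1.
by rewrite (rwc _ (esym (tens_compl _ _ _))) braidK tensm1 compm1 assocVK.
Qed.
Lemma left_swap_iso X Y Z : is_iso (left_swap X Y Z).
Proof. by exists (left_swap Y X Z); rewrite !left_swapK. Qed.

Lemma left_swap_assoc X Y Z : left_swap X Y Z ∘ assoc X Y Z = assoc Y X Z ∘ (braid X Y ⊗m idm Z).
Proof. by rewrite left_swapE (rwc _ (assocK X Y Z)) compm1. Qed.

(** The hexagon with a spectator factor [W]: moving [Z] past [Y] and then past [X] is moving it past
    [Y ⊗ X]. *)
Lemma left_swap_tens Z Y X W :
  (idm Y ⊗m left_swap Z X W) ∘ left_swap Z Y (X ⊗ W)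
  = assoc Y X (Z ⊗ W) ∘ left_swap Z (Y ⊗ X) W ∘ (idm Z ⊗m assocV Y X W).
Proof.
apply: (iso_epi (tensm_iso (iso_id Z) (assoc_iso Y X W))).
rewrite (rwc _ (esym (tens_compr _ _ _))) assocK tensm1 compm1.
apply: (iso_epi (assoc_iso Z (Y ⊗ X) W)).
rewrite (rwc _ (left_swap_assoc Z (Y ⊗ X) W)) compmA -(pentagon Y X Z W).
apply: (iso_epi (tensm_iso (assoc_iso Z Y X) (iso_id W))).
have -> : (idm Y ⊗m left_swap Z X W) ∘ left_swap Z Y (X ⊗ W) ∘ (idm Z ⊗m assoc Y X W)
    ∘ assoc Z (Y ⊗ X) W ∘ (assoc Z Y X ⊗m idm W)
  = (idm Y ⊗m left_swap Z X W) ∘ assoc Y Z (X ⊗ W) ∘ assoc (Y ⊗ Z) X W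
    ∘ ((braid Z Y ⊗m idm X) ⊗m idm W).
  rewrite (rwc32 _ (pentagon Z Y X W)); lassoc.
  rewrite (rwc _ (left_swap_assoc Z Y _)) compmA.
  by rewrite -tensm1 (rwc2 _ (esym (assoc_nat _ _ _))).
rewrite -(rwc32 _ (pentagon Y Z X W)); lassoc; rewrite -tens_compr left_swap_assoc tens_compr.
rewrite -(rwc2 _ (assoc_nat _ _ _)) -[LHS]compmA -[LHS]compmA -[RHS]compmA -[RHS]compmA.
congr (_ ∘ _); rewrite -!tens_compl; congr (_ ⊗m _).
by rewrite [RHS]compmA hexagon compmA.
Qed.

Lemma left_swap_tens_inv Y Z X W :
  left_swap Y Z (X ⊗ W) ∘ (idm Y ⊗m left_swap X Z W)
  = (idm Z ⊗m assoc Y X W) ∘ left_swap (Y ⊗ X) Z W ∘ assocV Y X (Z ⊗ W).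
Proof.
apply: (iso_mono (left_swap_iso Z Y (X ⊗ W))); lassoc; rewrite left_swapK comp1m.
apply: (iso_mono (tensm_iso (iso_id Y) (left_swap_iso Z X W))).
rewrite -tens_compr left_swapK tensm1; lassoc; rewrite left_swap_tens.
rewrite (rwc _ (esym (tens_compr _ _ _))) assocK tensm1 compm1.
by rewrite (rwc _ (left_swapK _ _ _)) compm1 assocVK.
Qed.

(** The braid relation. It is what makes the order irrelevant in which two factors are pulled to the
    front. *)
Lemma left_swap_braided X Y Z W :
  left_swap X Y (Z ⊗ W) ∘ (idm X ⊗m left_swap Z Y W) ∘ left_swap Z X (Y ⊗ W)
  = (idm Y ⊗m left_swap Z X W) ∘ left_swap Z Y (X ⊗ W) ∘ (idm Z ⊗m left_swap X Y W).
Proof.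
rewrite -[LHS]compmA left_swap_tens left_swap_tens; lassoc; rewrite left_swap_assoc.
rewrite -[LHS]compmA -[LHS]compmA -[RHS]compmA -[RHS]compmA; congr (_ ∘ _).
rewrite -tens_compr (left_swapE X Y); lassoc; rewrite assocK comp1m.
by rewrite tens_compr; lassoc; rewrite left_swap_nat tensm1.
Qed.

Lemma left_swap_I X Y : (idm X ⊗m lunit Y) ∘ left_swap unitI X Y = lunit (X ⊗ Y).
Proof.
rewrite left_swapE; lassoc; rewrite triangle -tens_compl runit_braid -lunit_tens.
by rewrite -compmA assocVK compm1.
Qed.

Lemma left_swap_braid X Y Z :
  left_swap Z X Y ∘ braid (X ⊗ Y) Z = (idm X ⊗m braid Y Z) ∘ assoc X Y Z.
Proof.
apply: (iso_epi (braid_iso Z (X ⊗ Y))); rewrite -compmA braidK compm1.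
apply: (iso_epi (assoc_iso Z X Y)); rewrite left_swap_assoc -[RHS]compmA -[RHS]compmA.
rewrite (compmA (assoc _ _ _)) hexagon; lassoc.
by rewrite -tens_compr braidK tensm1 comp1m.
Qed.

Lemma left_swap_tensr X Y Z W :
  left_swap X Y (Z ⊗ W) ∘ (idm X ⊗m assoc Y Z W) ∘ assoc X (Y ⊗ Z) W
  = (idm Y ⊗m assoc X Z W) ∘ assoc Y (X ⊗ Z) W ∘ (left_swap X Y Z ⊗m idm W).
Proof.
apply: (iso_epi (tensm_iso (assoc_iso X Y Z) (iso_id W))).
rewrite (rwc32 _ (pentagon X Y Z W)) left_swap_assoc.
rewrite (rwc _ (esym (tens_compl _ _ _))) left_swap_assoc tens_compl; lassoc.
by rewrite pentagon -tensm1 (rwc2 _ (esym (assoc_nat _ _ _))).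
Qed.

Lemma bt_cat_iso (T : Type) (F : T -> V) l l' : is_iso (bt_cat F l l').
Proof.
elim: l => [|x l IH] /=; first exact: lunit_iso.
by apply: iso_comp (assoc_iso _ _ _); apply: tensm_iso IH; exact: iso_id.
Qed.

End SymmetricMonoidal.

(** * Reordering the factors of an iterated tensor product *)

Section Shuffles.
Variables (V : SymMonCat) (T : eqType) (F : T -> V).
Implicit Types (x y z : T) (l r s t : seq T).

Definition bt_cast l l' (e : l = l') : Hom (bt F l) (bt F l') := eqhom (congr1 (bt F) e).

Lemma bt_cast_id l (e : l = l) : bt_cast e = idm _.
Proof. exact: eqhom_id. Qed.

(** A form of [bt_pull] in which the remaining list is a parameter [r], equal to [rem x l] by
    hypothesis. Inductions can then name the remainder freely, without rewriting inside a type. *)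
Definition pull_to x l r (h : x \in l) (e : rem x l = r) : Hom (bt F l) (F x ⊗ bt F r) :=
  (idm _ ⊗m bt_cast e) ∘ bt_pull F h.

Lemma bt_pullE x l (h : x \in l) : bt_pull F h = pull_to h erefl.
Proof. by rewrite /pull_to bt_cast_id tensm1 comp1m. Qed.

Lemma pull_to_head x l h (e : rem x (x :: l) = l) : pull_to h e = idm _.
Proof.
rewrite /pull_to /=; move: e h => /=.
case: eqP => // e1 e h; rewrite bt_cast_id tensm1 comp1m.
by rewrite eqhom_id tensm1.
Qed.

Lemma pull_to_behead x y l r h (e : rem x (y :: l) = y :: r) h' (e' : rem x l = r) :
  y <> x -> pull_to h e = left_swap _ _ _ ∘ (idm (F y) ⊗m pull_to h' e').
Proof.
move=> ne; case: _ / e' e => e; rewrite /pull_to /=; move: e h => /=.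
case: eqP => // ne' e h; rewrite !bt_cast_id !tensm1 !comp1m.
by congr (_ ∘ (_ ⊗m bt_pull _ _)); apply: Prop_irrelevance.
Qed.

Lemma perm_rem x l t (h : perm_eq l (x :: t)) r : rem x l = r -> perm_eq r t.
Proof. by move=> <-; exact: perm_behead. Qed.

Lemma bt_shuffle_nil (h : perm_eq [::] [::]) : bt_shuffle F h = idm _.
Proof. by rewrite /= eqhom_id. Qed.

Lemma bt_shuffle_cons x l t (h : perm_eq l (x :: t)) r (h1 : x \in l) (e : rem x l = r)
    (h2 : perm_eq r t) :
  bt_shuffle F h = (idm _ ⊗m bt_shuffle F h2) ∘ pull_to h1 e.
Proof.
case: _ / e h2 => h2 /=; rewrite bt_pullE.
by congr ((_ ⊗m bt_shuffle _ _) ∘ pull_to _ _); exact: Prop_irrelevance.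
Qed.

(** Induction on [l]. If the head is [x] or [y], one of the two pulls is trivial and symmetry of the
    swap suffices; otherwise the head is passed by both, and the braid relation exchanges the three
    factors. *)
Lemma pull_to_comm x y l r r' s (hy : y \in l) (ey : rem y l = r) (hx : x \in r)
    (ex : rem x r = s) (hx' : x \in l) (ex' : rem x l = r') (hy' : y \in r')
    (ey' : rem y r' = s) :
  x <> y ->
  left_swap _ _ _ ∘ (idm (F y) ⊗m pull_to hx ex) ∘ pull_to hy ey
  = (idm (F x) ⊗m pull_to hy' ey') ∘ pull_to hx' ex'.
Proof.
elim: l r r' s hy ey hx ex hx' ex' hy' ey' => [//|z l IH] r r' s hy ey hx ex hx' ex' hy' ey' ne.
have [zx|zx] := eqVneq z x.
  subst z; have rl := ex'; rewrite /= eqxx in rl; destruct rl.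
  have ry := ey; rewrite /= (introF eqP ne) in ry; destruct ry.
  have sl := ex; rewrite /= eqxx in sl; destruct sl.
  rewrite !pull_to_head tensm1 !compm1.
  rewrite (pull_to_behead _ _ hy' ey') //; lassoc.
  by rewrite left_swapK comp1m.
have [zy|zy] := eqVneq z y.
  subst z; have rl := ey; rewrite /= eqxx in rl; destruct rl.
  have ry := ex'; rewrite /= eq_sym (introF eqP ne) in ry; destruct ry.
  have sl := ey'; rewrite /= eqxx in sl; destruct sl.
  rewrite !pull_to_head tensm1 comp1m compm1.
  by rewrite (pull_to_behead _ _ hx ex) //; apply/eqP.
have rl := ey; rewrite /= (negPf zy) in rl; destruct rl.
have rl := ex; rewrite /= (negPf zx) in rl; destruct rl.
have rl := ex'; rewrite /= (negPf zx) in rl; destruct rl.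
have hyl : y \in l by apply: (mem_tail hy); apply/eqP.
have hxl : x \in l by apply: (mem_tail hx'); apply/eqP.
have hxr : x \in rem y l by apply: (mem_tail hx); apply/eqP.
have hyr : y \in rem x l by apply: (mem_tail hy'); apply/eqP.
have ey2 : rem y (rem x l) = rem x (rem y l).
  by move: ey'; rewrite /= (negPf zy); case.
rewrite (pull_to_behead _ ey hyl erefl); last exact/eqP.
rewrite (pull_to_behead _ ex hxr erefl); last exact/eqP.
rewrite (pull_to_behead _ ex' hxl erefl); last exact/eqP.
rewrite (pull_to_behead _ ey' hyr ey2); last exact/eqP.
have := IH _ _ _ hyl erefl hxr erefl hxl erefl hyr ey2 ne => {}IH.
tcompr; lassoc.
rewrite (rwc2 _ (esym (left_swap_nat _ _ _))) left_swap_braided.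
rewrite (rwc2 _ (esym (left_swap_nat _ _ _))).
rewrite -[LHS]compmA -[LHS]compmA -[RHS]compmA; congr (_ ∘ _).
by rewrite -!tens_compr -IH; lassoc.
Qed.

(** A shuffle pulls the labels of [l'] one after the other, so the claim is proved by induction on
    [l']: a head different from [x] is exchanged with [x] by [pull_to_comm]. *)
Lemma pull_to_shuffle x l l' r r' (h : perm_eq l l') (hx : x \in l) (e : rem x l = r)
    (hx' : x \in l') (e' : rem x l' = r') (h' : perm_eq r r') :
  pull_to hx' e' ∘ bt_shuffle F h = (idm _ ⊗m bt_shuffle F h') ∘ pull_to hx e.
Proof.
elim: l' l r r' h hx e hx' e' h' => [//|y t IH] l r r' h hx e hx' e' h'.
have [yx|yx] := eqVneq y x.
  subst y; have rl := e'; rewrite /= eqxx in rl; destruct rl.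
  rewrite pull_to_head comp1m.
  exact: bt_shuffle_cons.
have rl := e'; rewrite /= (negPf yx) in rl; destruct rl.
have hyl := perm_head h; have hp := perm_behead h.
have hxt : x \in t by apply: (mem_tail hx'); apply/eqP.
have hxr : x \in rem y l by rewrite (perm_mem hp).
have hyr : y \in r by rewrite (perm_mem h') mem_head.
have hp2 : perm_eq (rem x (rem y l)) (rem x t).
  have := perm_rem (perm_trans hp (perm_to_rem hxt)); exact.
have er : rem y r = rem x (rem y l).
  rewrite -e; elim: (l) => //= z l0 IHl.
  have [zx|zx] := eqVneq z x; have [zy|zy] := eqVneq z y; rewrite /=.
  - by rewrite -zy zx eqxx in yx.
  - by rewrite zx eqxx.
  - by rewrite zy eqxx.
  - by rewrite (negPf zx) (negPf zy) IHl.
rewrite (bt_shuffle_cons h hyl erefl hp) (bt_shuffle_cons h' hyr er hp2).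
rewrite (pull_to_behead _ e' hxt erefl); last exact/eqP.
lassoc; rewrite (rwc _ (esym (tens_compr _ _ _))) (IH _ _ _ hp hxr erefl hxt erefl hp2).
tcompr; lassoc; rewrite left_swap_nat -[LHS]compmA -[LHS]compmA -[RHS]compmA.
congr (_ ∘ _); lassoc; apply: pull_to_comm.
by move=> xy; rewrite xy eqxx in yx.
Qed.

Lemma bt_shuffleM l l' l'' (h : perm_eq l l') (h' : perm_eq l' l'') (h'' : perm_eq l l'') :
  bt_shuffle F h' ∘ bt_shuffle F h = bt_shuffle F h''.
Proof.
elim: l'' l l' h h' h'' => [|x t IH] l l' h h' h''.
  have e' := perm_nilE h'; subst l'; have e := perm_nilE h''; subst l.
  by rewrite !bt_shuffle_nil comp1m.
have hx' := perm_head h'; have hx := perm_head h''.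
have hp : perm_eq (rem x l) (rem x l').
  exact: (perm_trans (perm_behead h'') (etrans (perm_sym _ _) (perm_behead h'))).
rewrite (bt_shuffle_cons h' hx' erefl (perm_behead h')).
rewrite (bt_shuffle_cons h'' hx erefl (perm_behead h'')).
rewrite -compmA (pull_to_shuffle h hx erefl hx' erefl hp); lassoc.
by rewrite -tens_compr (IH _ _ hp (perm_behead h') (perm_behead h'')).
Qed.

Lemma bt_shuffle_id l (h : perm_eq l l) : bt_shuffle F h = idm _.
Proof.
elim: l h => [|x l IH] h; first exact: bt_shuffle_nil.
have e : rem x (x :: l) = l by rewrite /= eqxx.
by rewrite (bt_shuffle_cons h (mem_head _ _) e (perm_refl l)) pull_to_head IH tensm1 comp1m.
Qed.

Lemma bt_shuffle_iso l l' (h : perm_eq l l') : is_iso (bt_shuffle F h).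
Proof.
have h' : perm_eq l' l by rewrite perm_sym.
by exists (bt_shuffle F h'); rewrite !(bt_shuffleM _ _ (perm_refl _)) !bt_shuffle_id.
Qed.

Lemma bt_shuffle_behead x l l' (h : perm_eq (x :: l) (x :: l')) (h' : perm_eq l l') :
  bt_shuffle F h = idm _ ⊗m bt_shuffle F h'.
Proof.
have e : rem x (x :: l) = l by rewrite /= eqxx.
by rewrite (bt_shuffle_cons h (mem_head _ _) e h') pull_to_head compm1.
Qed.

Lemma pull_to_catl x l1 l2 r1 (h : x \in l1 ++ l2) (e : rem x (l1 ++ l2) = r1 ++ l2)
    (h' : x \in l1) (e' : rem x l1 = r1) :
  pull_to h e ∘ bt_cat F l1 l2 = (idm _ ⊗m bt_cat F r1 l2) ∘ assoc _ _ _ ∘ (pull_to h' e' ⊗m idm _).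
Proof.
elim: l1 r1 h e h' e' => [//|y l1 IH] r1 h e h' e'.
have [yx|yx] := eqVneq y x.
  subst y; have rl := e'; rewrite /= eqxx in rl; destruct rl.
  by rewrite (@pull_to_head x (l1 ++ l2) h e) (@pull_to_head x l1 h' e') comp1m tensm1 compm1.
have rl := e'; rewrite /= (negPf yx) in rl; destruct rl.
have ne : y <> x by apply/eqP.
have h1 : x \in l1 by exact: mem_tail h' ne.
have h2 : x \in l1 ++ l2 by rewrite mem_cat h1.
have e2 : rem x (l1 ++ l2) = rem x l1 ++ l2.
  by move: e; rewrite /= (negPf yx); case.
rewrite (@pull_to_behead x y (l1 ++ l2) (rem x l1 ++ l2) h e h2 e2 ne).
rewrite (pull_to_behead h' e' h1 erefl ne) /= tens_compl; lassoc.
rewrite (rwc _ (esym (tens_compr _ _ _))) (IH _ h2 e2 h1 erefl); tcompr; lassoc.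
rewrite left_swap_nat (rwc2 _ (esym (assoc_nat _ _ _))); lassoc; congr (_ ∘ _).
by rewrite (rwc3 _ (left_swap_tensr _ _ _ _)); lassoc.
Qed.

Lemma pull_to_catr x l1 l2 (h : x \in l1 ++ x :: l2) (e : rem x (l1 ++ x :: l2) = l1 ++ l2) :
  x \notin l1 ->
  pull_to h e ∘ bt_cat F l1 (x :: l2) = (idm _ ⊗m bt_cat F l1 l2) ∘ left_swap _ _ _.
Proof.
elim: l1 h e => [|y l1 IH] h e; rewrite ?inE ?negb_or.
  by rewrite (@pull_to_head x l2 h e) comp1m left_swap_I.
move=> /andP[xy xl].
have ne : y <> x by move=> yx; rewrite yx eqxx in xy.
have h2 : x \in l1 ++ x :: l2 by rewrite mem_cat mem_head orbT.
have e2 : rem x (l1 ++ x :: l2) = l1 ++ l2.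
  by move: e; rewrite /= (introF eqP ne); case.
rewrite (@pull_to_behead x y (l1 ++ x :: l2) (l1 ++ l2) h e h2 e2 ne) /=; lassoc.
rewrite (rwc _ (esym (tens_compr _ _ _))) (IH h2 e2 xl); tcompr; lassoc.
rewrite left_swap_nat -[LHS]compmA -[LHS]compmA -[RHS]compmA; congr (_ ∘ _); lassoc.
by rewrite left_swap_tens_inv -[LHS]compmA assocK compm1.
Qed.

Lemma bt_cat_shuffle l1 l1' l2 l2' (h1 : perm_eq l1 l1') (h2 : perm_eq l2 l2')
    (h : perm_eq (l1 ++ l2) (l1' ++ l2')) :
  bt_cat F l1' l2' ∘ (bt_shuffle F h1 ⊗m bt_shuffle F h2) = bt_shuffle F h ∘ bt_cat F l1 l2.
Proof.
elim: l1' l1 h1 h => [|x t IH] l1 h1 h.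
  have e := perm_nilE h1; subst l1.
  rewrite bt_shuffle_nil /= lunit_nat; congr (_ ∘ _); congr (bt_shuffle _ _).
  exact: Prop_irrelevance.
have hx := perm_head h1; have hp := perm_behead h1.
have hx' : x \in l1 ++ l2 by rewrite mem_cat hx.
have e : rem x (l1 ++ l2) = rem x l1 ++ l2.
  elim: (l1) hx => //= y l IHl; rewrite inE eq_sym.
  by case: eqP => //= _ /IHl->.
have hp2 : perm_eq (rem x l1 ++ l2) (t ++ l2') by rewrite perm_cat.
rewrite (bt_shuffle_cons h1 hx erefl hp).
rewrite (@bt_shuffle_cons x (l1 ++ l2) (t ++ l2') h _ hx' e hp2).
rewrite -[RHS]compmA (pull_to_catl hx' e hx erefl) -(compm1 (bt_shuffle F h2)) tensmM.
lassoc; congr (_ ∘ _).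
rewrite /= -[LHS]compmA assoc_nat; lassoc; congr (_ ∘ _).
by rewrite -!tens_compr (IH _ hp hp2).
Qed.

Lemma bt_cat_assoc l1 l2 l3 (h : perm_eq ((l1 ++ l2) ++ l3) (l1 ++ (l2 ++ l3))) :
  bt_cat F l1 (l2 ++ l3) ∘ (idm _ ⊗m bt_cat F l2 l3) ∘ assoc _ _ _
  = bt_shuffle F h ∘ bt_cat F (l1 ++ l2) l3 ∘ (bt_cat F l1 l2 ⊗m idm _).
Proof.
elim: l1 h => [|x l1 IH] h.
  rewrite (@bt_shuffle_id (l2 ++ l3) h) /= comp1m lunit_nat -[LHS]compmA.
  by rewrite lunit_tens.
have h' : perm_eq ((l1 ++ l2) ++ l3) (l1 ++ (l2 ++ l3)) by rewrite catA.
rewrite (@bt_shuffle_behead x ((l1 ++ l2) ++ l3) (l1 ++ (l2 ++ l3)) h h') /= tens_compl; lassoc.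
rewrite (rwc2 _ (assoc_nat _ _ _)) -!tens_compr -(IH h') -tensm1 (rwc2 _ (assoc_nat _ _ _)).
by tcompr; lassoc; rewrite (rwc32 _ (pentagon _ _ _ _)); lassoc.
Qed.

Lemma bt_cat_runit l (h : perm_eq l (l ++ [::])) :
  bt_cat F l [::] = bt_shuffle F h ∘ runit (bt F l).
Proof.
elim: l h => [|x l IH] h.
  by rewrite (@bt_shuffle_id [::] h) /= comp1m lunit_runit_I.
have h' : perm_eq l (l ++ [::]) by rewrite cats0.
rewrite (@bt_shuffle_behead x l (l ++ [::]) h h') /= (IH h') runit_tens; tcompr; lassoc.
by [].
Qed.

(** Distinct labels are essential here: on equal labels [bt_shuffle] keeps the order of the
    occurrences, whereas the braiding exchanges them. *)
Lemma bt_cat_braid l1 l2 (h : perm_eq (l1 ++ l2) (l2 ++ l1)) :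
  uniq (l1 ++ l2) ->
  bt_cat F l2 l1 ∘ braid (bt F l1) (bt F l2) = bt_shuffle F h ∘ bt_cat F l1 l2.
Proof.
elim: l1 h => [|x l1 IH] h u.
  have h' : perm_eq l2 (l2 ++ [::]) by rewrite cats0.
  rewrite (bt_cat_runit h') -[LHS]compmA runit_braid; congr (bt_shuffle _ _ ∘ _).
  exact: Prop_irrelevance.
move: u => /= /andP[]; rewrite mem_cat negb_or => /andP[_ xl2] u.
have e : rem x (l2 ++ x :: l1) = l2 ++ l1.
  elim: (l2) xl2 => [|y l IHl]; first by rewrite /= eqxx.
  by rewrite inE negb_or /= => /andP[xy /IHl ->]; rewrite eq_sym (negPf xy).
have hx : x \in l2 ++ x :: l1 by rewrite mem_cat mem_head orbT.
have h1 : perm_eq (l1 ++ l2) (l2 ++ l1) by rewrite perm_catC.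
have h2 : perm_eq (l2 ++ x :: l1) (x :: l2 ++ l1) by rewrite -cat1s perm_catCA.
have h3 : perm_eq (x :: l1 ++ l2) (x :: l2 ++ l1) by rewrite perm_cons.
apply: (iso_mono (bt_shuffle_iso h2)); rewrite [RHS]compmA.
rewrite (bt_shuffleM h h2 h3) (bt_shuffle_behead h3 h1).
rewrite (bt_shuffle_cons h2 hx e (perm_refl _)) bt_shuffle_id tensm1 comp1m.
rewrite compmA (pull_to_catr hx e xl2) -[LHS]compmA left_swap_braid.
by lassoc; rewrite -tens_compr (IH h1 u) tens_compr -compmA.
Qed.

End Shuffles.

(** * Coherence for maps that only permute labelled factors *)

Section Canonical.
Variables (V : SymMonCat) (T : eqType) (F : T -> V).

(** An object identified with a right-nested tensor product of atoms. The labels, and not the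
    objects, say which factor is which. *)
Record presented := Presented {
  pob :> V;
  plist : seq T;
  pmap : Hom pob (bt F plist);
  pmap_iso : is_iso pmap }.

Definition canonical (a b : presented) (f : Hom a b) : Prop :=
  ~~ uniq (plist a) \/
  exists h : perm_eq (plist a) (plist b), pmap b ∘ f = bt_shuffle F h ∘ pmap a.

Lemma canonicalI (a b : presented) (f : Hom a b) :
  (uniq (plist a) ->
   exists h : perm_eq (plist a) (plist b), pmap b ∘ f = bt_shuffle F h ∘ pmap a) ->
  canonical f.
Proof. by rewrite /canonical; case: (uniq _) => /= h; [right; apply: h | left]. Qed.

Lemma canonicalE (a b : presented) (f : Hom a b) : canonical f -> uniq (plist a) ->
  exists h : perm_eq (plist a) (plist b), pmap b ∘ f = bt_shuffle F h ∘ pmap a.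
Proof. by case=> [/negP|]. Qed.

Definition pres_unit : presented := Presented (iso_id (bt F [::])).

Lemma pres_atom_iso t : is_iso (runitV (F t) : Hom (F t) (bt F [:: t])).
Proof. exact: runitV_iso. Qed.
Definition pres_atom t : presented := Presented (pres_atom_iso t).

Lemma pres_tens_iso (a b : presented) :
  is_iso (bt_cat F (plist a) (plist b) ∘ (pmap a ⊗m pmap b)).
Proof.
by apply: iso_comp; [exact: bt_cat_iso | exact: tensm_iso (pmap_iso a) (pmap_iso b)].
Qed.
Definition pres_tens (a b : presented) : presented := Presented (pres_tens_iso a b).

Fixpoint bt_pmap (S : Type) (Z : S -> presented) (l : seq S) :
    Hom (bt Z l) (bt F (flatten (map (fun s => plist (Z s)) l))) :=
  match l with
  | [::] => idm _
  | s :: l' => bt_cat F (plist (Z s)) _ ∘ (pmap (Z s) ⊗m bt_pmap Z l')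
  end.

Lemma bt_pmap_iso (S : Type) (Z : S -> presented) l : is_iso (bt_pmap Z l).
Proof.
elim: l => [|s l IH] /=; first exact: iso_id.
by apply: iso_comp; [exact: bt_cat_iso | exact: tensm_iso (pmap_iso _) IH].
Qed.
Definition pres_bt (S : Type) (Z : S -> presented) l : presented :=
  Presented (bt_pmap_iso Z l).

(** The coherence theorem: both maps are the shuffle between the same two lists, and a shuffle does
    not depend on the proof that the lists are permutations of each other. *)
Lemma canonical_eq (a b : presented) (f g : Hom a b) :
  uniq (plist a) -> canonical f -> canonical g -> f = g.
Proof.
move=> u /canonicalE/(_ u)[h e] /canonicalE/(_ u)[h' e']; apply: (iso_mono (pmap_iso b)).
by rewrite e e' (Prop_irrelevance h h').
Qed.

Lemma canonical_comp (a b c : presented) (g : Hom b c) (f : Hom a b) :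
  canonical g -> canonical f -> canonical (g ∘ f).
Proof.
move=> cg cf; apply: canonicalI => u; have [h e] := canonicalE cf u.
have [|h' e'] := canonicalE cg; first by rewrite -(perm_uniq h).
exists (perm_trans h h'); rewrite compmA e' -compmA e compmA.
by rewrite (bt_shuffleM F h h' (perm_trans h h')).
Qed.

Lemma canonical_id (a : presented) : canonical (a := a) (b := a) (idm a).
Proof. by apply: canonicalI => _; exists (perm_refl _); rewrite bt_shuffle_id compm1 comp1m. Qed.

(** For a source with repeated labels the canonicity of [f] carries no information, so the agreement
    of the two lists is a separate hypothesis. *)
Lemma canonical_inv (a b : presented) (f : Hom a b) (g : Hom b a) :
  perm_eq (plist b) (plist a) ->
  g ∘ f = idm a -> f ∘ g = idm b -> canonical f -> canonical g.
Proof.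
move=> h1 gf fg cf; apply: canonicalI => u; have ua : uniq (plist a) by rewrite -(perm_uniq h1).
have [h e] := canonicalE cf ua; exists h1.
apply: (iso_mono (bt_shuffle_iso F h)); rewrite !compmA -e -(compmA _ f) fg compm1.
by rewrite (bt_shuffleM F h1 h (perm_refl _)) bt_shuffle_id comp1m.
Qed.

Lemma canonical_tens (a b a' b' : presented) (f : Hom a a') (g : Hom b b') :
  canonical f -> canonical g ->
  canonical (a := pres_tens a b) (b := pres_tens a' b') (f ⊗m g).
Proof.
move=> cf cg; apply: canonicalI; rewrite /= cat_uniq => /and3P[ua _ ub].
have [h e] := canonicalE cf ua; have [h' e'] := canonicalE cg ub; have h2 := perm_cat h h';
  exists h2.
rewrite -[LHS]compmA -tensmM e e' tensmM [LHS]compmA (bt_cat_shuffle _ _ _ h2).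
by rewrite -compmA.
Qed.

Lemma canonical_assoc (a b c : presented) :
  canonical (a := pres_tens (pres_tens a b) c) (b := pres_tens a (pres_tens b c)) (assoc a b c).
Proof.
have h : perm_eq ((plist a ++ plist b) ++ plist c) (plist a ++ (plist b ++ plist c)).
  by rewrite catA.
apply: canonicalI => u; exists h => /=.
have -> : pmap a ⊗m (bt_cat F (plist b) (plist c) ∘ (pmap b ⊗m pmap c))
    = (idm _ ⊗m bt_cat F (plist b) (plist c)) ∘ (pmap a ⊗m (pmap b ⊗m pmap c)).
  by rewrite -tensmM comp1m.
have -> : (bt_cat F (plist a) (plist b) ∘ (pmap a ⊗m pmap b)) ⊗m pmap c
    = (bt_cat F (plist a) (plist b) ⊗m idm _) ∘ ((pmap a ⊗m pmap b) ⊗m pmap c).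
  by rewrite -tensmM comp1m.
by lassoc; rewrite (rwc2 _ (esym (assoc_nat _ _ _))) (bt_cat_assoc _ h).
Qed.

Lemma canonical_assocV (a b c : presented) :
  canonical (a := pres_tens a (pres_tens b c)) (b := pres_tens (pres_tens a b) c) (assocV a b c).
Proof.
refine (canonical_inv (a := pres_tens (pres_tens a b) c) (b := pres_tens a (pres_tens b c))
  _ (assocK _ _ _) (assocVK _ _ _) (canonical_assoc a b c)).
by rewrite /= catA.
Qed.

Lemma canonical_lunit (a : presented) :
  canonical (a := pres_tens pres_unit a) (b := a) (lunit a).
Proof.
by apply: canonicalI => u; exists (perm_refl _) => /=; rewrite bt_shuffle_id comp1m lunit_nat.
Qed.

Lemma canonical_lunitV (a : presented) :
  canonical (a := a) (b := pres_tens pres_unit a) (lunitV a).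
Proof. by refine (canonical_inv (a := pres_tens pres_unit a) (b := a) _ (lunitK a) (lunitVK a)
  (canonical_lunit a)). Qed.

Lemma canonical_runit (a : presented) :
  canonical (a := pres_tens a pres_unit) (b := a) (runit a).
Proof.
have h : perm_eq (plist a) (plist a ++ [::]) by rewrite cats0.
have h' : perm_eq (plist a ++ [::]) (plist a) by rewrite cats0.
apply: canonicalI => u; exists h' => /=;
  rewrite (bt_cat_runit _ h) [RHS]compmA [X in _ = X ∘ _]compmA.
by rewrite (bt_shuffleM F h h' (perm_refl _)) bt_shuffle_id comp1m runit_nat.
Qed.

Lemma canonical_runitV (a : presented) :
  canonical (a := a) (b := pres_tens a pres_unit) (runitV a).
Proof.
refine (canonical_inv (a := pres_tens a pres_unit) (b := a) _ (runitK a) (runitVK a)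
  (canonical_runit a)).
by rewrite /= cats0.
Qed.

Lemma canonical_braid (a b : presented) :
  canonical (a := pres_tens a b) (b := pres_tens b a) (braid a b).
Proof.
have h : perm_eq (plist a ++ plist b) (plist b ++ plist a) by rewrite perm_catC.
apply: canonicalI => u; exists h => /=; rewrite -[LHS]compmA -braid_nat !compmA; congr (_ ∘ _).
exact: bt_cat_braid.
Qed.

Lemma canonical_left_swap (a b c : presented) :
  canonical (a := pres_tens a (pres_tens b c)) (b := pres_tens b (pres_tens a c))
    (left_swap a b c).
Proof.
apply: canonical_comp (canonical_assocV a b c).
apply: canonical_comp (canonical_assoc b a c) _.
by apply: canonical_tens (canonical_id _); exact: canonical_braid.
Qed.

Lemma canonical_interchange (a b c d : presented) :
  canonical (a := pres_tens (pres_tens a b) (pres_tens c d))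
    (b := pres_tens (pres_tens a c) (pres_tens b d)) (interchange a b c d).
Proof.
apply: canonical_comp (canonical_assoc a b (pres_tens c d)).
apply: canonical_comp (canonical_assocV a c (pres_tens b d)) _.
by apply: canonical_tens (canonical_id _) _; exact: canonical_left_swap.
Qed.

Lemma canonical_eqhom (a b : presented) (e : pob a = pob b) : a = b ->
  canonical (eqhom e).
Proof. by move=> ab; move: e; rewrite ab => e; rewrite eqhom_id; exact: canonical_id. Qed.

Section Families.
Variable S : Type.
Implicit Types Z : S -> presented.

Lemma canonical_bt_map Z Z' (f : forall s, Hom (Z s) (Z' s)) l :
  (forall s, canonical (f s)) ->
  canonical (a := pres_bt Z l) (b := pres_bt Z' l) (bt_map f l).
Proof.
move=> cf; elim: l => [|s l IH]; first exact: (canonical_id pres_unit).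
exact: (canonical_tens (cf s) IH).
Qed.

Lemma canonical_bt_cat Z l l' :
  canonical (a := pres_tens (pres_bt Z l) (pres_bt Z l')) (b := pres_bt Z (l ++ l'))
    (bt_cat Z l l').
Proof.
elim: l => [|s l IH]; first exact: (canonical_lunit (pres_bt Z l')).
apply: (canonical_comp (b := pres_tens (Z s) (pres_tens (pres_bt Z l) (pres_bt Z l'))) _
          (canonical_assoc _ _ _)).
exact: (canonical_tens (canonical_id _) IH).
Qed.

Lemma canonical_bt_unzip Z Z' l :
  canonical (a := pres_bt (fun s => pres_tens (Z s) (Z' s)) l)
    (b := pres_tens (pres_bt Z l) (pres_bt Z' l)) (bt_unzip Z Z' l).
Proof.
elim: l => [|s l IH]; first exact: (canonical_lunitV pres_unit).
apply: (canonical_comp (canonical_interchange (Z s) (Z' s) (pres_bt Z l) (pres_bt Z' l))).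
exact: (canonical_tens (canonical_id (pres_tens (Z s) (Z' s))) IH).
Qed.

Lemma canonical_bt_units (l : seq S) :
  canonical (a := pres_bt (fun _ => pres_unit) l) (b := pres_unit) (bt_units V l).
Proof.
elim: l => [|s l IH]; first exact: (canonical_id pres_unit).
exact: (canonical_comp (canonical_lunit pres_unit) (canonical_tens (canonical_id pres_unit) IH)).
Qed.
End Families.

Lemma canonical_bt_flatten (S S' : Type) (Z : S' -> presented) (a : S -> seq S') l :
  canonical (a := pres_bt (fun s => pres_bt Z (a s)) l) (b := pres_bt Z (flatten (map a l)))
    (bt_flatten Z a l).
Proof.
elim: l => [|s l IH]; first exact: (canonical_id pres_unit).
apply: (canonical_comp (canonical_bt_cat Z (a s) (flatten (map a l)))).
exact: (canonical_tens (canonical_id (pres_bt Z (a s))) IH).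
Qed.

Lemma canonical_bt_to_map (S S' : Type) (Z : S -> presented) (Z' : S' -> presented) (f : S -> S')
    (e : forall s, pob (Z s) = pob (Z' (f s))) l : (forall s, Z s = Z' (f s)) ->
  canonical (a := pres_bt Z l) (b := pres_bt Z' (map f l))
    (bt_to_map (X := Z) (Y := Z') (f := f) e l).
Proof.
move=> e'; elim: l => [|s l IH]; first exact: (canonical_id pres_unit).
exact: (canonical_tens (canonical_eqhom _ (e' s)) IH).
Qed.

Lemma canonical_bt_of_map (S S' : Type) (Z' : S' -> presented) (f : S -> S') l :
  canonical (a := pres_bt Z' (map f l)) (b := pres_bt (fun s => Z' (f s)) l)
    (bt_of_map Z' f l).
Proof.
elim: l => [|s l IH]; first exact: (canonical_id pres_unit).
exact: (canonical_tens (canonical_id _) IH).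
Qed.

Lemma canonical_bt_pull (S : eqType) (Z : S -> presented) (x : S) l (h : x \in l) :
  canonical (a := pres_bt Z l) (b := pres_tens (Z x) (pres_bt Z (rem x l))) (bt_pull Z h).
Proof.
elim: l h => [//|y l IH] h /=; rewrite /pres_bt /=.
case: eqP => [e|ne].
  subst y; rewrite eqhom_id.
  exact: (canonical_tens (canonical_id (Z x)) (canonical_id (pres_bt Z l))).
apply: (canonical_comp (canonical_left_swap (Z y) (Z x) (pres_bt Z (rem x l)))).
exact: (canonical_tens (canonical_id _) (IH _)).
Qed.

Lemma canonical_bt_shuffle (S : eqType) (Z : S -> presented) l l' (h : perm_eq l l') :
  canonical (a := pres_bt Z l) (b := pres_bt Z l') (bt_shuffle Z h).
Proof.
elim: l' l h => [|x t IH] l h.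
  have e := perm_nilE h; subst l; rewrite bt_shuffle_nil; exact: canonical_id.
apply: (canonical_comp _ (canonical_bt_pull Z (perm_head h))).
exact: (canonical_tens (canonical_id (Z x)) (IH _ _)).
Qed.

Definition pres_ntens n (Z : 'I_n -> presented) : presented := pres_bt Z (ords n).

Lemma canonical_ntens_map n (Z Z' : 'I_n -> presented) (f : forall i, Hom (Z i) (Z' i)) :
  (forall i, canonical (f i)) ->
  canonical (a := pres_ntens Z) (b := pres_ntens Z') (ntens_map f).
Proof. exact: canonical_bt_map. Qed.

Lemma canonical_ntens_units n :
  canonical (a := pres_ntens (fun _ : 'I_n => pres_unit)) (b := pres_unit) (ntens_units V n).
Proof. exact: canonical_bt_units. Qed.

Lemma canonical_ntens_unzip (P : presented) n (Z Z' : 'I_n -> presented) :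
  canonical (a := pres_tens P (pres_ntens (fun i => pres_tens (Z i) (Z' i))))
    (b := pres_tens (pres_tens P (pres_ntens Z)) (pres_ntens Z')) (ntens_unzip P Z Z').
Proof.
apply: (canonical_comp (canonical_assocV P (pres_ntens Z) (pres_ntens Z'))).
exact: (canonical_tens (canonical_id P) (canonical_bt_unzip Z Z' _)).
Qed.

Lemma canonical_ntens_reindex m n (Z : 'I_m -> presented) (Z' : 'I_n -> presented)
    (s : 'I_m -> 'I_n) (bs : bijective s) (e : forall i, pob (Z i) = pob (Z' (s i))) :
  (forall i, Z i = Z' (s i)) ->
  canonical (a := pres_ntens Z) (b := pres_ntens Z') (ntens_reindex (Y := Z') bs e).
Proof.
move=> e'; apply: (canonical_comp (canonical_bt_shuffle Z' (perm_ords bs))).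
exact: canonical_bt_to_map.
Qed.

Lemma canonical_ntens_flat n (k : 'I_n -> nat) (Z : forall i, 'I_(k i) -> presented) :
  canonical (a := pres_ntens (fun i => pres_ntens (Z i)))
    (b := pres_ntens (fun m => Z (tagnat.sig1 m) (tagnat.sig2 m)))
    (ntens_flat (fun i j => Z i j)).
Proof.
pose Y (z : {i : 'I_n & 'I_(k i)}) := Z (tag z) (tagged z).
pose a i := map (Tagged (fun i => 'I_(k i))) (ords (k i)).
apply: (canonical_comp (b := pres_ntens (fun i => pres_bt Y (a i)))); last first.
  by apply: canonical_bt_map => i; exact: canonical_bt_to_map.
apply: (canonical_comp (b := pres_bt Y (sig_seq k (ords n)))); last first.
  exact: canonical_bt_flatten.
apply: (canonical_comp (canonical_bt_of_map Y (@tagnat.sig n k) (ords (\sum_i k i)))).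
exact: canonical_bt_shuffle.
Qed.

End Canonical.

(** * Naturality and invertibility of the structural maps *)

Section Naturality.
Variable V : SymMonCat.

Lemma bt_map_ext (T : Type) (X Y : T -> V) (f g : forall t, Hom (X t) (Y t)) l :
  (forall t, f t = g t) -> bt_map f l = bt_map g l.
Proof. by move=> fg; elim: l => //= t l ->; rewrite fg. Qed.

Lemma bt_cat_nat (T : Type) (X Y : T -> V) (f : forall t, Hom (X t) (Y t)) l l' :
  bt_cat Y l l' ∘ (bt_map f l ⊗m bt_map f l') = bt_map f (l ++ l') ∘ bt_cat X l l'.
Proof.
elim: l => [|t l IH] /=; first by rewrite lunit_nat.
by rewrite -[LHS]compmA assoc_nat; lassoc; rewrite -!tensmM IH !compm1 comp1m.
Qed.

Lemma bt_flatten_nat (S T : Type) (X Y : T -> V) (f : forall t, Hom (X t) (Y t))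
    (a : S -> seq T) l :
  bt_flatten Y a l ∘ bt_map (fun s => bt_map f (a s)) l
  = bt_map f (flatten (map a l)) ∘ bt_flatten X a l.
Proof.
elim: l => [|s l IH] /=; first by rewrite compm1.
by lassoc; rewrite -bt_cat_nat -[LHS]compmA -[RHS]compmA -!tensmM IH compm1 comp1m.
Qed.

Lemma bt_to_map_nat (S T : Type) (X X' : S -> V) (Y Y' : T -> V) (a : S -> T)
    (e : forall s, X s = Y (a s)) (e' : forall s, X' s = Y' (a s))
    (f : forall s, Hom (X s) (X' s)) (g : forall t, Hom (Y t) (Y' t)) l :
  (forall s, eqhom (e' s) ∘ f s = g (a s) ∘ eqhom (e s)) ->
  bt_to_map e' l ∘ bt_map f l = bt_map g (map a l) ∘ bt_to_map e l.
Proof.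
move=> h; elim: l => [|s l IH] /=; first by rewrite compm1.
by rewrite -!tensmM IH h.
Qed.

Lemma bt_of_map_nat (S T : Type) (Y Y' : T -> V) (a : S -> T)
    (g : forall t, Hom (Y t) (Y' t)) l :
  bt_of_map Y' a l ∘ bt_map g (map a l) = bt_map (fun s => g (a s)) l ∘ bt_of_map Y a l.
Proof.
elim: l => [|s l IH] /=; first by rewrite compm1.
by rewrite -!tensmM IH comp1m compm1.
Qed.

Lemma bt_pull_nat (T : eqType) (X Y : T -> V) (f : forall t, Hom (X t) (Y t)) x l
    (h : x \in l) :
  bt_pull Y h ∘ bt_map f l = (f x ⊗m bt_map f (rem x l)) ∘ bt_pull X h.
Proof.
elim: l h => [//|y l IH] h /=; case: eqP => [e|ne].
  by subst y; rewrite !eqhom_id !tensm1 comp1m compm1.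
rewrite -[LHS]compmA -tensmM IH comp1m -{1}[f y]compm1 tensmM; lassoc.
by rewrite left_swap_nat.
Qed.

Lemma bt_shuffle_nat (T : eqType) (X Y : T -> V) (f : forall t, Hom (X t) (Y t)) l l'
    (h : perm_eq l l') :
  bt_shuffle Y h ∘ bt_map f l = bt_map f l' ∘ bt_shuffle X h.
Proof.
elim: l' l h => [|x t IH] l h.
  by have e := perm_nilE h; subst l; rewrite !bt_shuffle_nil compm1.
rewrite /= -[LHS]compmA bt_pull_nat; lassoc; congr (_ ∘ _).
by rewrite -!tensmM IH comp1m compm1.
Qed.

Lemma ntens_reindex_nat m n (X X' : 'I_m -> V) (Y Y' : 'I_n -> V) (s : 'I_m -> 'I_n)
    (bs : bijective s) (e : forall i, X i = Y (s i)) (e' : forall i, X' i = Y' (s i))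
    (f : forall i, Hom (X i) (X' i)) (g : forall i, Hom (Y i) (Y' i)) :
  (forall i, eqhom (e' i) ∘ f i = g (s i) ∘ eqhom (e i)) ->
  ntens_reindex bs e' ∘ ntens_map f = ntens_map g ∘ ntens_reindex bs e.
Proof.
move=> h; rewrite /ntens_reindex -[LHS]compmA (bt_to_map_nat _ h) !compmA.
by rewrite bt_shuffle_nat.
Qed.

Lemma ntens_flat_nat n (k : 'I_n -> nat) (X Y : forall i, 'I_(k i) -> V)
    (f : forall i j, Hom (X i j) (Y i j)) :
  ntens_flat Y ∘ ntens_map (fun i => ntens_map (f i))
  = ntens_map (fun m => f (tagnat.sig1 m) (tagnat.sig2 m)) ∘ ntens_flat X.
Proof.
rewrite /ntens_flat /=.
pose g (z : {i : 'I_n & 'I_(k i)}) := f (tag z) (tagged z).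
have e i : bt_to_map (X := Y i) (Y := fun z : {i : 'I_n & 'I_(k i)} => Y (tag z) (tagged z))
      (f := Tagged (fun i => 'I_(k i))) (fun j => erefl) (ords (k i)) ∘ ntens_map (f i)
    = bt_map g (map (Tagged (fun i => 'I_(k i))) (ords (k i)))
      ∘ bt_to_map (X := X i) (Y := fun z : {i : 'I_n & 'I_(k i)} => X (tag z) (tagged z))
      (f := Tagged (fun i => 'I_(k i))) (fun j => erefl) (ords (k i)).
  by apply: bt_to_map_nat => j /=; rewrite comp1m compm1.
rewrite -[LHS]compmA -bt_mapM.
rewrite (bt_map_ext _ e) bt_mapM; lassoc; congr (_ ∘ _).
rewrite -[LHS]compmA (bt_flatten_nat g); lassoc; congr (_ ∘ _).
rewrite -[LHS]compmA (bt_shuffle_nat g); lassoc; congr (_ ∘ _).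
exact: (bt_of_map_nat _ g).
Qed.

Lemma bt_map_iso (T : Type) (X Y : T -> V) (f : forall t, Hom (X t) (Y t)) l :
  (forall t, is_iso (f t)) -> is_iso (bt_map f l).
Proof.
by move=> fi; elim: l => [|t l IH] /=; [exact: iso_id | exact: tensm_iso].
Qed.

Lemma ntens_map_iso n (X Y : 'I_n -> V) (f : forall t, Hom (X t) (Y t)) :
  (forall t, is_iso (f t)) -> is_iso (ntens_map f).
Proof. exact: bt_map_iso. Qed.

Lemma bt_to_map_iso (S T : Type) (X : S -> V) (Y : T -> V) (a : S -> T)
    (e : forall s, X s = Y (a s)) l : is_iso (bt_to_map e l).
Proof.
elim: l => [|s l IH] /=; first exact: iso_id.
by apply: tensm_iso IH; exact: eqhom_iso.
Qed.

Lemma bt_of_map_iso (S T : Type) (Y : T -> V) (a : S -> T) l : is_iso (bt_of_map Y a l).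
Proof.
by elim: l => [|s l IH] /=; [exact: iso_id | apply: tensm_iso IH; exact: iso_id].
Qed.

Lemma bt_flatten_iso (S T : Type) (X : T -> V) (a : S -> seq T) l :
  is_iso (bt_flatten X a l).
Proof.
elim: l => [|s l IH] /=; first exact: iso_id.
by apply: iso_comp; [exact: bt_cat_iso | apply: tensm_iso IH; exact: iso_id].
Qed.

Lemma ntens_flat_iso n (k : 'I_n -> nat) (X : forall i, 'I_(k i) -> V) :
  is_iso (ntens_flat X).
Proof.
apply: iso_comp; last by apply: bt_map_iso => i; exact: bt_to_map_iso.
apply: iso_comp; last exact: bt_flatten_iso.
by apply: iso_comp; [exact: bt_of_map_iso | exact: bt_shuffle_iso].
Qed.

Lemma ntens_unzip_iso (P : V) n (X Y : 'I_n -> V) : is_iso (ntens_unzip P X Y).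
Proof.
apply: iso_comp; first exact: assocV_iso.
apply: tensm_iso; first exact: iso_id.
suff: forall l, is_iso (bt_unzip X Y l) by apply.
elim=> [|i l IH] /=; first exact: lunitV_iso.
apply: iso_comp; last by apply: tensm_iso IH; exact: iso_id.
apply: iso_comp (assoc_iso _ _ _); apply: iso_comp (assocV_iso _ _ _) _.
by apply: tensm_iso; [exact: iso_id | exact: left_swap_iso].
Qed.
End Naturality.

(** * Lexicographic numbering of pairs and triples *)

Lemma sig_Rank n (k : 'I_n -> nat) i (j : 'I_(k i)) (T : Type) (f : forall i, 'I_(k i) -> T) :
  f (tagnat.sig1 (tagnat.Rank i j)) (tagnat.sig2 (tagnat.Rank i j)) = f i j.
Proof.
rewrite /tagnat.sig1 /tagnat.sig2 /tagnat.Rank.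
by rewrite tagnat.rankK.
Qed.

Lemma ltn_Rank n (k : 'I_n -> nat) (i a : 'I_n) (j : 'I_(k i)) (b : 'I_(k a)) :
  (tagnat.Rank i j < tagnat.Rank a b)%N = (i < a)%N || ((i == a) && (j < b)%N).
Proof.
have -> : (tagnat.Rank i j < tagnat.Rank a b)%N = (tagnat.Rank i j < tagnat.Rank a b)%O by [].
rewrite tagnat.lt_rank ltEsig /= !leEord.
have [ia|ai|e] := ltngtP i a; rewrite ?andbF //=.
- by rewrite -val_eqE /= gtn_eqF.
- have e' := val_inj e; rewrite e' in j *; rewrite tagged_asE eqxx; exact.
Qed.

Lemma sum_ltn_Rank n (k : 'I_n -> nat) (r : forall i, 'I_(k i) -> nat) a (b : 'I_(k a)) :
  \sum_(m < \sum_i k i | (m < tagnat.Rank a b)%N) r (tagnat.sig1 m) (tagnat.sig2 m)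
  = \sum_(i < n | (i < a)%N) \sum_j r i j + \sum_(j < k a | (j < b)%N) r a j.
Proof.
rewrite (reindex (@tagnat.rank n k)) /=; last exact: (onW_bij _ tagnat.rank_bij).
rewrite (eq_big (fun z : {i : 'I_n & 'I_(k i)} =>
  true && ((tag z < a)%N || (tag z == a) && (tagged z < b)%N))
  (fun z => r (tag z) (tagged z))); last first.
- by move=> z _; rewrite /tagnat.sig1 /tagnat.sig2 tagnat.rankK.
- by case=> i j; rewrite -ltn_Rank.
rewrite -(@sig_big_dep nat 0 addn 'I_n (fun i => 'I_(k i)) xpredT (fun i j =>
  (i < a)%N || (i == a) && (j < b)%N) r).
rewrite (bigID (fun i : 'I_n => (i < a)%N)) /=; congr (_ + _).
  by apply: eq_bigr => i ia; apply: eq_bigl => j; rewrite ia.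
rewrite (bigD1 a) /= ?ltnn // [X in _ + X]big1 ?addn0; last first.
  by move=> i /andP[/negPf ia /negPf iea]; rewrite big_pred0 // => j; rewrite ia iea.
by apply: eq_bigl => j; rewrite ?ltnn eqxx.
Qed.

(** A triple [(i, j, l)] has the same number in both nested lexicographic orders, since that number
    counts the triples before it, and [sum_ltn_Rank] computes the count. The map [u] identifies the
    two index types, whose bounds are different sums. *)
Lemma sig_RankRank n (k : 'I_n -> nat) (r : forall i, 'I_(k i) -> nat)
    (u : 'I_(\sum_i \sum_j r i j) -> 'I_(\sum_m r (tagnat.sig1 m) (tagnat.sig2 m)))
    (hu : forall M, u M = M :> nat) (T : Type) (f : forall i j, 'I_(r i j) -> T) M :
  f (tagnat.sig1 (tagnat.sig1 (u M))) (tagnat.sig2 (tagnat.sig1 (u M))) (tagnat.sig2 (u M))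
  = f (tagnat.sig1 M) (tagnat.sig1 (tagnat.sig2 M)) (tagnat.sig2 (tagnat.sig2 M)).
Proof.
pose a := tagnat.sig1 (tagnat.sig1 (u M)); pose b : 'I_(k a) := tagnat.sig2 (tagnat.sig1 (u M)).
pose c : 'I_(r a b) := tagnat.sig2 (u M).
suff e : M = tagnat.Rank a (tagnat.Rank b c).
  rewrite [in RHS]e (sig_Rank _ (fun i m => f i (tagnat.sig1 m) (tagnat.sig2 m))).
  by rewrite (sig_Rank _ (f a)).
have e1 := @tagnat.RankEsum n (fun i => \sum_j r i j) a (tagnat.Rank b c).
have e2 := @tagnat.RankEsum (k a) (r a) b c.
apply: val_inj; apply: etrans (esym e1); rewrite e2 -[LHS]hu.
apply: etrans (tagnat.rect (u M)) _; rewrite addnA; congr (_ + _).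
by rewrite -sum_ltn_Rank tagnat.sig2K.
Qed.

(** * The coherence identities behind the operad axioms, for labelled factors *)

Section Coherence.
Variables (V : SymMonCat) (T : eqType) (F : T -> V).
Local Notation presented := (presented F).

(** The function [g] reads off a label the index of its factor, so labels of different factors
    cannot coincide. *)
Lemma uniq_ntens n (Z : 'I_n -> presented) (U : eqType) (g : T -> U) (h : 'I_n -> U) :
  injective h -> (forall i, uniq (plist (Z i))) ->
  (forall i t, t \in plist (Z i) -> g t = h i) -> uniq (plist (pres_ntens Z)).
Proof.
move=> hi uZ gZ; rewrite /pres_ntens /=.
have: uniq (ords n) by rewrite ords_enum enum_uniq.
elim: (ords n) => //= i l IH /andP[il ul]; rewrite cat_uniq uZ (IH ul) andbT /=.
apply/hasPn => t /flattenP[s /mapP[j jl ->]] tj; apply/negP => ti.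
by move: il; rewrite (hi i j) ?jl // -(gZ _ _ ti) (gZ _ _ tj).
Qed.

Lemma mem_ntens n (Z : 'I_n -> presented) t :
  t \in plist (pres_ntens Z) -> exists i, t \in plist (Z i).
Proof. by move=> /flattenP[s /mapP[j _ ->]] tj; exists j. Qed.

Lemma coherence_reindex_flat m n (s : 'I_m -> 'I_n) (bs : bijective s)
    (k' : 'I_m -> nat) (k : 'I_n -> nat) (t : forall i, 'I_(k' i) -> 'I_(k (s i)))
    (bt : forall i, bijective (t i)) (u : 'I_(\sum_i k' i) -> 'I_(\sum_i k i)) (bu : bijective u)
    (hu : forall m, u m = tagnat.Rank (s (tagnat.sig1 m)) (t _ (tagnat.sig2 m)))
    (P : presented) (Q : 'I_n -> presented) (Y : forall i, 'I_(k i) -> presented)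
    (e : forall i, pob (Y (s (tagnat.sig1 i)) (t _ (tagnat.sig2 i)))
                   = pob (Y (tagnat.sig1 (u i)) (tagnat.sig2 (u i)))) :
  uniq (plist (pres_tens P (pres_ntens (fun i =>
          pres_tens (Q (s i)) (pres_ntens (fun j => Y (s i) (t i j))))))) ->
  (idm _ ⊗m ntens_flat (fun i j => Y i j)) ∘ ntens_unzip P Q (fun i => ntens (Y i))
  ∘ (idm P ⊗m ntens_reindex (Y := fun i => Q i ⊗ ntens (Y i)) bs (fun i => erefl))
  ∘ (idm P ⊗m ntens_map (fun i => idm (Q (s i)) ⊗m
                           ntens_reindex (Y := fun j => Y (s i) j) (bt i) (fun j => erefl)))
  = (idm _ ⊗m ntens_reindex (Y := fun m => Y (tagnat.sig1 m) (tagnat.sig2 m)) bu e)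
    ∘ (idm _ ⊗m ntens_flat (fun i j => Y (s i) (t i j)))
    ∘ ((idm P ⊗m ntens_reindex (Y := Q) bs (fun i => erefl)) ⊗m idm _)
    ∘ ntens_unzip P (fun i => Q (s i)) (fun i => ntens (fun j => Y (s i) (t i j))).
Proof.
move=> un.
pose src := pres_tens P (pres_ntens (fun i =>
          pres_tens (Q (s i)) (pres_ntens (fun j => Y (s i) (t i j))))).
pose tgt := pres_tens (pres_tens P (pres_ntens Q))
   (pres_ntens (fun m => Y (tagnat.sig1 m) (tagnat.sig2 m))).
apply: (@canonical_eq V T F src tgt) => //.
- apply: (canonical_comp (b := pres_tens P (pres_ntens (fun i =>
          pres_tens (Q (s i)) (pres_ntens (fun j => Y (s i) j)))))); last first.
    apply: (canonical_tens (canonical_id P)); apply: canonical_ntens_map => i.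
    apply: (canonical_tens (canonical_id _)).
    exact: (canonical_ntens_reindex (Z := fun j => Y (s i) (t i j)) (Z' := Y (s i))).
  apply: (canonical_comp (b := pres_tens P (pres_ntens (fun i =>
          pres_tens (Q i) (pres_ntens (Y i)))))); last first.
    apply: (canonical_tens (canonical_id P)).
    exact: (canonical_ntens_reindex (Z := fun i => pres_tens (Q (s i)) (pres_ntens (Y (s i))))
              (Z' := fun i => pres_tens (Q i) (pres_ntens (Y i)))).
  apply: (canonical_comp (b := pres_tens (pres_tens P (pres_ntens Q))
            (pres_ntens (fun i => pres_ntens (Y i))))); last exact: canonical_ntens_unzip.
  exact: (canonical_tens (canonical_id _) (canonical_ntens_flat Y)).
apply: (canonical_comp (b := pres_tens (pres_tens P (pres_ntens (fun i => Q (s i))))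
   (pres_ntens (fun i => pres_ntens (fun j => Y (s i) (t i j)))))); last first.
  exact: canonical_ntens_unzip.
apply: (canonical_comp (b := pres_tens (pres_tens P (pres_ntens Q))
   (pres_ntens (fun i => pres_ntens (fun j => Y (s i) (t i j)))))); last first.
  apply: canonical_tens (canonical_id _).
  apply: (canonical_tens (canonical_id P)).
  exact: (canonical_ntens_reindex (Z := fun i => Q (s i)) (Z' := Q)).
apply: (canonical_comp (b := pres_tens (pres_tens P (pres_ntens Q))
   (pres_ntens (fun m => Y (s (tagnat.sig1 m)) (t _ (tagnat.sig2 m)))))); last first.
  exact: (canonical_tens (canonical_id _)
            (canonical_ntens_flat (fun i j => Y (s i) (t i j)))).
apply: (canonical_tens (canonical_id _)).
apply: (canonical_ntens_reindex (Z := fun m => Y (s (tagnat.sig1 m)) (t _ (tagnat.sig2 m)))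
   (Z' := fun m => Y (tagnat.sig1 m) (tagnat.sig2 m))) => i.
by rewrite hu; exact: (esym (sig_Rank _ Y)).
Qed.

(** Here and below [u] is the identity on values; it mediates between ['I_n] and an ordinal whose
    bound is a sum that equals [n] only propositionally. *)
Lemma coherence_flat_unit n (Y : 'I_n -> presented) (u : 'I_n -> 'I_(\sum_(i < 1) n))
    (bu : bijective u) (e : forall i, pob (Y i) = pob (Y (tagnat.sig2 (u i)))) :
  (forall i, u i = i :> nat) ->
  uniq (plist (pres_ntens Y)) ->
  ntens_reindex (X := Y) (Y := fun m => Y (tagnat.sig2 m)) bu e
  = ntens_flat (fun (_ : 'I_1) j => Y j) ∘ runitV (ntens Y).
Proof.
move=> hu un.
apply: (@canonical_eq V T F (pres_ntens Y) (pres_ntens (fun m => Y (tagnat.sig2 m)))) => //.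
  apply: (canonical_ntens_reindex (Z := Y) (Z' := fun m => Y (tagnat.sig2 m))) => i.
  congr Y; apply: val_inj; rewrite /= -[LHS]hu tagnat.rect big_pred0 // => j.
  by rewrite (ord1 (tagnat.sig1 (u i))).
apply: (canonical_comp (b := pres_ntens (fun _ : 'I_1 => pres_ntens Y))).
  exact: (canonical_ntens_flat (fun _ => Y)).
exact: (canonical_runitV (pres_ntens Y)).
Qed.

Lemma coherence_units_l (B D : presented) :
  uniq (plist (pres_tens B D)) ->
  ((idm unitI ⊗m runitV B) ⊗m runitV D) ∘ (lunitV B ⊗m idm D)
  = ntens_unzip unitI (fun _ : 'I_1 => B) (fun _ : 'I_1 => D)
    ∘ (idm unitI ⊗m runitV (B ⊗ D)) ∘ lunitV (B ⊗ D).
Proof.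
move=> un.
apply: (@canonical_eq V T F (pres_tens B D)
  (pres_tens (pres_tens (pres_unit F) (pres_tens B (pres_unit F))) (pres_tens D (pres_unit F))))
    => //.
  apply: (canonical_comp (b := pres_tens (pres_tens (pres_unit F) B) D)).
    apply: canonical_tens (canonical_runitV D).
    exact: (canonical_tens (canonical_id _) (canonical_runitV B)).
  exact: (canonical_tens (canonical_lunitV B) (canonical_id D)).
apply: (canonical_comp (b := pres_tens (pres_unit F) (pres_tens B D))
          _ (canonical_lunitV (pres_tens B D))).
apply: (canonical_comp (b := pres_tens (pres_unit F) (pres_tens (pres_tens B D) (pres_unit F)))).
  exact: (canonical_ntens_unzip (pres_unit F) (fun _ : 'I_1 => B) (fun _ => D)).
exact: (canonical_tens (canonical_id _) (canonical_runitV (pres_tens B D))).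
Qed.

Lemma coherence_flat_units n (Y : 'I_n -> presented) (u : 'I_n -> 'I_(\sum_(i < n) 1))
    (bu : bijective u) (e : forall i, pob (Y i) = pob (Y (tagnat.sig1 (u i)))) :
  (forall i, u i = i :> nat) ->
  uniq (plist (pres_ntens Y)) ->
  ntens_reindex (X := Y) (Y := fun m => Y (tagnat.sig1 m)) bu e
  = ntens_flat (fun i (_ : 'I_1) => Y i) ∘ ntens_map (fun i => runitV (Y i)).
Proof.
move=> hu un.
apply: (@canonical_eq V T F (pres_ntens Y) (pres_ntens (fun m => Y (tagnat.sig1 m)))) => //.
  apply: (canonical_ntens_reindex (Z := Y) (Z' := fun m => Y (tagnat.sig1 m))) => i.
  congr Y; apply: val_inj; rewrite /= -[LHS]hu tagnat.rect (ord1 (tagnat.sig2 (u i))) addn0.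
  have le : tagnat.sig1 (u i) <= n by apply: ltnW.
  by rewrite -(big_ord_widen n (fun _ => 1) le) sum1_card card_ord.
apply: (canonical_comp (b := pres_ntens (fun i => pres_ntens (fun _ : 'I_1 => Y i)))).
  exact: (canonical_ntens_flat (fun i _ => Y i)).
apply: (canonical_ntens_map (Z := Y) (Z' := fun i => pres_ntens (fun _ : 'I_1 => Y i))) => i.
exact: (canonical_runitV (Y i)).
Qed.

(** Each [Y i] receives two unit factors: one moves next to [P], where a unit operation is inserted,
    and the other is the empty tail of a unary tensor product. *)
Definition units_r (P : V) n (Y : 'I_n -> V) :
    Hom (P ⊗ ntens Y) ((P ⊗ ntens (fun _ : 'I_n => unitI)) ⊗ ntens (fun i => Y i ⊗ unitI)) :=
  ntens_unzip P (fun _ : 'I_n => unitI) (fun i => Y i ⊗ unitI)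
  ∘ (idm P ⊗m ntens_map (fun i => (idm unitI ⊗m runitV (Y i)) ∘ lunitV (Y i))).

Lemma coherence_units_r (P : presented) n (Y : 'I_n -> presented) :
  uniq (plist (pres_tens P (pres_ntens Y))) ->
  ((runit P ∘ (idm P ⊗m ntens_units V n)) ⊗m idm _)
    ∘ ((idm _ ⊗m ntens_map (fun i => runit (Y i))) ∘ units_r P Y)
  = idm (P ⊗ ntens Y).
Proof.
move=> un.
apply: (@canonical_eq V T F (pres_tens P (pres_ntens Y)) (pres_tens P (pres_ntens Y))) => //;
  last exact: canonical_id.
pose PI := pres_tens P (pres_ntens (fun _ : 'I_n => pres_unit F)).
apply: (canonical_comp (b := pres_tens PI (pres_ntens Y))).
  apply: canonical_tens (canonical_id _).
  apply: (canonical_comp (canonical_runit P)).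
  exact: (canonical_tens (canonical_id P) (canonical_ntens_units _ n)).
apply: (canonical_comp (b := pres_tens PI (pres_ntens (fun i => pres_tens (Y i) (pres_unit F))))).
  apply: (canonical_tens (canonical_id PI)).
  by apply: canonical_ntens_map => i; exact: (canonical_runit (Y i)).
apply: (canonical_comp (b := pres_tens P (pres_ntens (fun i =>
          pres_tens (pres_unit F) (pres_tens (Y i) (pres_unit F)))))).
  exact: canonical_ntens_unzip.
apply: (canonical_tens (canonical_id P)).
apply: (canonical_ntens_map (Z' := fun i =>
          pres_tens (pres_unit F) (pres_tens (Y i) (pres_unit F)))) => i.
apply: (canonical_comp (b := pres_tens (pres_unit F) (Y i)) _ (canonical_lunitV (Y i))).
exact: (canonical_tens (canonical_id _) (canonical_runitV (Y i))).
Qed.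

(** Both sides sort the factors of a three-level composite into groups; the left side begins with
    the two inner levels, the right side with the two outer ones. *)
Lemma coherence_flat_flat n (k : 'I_n -> nat) (r : forall i, 'I_(k i) -> nat)
    (u : 'I_(\sum_i \sum_j r i j) -> 'I_(\sum_m r (tagnat.sig1 m) (tagnat.sig2 m)))
    (bu : bijective u)
    (P : presented) (Q : 'I_n -> presented) (R : forall i, 'I_(k i) -> presented)
    (Y : forall i j, 'I_(r i j) -> presented)
    (e : forall M, pob (Y _ (tagnat.sig1 (tagnat.sig2 M)) (tagnat.sig2 (tagnat.sig2 M)))
            = pob (Y _ (tagnat.sig2 (tagnat.sig1 (u M))) (tagnat.sig2 (u M)))) :
  (forall M, u M = M :> nat) ->
  uniq (plist (pres_tens P (pres_ntens (fun i => pres_tens (Q i) (pres_ntens (fun j =>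
          pres_tens (R i j) (pres_ntens (Y i j)))))))) ->
  (idm _ ⊗m ntens_reindex
     (X := fun M => Y _ (tagnat.sig1 (tagnat.sig2 M)) (tagnat.sig2 (tagnat.sig2 M)))
     (Y := fun M => Y _ (tagnat.sig2 (tagnat.sig1 M)) (tagnat.sig2 M)) bu e)
  ∘ (((idm _ ⊗m ntens_flat (fun i j => R i j)) ∘ ntens_unzip P Q (fun i => ntens (R i))) ⊗m idm _)
  ∘ ((idm _ ⊗m ntens_flat (fun i m => Y i (tagnat.sig1 m) (tagnat.sig2 m)))
     ∘ ntens_unzip P (fun i => Q i ⊗ ntens (R i))
         (fun i => ntens (fun m => Y i (tagnat.sig1 m) (tagnat.sig2 m)))
     ∘ (idm P ⊗m ntens_map (fun i => (idm _ ⊗m ntens_flat (fun j l => Y i j l))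
                           ∘ ntens_unzip (Q i) (R i) (fun j => ntens (Y i j)))))
  = (idm _ ⊗m ntens_flat (fun m l => Y (tagnat.sig1 m) (tagnat.sig2 m) l))
    ∘ ntens_unzip (P ⊗ ntens Q) (fun m => R (tagnat.sig1 m) (tagnat.sig2 m))
        (fun m => ntens (Y (tagnat.sig1 m) (tagnat.sig2 m)))
    ∘ (idm _ ⊗m ntens_flat (fun i j => R i j ⊗ ntens (Y i j)))
    ∘ ntens_unzip P Q (fun i => ntens (fun j => R i j ⊗ ntens (Y i j))).
Proof.
move=> hu un.
pose RY i j := pres_tens (R i j) (pres_ntens (Y i j)).
pose Rm m := R (tagnat.sig1 m) (tagnat.sig2 m).
pose Ym m l := Y (tagnat.sig1 m) (tagnat.sig2 m) l.
pose Yi i m := Y i (tagnat.sig1 m) (tagnat.sig2 m).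
pose PQ := pres_tens P (pres_ntens Q).
apply: (@canonical_eq V T F
  (pres_tens P (pres_ntens (fun i => pres_tens (Q i) (pres_ntens (RY i)))))
  (pres_tens (pres_tens PQ (pres_ntens Rm))
             (pres_ntens (fun M : 'I_(\sum_m r (tagnat.sig1 m) (tagnat.sig2 m))
               => Ym (tagnat.sig1 M) (tagnat.sig2 M))))) => //.
- pose mid := pres_tens (pres_tens P (pres_ntens (fun i => pres_tens (Q i) (pres_ntens (R i)))))
     (pres_ntens (fun M : 'I_(\sum_i \sum_j r i j) => Yi (tagnat.sig1 M) (tagnat.sig2 M))).
  apply: (canonical_comp (b := mid)).
    apply: (canonical_comp (b := pres_tens (pres_tens PQ (pres_ntens Rm))
               (pres_ntens (fun M : 'I_(\sum_i \sum_j r i j) =>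
                 Yi (tagnat.sig1 M) (tagnat.sig2 M))))).
      apply: (canonical_tens (canonical_id _)).
      apply: (canonical_ntens_reindex (Z := fun M : 'I_(\sum_i \sum_j r i j) =>
        Yi (tagnat.sig1 M) (tagnat.sig2 M))
               (Z' := fun M : 'I_(\sum_m r (tagnat.sig1 m) (tagnat.sig2 m))
                 => Ym (tagnat.sig1 M) (tagnat.sig2 M))) => M.
      exact: (esym (sig_RankRank hu Y M)).
    apply: canonical_tens (canonical_id _).
    apply: (canonical_comp (b := pres_tens PQ (pres_ntens (fun i => pres_ntens (R i))))).
      exact: (canonical_tens (canonical_id _) (canonical_ntens_flat R)).
    exact: canonical_ntens_unzip.
  apply: (canonical_comp (b := pres_tens P (pres_ntens (fun i =>
     pres_tens (pres_tens (Q i) (pres_ntens (R i))) (pres_ntens (Yi i)))))).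
    apply: (canonical_comp (b := pres_tens (pres_tens P (pres_ntens
        (fun i => pres_tens (Q i) (pres_ntens (R i))))) (pres_ntens (fun i => pres_ntens (Yi i))))).
      exact: (canonical_tens (canonical_id _) (canonical_ntens_flat Yi)).
    exact: (canonical_ntens_unzip P (fun i => pres_tens (Q i) (pres_ntens (R i)))).
  apply: (canonical_tens (canonical_id P)).
  apply: (canonical_ntens_map (Z := fun i => pres_tens (Q i) (pres_ntens (RY i)))
    (Z' := fun i => pres_tens (pres_tens (Q i) (pres_ntens (R i))) (pres_ntens (Yi i)))) => i.
  apply: (canonical_comp (b := pres_tens (pres_tens (Q i) (pres_ntens (R i)))
      (pres_ntens (fun j => pres_ntens (Y i j))))).
    exact: (canonical_tens (canonical_id _) (canonical_ntens_flat (Y i))).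
  exact: canonical_ntens_unzip.
apply: (canonical_comp (b := pres_tens PQ (pres_ntens (fun i => pres_ntens (RY i))))); last first.
  exact: (canonical_ntens_unzip P Q (fun i => pres_ntens (RY i))).
apply: (canonical_comp (b := pres_tens PQ (pres_ntens (fun m =>
          pres_tens (Rm m) (pres_ntens (Ym m)))))); last first.
  exact: (canonical_tens (canonical_id PQ) (canonical_ntens_flat RY)).
apply: (canonical_comp (b := pres_tens (pres_tens PQ (pres_ntens Rm))
          (pres_ntens (fun m => pres_ntens (Ym m))))); last exact: canonical_ntens_unzip.
exact: (canonical_tens (canonical_id _) (canonical_ntens_flat Ym)).
Qed.

End Coherence.

(** * The same identities for arbitrary families of objects *)

Section Concrete.
Variable V : SymMonCat.

Lemma uniq_atoms (T : eqType) (F : T -> V) n (a : 'I_n -> T) :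
  injective a -> uniq (plist (pres_ntens (fun i => pres_atom F (a i)))).
Proof.
move=> ai; apply: (@uniq_ntens V T F n _ T id a) => // i t.
by rewrite inE => /eqP.
Qed.

Lemma mem_atoms (T : eqType) (F : T -> V) n (a : 'I_n -> T) t :
  t \in plist (pres_ntens (fun i => pres_atom F (a i))) -> exists i, t = a i.
Proof. by move=> /mem_ntens[i]; rewrite inE => /eqP->; exists i. Qed.

Lemma Tagged_inj (I : eqType) (T_ : I -> eqType) i : injective (Tagged (i := i) T_).
Proof. by move=> x y /eqP; rewrite eq_Tagged => /eqP. Qed.

Lemma ntens_reindex_flat m n (s : 'I_m -> 'I_n) (bs : bijective s)
    (k' : 'I_m -> nat) (k : 'I_n -> nat) (t : forall i, 'I_(k' i) -> 'I_(k (s i)))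
    (bt : forall i, bijective (t i)) (u : 'I_(\sum_i k' i) -> 'I_(\sum_i k i)) (bu : bijective u)
    (hu : forall m, u m = tagnat.Rank (s (tagnat.sig1 m)) (t _ (tagnat.sig2 m)))
    (P : V) (Q : 'I_n -> V) (Y : forall i, 'I_(k i) -> V)
    (e : forall i, Y (s (tagnat.sig1 i)) (t _ (tagnat.sig2 i))
                   = Y (tagnat.sig1 (u i)) (tagnat.sig2 (u i))) :
  (idm _ ⊗m ntens_flat (fun i j => Y i j)) ∘ ntens_unzip P Q (fun i => ntens (Y i))
  ∘ (idm P ⊗m ntens_reindex (Y := fun i => Q i ⊗ ntens (Y i)) bs (fun i => erefl))
  ∘ (idm P ⊗m ntens_map (fun i => idm (Q (s i)) ⊗m
                           ntens_reindex (Y := fun j => Y (s i) j) (bt i) (fun j => erefl)))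
  = (idm _ ⊗m ntens_reindex (Y := fun m => Y (tagnat.sig1 m) (tagnat.sig2 m)) bu e)
    ∘ (idm _ ⊗m ntens_flat (fun i j => Y (s i) (t i j)))
    ∘ ((idm P ⊗m ntens_reindex (Y := Q) bs (fun i => erefl)) ⊗m idm _)
    ∘ ntens_unzip P (fun i => Q (s i)) (fun i => ntens (fun j => Y (s i) (t i j))).
Proof.
(* Every factor gets a label of its own, even where two factors are the same object. This supplies
   the distinctness that the coherence theorem requires. *)
pose T : eqType := option ('I_n + {i : 'I_n & 'I_(k i)}).
pose F (x : T) : V := match x with
  | None => P | Some (inl i) => Q i | Some (inr z) => Y (tag z) (tagged z) end.
pose PP := pres_atom F None.
pose QQ i := pres_atom F (Some (inl i)).
pose YY i (j : 'I_(k i)) := pres_atom F (Some (inr (Tagged (fun i => 'I_(k i)) j))).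
apply: (@coherence_reindex_flat V T F m n s bs k' k t bt u bu hu PP QQ YY e).
apply/andP; split.
  by apply/negP => /mem_ntens[i]; rewrite mem_cat inE => /orP[/eqP //|/mem_atoms[j]].
apply: (@uniq_ntens V T F m _ (option 'I_n)
  (fun x => match x with None => None | Some (inl i) => Some i | Some (inr z) => Some (tag z) end)
  (fun i => Some (s i))).
- by move=> i i' [] /(bij_inj bs).
- move=> i; apply/andP; split; first by apply/negP => /mem_atoms[j].
  apply: (@uniq_atoms T F _ (fun j => Some (inr (Tagged (fun i => 'I_(k i)) (t i j))))).
  by move=> j j' [] /eqP; rewrite eq_Tagged => /eqP /(bij_inj (bt i)).
by move=> i x; rewrite mem_cat inE => /orP[/eqP->|/mem_atoms[j ->]].
Qed.

Lemma ntens_flat_unit n (Y : 'I_n -> V) (u : 'I_n -> 'I_(\sum_(i < 1) n))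
    (bu : bijective u) (e : forall i, Y i = Y (tagnat.sig2 (u i))) :
  (forall i, u i = i :> nat) ->
  ntens_reindex (X := Y) (Y := fun m => Y (tagnat.sig2 m)) bu e
  = ntens_flat (fun (_ : 'I_1) j => Y j) ∘ runitV (ntens Y).
Proof.
move=> hu; pose T : eqType := 'I_n.
apply: (@coherence_flat_unit V T Y n (fun i => pres_atom Y (i : T)) u bu e hu).
exact: uniq_atoms.
Qed.

Lemma ntens_unzip_unit (B D : V) :
  ((idm unitI ⊗m runitV B) ⊗m runitV D) ∘ (lunitV B ⊗m idm D)
  = ntens_unzip unitI (fun _ : 'I_1 => B) (fun _ : 'I_1 => D)
    ∘ (idm unitI ⊗m runitV (B ⊗ D)) ∘ lunitV (B ⊗ D).
Proof.
pose F (b : bool) := if b then B else D.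
exact: (@coherence_units_l V bool F (pres_atom F true) (pres_atom F false)).
Qed.

Lemma ntens_flat_units n (Y : 'I_n -> V) (u : 'I_n -> 'I_(\sum_(i < n) 1))
    (bu : bijective u) (e : forall i, Y i = Y (tagnat.sig1 (u i))) :
  (forall i, u i = i :> nat) ->
  ntens_reindex (X := Y) (Y := fun m => Y (tagnat.sig1 m)) bu e
  = ntens_flat (fun i (_ : 'I_1) => Y i) ∘ ntens_map (fun i => runitV (Y i)).
Proof.
move=> hu; pose T : eqType := 'I_n.
apply: (@coherence_flat_units V T Y n (fun i => pres_atom Y (i : T)) u bu e hu).
exact: uniq_atoms.
Qed.

Lemma units_rK (P : V) n (Y : 'I_n -> V) :
  ((runit P ∘ (idm P ⊗m ntens_units V n)) ⊗m idm _)
    ∘ ((idm _ ⊗m ntens_map (fun i => runit (Y i))) ∘ units_r P Y)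
  = idm (P ⊗ ntens Y).
Proof.
pose T : eqType := option 'I_n.
pose F (x : T) := if x is Some i then Y i else P.
apply: (@coherence_units_r V T F (pres_atom F None) n (fun i => pres_atom F (Some i))).
apply/andP; split; first by apply/negP => /mem_atoms[i].
by apply: (@uniq_atoms T F _ Some) => i j [].
Qed.

Lemma ntens_flat_flat n (k : 'I_n -> nat) (r : forall i, 'I_(k i) -> nat)
    (u : 'I_(\sum_i \sum_j r i j) -> 'I_(\sum_m r (tagnat.sig1 m) (tagnat.sig2 m)))
    (bu : bijective u)
    (P : V) (Q : 'I_n -> V) (R : forall i, 'I_(k i) -> V)
    (Y : forall i j, 'I_(r i j) -> V)
    (e : forall M, Y _ (tagnat.sig1 (tagnat.sig2 M)) (tagnat.sig2 (tagnat.sig2 M))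
            = Y _ (tagnat.sig2 (tagnat.sig1 (u M))) (tagnat.sig2 (u M))) :
  (forall M, u M = M :> nat) ->
  (idm _ ⊗m ntens_reindex
     (X := fun M => Y _ (tagnat.sig1 (tagnat.sig2 M)) (tagnat.sig2 (tagnat.sig2 M)))
     (Y := fun M => Y _ (tagnat.sig2 (tagnat.sig1 M)) (tagnat.sig2 M)) bu e)
  ∘ (((idm _ ⊗m ntens_flat (fun i j => R i j)) ∘ ntens_unzip P Q (fun i => ntens (R i))) ⊗m idm _)
  ∘ ((idm _ ⊗m ntens_flat (fun i m => Y i (tagnat.sig1 m) (tagnat.sig2 m)))
     ∘ ntens_unzip P (fun i => Q i ⊗ ntens (R i))
         (fun i => ntens (fun m => Y i (tagnat.sig1 m) (tagnat.sig2 m)))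
     ∘ (idm P ⊗m ntens_map (fun i => (idm _ ⊗m ntens_flat (fun j l => Y i j l))
                           ∘ ntens_unzip (Q i) (R i) (fun j => ntens (Y i j)))))
  = (idm _ ⊗m ntens_flat (fun m l => Y (tagnat.sig1 m) (tagnat.sig2 m) l))
    ∘ ntens_unzip (P ⊗ ntens Q) (fun m => R (tagnat.sig1 m) (tagnat.sig2 m))
        (fun m => ntens (Y (tagnat.sig1 m) (tagnat.sig2 m)))
    ∘ (idm _ ⊗m ntens_flat (fun i j => R i j ⊗ ntens (Y i j)))
    ∘ ntens_unzip P Q (fun i => ntens (fun j => R i j ⊗ ntens (Y i j))).
Proof.
move=> hu.
pose K2 i : eqType := 'I_(k i).
pose K3 i : eqType := {j : 'I_(k i) & 'I_(r i j)}.
pose T : eqType := option ('I_n + ({i : 'I_n & K2 i} + {i : 'I_n & K3 i})).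
pose F (x : T) : V := match x with
  | None => P | Some (inl i) => Q i | Some (inr (inl z)) => R (tag z) (tagged z)
  | Some (inr (inr z)) => Y (tag z) (tag (tagged z)) (tagged (tagged z)) end.
pose PP := pres_atom F None.
pose QQ i := pres_atom F (Some (inl i)).
pose RR i (j : 'I_(k i)) := pres_atom F (Some (inr (inl (Tagged K2 j)))).
pose YY i (j : 'I_(k i)) (l : 'I_(r i j))
  := pres_atom F (Some (inr (inr (Tagged K3 (Tagged (fun j => 'I_(r i j)) l))))).
apply: (@coherence_flat_flat V T F n k r u bu PP QQ RR YY e hu).
pose g1 (x : T) := match x with
  | None => None | Some (inl i) => Some i | Some (inr (inl z)) => Some (tag z)
  | Some (inr (inr z)) => Some (tag z) end.
pose a3 i (j : 'I_(k i)) (l : 'I_(r i j)) : T := Some (inr (inr (Tagged K3 (Tagged (fun j =>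
  'I_(r i j)) l)))).
pose a2 i (j : 'I_(k i)) : T := Some (inr (inl (Tagged K2 j))).
have mY i x : x \in plist (pres_ntens (fun j => pres_tens (RR i j) (pres_ntens (YY i j)))) ->
    exists j, x = a2 i j \/ exists l, x = a3 i j l.
  move=> /mem_ntens[j]; rewrite mem_cat inE => /orP[/eqP->|/mem_atoms[l ->]]; exists j;
    first by left.
  by right; exists l.
apply/andP; split.
  apply/negP => /mem_ntens[i]; rewrite mem_cat inE => /orP[/eqP //|].
  by move=> /mY[j [//|[l]]].
apply: (@uniq_ntens V T F n _ (option 'I_n) g1 Some).
- by move=> i i' [].
- move=> i; apply/andP; split; first by apply/negP => /mY[j [//|[l]]].
  pose g2 (x : T) : option {i : 'I_n & K2 i} := match x with
    | Some (inr (inl z)) => Some z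
    | Some (inr (inr z)) => Some (Tagged K2 (tag (tagged z))) | _ => None end.
  apply: (@uniq_ntens V T F (k i) _ _ g2 (fun j => Some (Tagged K2 (j : K2 i)))).
  + by move=> j j' [] /Tagged_inj.
  + move=> j; apply/andP; split; first by apply/negP => /mem_atoms[l].
    by apply: (@uniq_atoms T F _ (a3 i j)) => l l' [] /Tagged_inj /Tagged_inj.
  by move=> j x; rewrite mem_cat inE => /orP[/eqP->|/mem_atoms[l ->]].
by move=> i x; rewrite mem_cat inE => /orP[/eqP-> //|/mY[j [->|[l ->]]]].
Qed.

Lemma ntens_reindex_id n (Y : 'I_n -> V) (s : 'I_n -> 'I_n) (bs : bijective s)
    (e : forall i, Y i = Y (s i)) : (forall i, s i = i) ->
      ntens_reindex (X := Y) (Y := Y) bs e = idm _.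
Proof.
move=> hs; pose T : eqType := 'I_n.
pose Z i := pres_atom Y (i : T).
apply: (@canonical_eq V T Y (pres_ntens Z) (pres_ntens Z)); first exact: uniq_atoms.
  by apply: (canonical_ntens_reindex (Z := Z) (Z' := Z)) => i; rewrite hs.
exact: (canonical_id (pres_ntens Z)).
Qed.

Lemma ntens_reindex_comp m n l (Y : 'I_n -> V) (s : 'I_m -> 'I_n) (t : 'I_l -> 'I_m)
    (u : 'I_l -> 'I_n) (bs : bijective s) (bt : bijective t) (bu : bijective u)
    (e : forall i, Y (s (t i)) = Y (u i)) :
  (forall i, u i = s (t i)) ->
  ntens_reindex (Y := Y) bs (fun i => erefl)
    ∘ ntens_reindex (Y := fun i => Y (s i)) bt (fun i => erefl)
  = ntens_reindex (Y := Y) bu e.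
Proof.
move=> hu; pose T : eqType := 'I_n.
pose Z i := pres_atom Y (i : T).
apply: (@canonical_eq V T Y (pres_ntens (fun i => Z (s (t i)))) (pres_ntens Z)).
- by apply: uniq_atoms => i j /(bij_inj bs) /(bij_inj bt).
- apply: (canonical_comp (b := pres_ntens (fun i => Z (s i)))).
    exact: (canonical_ntens_reindex (Z := fun i => Z (s i)) (Z' := Z)).
  exact: (canonical_ntens_reindex (Z := fun i => Z (s (t i))) (Z' := fun i => Z (s i))).
by apply: (canonical_ntens_reindex (Z := fun i => Z (s (t i))) (Z' := Z)) => i; rewrite hu.
Qed.
End Concrete.

(** * Lifting an operad action along a family of maps *)

Section FlatOperads.
Variable V : SymMonCat.

(** Indexing operations by arities instead of profiles avoids transport along equalities
    of profiles. *)
Record FlatOperad := {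
  fo :> nat -> V;
  fperm : forall m n (s : 'I_m -> 'I_n), bijective s -> Hom (fo n) (fo m);
  fperm_id : forall n (s : 'I_n -> 'I_n) (bs : bijective s), (forall i, s i = i) ->
    fperm bs = idm _;
  fperm_comp : forall l m n (s : 'I_m -> 'I_n) (t : 'I_l -> 'I_m) (u : 'I_l -> 'I_n)
      (bs : bijective s) (bt : bijective t) (bu : bijective u), (forall i, u i = s (t i)) ->
    fperm bu = fperm bt ∘ fperm bs;
  funit : Hom unitI (fo 1);
  fcomp : forall n (k : 'I_n -> nat),
    Hom (fo n ⊗ ntens (fun i => fo (k i))) (fo (\sum_i k i));
  f_equivariant : forall m n (s : 'I_m -> 'I_n) (bs : bijective s)
      (k' : 'I_m -> nat) (k : 'I_n -> nat) (t : forall i, 'I_(k' i) -> 'I_(k (s i)))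
      (bt : forall i, bijective (t i)) (u : 'I_(\sum_i k' i) -> 'I_(\sum_i k i))
      (bu : bijective u),
    (forall m, u m = tagnat.Rank (s (tagnat.sig1 m)) (t _ (tagnat.sig2 m))) ->
    fcomp k' ∘ (fperm bs ⊗m ntens_map (fun i => fperm (bt i)))
    = fperm bu ∘ fcomp k
      ∘ (idm _ ⊗m ntens_reindex (Y := fun i => fo (k i)) bs (fun i => erefl));
  f_unit_left : forall n (u : 'I_n -> 'I_(\sum_(i < 1) n)) (bu : bijective u),
    (forall i, u i = i :> nat) ->
    fperm bu ∘ fcomp (fun _ : 'I_1 => n) ∘ (funit ⊗m runitV _) ∘ lunitV (fo n) = idm _;
  f_unit_right : forall n (u : 'I_n -> 'I_(\sum_(i < n) 1)) (bu : bijective u),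
    (forall i, u i = i :> nat) ->
    fperm bu ∘ fcomp (fun _ : 'I_n => 1) ∘ (idm _ ⊗m ntens_map (fun _ => funit))
    = runit (fo n) ∘ (idm _ ⊗m ntens_units V n);
  f_assoc : forall n (k : 'I_n -> nat) (r : forall i, 'I_(k i) -> nat)
      (u : 'I_(\sum_i \sum_j r i j) -> 'I_(\sum_m r (tagnat.sig1 m) (tagnat.sig2 m)))
      (bu : bijective u),
    (forall M, u M = M :> nat) ->
    fcomp (fun i => \sum_j r i j) ∘ (idm _ ⊗m ntens_map (fun i => fcomp (r i)))
    = fperm bu ∘ fcomp (fun m => r (tagnat.sig1 m) (tagnat.sig2 m))
      ∘ (fcomp k ⊗m ntens_flat (fun i j => fo (r i j))) ∘ ntens_unzip _ _ _ }.

Definition is_flat_map (L L' : FlatOperad) (g : forall n, Hom (L n) (L' n)) : Prop :=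
  [/\ forall m n (s : 'I_m -> 'I_n) (bs : bijective s),
        g m ∘ fperm L bs = fperm L' bs ∘ g n,
      g 1 ∘ funit L = funit L'
    & forall n (k : 'I_n -> nat),
        g _ ∘ fcomp L k = fcomp L' k ∘ (g n ⊗m ntens_map (fun i => g (k i)))].

Section OfOperad.
Variable O : Operad V unit.

Definition uprof (n : nat) : Profile unit := Prof n (fun _ => tt).

Lemma uprofE (p : Profile unit) : uprof (len p) = p.
Proof.
case: p => n c; rewrite /uprof; congr (Prof _ _).
by apply: funext => i; case: (c i).
Qed.

Definition unit_perm m n (s : 'I_m -> 'I_n) (bs : bijective s) :
    ProfPerm (uprof m) (uprof n) :=
  Build_ProfPerm (p' := uprof m) (p := uprof n) bs (fun i => erefl).

Lemma reindex_irrel (W : SymMonCat) m n (X : 'I_m -> W) (Y : 'I_n -> W) (s : 'I_m -> 'I_n)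
    (bs : bijective s) (e e' : forall i, X i = Y (s i)) :
  ntens_reindex bs e = ntens_reindex bs e'.
Proof. by congr (ntens_reindex bs _); apply: functional_extensionality_dep => i;
  exact: Prop_irrelevance. Qed.

Definition flat_operad : FlatOperad.
Proof.
unshelve refine {| fo := fun n => O (uprof n) tt;
  fperm := fun m n s bs => cact O tt (unit_perm bs);
  funit := opunit O tt;
  fcomp := fun n k => opcomp O (p := uprof n) (fun i => uprof (k i)) tt |}.
- by move=> n s bs hs; apply: cact_id.
- by move=> l m n s t u bs bt bu hu; apply: cact_comp.
- move=> m n s bs k' k t bt u bu hu.
  have := @op_equivariant V unit O (uprof m) (uprof n) (unit_perm bs)
    (fun i => uprof (k' i)) (fun i => uprof (k i)) (fun i => unit_perm (bt i)) tt (unit_perm bu) hu.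
  move=> h; apply: etrans h _; congr (_ ∘ (_ ⊗m _)); exact: reindex_irrel.
- move=> n u bu hu; exact: (@op_unit_left V unit O (uprof n) tt (unit_perm bu) hu).
- move=> n u bu hu; exact: (@op_unit_right V unit O (uprof n) tt (unit_perm bu) hu).
move=> n k r u bu hu.
exact: (@op_assoc V unit O (uprof n) (fun i => uprof (k i)) (fun i j => uprof (r i j)) tt
  (unit_perm bu) hu).
Defined.
End OfOperad.

Section ToOperad.
Variable L : FlatOperad.

Definition flat_coll : Collection V unit.
Proof.
unshelve refine {| cob := fun p _ => L (len p);
  cact := fun p' p _ s => fperm L (pperm_bij s) |}.
- by move=> p d s hs; apply: fperm_id.
- by move=> p'' p' p d s t u hu; apply: fperm_comp.
Defined.

Definition to_operad : Operad V unit.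
Proof.
unshelve refine {| opcoll := flat_coll; opunit := fun _ => funit L : Hom _ (flat_coll (prof1 _) _);
  opcomp := fun p q _ => fcomp L (fun i => len (q i)) |}.
- move=> p' p s q' q t d u hu.
  refine (etrans (@f_equivariant L _ _ _ (pperm_bij s) (fun i => len (q' i)) (fun i => len (q i))
    (fun i => t i) (fun i => pperm_bij (t i)) _ (pperm_bij u) hu) _).
  congr (_ ∘ (_ ⊗m _)); exact: reindex_irrel.
- move=> q d u hu; exact: (@f_unit_left L (len q) u (pperm_bij u) hu).
- move=> p d u hu; exact: (@f_unit_right L (len p) u (pperm_bij u) hu).
move=> p q r d u hu; exact: (@f_assoc L (len p) (fun i => len (q i)) (fun i j => len (r i j))
  u (pperm_bij u) hu).
Defined.
End ToOperad.

Section FlatActions.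
Variables (L : FlatOperad) (S : SmallSet) (X : S -> V).
Variable ok : forall n, ('I_n -> S) -> S -> Prop.
Variable act : forall n (x : 'I_n -> S) e, ok x e -> Hom (L n ⊗ ntens (fun i => X (x i))) (X e).

Record flat_action : Prop := {
  fact_equivariant : forall m n (s : 'I_m -> 'I_n) (bs : bijective s) (x : 'I_n -> S) e
      (h : ok x e) (h' : ok (fun i => x (s i)) e),
    act h' ∘ (fperm L bs ⊗m idm _)
    = act h ∘ (idm _ ⊗m ntens_reindex (Y := fun i => X (x i)) bs (fun i => erefl));
  fact_unit : forall e (h : ok (fun _ : 'I_1 => e) e),
    act h ∘ (funit L ⊗m runitV _) ∘ lunitV (X e) = idm _;
  fact_assoc : forall n (k : 'I_n -> nat) (x : forall i, 'I_(k i) -> S) (y : 'I_n -> S) e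
      (h : ok y e) (hq : forall i, ok (x i) (y i))
      (h' : ok (fun m => x (tagnat.sig1 m) (tagnat.sig2 m)) e),
    act h ∘ (idm _ ⊗m ntens_map (fun i => act (hq i)))
    = act h' ∘ (fcomp L k ⊗m ntens_flat (fun i j => X (x i j))) ∘ ntens_unzip _ _ _ }.

Hypothesis act_law : flat_action.

Lemma fact_reindex m n (s : 'I_m -> 'I_n) (bs : bijective s) (x : 'I_n -> S) (x' : 'I_m -> S)
    (xx : forall i, x' i = x (s i)) e (h : ok x e) (h' : ok x' e) :
  act h' ∘ (fperm L bs ⊗m idm _)
  = act h ∘ (idm _ ⊗m ntens_reindex (Y := fun i => X (x i)) bs (fun i => congr1 X (xx i))).
Proof.
have e' : x' = fun i => x (s i) by apply: funext.
subst x'; rewrite (fact_equivariant act_law bs h h'); congr (_ ∘ (_ ⊗m _)); exact: reindex_irrel.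
Qed.

End FlatActions.
End FlatOperads.

(** * Calculus of internal homs *)

Section Closed.
Variable V : ClosedSymMonCat.

Lemma uncurry_nat (X' X Y Z : V) (a : Hom X' X) (f : Hom X (ihom Y Z)) :
  uncurry (f ∘ a) = uncurry f ∘ (a ⊗m idm Y).
Proof. by rewrite -(curryK (uncurry f ∘ (a ⊗m idm Y))) curry_nat uncurryK. Qed.

Lemma curry_inj (X Y Z : V) (f g : Hom (X ⊗ Y) Z) : curry f = curry g -> f = g.
Proof. by move=> e; rewrite -(curryK f) e curryK. Qed.

Lemma uncurry_inj (X Y Z : V) (f g : Hom X (ihom Y Z)) : uncurry f = uncurry g -> f = g.
Proof. by move=> e; rewrite -(uncurryK f) e uncurryK. Qed.

Definition ihom_post (X Y Z : V) (f : Hom Y Z) : Hom (ihom X Y) (ihom X Z) :=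
  curry (f ∘ uncurry (idm _)).

Lemma uncurry_post (W X Y Z : V) (f : Hom Y Z) (h : Hom W (ihom X Y)) :
  uncurry (ihom_post X f ∘ h) = f ∘ uncurry h.
Proof. by rewrite uncurry_nat curryK -compmA -uncurry_nat comp1m. Qed.

Lemma curry_post (W X Y Z : V) (f : Hom Y Z) (h : Hom (W ⊗ X) Y) :
  curry (f ∘ h) = ihom_post X f ∘ curry h.
Proof. by apply: uncurry_inj; rewrite uncurry_post !curryK. Qed.

Lemma uncurry_pre (W X Y Z : V) (f : Hom X Y) (h : Hom W (ihom Y Z)) :
  uncurry (ihom_pre Z f ∘ h) = uncurry h ∘ (idm W ⊗m f).
Proof.
rewrite uncurry_nat /ihom_pre curryK -compmA tensm_r -(tensm_l h f) compmA.
by rewrite -uncurry_nat comp1m.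
Qed.

End Closed.

(** * The universal operad acting on the lifted objects *)

Section Lifting.
Variables (V : ClosedSymMonCat) (complete_V : complete V).
Variables (L : FlatOperad V) (S : SmallSet) (X Y : S -> V) (q : forall s, Hom (Y s) (X s)).
Variable ok : forall n, ('I_n -> S) -> S -> Prop.
Variable act : forall n (x : 'I_n -> S) e, ok x e -> Hom (L n ⊗ ntens (fun i => X (x i))) (X e).
Hypothesis act_law : flat_action act.
(** Admissible patterns of sorts. The inputs determine the output, and by [ok_split] a pattern of a
    composite operation factors through intermediate sorts; together these let a composite of lifts
    be defined from the outer pattern alone. Algebras have one sort and all patterns; modules have
    two sorts and linear patterns. *)
Hypothesis ok_fun : forall n (x : 'I_n -> S) e e', ok x e -> ok x e' -> e = e'.
Hypothesis ok_unit : forall e, ok (fun _ : 'I_1 => e) e.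
Hypothesis ok_perm : forall m n (s : 'I_m -> 'I_n) (bs : bijective s) (x : 'I_n -> S) e,
  ok (fun i => x (s i)) e -> ok x e.
Hypothesis ok_split : forall n (k : 'I_n -> nat) (x : forall i, 'I_(k i) -> S) e,
  ok (fun m => x (tagnat.sig1 m) (tagnat.sig2 m)) e ->
  exists y : 'I_n -> S, (forall i, ok (x i) (y i)) /\ ok y e.
Hypothesis ok_comp : forall n (k : 'I_n -> nat) (x : forall i, 'I_(k i) -> S) (y : 'I_n -> S) e,
  (forall i, ok (x i) (y i)) -> ok y e -> ok (fun m => x (tagnat.sig1 m) (tagnat.sig2 m)) e.

Local Notation NY x := (ntens (fun i => Y (x i))).

Definition lift_compat n (T : V) (phi : Hom T (L n))
    (psi : forall (x : 'I_n -> S) e, ok x e -> Hom (T ⊗ NY x) (Y e)) : Prop :=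
  forall x e (h : ok x e), q e ∘ psi x e h = act h ∘ (phi ⊗m ntens_map (fun i => q (x i))).

(* [lob] represents the operations of [L] together with lifts along [q] of their action on [X]. *)
Record lift_rep n := LiftRep {
  lob : V;
  lpi : Hom lob (L n);
  lact : forall (x : 'I_n -> S) e, ok x e -> Hom (lob ⊗ NY x) (Y e);
  lact_compat : lift_compat lpi lact;
  lift_ex : forall T (phi : Hom T (L n)) psi, lift_compat phi psi ->
    exists h : Hom T lob, lpi ∘ h = phi /\
      forall x e (k : ok x e), lact k ∘ (h ⊗m idm _) = psi x e k;
  lift_ext : forall T (h h' : Hom T lob), lpi ∘ h = lpi ∘ h' ->
    (forall x e (k : ok x e), lact k ∘ (h ⊗m idm _) = lact k ∘ (h' ⊗m idm _)) -> h = h' }.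

Section Rep.
Variable n : nat.
Definition lift_idx : SmallSet := {x : 'I_n -> S & {e : S | ok x e}}.
(** The diagram of a generalized fibre product: [None] is [L n], [inl j] is the internal hom into
    [Y] and [inr j] the one into [X], for the pattern [j]. A cone is an operation together with
    lifts of all its actions. *)
Definition lift_vert : SmallSet := option (lift_idx + lift_idx)%type.
Definition lift_edge (i j : lift_vert) : SmallSet :=
  match i, j with
  | None, Some (inr _) => unit
  | Some (inl i), Some (inr j) => i = j
  | _, _ => void
  end.
Definition lift_vob (i : lift_vert) : V :=
  match i with
  | None => L n
  | Some (inl j) => ihom (NY (projT1 j)) (Y (sval (projT2 j)))
  | Some (inr j) => ihom (NY (projT1 j)) (X (sval (projT2 j)))
  end.
Definition lift_vmap (i j : lift_vert) : lift_edge i j -> Hom (lift_vob i) (lift_vob j) :=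
  match i, j return lift_edge i j -> Hom (lift_vob i) (lift_vob j) with
  | None, Some (inr j) => fun _ =>
      curry (act (svalP (projT2 j)) ∘ (idm _ ⊗m ntens_map (fun i => q (projT1 j i))))
  | Some (inl i), Some (inr j) => fun e =>
      match e in _ = j return Hom (lift_vob (Some (inl i))) (lift_vob (Some (inr j))) with
      | erefl => ihom_post _ (q (sval (projT2 i))) end
  | None, None => fun e => match e with end
  | None, Some (inl _) => fun e => match e with end
  | Some (inl _), None => fun e => match e with end
  | Some (inl _), Some (inl _) => fun e => match e with end
  | Some (inr _), None => fun e => match e with end
  | Some (inr _), Some (inl _) => fun e => match e with end
  | Some (inr _), Some (inr _) => fun e => match e with end
  end.
Definition lift_diagram : Diagram V :=
  {| dvert := lift_vert; dedge := lift_edge; dob := lift_vob; dmap := lift_vmap |}.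

Lemma lift_rep_exists : exists r : lift_rep n, True.
Proof.
have [Z [c [cone univ]]] := complete_V lift_diagram.
pose idx x e (h : ok x e) : lift_idx := existT _ x (exist _ e h).
pose a x e (h : ok x e) : Hom (Z ⊗ NY x) (Y e) := uncurry (c (Some (inl (idx x e h)))).
have ac : lift_compat (c None) a.
  move=> x e h; apply: curry_inj; rewrite curry_post uncurryK.
  have := cone (Some (inl (idx x e h))) (Some (inr (idx x e h))) erefl => /= ->.
  have := cone None (Some (inr (idx x e h))) tt => /= <-.
  rewrite -curry_nat -compmA tensm_r; congr curry; congr (_ ∘ _); congr act;
    exact: Prop_irrelevance.
suff [r1 r2] : (forall T (phi : Hom T (L n)) psi, lift_compat phi psi ->
    exists h : Hom T Z, c None ∘ h = phi /\
      forall x e (k : ok x e), a x e k ∘ (h ⊗m idm _) = psi x e k) /\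
    (forall T (h h' : Hom T Z), c None ∘ h = c None ∘ h' ->
    (forall x e (k : ok x e), a x e k ∘ (h ⊗m idm _) = a x e k ∘ (h' ⊗m idm _)) -> h = h').
  by exists (@LiftRep n Z (c None) a ac r1 r2).
split.
- move=> T phi psi compat.
  pose w (i : dvert lift_diagram) : Hom T (dob lift_diagram i) :=
    match i return Hom T (lift_vob i) with
    | None => phi
    | Some (inl j) => curry (psi (projT1 j) _ (svalP (projT2 j)))
    | Some (inr j) => ihom_post _ (q _) ∘ curry (psi (projT1 j) _ (svalP (projT2 j)))
    end.
  have [|h [hw _]] := univ T w.
    case=> [[i|i]|] [[j|j]|] //= e; first by case: j / e.
    rewrite -curry_nat -compmA tensm_r -curry_post; congr curry.
    exact: esym (compat _ _ _).
  exists h; split; first exact: (hw None).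
  move=> x e k; rewrite /a -uncurry_nat (hw (Some (inl (idx x e k)))) /=.
  by rewrite curryK; congr (psi _ _ _); exact: Prop_irrelevance.
move=> T h h' e1 e2.
pose w (i : dvert lift_diagram) : Hom T (dob lift_diagram i) := c i ∘ h.
have [|g [_ gu]] := univ T w; first by move=> i j e; rewrite /w compmA cone.
have -> : h = g by apply: esym; apply: gu.
apply: gu => -[[j|j]|]; rewrite /w; last exact: esym.
  case: j => x [e k]; apply: uncurry_inj; rewrite !uncurry_nat.
  exact: esym (e2 x e k).
have cj := cone (Some (inl j)) (Some (inr j)) erefl; rewrite /= in cj.
rewrite -cj -!compmA; congr (_ ∘ _).
case: j {cj} => x [e k]; apply: uncurry_inj; rewrite !uncurry_nat.
exact: esym (e2 x e k).
Qed.
End Rep.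

Definition the_rep n : lift_rep n := projT1 (cid (lift_rep_exists n)).
Definition W n : V := lob (the_rep n).
Definition wpi n : Hom (W n) (L n) := lpi (the_rep n).
Definition wact n (x : 'I_n -> S) e (h : ok x e) : Hom (W n ⊗ NY x) (Y e) :=
  lact (the_rep n) h.

Lemma wact_compat n : lift_compat (@wpi n) (@wact n).
Proof. exact: lact_compat. Qed.

Lemma wact_irrel n (x : 'I_n -> S) e (h h' : ok x e) : wact h = wact h'.
Proof. by rewrite (Prop_irrelevance h h'). Qed.

(** A map into [W n] is assembled from lifts chosen separately for each pattern of sorts. The
    predicate [P] transports whatever is known about these lifts to the map obtained by choice. *)
Lemma W_ex n T (phi : Hom T (L n))
    (P : forall (x : 'I_n -> S) e, ok x e -> Hom (T ⊗ NY x) (Y e) -> Prop) :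
  (forall x e (h : ok x e), exists2 v : Hom (T ⊗ NY x) (Y e), P x e h v &
     q e ∘ v = act h ∘ (phi ⊗m ntens_map (fun i => q (x i)))) ->
  exists h : Hom T (W n), wpi n ∘ h = phi /\
      forall x e (k : ok x e), P x e k (wact k ∘ (h ⊗m idm _)).
Proof.
move=> ex; pose v x e (h : ok x e) := s2val (cid2 (ex x e h)).
have vc : lift_compat phi v by move=> x e h; exact: (s2valP' (cid2 (ex x e h))).
have [h [h1 h2]] := lift_ex (the_rep n) vc; exists h; split=> // x e k.
by rewrite h2; exact: (s2valP (cid2 (ex x e k))).
Qed.

Lemma W_ext n T (h h' : Hom T (W n)) : wpi n ∘ h = wpi n ∘ h' ->
  (forall x e (k : ok x e), wact k ∘ (h ⊗m idm _) = wact k ∘ (h' ⊗m idm _)) -> h = h'.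
Proof. exact: lift_ext. Qed.

Definition sort_cast n (x x' : 'I_n -> S) (E : x = x') : Hom (NY x) (NY x') :=
  eqhom (congr1 (fun x : 'I_n -> S => NY x) E).

Lemma sort_cast_id n (x : 'I_n -> S) (E : x = x) : sort_cast E = idm _.
Proof. exact: eqhom_id. Qed.

Lemma perm_sorts m n (s : 'I_m -> 'I_n) (bs : bijective s) (z : 'I_m -> S) :
  exists x : 'I_n -> S, (fun i => x (s i)) = z.
Proof. by case: bs => t st ts; exists (fun i => z (t i)); apply: funext => i; rewrite st. Qed.

Lemma perm_sorts_inj m n (s : 'I_m -> 'I_n) (bs : bijective s) (x x' : 'I_n -> S) :
  (fun i => x (s i)) = (fun i => x' (s i)) -> x = x'.
Proof.
case: bs => t st ts e; apply: funext => i; rewrite -(ts i).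
exact: (congr1 (fun f => f (t i)) e).
Qed.

Lemma flat_sorts n (k : 'I_n -> nat) (z : 'I_(\sum_i k i) -> S) :
  exists x : forall i, 'I_(k i) -> S, (fun m => x (tagnat.sig1 m) (tagnat.sig2 m)) = z.
Proof.
exists (fun i j => z (tagnat.Rank i j)); apply: funext => m.
by rewrite tagnat.sig2K.
Qed.

Lemma flat_sorts_inj n (k : 'I_n -> nat) (x x' : forall i, 'I_(k i) -> S) :
  (fun m => x (tagnat.sig1 m) (tagnat.sig2 m)) = (fun m => x' (tagnat.sig1 m) (tagnat.sig2 m)) ->
  x = x'.
Proof.
move=> e; apply: functional_extensionality_dep => i; apply: funext => j.
by rewrite -(sig_Rank j x) -(sig_Rank j x') (congr1 (fun f => f (tagnat.Rank i j)) e).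
Qed.

(** The action of [s] is prescribed on patterns of the form [x ∘ s]. Every pattern [z] has this
    form, but only up to an equality of functions, hence the quantification over [x] and [E]. *)
Lemma wperm_ex m n (s : 'I_m -> 'I_n) (bs : bijective s) :
  exists w : Hom (W n) (W m), wpi m ∘ w = fperm L bs ∘ wpi n /\
    forall (z : 'I_m -> S) e (h : ok z e) (x : 'I_n -> S) (E : (fun i => x (s i)) = z)
        (h' : ok x e),
      (wact h ∘ (w ⊗m idm _)) ∘ (idm _ ⊗m sort_cast E)
      = wact h' ∘ (idm _ ⊗m ntens_reindex (Y := fun i => Y (x i)) bs (fun i => erefl)).
Proof.
apply: (@W_ex _ _ _ (fun z e h v => forall (x : 'I_n -> S) (E : (fun i => x (s i)) = z)
        (h' : ok x e), v ∘ (idm _ ⊗m sort_cast E)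
      = wact h' ∘ (idm _ ⊗m ntens_reindex (Y := fun i => Y (x i)) bs (fun i => erefl)))).
move=> z e h; have [x E] := perm_sorts bs z; subst z.
have h' := ok_perm bs h.
exists (wact h' ∘ (idm _ ⊗m ntens_reindex (Y := fun i => Y (x i)) bs (fun i => erefl))).
  move=> x1 E h1; have E1 := perm_sorts_inj bs E; subst x1.
  by rewrite sort_cast_id tensm1 compm1 (wact_irrel h' h1).
rewrite compmA wact_compat -[LHS]compmA -tensmM compm1.
rewrite -(ntens_reindex_nat (e := fun i => erefl) bs (f := fun i => q (x (s i)))); last first.
  by move=> i; rewrite /= comp1m compm1.
rewrite -[wpi n]comp1m tensmM compmA comp1m -(fact_equivariant act_law bs h' h).
by rewrite -compmA -tensmM comp1m.
Qed.

Definition wperm m n (s : 'I_m -> 'I_n) (bs : bijective s) : Hom (W n) (W m) :=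
  projT1 (cid (wperm_ex bs)).

Lemma wpi_perm m n (s : 'I_m -> 'I_n) (bs : bijective s) :
  wpi m ∘ wperm bs = fperm L bs ∘ wpi n.
Proof. by case: (projT2 (cid (wperm_ex bs))). Qed.

Lemma wact_perm m n (s : 'I_m -> 'I_n) (bs : bijective s) (x : 'I_n -> S) (z : 'I_m -> S) e
    (h : ok x e) (h' : ok z e) (xz : forall i, z i = x (s i)) :
  wact h' ∘ (wperm bs ⊗m idm _)
  = wact h ∘ (idm _ ⊗m ntens_reindex (Y := fun i => Y (x i)) bs (fun i => congr1 Y (xz i))).
Proof.
have E : (fun i => x (s i)) = z by apply: funext => i.
subst z; have := (projT2 (cid (wperm_ex bs))).2 _ e h' x erefl h.
rewrite sort_cast_id tensm1 compm1 => ->.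
by congr (_ ∘ (_ ⊗m _)); exact: reindex_irrel.
Qed.

Lemma wunit_ex :
  exists w : Hom unitI (W 1), wpi 1 ∘ w = funit L /\
    forall (z : 'I_1 -> S) e (h : ok z e) (E : (fun _ => e) = z),
      (wact h ∘ (w ⊗m idm _)) ∘ (idm _ ⊗m (sort_cast E ∘ runitV (Y e))) ∘ lunitV (Y e) = idm _.
Proof.
apply: (@W_ex 1 unitI (funit L) (fun z e h v => forall (E : (fun _ => e) = z),
      v ∘ (idm _ ⊗m (sort_cast E ∘ runitV (Y e))) ∘ lunitV (Y e) = idm _)).
move=> z e h; have ez : e = z ord0.
  apply: (ok_fun h); have -> : z = (fun _ => z ord0) by apply: funext => i; rewrite (ord1 i).
  exact: ok_unit.
have E : (fun _ => e) = z by apply: funext => i; rewrite (ord1 i).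
(* A unit operation has to be lifted to the identity of [Y e], which is this canonical isomorphism
   when its source is written as a unary tensor product. *)
subst z; exists (lunit (Y e) ∘ (idm _ ⊗m runit (Y e))).
  move=> E; rewrite sort_cast_id comp1m (rwc _ (esym (tens_compr _ _ _))) runitVK tensm1 compm1.
  by rewrite lunitVK.
apply: (iso_epi (tensm_iso (iso_id unitI) (runitV_iso (Y e)))).
apply: (iso_epi (lunitV_iso (Y e))).
rewrite !compmA (rwc _ (esym (tens_compr _ _ _))) runitVK tensm1 compm1 (rwc _ (lunitVK _)).
rewrite compm1.
rewrite -[LHS]comp1m -(fact_unit act_law h).
have e1 : (funit L ⊗m runitV (X e)) ∘ lunitV (X e) ∘ q e
    = (funit L ⊗m (q e ⊗m idm unitI)) ∘ (idm unitI ⊗m runitV (Y e)) ∘ lunitV (Y e).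
  rewrite -[LHS]compmA lunitV_nat compmA -[X in X ∘ _]tensmM runitV_nat compm1.
  by rewrite -[in RHS]tensmM compm1.
rewrite -!compmA; congr (_ ∘ _); rewrite -!compmA in e1; exact: e1.
Qed.

Definition wunit : Hom unitI (W 1) := projT1 (cid wunit_ex).

Lemma wpi_unit : wpi 1 ∘ wunit = funit L.
Proof. by case: (projT2 (cid wunit_ex)). Qed.

Lemma wact_unit e (h : ok (fun _ : 'I_1 => e) e) :
  wact h ∘ (wunit ⊗m runitV _) ∘ lunitV (Y e) = idm _.
Proof.
have := (projT2 (cid wunit_ex)).2 _ e h erefl.
by rewrite sort_cast_id comp1m -[X in X ∘ _]compmA -tensmM compm1 comp1m.
Qed.

(** The lift of a composite must be the composite of the lifts. It is transported along the inverses
    of the unzipping and flattening isomorphisms, and it does not depend on the intermediate sorts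
    [y], since [ok_fun] makes them unique. *)
Lemma wcomp_ex n (k : 'I_n -> nat) :
  exists w : Hom (W n ⊗ ntens (fun i => W (k i))) (W (\sum_i k i)),
    wpi _ ∘ w = fcomp L k ∘ (wpi n ⊗m ntens_map (fun i => wpi (k i))) /\
    forall z e (h : ok z e) (x : forall i, 'I_(k i) -> S)
        (E : (fun m => x (tagnat.sig1 m) (tagnat.sig2 m)) = z) (y : 'I_n -> S)
        (hx : forall i, ok (x i) (y i)) (hy : ok y e),
      (wact h ∘ (w ⊗m idm _)) ∘ (idm _ ⊗m (sort_cast E ∘ ntens_flat (fun i j => Y (x i j))))
        ∘ ntens_unzip _ _ _
      = wact hy ∘ (idm _ ⊗m ntens_map (fun i => wact (hx i))).
Proof.
apply: (@W_ex _ (W n ⊗ ntens (fun i => W (k i))) _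
  (fun z e h v => forall (x : forall i, 'I_(k i) -> S)
        (E : (fun m => x (tagnat.sig1 m) (tagnat.sig2 m)) = z) (y : 'I_n -> S)
        (hx : forall i, ok (x i) (y i)) (hy : ok y e),
      v ∘ (idm _ ⊗m (sort_cast E ∘ ntens_flat (fun i j => Y (x i j)))) ∘ ntens_unzip _ _ _
      = wact hy ∘ (idm _ ⊗m ntens_map (fun i => wact (hx i))))).
move=> z e h; have [x E] := flat_sorts z; subst z.
have [y [hx hy]] := ok_split h.
have fi := tensm_iso (iso_id (W n ⊗ ntens (fun i => W (k i)))) (ntens_flat_iso (fun i j =>
  Y (x i j))).
have ui := ntens_unzip_iso (W n) (fun i => W (k i)) (fun i => ntens (fun j => Y (x i j))).
have [f' [ff' f'f]] := fi; have [u' [uu' u'u]] := ui.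
exists (wact hy ∘ (idm _ ⊗m ntens_map (fun i => wact (hx i))) ∘ u' ∘ f').
  move=> x1 E y1 hx1 hy1; have E1 := flat_sorts_inj E; subst x1.
  have E1 : y1 = y by apply: funext => i; apply: ok_fun (hx1 i) (hx i).
  subst y1; rewrite sort_cast_id comp1m (rwc _ ff') compm1 (rwc _ uu') compm1.
  rewrite (wact_irrel hy hy1); congr (_ ∘ (_ ⊗m ntens_map _)).
  by apply: functional_extensionality_dep => i; exact: wact_irrel.
apply: (iso_epi fi); apply: (iso_epi ui).
lassoc; rewrite (rwc _ ff') compm1 (rwc _ uu') compm1 wact_compat.
rewrite -[LHS]compmA -tensmM compm1 -ntens_mapM.
have -> : ntens_map (fun i => q (y i) ∘ wact (hx i))
    = ntens_map (fun i => act (hx i)) ∘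
      ntens_map (fun i => wpi (k i) ⊗m ntens_map (fun j => q (x i j))).
  by rewrite -ntens_mapM; congr ntens_map; apply: functional_extensionality_dep => i;
    rewrite wact_compat.
rewrite -[wpi n]comp1m tensmM compmA (fact_assoc act_law hy hx h) comp1m.
rewrite -[LHS]compmA ntens_unzip_nat [LHS]compmA; congr (_ ∘ _).
rewrite -[LHS]compmA -[RHS]compmA -!tensmM compm1; congr (_ ∘ (_ ⊗m _)).
exact: ntens_flat_nat.
Qed.

Definition wcomp n (k : 'I_n -> nat) : Hom (W n ⊗ ntens (fun i => W (k i))) (W (\sum_i k i)) :=
  projT1 (cid (wcomp_ex k)).

Lemma wpi_comp n (k : 'I_n -> nat) :
  wpi _ ∘ wcomp k = fcomp L k ∘ (wpi n ⊗m ntens_map (fun i => wpi (k i))).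
Proof. by case: (projT2 (cid (wcomp_ex k))). Qed.

Lemma wact_comp n (k : 'I_n -> nat) (x : forall i, 'I_(k i) -> S) (y : 'I_n -> S) e
    (h : ok (fun m => x (tagnat.sig1 m) (tagnat.sig2 m)) e)
    (hx : forall i, ok (x i) (y i)) (hy : ok y e) :
  wact hy ∘ (idm _ ⊗m ntens_map (fun i => wact (hx i)))
  = wact h ∘ (wcomp k ⊗m ntens_flat (fun i j => Y (x i j))) ∘ ntens_unzip _ _ _.
Proof.
rewrite -((projT2 (cid (wcomp_ex k))).2 _ e h x erefl y hx hy) sort_cast_id comp1m.
by rewrite -[X in X ∘ _]compmA tensm_l.
Qed.

(** All axioms of the lifted operad follow the same scheme given by [W_ext]: after projection they
    are the axioms of [L], and on the objects [Y] they reduce to compositions of actions and a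
    coherence identity. *)
Lemma wperm_id n (s : 'I_n -> 'I_n) (bs : bijective s) : (forall i, s i = i) ->
  wperm bs = idm _.
Proof.
move=> hs; apply: W_ext => [|x e h].
  by rewrite wpi_perm (fperm_id _ bs hs) comp1m compm1.
have xx i : x i = x (s i) by rewrite hs.
rewrite (wact_perm bs h h xx) ntens_reindex_id //.
Qed.

Lemma wperm_comp l m n (s : 'I_m -> 'I_n) (t : 'I_l -> 'I_m) (u : 'I_l -> 'I_n)
      (bs : bijective s) (bt : bijective t) (bu : bijective u) : (forall i, u i = s (t i)) ->
  wperm bu = wperm bt ∘ wperm bs.
Proof.
move=> hu; apply: W_ext => [|z e h].
  by rewrite wpi_perm (fperm_comp _ bs bt bu hu) compmA wpi_perm -[RHS]compmA wpi_perm compmA.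
have [x1 E] := perm_sorts bt z; subst z; have [x E] := perm_sorts bs x1; subst x1.
have h1 : ok (fun i => x (s i)) e := ok_perm (x := fun i => x (s i)) bt h; have h2 := ok_perm bs h1.
have xx i : x (s (t i)) = x (u i) by rewrite hu.
rewrite (wact_perm bu h2 h xx) tens_compl compmA (wact_perm bt h1 h (fun i => erefl)).
rewrite -[RHS]compmA tensm_r -(tensm_l (wperm bs)) [RHS]compmA.
rewrite (wact_perm bs h2 h1 (fun i => erefl)) -[RHS]compmA -tensmM comp1m.
by rewrite (ntens_reindex_comp bs bt bu (fun i => congr1 Y (xx i)) hu).
Qed.

Lemma wcomp_equivariant m n (s : 'I_m -> 'I_n) (bs : bijective s)
      (k' : 'I_m -> nat) (k : 'I_n -> nat) (t : forall i, 'I_(k' i) -> 'I_(k (s i)))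
      (bt : forall i, bijective (t i)) (u : 'I_(\sum_i k' i) -> 'I_(\sum_i k i))
      (bu : bijective u) :
    (forall m, u m = tagnat.Rank (s (tagnat.sig1 m)) (t _ (tagnat.sig2 m))) ->
    wcomp k' ∘ (wperm bs ⊗m ntens_map (fun i => wperm (bt i)))
    = wperm bu ∘ wcomp k
      ∘ (idm _ ⊗m ntens_reindex (Y := fun i => W (k i)) bs (fun i => erefl)).
Proof.
move=> hu; apply: W_ext => [|z e h].
  rewrite [LHS]compmA wpi_comp -[LHS]compmA -tensmM -ntens_mapM wpi_perm.
  have -> : ntens_map (fun i => wpi (k' i) ∘ wperm (bt i))
      = ntens_map (fun i => fperm L (bt i)) ∘ ntens_map (fun i => wpi (k (s i))).
    rewrite -ntens_mapM; congr ntens_map; apply: functional_extensionality_dep => i.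
    exact: wpi_perm.
  rewrite tensmM [LHS]compmA (f_equivariant _ bs bt bu hu); lassoc.
  rewrite wpi_perm (rwc _ (wpi_comp _)); lassoc.
  rewrite -[LHS]compmA -[RHS]compmA; congr (_ ∘ _).
  rewrite -!tensmM !comp1m compm1; congr (_ ⊗m _).
  by apply: ntens_reindex_nat => i; rewrite /= comp1m compm1.
have [x1 E1] := perm_sorts bu z; have [x E2] := flat_sorts x1.
pose x' i (j : 'I_(k' i)) := x (s i) (t i j).
have xx i : x' (tagnat.sig1 i) (tagnat.sig2 i) = x (tagnat.sig1 (u i)) (tagnat.sig2 (u i)).
  by rewrite hu; exact: (esym (sig_Rank _ x)).
have Ez : (fun m => x' (tagnat.sig1 m) (tagnat.sig2 m)) = z.
  by rewrite -E1 -E2; apply: funext => i; rewrite xx.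
clear x1 E1 E2; subst z.
have [y' [hx' hy']] := ok_split h; have [y Ey] := perm_sorts bs y'; subst y'.
have hy := ok_perm bs hy'.
have hx i : ok (x i) (y i).
  case: (bs) => s' ss' s's; rewrite -(s's i).
  exact: (ok_perm (bt (s' i)) (hx' (s' i))).
have h2 : ok (fun m => x (tagnat.sig1 m) (tagnat.sig2 m)) e by apply: ok_comp hx hy.
have fi := tensm_iso (iso_id (W n ⊗ ntens (fun i => W (k (s i)))))
             (ntens_flat_iso (fun i j => Y (x' i j))).
apply: (iso_epi fi).
have ui := ntens_unzip_iso (W n) (fun i => W (k (s i))) (fun i => ntens (fun j => Y (x' i j))).
apply: (iso_epi ui).
have e1 : wact h ∘ ((wcomp k' ∘ (wperm bs ⊗m ntens_map (fun i => wperm (bt i)))) ⊗m idm _)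
    ∘ (idm _ ⊗m ntens_flat (fun i j => Y (x' i j))) ∘ ntens_unzip _ _ _
  = wact hy' ∘ (wperm bs ⊗m idm _)
    ∘ (idm _ ⊗m ntens_map (fun i => wact (hx' i) ∘ (wperm (bt i) ⊗m idm _))).
  rewrite -[RHS]compmA tensm_l -[wperm bs in RHS]comp1m ntens_mapM tensmM [RHS]compmA.
  rewrite (wact_comp h hx' hy') -[RHS]compmA ntens_unzip_nat ntens_map1 [RHS]compmA.
  rewrite -[X in X ∘ _ = _]compmA tensm_l; congr (_ ∘ _).
  by rewrite -[RHS]compmA -tensmM compm1.
rewrite e1 (wact_perm bs hy hy' (fun i => erefl)).
have -> : ntens_map (fun i => wact (hx' i) ∘ (wperm (bt i) ⊗m idm _))
  = ntens_map (fun i => wact (hx (s i))) ∘ ntens_map (fun i => idm _ ⊗m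
        ntens_reindex (Y := fun j => Y (x (s i) j)) (bt i) (fun j => erefl)).
  rewrite -ntens_mapM; congr ntens_map; apply: functional_extensionality_dep => i.
  exact: (wact_perm (bt i) (hx (s i)) (hx' i) (fun j => erefl)).
tcompr; lassoc.
rewrite -[X in X ∘ _ = _]compmA -tens_compr.
rewrite (ntens_reindex_nat (Y := fun i => W (k i) ⊗ ntens (fun j => Y (x i j)))
           (e := fun i => erefl) bs (g := fun i => wact (hx i))); last first.
  by move=> i; rewrite /= comp1m compm1.
tcompr; lassoc; rewrite (wact_comp h2 hx hy).
tcompl; lassoc; rewrite (wact_perm bu h2 h xx).
have swap (A A' B B' : V) (f : Hom A A') (g : Hom B B') :
    (idm A' ⊗m g) ∘ (f ⊗m idm B) = (f ⊗m idm B') ∘ (idm A ⊗m g) by rewrite tensm_r tensm_l.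
rewrite (rwc2 _ (swap _ _ _ _ (wcomp k) _)) -(tensm_l (wcomp k)).
rewrite (rwc2 _ (esym (swap _ _ _ _ (idm (W n) ⊗m ntens_reindex bs (fun i => erefl)) _))).
have key := @ntens_reindex_flat V m n s bs k' k t bt u bu hu (W n) (fun i => W (k i))
  (fun i j => Y (x i j)) (fun i => congr1 Y (xx i)).
rassoc; congr (_ ∘ (_ ∘ _)); move: key; rassoc; exact.
Qed.

Lemma wcomp_unit_left n (u : 'I_n -> 'I_(\sum_(i < 1) n)) (bu : bijective u) :
  (forall i, u i = i :> nat) ->
  wperm bu ∘ wcomp (fun _ : 'I_1 => n) ∘ (wunit ⊗m runitV _) ∘ lunitV (W n) = idm _.
Proof.
move=> hu; apply: W_ext => [|x e h].
  rewrite compm1; lassoc; rewrite wpi_perm (rwc _ (wpi_comp _)); lassoc.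
  have -> : fperm L bu ∘ fcomp L (fun _ : 'I_1 => n) ∘ (wpi 1 ⊗m ntens_map (fun _ : 'I_1 => wpi n))
      ∘ (wunit ⊗m runitV (W n)) = fperm L bu ∘ fcomp L (fun _ : 'I_1 => n)
      ∘ (funit L ⊗m runitV (L n)) ∘ (idm _ ⊗m wpi n).
    rewrite -[LHS]compmA -[RHS]compmA -!tensmM wpi_unit compm1; congr (_ ∘ (_ ⊗m _)).
    by rewrite runitV_nat.
  rewrite -[LHS]compmA -lunitV_nat [LHS]compmA.
  rewrite (f_unit_left L bu hu).
  by rewrite comp1m.
have h1 : ok (fun _ : 'I_1 => e) e by exact: ok_unit.
have h2 : ok (fun m => (fun (_ : 'I_1) => x) (tagnat.sig1 m) (tagnat.sig2 m)) e.
  exact: (ok_comp (x := fun _ : 'I_1 => x) (fun _ => h) h1).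
have xx i : x i = x (tagnat.sig2 (u i)).
  congr x; apply: val_inj; rewrite /= -[LHS]hu tagnat.rect big_pred0 // => j.
  by rewrite (ord1 (tagnat.sig1 (u i))).
rewrite tensm1 compm1; tcompl; lassoc; rewrite (wact_perm bu h2 h xx).
rewrite ntens_flat_unit //; tcompr; lassoc.
have swap (A A' B B' : V) (f : Hom A A') (g : Hom B B') :
    (idm A' ⊗m g) ∘ (f ⊗m idm B) = (f ⊗m idm B') ∘ (idm A ⊗m g) by rewrite tensm_r tensm_l.
rewrite (rwc2 _ (swap _ _ _ _ (wcomp (fun _ => n)) _)).
rewrite (rwc2 _ (swap _ _ _ _ (wcomp (fun _ => n)) _)) (rwc _ (tensm_l (wcomp (fun _ => n)) _)).
have e1 : (idm _ ⊗m runitV (NY x)) ∘ ((wunit ⊗m runitV (W n)) ⊗m idm _) ∘ (lunitV (W n) ⊗m idm _)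
   = ntens_unzip (W 1) (fun _ : 'I_1 => W n) (fun _ : 'I_1 => NY x)
     ∘ (wunit ⊗m ((idm _ ⊗m idm _) ⊗m idm _))
     ∘ (idm unitI ⊗m runitV (W n ⊗ NY x)) ∘ lunitV (W n ⊗ NY x).
  have := ntens_unzip_nat wunit (fun _ : 'I_1 => idm (W n)) (fun _ : 'I_1 => idm (NY x)) => /= ->.
  rewrite -[RHS]compmA -[RHS]compmA [X in _ = _ ∘ X]compmA -ntens_unzip_unit.
  rewrite [RHS]compmA; congr (_ ∘ _); rewrite -!tensmM comp1m compm1.
  by congr (_ ⊗m _); rewrite ntens_map1 ?comp1m ?compm1.
rewrite (rwc32 _ e1); lassoc.
have e2 : wact h2 ∘ (wcomp (fun _ : 'I_1 => n) ⊗m ntens_flat (fun (_ : 'I_1) j => Y (x j)))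
    ∘ ntens_unzip (W 1) (fun _ : 'I_1 => W n) (fun _ : 'I_1 => NY x)
    = wact h1 ∘ (idm _ ⊗m (wact h ⊗m idm _)).
  exact: (esym (wact_comp h2 (fun _ => h) h1)).
rewrite e2 -[RHS]comp1m -(wact_unit h1) -[RHS]compmA lunitV_nat; lassoc; congr (_ ∘ _).
rewrite -[LHS]compmA -[LHS]compmA -[RHS]compmA -!tensmM; congr (_ ∘ (_ ⊗m _)).
  by rewrite !compm1 comp1m.
by rewrite tensm1 tensm1 comp1m runitV_nat.
Qed.

Lemma wcomp_unit_right n (u : 'I_n -> 'I_(\sum_(i < n) 1)) (bu : bijective u) :
  (forall i, u i = i :> nat) ->
  wperm bu ∘ wcomp (fun _ : 'I_n => 1) ∘ (idm _ ⊗m ntens_map (fun _ => wunit))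
  = runit (W n) ∘ (idm _ ⊗m ntens_units V n).
Proof.
move=> hu; apply: W_ext => [|x e h].
  lassoc; rewrite wpi_perm (rwc _ (wpi_comp _)); lassoc.
  rewrite (rwc _ (esym (tensmM _ _ _ _))) compm1 -ntens_mapM.
  have -> : ntens_map (fun _ : 'I_n => wpi 1 ∘ wunit) = ntens_map (fun _ => funit L).
    by congr ntens_map; apply: functional_extensionality_dep => i; exact: wpi_unit.
  rewrite -(tensm_r (wpi n)) compmA (f_unit_right L bu hu) -[LHS]compmA tensm_r.
  by rewrite -runit_nat -[RHS]compmA tensm_l.
have h1 i : ok (fun _ : 'I_1 => x i) (x i) by exact: ok_unit.
have h2 : ok (fun m : 'I_(\sum_(i < n) 1) => x (tagnat.sig1 m)) e.
  exact: (ok_comp (x := fun i (_ : 'I_1) => x i) h1 h).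
have xx i : x i = x (tagnat.sig1 (u i)).
  congr x; apply: val_inj; rewrite /= -[LHS]hu tagnat.rect (ord1 (tagnat.sig2 (u i))) addn0.
  have le : tagnat.sig1 (u i) <= n by apply: ltnW.
  by rewrite -(big_ord_widen n (fun _ => 1) le) sum1_card card_ord.
(* Composition with this isomorphism turns the right-hand side of the unit law into plain [wact h],
   by [units_rK]. *)
pose J := (idm _ ⊗m ntens_map (fun i => runit (Y (x i)))) ∘ units_r (W n) (fun i => Y (x i)).
have Ji : is_iso J.
  apply: iso_comp.
    by apply: (tensm_iso (iso_id _)); apply: ntens_map_iso => i; exact: runit_iso.
  apply: iso_comp; first exact: ntens_unzip_iso.
  apply: (tensm_iso (iso_id _)); apply: ntens_map_iso => i.
  apply: iso_comp (lunitV_iso _); exact: tensm_iso (iso_id _) (runitV_iso _).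
apply: (iso_epi Ji).
rewrite -[RHS]compmA units_rK compm1 /J /units_r.
tcompl; lassoc; rewrite (wact_perm bu h2 h xx) ntens_flat_units //; tcompr; lassoc.
have swap (A A' B B' : V) (f : Hom A A') (g : Hom B B') :
    (idm A' ⊗m g) ∘ (f ⊗m idm B) = (f ⊗m idm B') ∘ (idm A ⊗m g) by rewrite tensm_r tensm_l.
rewrite (rwc2 _ (swap _ _ _ _ (wcomp _) _)) (rwc2 _ (swap _ _ _ _ (idm _ ⊗m _) _)).
have e0 : ntens_map (fun i => runitV (Y (x i))) ∘ ntens_map (fun i => runit (Y (x i))) = idm _.
  rewrite -ntens_mapM -ntens_map1; congr ntens_map.
  by apply: functional_extensionality_dep => i; rewrite runitVK || rewrite runitK.
rewrite (rwc _ (esym (tens_compr _ _ _))) e0 tensm1 compm1 (rwc _ (tensm_r _ _)).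
have := ntens_unzip_nat (idm (W n)) (fun _ : 'I_n => wunit) (fun i => idm (Y (x i) ⊗ unitI)).
rewrite ntens_map1 => e1; rewrite -(rwc2 _ e1).
have e2 := esym (wact_comp (x := fun i (_ : 'I_1) => x i) h2 h1 h).
rewrite e2 (rwc _ (esym (tens_compr _ _ _))) (rwc _ (esym (tens_compr _ _ _))).
rewrite -!ntens_mapM; have -> : (fun i => wact (h1 i) ∘ ((wunit ⊗m idm _) ∘
   ((idm unitI ⊗m runitV (Y (x i))) ∘ lunitV (Y (x i))))) = fun i => idm (Y (x i)).
  apply: functional_extensionality_dep => i; rewrite -(wact_unit (h1 i)); lassoc.
  by rewrite (rwc _ (tensm_l wunit _)).
by rewrite ntens_map1 tensm1 compm1.
Qed.

Lemma wcomp_assoc n (k : 'I_n -> nat) (r : forall i, 'I_(k i) -> nat)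
    (u : 'I_(\sum_i \sum_j r i j) -> 'I_(\sum_m r (tagnat.sig1 m) (tagnat.sig2 m)))
    (bu : bijective u) :
  (forall M, u M = M :> nat) ->
  wcomp (fun i => \sum_j r i j) ∘ (idm _ ⊗m ntens_map (fun i => wcomp (r i)))
  = wperm bu ∘ wcomp (fun m => r (tagnat.sig1 m) (tagnat.sig2 m))
    ∘ (wcomp k ⊗m ntens_flat (fun i j => W (r i j))) ∘ ntens_unzip _ _ _.
Proof.
move=> hu; apply: W_ext => [|z e h].
  lassoc; rewrite wpi_comp wpi_perm (rwc _ (wpi_comp _)) -[LHS]compmA -tensmM -ntens_mapM compm1.
  have -> : ntens_map (fun i => wpi (\sum_j r i j) ∘ wcomp (r i))
     = ntens_map (fun i => fcomp L (r i)) ∘ ntens_map (fun i => wpi (k i) ⊗m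
                                              ntens_map (fun j => wpi (r i j))).
    rewrite -ntens_mapM; congr ntens_map; apply: functional_extensionality_dep => i.
    exact: wpi_comp.
  rewrite -(tensm_r (wpi n)) tens_compr; lassoc; rewrite (rwc _ (tensm_r (wpi n) _)).
  rewrite (f_assoc L bu hu) -[LHS]compmA ntens_unzip_nat; lassoc; congr (_ ∘ _).
  rewrite -[LHS]compmA -[RHS]compmA -!tensmM wpi_comp; congr (_ ∘ (_ ⊗m _)).
  exact: ntens_flat_nat.
have [x Ez] : exists x : forall i j, 'I_(r i j) -> S, (fun M : 'I_(\sum_i \sum_j r i j) =>
    x (tagnat.sig1 M) (tagnat.sig1 (tagnat.sig2 M)) (tagnat.sig2 (tagnat.sig2 M))) = z.
  exists (fun i j l => z (tagnat.Rank i (tagnat.Rank j l))).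
  by apply: funext => M; rewrite !tagnat.sig2K.
pose x1 i (m : 'I_(\sum_j r i j)) := x i (tagnat.sig1 m) (tagnat.sig2 m).
subst z; have [y1 [hx1 hy1]] := ok_split (x := x1) h.
pose y2 i := sval (cid (ok_split (hx1 i))).
have hx2 i : forall j, ok (x i j) (y2 i j) := (svalP (cid (ok_split (hx1 i)))).1.
have hy2 i : ok (y2 i) (y1 i) := (svalP (cid (ok_split (hx1 i)))).2.
have h2 : ok (fun m => y2 (tagnat.sig1 m) (tagnat.sig2 m)) e by apply: ok_comp hy2 hy1.
pose r' m := r (tagnat.sig1 m) (tagnat.sig2 m).
pose x' m : 'I_(r' m) -> S := x (tagnat.sig1 m) (tagnat.sig2 m).
pose hx' m : ok (x' m) (y2 (tagnat.sig1 m) (tagnat.sig2 m)) := hx2 (tagnat.sig1 m) (tagnat.sig2 m).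
have h3 : ok (fun M => x' (tagnat.sig1 M) (tagnat.sig2 M)) e by apply: ok_comp hx' h2.
have xx M : x1 (tagnat.sig1 M) (tagnat.sig2 M) = x' (tagnat.sig1 (u M)) (tagnat.sig2 (u M)).
  exact: (esym (sig_RankRank hu x M)).
(* [K0] collects the operations of one inner composite on the left and its arguments on the right;
   [K1] does the same for all three levels. Both are invertible, so the law may be tested after
   them. *)
pose K0 i := (idm _ ⊗m ntens_flat (fun j l => Y (x i j l)))
           ∘ ntens_unzip (W (k i)) (fun j => W (r i j)) (fun j => NY (x i j)).
pose K1 := (idm _ ⊗m ntens_flat (fun i m => Y (x1 i m)))
     ∘ ntens_unzip (W n) (fun i => W (k i) ⊗ ntens (fun j => W (r i j))) (fun i => NY (x1 i))
     ∘ (idm (W n) ⊗m ntens_map K0).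
have K0i i : is_iso (K0 i).
  apply: iso_comp (ntens_unzip_iso _ _ _); exact: tensm_iso (iso_id _) (ntens_flat_iso _).
have K1i : is_iso K1.
  apply: iso_comp; last exact: tensm_iso (iso_id _) (ntens_map_iso K0i).
  apply: iso_comp (ntens_unzip_iso _ _ _); exact: tensm_iso (iso_id _) (ntens_flat_iso _).
apply: (iso_epi K1i).
have swap (A A' B B' : V) (f : Hom A A') (g : Hom B B') :
    (idm A' ⊗m g) ∘ (f ⊗m idm B) = (f ⊗m idm B') ∘ (idm A ⊗m g) by rewrite tensm_r tensm_l.
(* The threefold composite of actions. The left side of the law reaches it by evaluating the inner
   composites first, the right side by evaluating the outer composite first. *)
transitivity (wact hy1 ∘ (idm _ ⊗m ntens_map (fun i => wact (hy2 i)))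
   ∘ (idm _ ⊗m ntens_map (fun i => idm _ ⊗m ntens_map (fun j => wact (hx2 i j))))).
  have e1 : ntens_map (fun i => wact (hy2 i))
       ∘ ntens_map (fun i => idm _ ⊗m ntens_map (fun j => wact (hx2 i j)))
     = ntens_map (fun i => wact (hx1 i)) ∘ ntens_map (fun i => wcomp (r i) ⊗m idm _)
       ∘ ntens_map K0.
    rewrite -!ntens_mapM; congr ntens_map; apply: functional_extensionality_dep => i.
    rewrite (wact_comp (hx1 i) (hx2 i) (hy2 i)) /K0; lassoc.
    by rewrite (rwc _ (tensm_l (wcomp (r i)) _)).
  rewrite -[RHS]compmA -tens_compr e1; tcompr; lassoc; rewrite (wact_comp h hx1 hy1).
  have := ntens_unzip_nat (idm (W n)) (fun i => wcomp (r i)) (fun i => idm (NY (x1 i))).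
  rewrite ntens_map1 => e2; rewrite (rwc2 _ e2) /K1; tcompl; lassoc.
  rewrite (rwc _ (tensm_l _ _)).
  have swap' (A A' A'' B B' : V) (f : Hom A A') (f' : Hom A' A'') (g : Hom B B') :
    (f' ⊗m idm B') ∘ (f ⊗m g) = (f' ⊗m g) ∘ (f ⊗m idm B) by rewrite -!tensmM comp1m compm1.
  by rewrite (rwc2 _ (swap' _ _ _ _ _ _ _ _)).
tcompl; lassoc; rewrite (wact_perm bu h3 h xx).
rewrite -(tensm_l (wcomp k)); tcompl; lassoc.
rewrite (rwc2 _ (swap _ _ _ _ (wcomp _) _)) (rwc2 _ (swap _ _ _ _ (wcomp k ⊗m idm _) _)).
have key := @ntens_flat_flat V n k r u bu (W n) (fun i => W (k i)) (fun i j => W (r i j))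
  (fun i j l => Y (x i j l)) (fun M => congr1 Y (xx M)) hu.
have -> : wact h3 ∘ (wcomp (fun m => r (tagnat.sig1 m) (tagnat.sig2 m)) ⊗m idm _)
    ∘ ((wcomp k ⊗m idm _) ⊗m idm _)
    ∘ (idm _ ⊗m ntens_reindex (X := fun M => Y (x1 (tagnat.sig1 M) (tagnat.sig2 M)))
        (Y := fun M => Y (x' (tagnat.sig1 M) (tagnat.sig2 M))) bu (fun M => congr1 Y (xx M)))
    ∘ ((idm _ ⊗m ntens_flat (fun i j => W (r i j))) ⊗m idm _)
    ∘ (ntens_unzip _ _ _ ⊗m idm _) ∘ K1
  = wact h3 ∘ (wcomp (fun m => r (tagnat.sig1 m) (tagnat.sig2 m)) ⊗m idm _)
    ∘ ((wcomp k ⊗m idm _) ⊗m idm _)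
    ∘ ((idm _ ⊗m ntens_flat (fun m l => Y (x' m l)))
    ∘ ntens_unzip (W n ⊗ ntens (fun i => W (k i))) (fun m => W (r' m)) (fun m => NY (x' m))
    ∘ (idm _ ⊗m ntens_flat (fun i j => W (r i j) ⊗ NY (x i j)))
    ∘ ntens_unzip (W n) (fun i => W (k i)) (fun i => ntens (fun j => W (r i j) ⊗ NY (x i j)))).
  rewrite -key /K1; tcompl; lassoc; by [].
lassoc; rewrite (rwc2 _ (esym (swap _ _ _ _ (wcomp k ⊗m idm _) _))) (rwc _ (tensm_l (wcomp _) _)).
have := ntens_unzip_nat (wcomp k) (fun m => idm (W (r' m))) (fun m => idm (NY (x' m))).
rewrite !ntens_map1 => e1; rewrite -(rwc2 _ e1).
have -> : ntens_map (fun m => idm (W (r' m)) ⊗m idm (NY (x' m))) = idm _.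
  by rewrite -ntens_map1; congr ntens_map; apply: functional_extensionality_dep => m;
    rewrite tensm1.
rewrite -(wact_comp h3 hx' h2) (rwc2 _ (swap _ _ _ _ (wcomp k) _)).
have := ntens_flat_nat (fun i j => wact (hx2 i j)) => e2.
rewrite [in RHS](rwc _ (esym (tens_compr _ _ _))) -e2 [in RHS]tens_compr; lassoc.
rewrite (rwc _ (tensm_l (wcomp k) _)).
have := ntens_unzip_nat (idm (W n)) (fun i => idm (W (k i))) (fun i => ntens_map (fun j =>
  wact (hx2 i j))).
rewrite ntens_map1 tensm1 => e3; rewrite -(rwc2 _ e3).
by rewrite -(wact_comp h2 hy2 hy1).
Qed.

Definition lifted_operad : FlatOperad V :=
  {| fo := W; fperm := wperm; fperm_id := wperm_id; fperm_comp := wperm_comp; funit := wunit;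
     fcomp := wcomp; f_equivariant := wcomp_equivariant; f_unit_left := wcomp_unit_left;
     f_unit_right := wcomp_unit_right; f_assoc := wcomp_assoc |}.

Lemma lifted_action : flat_action (L := lifted_operad) (X := Y) wact.
Proof.
split.
- by move=> m n s bs x e h h'; exact: (wact_perm bs h h' (fun i => erefl)).
- exact: wact_unit.
- by move=> n k x y e h hq h'; exact: (wact_comp h' hq h).
Qed.

Lemma wpi_flat_map : is_flat_map (L := lifted_operad) wpi.
Proof.
split; [exact: wpi_perm | exact: wpi_unit | exact: wpi_comp].
Qed.

Section Universal.
Variables (K : FlatOperad V) (g : forall n, Hom (K n) (L n)).
Variable b : forall n (x : 'I_n -> S) e, ok x e -> Hom (K n ⊗ NY x) (Y e).
Hypotheses (g_map : is_flat_map g) (b_law : flat_action b).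
Hypothesis b_compat : forall n x e (h : ok x e),
  q e ∘ b h = act h ∘ (g n ⊗m ntens_map (fun i => q (x i))).

(** The map exists by [W_ex] and is an operad map by the uniqueness in [W_ext]. Used for the initial
    pair, where it classifies actions of the initial operad on a fixed object. *)
Lemma lifted_univ : exists h : forall n, Hom (K n) (W n),
  [/\ is_flat_map (L' := lifted_operad) h, forall n, wpi n ∘ h n = g n
    & forall n x e (k : ok x e), wact k ∘ (h n ⊗m idm _) = b k].
Proof.
have ex n : exists h : Hom (K n) (W n), wpi n ∘ h = g n /\
    forall x e (k : ok x e), wact k ∘ (h ⊗m idm _) = b k.
  apply: (@W_ex n (K n) (g n) (fun x e k v => v = b k)) => x e k; exists (b k) => //.
pose h n := projT1 (cid (ex n)).
have h1 n : wpi n ∘ h n = g n by exact: (projT2 (cid (ex n))).1.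
have h2 n x e (k : ok x e) : wact k ∘ (h n ⊗m idm _) = b k by exact: (projT2 (cid (ex n))).2.
have [g1 g2 g3] := g_map.
exists h; split=> //; split.
- move=> m n s bs; apply: W_ext => [|z e k].
    by rewrite !compmA h1 wpi_perm -[RHS]compmA h1 g1.
  have [x E] := perm_sorts bs z; subst z; have k' := ok_perm bs k.
  rewrite !tens_compl; lassoc; rewrite h2 (wact_perm bs k' k (fun i => erefl)).
  rewrite -[RHS]compmA tensm_r -(tensm_l (h n)) [RHS]compmA h2.
  rewrite (fact_reindex b_law bs (fun i => erefl) k' k).
  by congr (_ ∘ (_ ⊗m _)); exact: reindex_irrel.
- apply: W_ext => [|z e k]; first by rewrite compmA h1 g2 wpi_unit.
  have ez : e = z ord0.
    apply: (ok_fun k); have -> : z = (fun _ => z ord0) by apply: funext => i; rewrite (ord1 i).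
    exact: ok_unit.
  have E : (fun _ => e) = z by apply: funext => i; rewrite (ord1 i).
  subst z; apply: (iso_epi (tensm_iso (iso_id unitI) (runitV_iso (Y e)))).
  apply: (iso_epi (lunitV_iso (Y e))).
  rewrite tens_compl; lassoc; rewrite h2 (rwc _ (tensm_l (wunit) _)).
  rewrite (rwc _ (tensm_l (funit K) _)) (fact_unit b_law k).
  by have := wact_unit k => /= ->.
move=> n k; apply: W_ext => [|z e kz].
  rewrite !compmA h1 wpi_comp g3 -[RHS]compmA -tensmM h1 -ntens_mapM.
  by congr (_ ∘ (_ ⊗m ntens_map _)); apply: functional_extensionality_dep => i; rewrite h1.
have [x E] := flat_sorts z; subst z; have [y [hx hy]] := ok_split kz.
apply: (iso_epi (tensm_iso (iso_id _) (ntens_flat_iso (fun i j => Y (x i j))))).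
apply: (iso_epi (ntens_unzip_iso (K n) (fun i => K (k i)) (fun i => NY (x i)))).
rewrite tens_compl; lassoc; rewrite h2 (rwc _ (tensm_l (fcomp K k) _)).
rewrite -(fact_assoc b_law hy hx kz) tens_compl; lassoc.
rewrite -[X in _ = X ∘ _]compmA tensm_l.
have -> : (h n ⊗m ntens_map (fun i => h (k i))) ⊗m ntens_flat (fun i j => Y (x i j))
  = (idm _ ⊗m ntens_flat (fun i j => Y (x i j)))
    ∘ ((h n ⊗m ntens_map (fun i => h (k i))) ⊗m ntens_map (fun i => idm (NY (x i)))).
  by rewrite ntens_map1 tensm_r.
lassoc; rewrite -(rwc2 _ (ntens_unzip_nat _ _ _)) (rwc _ (tensm_l (wcomp k) _)).
rewrite -(wact_comp kz hx hy) -[RHS]compmA -tensmM comp1m -ntens_mapM.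
rewrite -(tensm_l (h n)) [RHS]compmA h2; congr (_ ∘ (_ ⊗m ntens_map _)).
by apply: functional_extensionality_dep => i; rewrite h2.
Qed.
End Universal.

End Lifting.

(** * Model categories *)

Section CategoryFacts.
Variable C : Category.

Lemma initial_ex (Z X : C) : is_initial Z -> exists f : Hom Z X, True.
Proof. by move=> /(_ X)[f _]; exists f. Qed.

Lemma initial_eq (Z X : C) (f g : Hom Z X) : is_initial Z -> f = g.
Proof. by move=> /(_ X)[h [_ u]]; rewrite -(u f I) -(u g I). Qed.

Lemma terminal_ex (Z X : C) : is_terminal Z -> exists f : Hom X Z, True.
Proof. by move=> /(_ X)[f _]; exists f. Qed.

Lemma terminal_eq (Z X : C) (f g : Hom X Z) : is_terminal Z -> f = g.
Proof. by move=> /(_ X)[h [_ u]]; rewrite -(u f I) -(u g I). Qed.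

Definition empty_diagram : Diagram C :=
  @Build_Diagram C void (fun _ _ => void) (fun i => match i with end)
    (fun i => match i with end).

Lemma cocomplete_initial : cocomplete C -> exists Z : C, is_initial Z.
Proof.
move=> /(_ empty_diagram)[Z [c [_ u]]]; exists Z => X.
have [|h [_ hu]] := u X (fun i => match i with end); first by case.
by exists h; split=> // h' _; apply: hu; case.
Qed.

Lemma complete_terminal : complete C -> exists Z : C, is_terminal Z.
Proof.
move=> /(_ empty_diagram)[Z [c [_ u]]]; exists Z => X.
have [|h [_ hu]] := u X (fun i => match i with end); first by case.
by exists h; split=> // h' _; apply: hu; case.
Qed.

Section Span.
Variables (A B X : C) (f : Hom A B) (g : Hom A X).
Definition span_vert := option bool.
Definition span_edge (i j : span_vert) : SmallSet :=
  match i, j with None, Some _ => unit | _, _ => void end.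
Definition span_ob (i : span_vert) : C :=
  match i with None => A | Some true => B | Some false => X end.
Definition span_map (i j : span_vert) : span_edge i j -> Hom (span_ob i) (span_ob j) :=
  match i, j return span_edge i j -> Hom (span_ob i) (span_ob j) with
  | None, Some true => fun _ => f
  | None, Some false => fun _ => g
  | None, None => fun e => match e with end
  | Some _, None => fun e => match e with end
  | Some _, Some _ => fun e => match e with end
  end.
Definition span_diagram : Diagram C :=
  {| dvert := span_vert; dedge := span_edge; dob := span_ob; dmap := span_map |}.

Lemma cocomplete_pushout : cocomplete C ->
  exists (P : C) (u : Hom B P) (v : Hom X P), is_pushout f g u v.
Proof.
move=> /(_ span_diagram)[P [c [cc u]]].
have e1 := cc None (Some true) tt; have e2 := cc None (Some false) tt; rewrite /= in e1 e2.
exists P, (c (Some true)), (c (Some false)); split; first by rewrite e1 e2.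
move=> Q u' v' e.
pose w (i : dvert span_diagram) : Hom (dob span_diagram i) Q :=
  match i return Hom (span_ob i) Q with
  | None => u' ∘ f | Some true => u' | Some false => v' end.
have [|h [hw hu]] := u Q w; first by case=> [[]|] [[]|] //= _; rewrite e.
exists h; split; first by split; [exact: (hw (Some true)) | exact: (hw (Some false))].
move=> h' [a b]; apply: hu => -[[]|] //=.
by rewrite -e1 compmA a.
Qed.
End Span.

Section Cospan.
Variables (A B X : C) (f : Hom B A) (g : Hom X A).
Definition cospan_edge (i j : span_vert) : SmallSet :=
  match i, j with Some _, None => unit | _, _ => void end.
Definition cospan_map (i j : span_vert) :
    cospan_edge i j -> Hom (span_ob A B X i) (span_ob A B X j) :=
  match i, j return cospan_edge i j -> Hom (span_ob A B X i) (span_ob A B X j) with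
  | Some true, None => fun _ => f
  | Some false, None => fun _ => g
  | None, None => fun e => match e with end
  | None, Some _ => fun e => match e with end
  | Some _, Some _ => fun e => match e with end
  end.
Definition cospan_diagram : Diagram C :=
  {| dvert := span_vert; dedge := cospan_edge; dob := span_ob A B X; dmap := cospan_map |}.

Definition is_pullback (P : C) (u : Hom P B) (v : Hom P X) : Prop :=
  f ∘ u = g ∘ v /\
  forall (Q : C) (u' : Hom Q B) (v' : Hom Q X), f ∘ u' = g ∘ v' ->
    exists! h : Hom Q P, u ∘ h = u' /\ v ∘ h = v'.

Lemma complete_pullback : complete C ->
  exists (P : C) (u : Hom P B) (v : Hom P X), is_pullback u v.
Proof.
move=> /(_ cospan_diagram)[P [c [cc u]]].
have e1 := cc (Some true) None tt; have e2 := cc (Some false) None tt; rewrite /= in e1 e2.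
exists P, (c (Some true)), (c (Some false)); split; first by rewrite e1 e2.
move=> Q u' v' e.
pose w (i : dvert cospan_diagram) : Hom Q (dob cospan_diagram i) :=
  match i return Hom Q (span_ob A B X i) with
  | None => f ∘ u' | Some true => u' | Some false => v' end.
have [|h [hw hu]] := u Q w; first by case=> [[]|] [[]|] //= _; rewrite e.
exists h; split; first by split; [exact: (hw (Some true)) | exact: (hw (Some false))].
move=> h' [a b]; apply: hu => -[[]|] //=.
by rewrite -e1 -compmA a.
Qed.
End Cospan.
End CategoryFacts.

Section ModelFacts.
Variables (D : Category) (M : ModelData D) (hM : is_model_category M).

Lemma retract_of_left (A B Z : D) (f : Hom A B) (i : Hom A Z) (p : Hom Z B) :
  p ∘ i = f -> lifts f p -> is_retract f i.
Proof.
move=> pif /(_ i (idm B)); rewrite comp1m pif => /(_ erefl)[h [hf ph]].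
exists (idm A), h, (idm A), p; split; rewrite ?comp1m ?compm1 //.
Qed.

Lemma retract_of_right (A B Z : D) (f : Hom A B) (i : Hom A Z) (p : Hom Z B) :
  p ∘ i = f -> lifts i f -> is_retract f p.
Proof.
move=> pif /(_ (idm A) p); rewrite compm1 pif => /(_ erefl)[h [hi fh]].
exists i, (idm B), h, (idm B); split; rewrite ?comp1m ?compm1 //.
Qed.

Lemma Cof_llp (A B : D) (f : Hom A B) :
  (forall X Y (g : Hom X Y), TrivFib M g -> lifts f g) -> Cof M f.
Proof.
move=> h; have [Z [i [p [ci tp e]]]] := mc_factor_TrivFib hM f.
exact: (mc_Cof_retract hM) (retract_of_left e (h _ _ _ tp)) ci.
Qed.

Lemma TrivCof_llp (A B : D) (f : Hom A B) :
  (forall X Y (g : Hom X Y), Fib M g -> lifts f g) -> TrivCof M f.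
Proof.
move=> h; have [Z [i [p [[ci wi] tp e]]]] := mc_factor_TrivCof hM f.
have r := retract_of_left e (h _ _ _ tp).
by split; [exact: (mc_Cof_retract hM) r ci | exact: (mc_WE_retract hM) r wi].
Qed.

Lemma TrivFib_rlp (A B : D) (f : Hom A B) :
  (forall X Y (g : Hom X Y), Cof M g -> lifts g f) -> TrivFib M f.
Proof.
move=> h; have [Z [i [p [ci [fp wp] e]]]] := mc_factor_TrivFib hM f.
have r := retract_of_right e (h _ _ _ ci).
by split; [exact: (mc_Fib_retract hM) r fp | exact: (mc_WE_retract hM) r wp].
Qed.

Lemma Fib_rlp (A B : D) (f : Hom A B) :
  (forall X Y (g : Hom X Y), TrivCof M g -> lifts g f) -> Fib M f.
Proof.
move=> h; have [Z [i [p [ci fp e]]]] := mc_factor_TrivCof hM f.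
exact: (mc_Fib_retract hM) (retract_of_right e (h _ _ _ ci)) fp.
Qed.

Lemma lifts_iso_l (A B X Y : D) (f : Hom A B) (g : Hom X Y) : is_iso f -> lifts f g.
Proof.
move=> [f' [f1 f2]] u v e; exists (u ∘ f'); split; first by rewrite -compmA f1 compm1.
by rewrite compmA -e -compmA f2 compm1.
Qed.

Lemma lifts_iso_r (A B X Y : D) (f : Hom A B) (g : Hom X Y) : is_iso g -> lifts f g.
Proof.
move=> [g' [g1 g2]] u v e; exists (g' ∘ v); split; first by rewrite -compmA e compmA g1 comp1m.
by rewrite compmA g2 comp1m.
Qed.

Lemma WE_iso (A B : D) (f : Hom A B) : is_iso f -> WE M f.
Proof.
by move=> fi; have [] : TrivFib M f by apply: TrivFib_rlp => *; exact: lifts_iso_r.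
Qed.

Lemma WE_id (A : D) : WE M (idm A).
Proof. exact: WE_iso (iso_id A). Qed.

Lemma TrivFib_iso (A B : D) (f : Hom A B) : is_iso f -> TrivFib M f.
Proof. by move=> fi; apply: TrivFib_rlp => *; exact: lifts_iso_r. Qed.

Lemma TrivCof_iso (A B : D) (f : Hom A B) : is_iso f -> TrivCof M f.
Proof. by move=> fi; apply: TrivCof_llp => *; exact: lifts_iso_l. Qed.

Lemma lifts_comp_l (A B B' X Y : D) (f : Hom A B) (f' : Hom B B') (g : Hom X Y) :
  lifts f g -> lifts f' g -> lifts (f' ∘ f) g.
Proof.
move=> l l' u v e; have [|h [h1 h2]] := l u (v ∘ f'); first by rewrite -compmA.
have [|h' [h3 h4]] := l' h v; first by [].
by exists h'; split=> //; rewrite compmA h3.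
Qed.

Lemma lifts_comp_r (A B X Y Y' : D) (f : Hom A B) (g : Hom X Y) (g' : Hom Y Y') :
  lifts f g -> lifts f g' -> lifts f (g' ∘ g).
Proof.
move=> l l' u v e; have [|h [h1 h2]] := l' (g ∘ u) v; first by rewrite compmA.
have [|h' [h3 h4]] := l u h; first by [].
by exists h'; split=> //; rewrite -compmA h4.
Qed.

Lemma Cof_comp (A B X : D) (f : Hom A B) (g : Hom B X) : Cof M f -> Cof M g -> Cof M (g ∘ f).
Proof.
move=> cf cg; apply: Cof_llp => U V' p tp.
by apply: lifts_comp_l; apply: (mc_lift_TrivFib hM).
Qed.

Lemma TrivFib_comp (A B X : D) (f : Hom A B) (g : Hom B X) :
  TrivFib M f -> TrivFib M g -> TrivFib M (g ∘ f).
Proof.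
move=> cf cg; apply: TrivFib_rlp => U V' p tp.
by apply: lifts_comp_r; apply: (mc_lift_TrivFib hM).
Qed.

Lemma Fib_comp (A B X : D) (f : Hom A B) (g : Hom B X) : Fib M f -> Fib M g -> Fib M (g ∘ f).
Proof.
move=> cf cg; apply: Fib_rlp => U V' p tp.
by apply: lifts_comp_r; apply: (mc_lift_TrivCof hM).
Qed.

Lemma cofibrant_lift (X A B : D) (p : Hom A B) (b : Hom X B) :
  cofibrant M X -> TrivFib M p -> exists a : Hom X A, p ∘ a = b.
Proof.
move=> cX tp; have [Z iZ] := cocomplete_initial (mc_cocomplete hM).
have [u _] := initial_ex X iZ; have [a _] := initial_ex A iZ.
have [|h [_ ph]] := mc_lift_TrivFib hM (cX Z u iZ) tp (u := a) (v := b).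
  exact: initial_eq.
by exists h.
Qed.

Lemma cofibrantI (X : D) :
  (forall A B (p : Hom A B) (b : Hom X B), TrivFib M p -> exists a : Hom X A, p ∘ a = b) ->
  cofibrant M X.
Proof.
move=> h Z u iZ; apply: Cof_llp => A B p tp a b e.
have [a' ea] := h _ _ p b tp; exists a'; split=> //; exact: initial_eq.
Qed.

Lemma fibrant_ext (X A B : D) (i : Hom A B) (a : Hom A X) :
  fibrant M X -> TrivCof M i -> exists b : Hom B X, b ∘ i = a.
Proof.
move=> fX ti; have [Z tZ] := complete_terminal (mc_complete hM).
have [u _] := terminal_ex X tZ; have [b _] := terminal_ex B tZ.
have [|h [hi _]] := mc_lift_TrivCof hM ti (fX Z u tZ) (u := a) (v := b).
  exact: terminal_eq.
by exists h.
Qed.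

Lemma fibrantI (X : D) :
  (forall A B (i : Hom A B) (a : Hom A X), TrivCof M i -> exists b : Hom B X, b ∘ i = a) ->
  fibrant M X.
Proof.
move=> h Z u tZ; apply: Fib_rlp => A B p tp a b e.
have [a' ea] := h _ _ p a tp; exists a'; split=> //; exact: terminal_eq.
Qed.

Lemma cofibrant_Cof (A B : D) (f : Hom A B) : cofibrant M A -> Cof M f -> cofibrant M B.
Proof.
move=> cA cf; apply: cofibrantI => X Y p b tp.
have [a ea] := cofibrant_lift (b ∘ f) cA tp.
by have [|h [_ e]] := mc_lift_TrivFib hM cf tp (u := a) (v := b); [rewrite ea | exists h].
Qed.

Lemma fibrant_Fib (A B : D) (f : Hom A B) : fibrant M B -> Fib M f -> fibrant M A.
Proof.
move=> cA cf; apply: fibrantI => X Y p b tp.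
have [a ea] := fibrant_ext (f ∘ b) cA tp.
by have [|h [e _]] := mc_lift_TrivCof hM tp cf (u := b) (v := a); [rewrite ea | exists h].
Qed.

Lemma cofibrant_retract (A B : D) (s : Hom A B) (r : Hom B A) :
  r ∘ s = idm A -> cofibrant M B -> cofibrant M A.
Proof.
move=> rs cB; apply: cofibrantI => X Y p b tp.
have [a ea] := cofibrant_lift (b ∘ r) cB tp.
by exists (a ∘ s); rewrite compmA ea -compmA rs compm1.
Qed.

Lemma fibrant_retract (A B : D) (s : Hom A B) (r : Hom B A) :
  r ∘ s = idm A -> fibrant M B -> fibrant M A.
Proof.
move=> rs cB; apply: fibrantI => X Y p b tp.
have [a ea] := fibrant_ext (s ∘ b) cB tp.
by exists (r ∘ a); rewrite -compmA ea compmA rs comp1m.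
Qed.

Lemma cofibrant_replacement_ex (X : D) : exists Q (q : Hom Q X), cofibrant_replacement M q.
Proof.
have [Z iZ] := cocomplete_initial (mc_cocomplete hM); have [u _] := initial_ex X iZ.
have [Q [i [p [ci tp e]]]] := mc_factor_TrivFib hM u.
exists Q, p; split=> // Z' u' iZ'; have [k _] := initial_ex Z iZ'.
apply: Cof_llp => A B g tg a b e'; have [a0 _] := initial_ex A iZ.
have [|h [_ h2]] := mc_lift_TrivFib hM ci tg (u := a0) (v := b); first exact: initial_eq.
by exists h; split=> //; exact: initial_eq.
Qed.

Lemma fibrant_replacement_ex (X : D) : exists R (r : Hom X R), fibrant_replacement M r.
Proof.
have [Z tZ] := complete_terminal (mc_complete hM); have [u _] := terminal_ex X tZ.
have [R [i [p [ci tp e]]]] := mc_factor_TrivCof hM u.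
exists R, i; split=> //; apply: fibrantI => A B j a tj.
have [b0 _] := terminal_ex B tZ.
have [|h [h1 _]] := mc_lift_TrivCof hM tj tp (u := a) (v := b0); first exact: terminal_eq.
by exists h.
Qed.

Lemma cofibrant_replacement_id (X : D) : cofibrant M X -> cofibrant_replacement M (idm X).
Proof. by move=> cX; split=> //; exact: TrivFib_iso (iso_id X). Qed.

Lemma fibrant_replacement_id (X : D) : fibrant M X -> fibrant_replacement M (idm X).
Proof. by move=> cX; split=> //; exact: TrivCof_iso (iso_id X). Qed.

Lemma cofibrant_replacement_map_ex (X Y QX QY : D) (f : Hom X Y) (q : Hom QX X)
    (q' : Hom QY Y) : cofibrant_replacement M q -> cofibrant_replacement M q' ->
  exists f' : Hom QX QY, q' ∘ f' = f ∘ q.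
Proof. by move=> [cX _] [_ tq']; exact: cofibrant_lift. Qed.

Lemma homotopic_refl (X Y : D) (f : Hom X Y) : homotopic M f f.
Proof.
have [Q [q hq]] := cofibrant_replacement_ex X.
have [R [r hr]] := fibrant_replacement_ex Y.
exists Q, R, q, r; split=> //.
exists Q, (idm Q), (idm Q), (idm Q), (r ∘ f ∘ q); split; rewrite ?compm1 //.
exact: WE_id.
Qed.

End ModelFacts.

(** * Tensor products and lifting properties *)

Section MonoidalModel.
Variables (V : ClosedSymMonCat) (M : ModelData V).
Hypotheses (hM : is_model_category M) (hmon : is_monoidal_model M).

Lemma initial_tens_l (Z Y : V) : is_initial Z -> is_initial (Z ⊗ Y).
Proof.
move=> iZ W; have [f _] := initial_ex (ihom Y W) iZ.
exists (uncurry f); split=> // g _; apply: curry_inj; rewrite uncurryK; exact: initial_eq.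
Qed.

Lemma initial_tens_r (Z Y : V) : is_initial Z -> is_initial (Y ⊗ Z).
Proof.
move=> iZ W; have [f _] := initial_ex W (initial_tens_l Y iZ).
exists (f ∘ braid Y Z); split=> // g _.
apply: (iso_epi (braid_iso Z Y)); apply: initial_eq; exact: initial_tens_l.
Qed.

(** The pushout-product axiom as a lifting property. The pushout disappears from the statement, so
    later uses only have to check commuting squares. *)
Lemma pushout_product_lift (A B X Y E F : V) (f : Hom A B) (g : Hom X Y) (p : Hom E F)
    (u1 : Hom (A ⊗ Y) E) (u2 : Hom (B ⊗ X) E) (v : Hom (B ⊗ Y) F) :
  Cof M f -> Cof M g -> Fib M p -> WE M f \/ WE M g \/ WE M p ->
  u1 ∘ (idm A ⊗m g) = u2 ∘ (f ⊗m idm X) ->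
  p ∘ u1 = v ∘ (f ⊗m idm Y) -> p ∘ u2 = v ∘ (idm B ⊗m g) ->
  exists h : Hom (B ⊗ Y) E, [/\ h ∘ (f ⊗m idm Y) = u1, h ∘ (idm B ⊗m g) = u2 & p ∘ h = v].
Proof.
move=> cf cg fp w e1 e2 e3.
have [P [a [b po]]] := cocomplete_pushout (idm A ⊗m g) (f ⊗m idm X) (mc_cocomplete hM).
have [ab up] := po.
have [|k [[ka kb] _]] := up _ (f ⊗m idm Y) (idm B ⊗m g); first by rewrite tensm_l tensm_r.
have [ck wk] := hmon.1 _ _ _ _ _ _ _ _ _ _ po ka kb cf cg.
have [t [[ta tb] _]] := up _ u1 u2 e1.
have [h [h1 h2]] : exists h : Hom (B ⊗ Y) E, h ∘ k = t /\ p ∘ h = v.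
  have sq : v ∘ k = p ∘ t.
    have e4 : (p ∘ u1) ∘ (idm A ⊗m g) = (p ∘ u2) ∘ (f ⊗m idm X) by rewrite -!compmA e1.
    have [z [_ zu]] := up _ (p ∘ u1) (p ∘ u2) e4.
    have <- : z = v ∘ k by apply: zu; split; rewrite -[LHS]compmA ?ka ?kb.
    by apply: zu; split; rewrite -[LHS]compmA ?ta ?tb.
  case: w => [wf|[wg|wp]].
  - by apply: (mc_lift_TrivCof hM) sq => //; split=> //; apply: wk; left.
  - by apply: (mc_lift_TrivCof hM) sq => //; split=> //; apply: wk; right.
  - by apply: (mc_lift_TrivFib hM) sq.
by exists h; split; rewrite // -?ka -?kb compmA h1.
Qed.

(** The pushout-product of [f] with the map from the initial object to [Y]; the second leg of the
    problem starts at [B ⊗ Z] with [Z] initial and is therefore automatic. *)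
Lemma tens_lifts (A B Y E F : V) (f : Hom A B) (p : Hom E F) :
  Cof M f -> cofibrant M Y -> Fib M p -> WE M f \/ WE M p -> lifts (f ⊗m idm Y) p.
Proof.
move=> cf cY fp w u v e.
have [Z iZ] := cocomplete_initial (mc_cocomplete hM); have [g _] := initial_ex Y iZ.
have [u2 _] := initial_ex E (initial_tens_r B iZ).
have [||||h [h1 _ h3]] := @pushout_product_lift _ _ _ _ _ _ f g p u u2 v cf (cY _ g iZ) fp.
- by case: w; [left | right; right].
- exact: initial_eq (initial_tens_r _ iZ).
- by rewrite e.
- exact: initial_eq (initial_tens_r _ iZ).
by exists h.
Qed.

Lemma Cof_tens (A B Y : V) (f : Hom A B) : Cof M f -> cofibrant M Y -> Cof M (f ⊗m idm Y).
Proof.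
move=> cf cY; apply: (Cof_llp hM) => E F p [fp wp]; apply: tens_lifts => //; by right.
Qed.

Lemma TrivCof_tens (A B Y : V) (f : Hom A B) :
  TrivCof M f -> cofibrant M Y -> TrivCof M (f ⊗m idm Y).
Proof.
move=> [cf wf] cY; apply: (TrivCof_llp hM) => E F p fp; apply: tens_lifts => //; by left.
Qed.

Lemma cofibrant_tens (X Y : V) : cofibrant M X -> cofibrant M Y -> cofibrant M (X ⊗ Y).
Proof.
move=> cX cY; have [Z iZ] := cocomplete_initial (mc_cocomplete hM).
have [g _] := initial_ex X iZ; have := Cof_tens (cX _ g iZ) cY.
apply: (cofibrant_Cof hM) => Z' u iZ'; apply: (Cof_llp hM) => A B p tp a b e.
have [h _] := initial_ex A (initial_tens_l Y iZ); exists h.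
by split; apply: initial_eq => //; exact: initial_tens_l.
Qed.

Lemma cofibrant_bt (unit_cofibrant : cofibrant M unitI) (T : Type) (X : T -> V) l :
  (forall t, cofibrant M (X t)) -> cofibrant M (bt X l).
Proof. by move=> cX; elim: l => //= t l IH; exact: cofibrant_tens. Qed.

Section LiftedTrivFib.
Hypothesis unit_cofibrant : cofibrant M unitI.
Variables (L : FlatOperad V) (S : SmallSet) (X Y : S -> V) (q : forall s, Hom (Y s) (X s)).
Variable ok : forall n, ('I_n -> S) -> S -> Prop.
Variable act : forall n (x : 'I_n -> S) e, ok x e -> Hom (L n ⊗ ntens (fun i => X (x i))) (X e).
Hypotheses (cY : forall s, cofibrant M (Y s)) (tq : forall s, TrivFib M (q s)).

(** By the description of maps into [W n], lifting against a cofibration [f] splits into one problem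
    for each pattern: [f] tensored with a product of objects [Y], which is again a cofibration,
    against a trivial fibration [q e0]. *)
Lemma wpi_TrivFib n : TrivFib M (wpi (mc_complete hM) q act n).
Proof.
apply: (TrivFib_rlp hM) => A B f cf u v e.
have [|h [h1 h2]] := @W_ex V (mc_complete hM) L S X Y q ok act n B v
  (fun x e k w => w ∘ (f ⊗m idm _) = wact (mc_complete hM) q act k ∘ (u ⊗m idm _)).
  move=> x e0 k; have cN : cofibrant M (ntens (fun i => Y (x i))) by exact: cofibrant_bt.
  have [|w [w1 w2]] := mc_lift_TrivFib hM (Cof_tens cf cN) (tq e0)
    (u := wact (mc_complete hM) q act k ∘ (u ⊗m idm _))
    (v := act k ∘ (v ⊗m ntens_map (fun i => q (x i)))).
    rewrite compmA wact_compat -[LHS]compmA -[RHS]compmA -!tensmM.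
    by rewrite e !compm1.
  by exists w.
exists h; split=> //; apply: W_ext => [|x e0 k]; first by rewrite compmA h1 -e.
by rewrite tens_compl compmA h2.
Qed.
End LiftedTrivFib.
End MonoidalModel.

(** * Cofibrant pairs *)

Section FlatMaps.
Variable V : SymMonCat.

Definition to_operad_map (L L' : FlatOperad V) (g : forall n, Hom (L n) (L' n)) :
    Hom (coll_fam (to_operad L)) (coll_fam (to_operad L')) :=
  fun z => g (len z.1).

Lemma to_operad_mapP (L L' : FlatOperad V) (g : forall n, Hom (L n) (L' n)) :
  is_flat_map g -> is_operad_map (L := to_operad L) (L' := to_operad L') (to_operad_map g).
Proof.
move=> [g1 g2 g3]; split.
- by move=> p' p d s; exact: g1.
- by move=> c; exact: g2.
by move=> p q d; exact: g3.
Qed.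

Lemma flat_map_of (O : Operad V unit) (L : FlatOperad V)
    (f : Hom (coll_fam O) (coll_fam (to_operad L))) :
  is_operad_map (L := O) (L' := to_operad L) f ->
  is_flat_map (L := flat_operad O) (fun n => f (uprof n, tt)).
Proof.
move=> [f1 f2 f3]; split.
- by move=> m n s bs; exact: (f1 _ _ tt (unit_perm bs)).
- exact: (f2 tt).
by move=> n k; exact: (f3 (uprof n) (fun i => uprof (k i)) tt).
Qed.

Section Cast.
Variable O : Operad V unit.

(** A profile with one colour equals the constant one, but only propositionally. These casts give
    the isomorphism between [O] and the operad rebuilt from its flat form; [uprof_ind] reduces
    proofs about them to constant profiles, where they are identities. *)
Definition ocast (p : Profile unit) (d : unit) : Hom (O (uprof (len p)) tt) (O p d) :=
  match d with tt => eqhom (congr1 (fun p => O p tt) (uprofE p)) end.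
Definition ocastV (p : Profile unit) (d : unit) : Hom (O p d) (O (uprof (len p)) tt) :=
  match d with tt => eqhom (esym (congr1 (fun p => O p tt) (uprofE p))) end.

Lemma ocast_uprof n : ocast (uprof n) tt = idm _.
Proof. exact: eqhom_id. Qed.
Lemma ocastV_uprof n : ocastV (uprof n) tt = idm _.
Proof. exact: eqhom_id. Qed.

Lemma ocastK p d : ocastV p d ∘ ocast p d = idm _.
Proof. by case: d => /=; case: _ / (congr1 _ _) => /=; rewrite comp1m. Qed.
Lemma ocastVK p d : ocast p d ∘ ocastV p d = idm _.
Proof. by case: d => /=; case: _ / (congr1 _ _) => /=; rewrite comp1m. Qed.

Lemma uprof_ind (P : Profile unit -> Prop) : (forall n, P (uprof n)) -> forall p, P p.
Proof. by move=> h p; rewrite -(uprofE p). Qed.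

Lemma uprofs_ind n (P : ('I_n -> Profile unit) -> Prop) :
  (forall k, P (fun i => uprof (k i))) -> forall q, P q.
Proof.
move=> h q; have -> : q = (fun i => uprof (len (q i))); last exact: h.
by apply: funext => i; rewrite uprofE.
Qed.

Lemma ocast_map : is_operad_map (L := to_operad (flat_operad O)) (L' := O)
  (fun z => ocast z.1 z.2).
Proof.
split=> /=.
- elim/uprof_ind => m; elim/uprof_ind => n [] s; rewrite !ocast_uprof comp1m compm1.
  have -> : s = unit_perm (pperm_bij s); last by [].
  case: s => f bf cf /=; congr Build_ProfPerm.
  by apply: functional_extensionality_dep => i; exact: Prop_irrelevance.
- by case; rewrite (ocast_uprof 1) comp1m.
move=> p q d; move: p q; elim/uprof_ind => n q; move: q; elim/uprofs_ind => k.
case: d; rewrite (ocast_uprof n) (ocast_uprof (\sum_i k i)) comp1m.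
have -> : ntens_map (fun i => ocast (uprof (k i)) (col (uprof n) i)) = idm _.
  rewrite -ntens_map1; congr ntens_map; apply: functional_extensionality_dep => i.
  exact: ocast_uprof.
by rewrite tensm1 compm1.
Qed.

Lemma ocastV_map : is_operad_map (L := O) (L' := to_operad (flat_operad O))
  (fun z => ocastV z.1 z.2).
Proof.
split=> /=.
- elim/uprof_ind => m; elim/uprof_ind => n [] s; rewrite !ocastV_uprof comp1m compm1.
  have -> : s = unit_perm (pperm_bij s); last by [].
  case: s => f bf cf /=; congr Build_ProfPerm.
  by apply: functional_extensionality_dep => i; exact: Prop_irrelevance.
- by case; rewrite (ocastV_uprof 1) comp1m.
move=> p q d; move: p q; elim/uprof_ind => n q; move: q; elim/uprofs_ind => k.
case: d; rewrite (ocastV_uprof n) (ocastV_uprof (\sum_i k i)) comp1m.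
have -> : ntens_map (fun i => ocastV (uprof (k i)) (col (uprof n) i)) = idm _.
  rewrite -ntens_map1; congr ntens_map; apply: functional_extensionality_dep => i.
  exact: ocastV_uprof.
by rewrite tensm1 compm1.
Qed.
End Cast.

Section FlatAlgebras.
Definition all_ok n (x : 'I_n -> unit) (e : unit) : Prop := True.

Section Of.
Variables (O : Operad V unit) (A : Algebra O).
Definition flat_alg_act n (x : 'I_n -> unit) e (h : all_ok x e) :
    Hom (flat_operad O n ⊗ ntens (fun _ : 'I_n => A tt)) (A tt) :=
  alg_act A (uprof n) tt.

Lemma flat_alg_law : flat_action (L := flat_operad O) (X := fun _ => A tt) flat_alg_act.
Proof.
have [a1 a2 a3] := alg_law A; split.
- move=> m n s bs x e h h'; have := a1 _ _ (unit_perm bs) tt I I => /= e1.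
  apply: etrans e1 _; congr (_ ∘ (_ ⊗m _)); exact: reindex_irrel.
- by move=> e h; exact: (a2 tt I).
move=> n k x y e h hq h'.
exact: (a3 (uprof n) (fun i => uprof (k i)) tt I (fun _ => I) I).
Qed.
End Of.

Section To.
Variables (L : FlatOperad V) (Y : unit -> V).
Variable act : forall n (x : 'I_n -> unit) e, all_ok x e ->
  Hom (L n ⊗ ntens (fun i => Y (x i))) (Y e).
Hypothesis act_law : flat_action act.

Definition to_alg_act (p : Profile unit) (d : unit) :
    Hom (to_operad L p d ⊗ ntens (fun i => Y (col p i))) (Y d) :=
  @act (len p) (col p) d I.

Lemma to_alg_law : is_action (L := to_operad L) (c := id) (ok := fun _ _ => True) (X := Y)
  (fun p d _ => to_alg_act p d).
Proof.
split.
- move=> p' p s d _ _; exact: (fact_reindex act_law (pperm_bij s) (pperm_col s) I I).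
- by move=> d _; exact: (fact_unit act_law (I : all_ok (fun _ : 'I_1 => d) d)).
move=> p q d _ _ _.
exact: (fact_assoc act_law (x := fun i => col (q i)) (y := col p) (e := d) I (fun i => I) I).
Qed.

Definition to_alg : Algebra (to_operad L) :=
  {| alg_ob := Y; alg_act := to_alg_act; alg_law := to_alg_law |}.
End To.
End FlatAlgebras.
End FlatMaps.

(** * The initial pair, and sections of trivial fibrations of pairs *)

Section Pairs.
Variables (V : ClosedSymMonCat) (M : ModelData V).
Hypotheses (hM : is_model_category M) (hmon : is_monoidal_model M).
Hypothesis unit_cofibrant : cofibrant M unitI.

Section Lift.
Variables (L : FlatOperad V) (X Y : V) (q : Hom Y X).
Variable act : forall n (x : 'I_n -> unit) e, all_ok x e -> Hom (L n ⊗ ntens (fun _ : 'I_n => X)) X.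
Hypothesis act_law : flat_action (X := fun _ => X) act.

Lemma lift_algebra : exists (L' : FlatOperad V) (pi : forall n, Hom (L' n) (L n))
    (a : forall n (x : 'I_n -> unit) e, all_ok x e -> Hom (L' n ⊗ ntens (fun _ : 'I_n => Y)) Y),
  [/\ is_flat_map pi, flat_action (X := fun _ => Y) a,
      forall n (x : 'I_n -> unit) e (h : all_ok x e),
        q ∘ a n x e h = act h ∘ (pi n ⊗m ntens_map (fun _ => q)),
      forall (K : FlatOperad V) (g : forall n, Hom (K n) (L n))
          (b : forall n (x : 'I_n -> unit) e, all_ok x e -> Hom (K n ⊗ ntens (fun _ : 'I_n => Y))
            Y),
        is_flat_map g -> flat_action (X := fun _ => Y) b ->
        (forall n (x : 'I_n -> unit) e (h : all_ok x e),
           q ∘ b n x e h = act h ∘ (g n ⊗m ntens_map (fun _ => q))) ->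
        exists h : forall n, Hom (K n) (L' n),
          [/\ is_flat_map h, forall n, pi n ∘ h n = g n
            & forall n (x : 'I_n -> unit) e (k : all_ok x e),
                a n x e k ∘ (h n ⊗m idm _) = b n x e k]
    & cofibrant M Y -> TrivFib M q -> forall n, TrivFib M (pi n)].
Proof.
have o1 n (x : 'I_n -> unit) e e' : all_ok x e -> all_ok x e' -> e = e' by case: e; case: e'.
have o2 e : all_ok (fun _ : 'I_1 => e) e by [].
have o3 m n (s : 'I_m -> 'I_n) (bs : bijective s) (x : 'I_n -> unit) e :
  all_ok (fun i => x (s i)) e -> all_ok x e by [].
have o4 n (k : 'I_n -> nat) (x : forall i, 'I_(k i) -> unit) e :
  all_ok (fun m => x (tagnat.sig1 m) (tagnat.sig2 m)) e ->
  exists y : 'I_n -> unit, (forall i, all_ok (x i) (y i)) /\ all_ok y e by exists (fun _ => tt).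
have o5 n (k : 'I_n -> nat) (x : forall i, 'I_(k i) -> unit) (y : 'I_n -> unit) e :
  (forall i, all_ok (x i) (y i)) -> all_ok y e ->
  all_ok (fun m => x (tagnat.sig1 m) (tagnat.sig2 m)) e by [].
pose c := mc_complete hM.
exists (@lifted_operad V c L unit (fun _ => X) (fun _ => Y) (fun _ =>
  q) all_ok act act_law o1 o2 o3 o4 o5).
exists (@wpi V c L unit (fun _ => X) (fun _ => Y) (fun _ => q) all_ok act).
exists (@wact V c L unit (fun _ => X) (fun _ => Y) (fun _ => q) all_ok act).
split.
- exact: wpi_flat_map.
- exact: lifted_action.
- by move=> n x e h; exact: wact_compat.
- by move=> K g b hg hb hc; exact: (@lifted_univ V c L unit (fun _ => X) (fun _ => Y) (fun _ =>
  q) all_ok act act_law o1 o2 o3 o4 o5 K g b hg hb hc).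
- by move=> cY tq n; exact: wpi_TrivFib.
Qed.
End Lift.

(** Without an initial object the cofibrancy of a pair would be an empty condition. The algebra
    lives on the initial object [Z]; its action, and the compatibility of [Z -> A1] with the
    actions, both come from lifted operads, into which the initial operad maps. *)
Lemma initial_pair (O0 : operad_cat V unit) : is_initial O0 ->
  exists Z : pairs_cat V, is_initial Z.
Proof.
move=> iO.
have [T tT] := complete_terminal (mc_complete hM).
have [Z iZ] := cocomplete_initial (mc_cocomplete hM).
have [q _] := initial_ex T iZ.
pose actT n (x : 'I_n -> unit) e (h : all_ok x e) :
   Hom (flat_operad O0 n ⊗ ntens (fun _ : 'I_n => T)) T := sval (cid (terminal_ex _ tT)).
have actT_law : flat_action (X := fun _ => T) actT by split=> *; exact: terminal_eq.
(* Lifting along a map to a terminal object imposes no compatibility, so [L1] pairs an operation of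
   [O0] with an arbitrary operation on [Z]. *)
have [L1 [p1 [a1 [_ a1_law _ univ1 _]]]] := lift_algebra q actT_law.
have [s0 _] := @initial_ex (operad_cat V unit) _ (to_operad L1) iO.
pose A0 := pullback_alg s0 (to_alg a1_law).
exists {| pair_op := O0; pair_alg := A0 |} => -[O1 A1].
have [phi _] := @initial_ex (operad_cat V unit) _ O1 iO.
have [f0 _] := initial_ex (A1 tt) iZ.
(* [L2] pairs an operation of [O1] with an operation on [Z] compatible with [f0], so an operad map
   from [O0] to it yields an action on [Z] for which [f0] is a map of algebras. *)
have [L2 [p2 [a2 [p2_map a2_law a2_compat _ _]]]] := lift_algebra f0 (flat_alg_law A1).
have [s1 _] := @initial_ex (operad_cat V unit) _ (to_operad L2) iO.
pose A2 := pullback_alg s1 (to_alg a2_law).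
have e1 n : sval phi (uprof n, tt) = p2 n ∘ sval s1 (uprof n, tt).
  pose pi2 : @Hom (operad_cat V unit) (to_operad L2) O1 :=
    exist (@is_operad_map V unit (to_operad L2) O1) _
      (operad_mapM (ocast_map O1) (to_operad_mapP p2_map)).
  have -> : phi = pi2 ∘ s1 by exact: initial_eq.
  by rewrite -[RHS]comp1m -(ocast_uprof O1 n) compmA.
(* The action of [A2] on [Z] is classified by a map [O0 -> L1], which equals [s0] by initiality;
   hence [A2] and [A0] carry the same action. *)
have [h [h_map _ ha]] := univ1 (flat_operad O0) (fun n => idm _) (flat_alg_act A2)
  (And3 (fun _ _ _ _ => etrans (comp1m _) (esym (compm1 _))) (comp1m _)
    (fun n k => etrans (comp1m _) (esym (etrans (congr1 _ (etrans (congr1 _ (ntens_map1 _))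
        (tensm1 _ _))) (compm1 _)))))
  (flat_alg_law A2) (fun _ _ _ _ => terminal_eq _ _ tT).
have e2 n : h n = sval s0 (uprof n, tt).
  pose h' : @Hom (operad_cat V unit) O0 (to_operad L1) :=
    exist (@is_operad_map V unit O0 (to_operad L1)) _
      (operad_mapM (to_operad_mapP h_map) (ocastV_map O0)).
  have <- : h' = s0 by exact: initial_eq.
  by rewrite -[LHS]compm1 -(ocastV_uprof O0 n).
have e3 n : alg_act A0 (uprof n) tt = alg_act A2 (uprof n) tt.
  by rewrite -[RHS](ha n (fun _ => tt) tt I) e2.
pose f : Hom (pair_fam {| pair_op := O0; pair_alg := A0 |}) (pair_fam {| pair_op := O1;
  pair_alg := A1 |}) :=
  fun z => match z with inl z => sval phi z | inr d => match d with tt => f0 end end.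
have f_map : is_pair_map f.
  split; first exact: (svalP phi).
  elim/uprof_ind => n [].
  rewrite e3 /= compmA; have := a2_compat n (fun _ => tt) tt I => e4.
  apply: etrans (congr1 (fun x => x ∘ _) e4) _.
  rewrite -[LHS]compmA -tensmM compm1 /=; congr (_ ∘ (_ ⊗m _)).
  exact: (esym (e1 n)).
exists (exist (@is_pair_map V _ _) f f_map); split=> // -[g [g1 g2]] _.
apply: sig_ext; apply: functional_extensionality_dep => -[z|[]] /=.
  have e : phi = exist (@is_operad_map V unit O0 O1) _ g1 by exact: initial_eq.
  by rewrite e.
exact: initial_eq.
Qed.

Lemma pair_section (O0 : operad_cat V unit) (X X' : pairs_cat V) (p : Hom X' X) :
  is_initial O0 -> cofibrant (pairs_model M) X -> TrivFib (pairs_model M) p ->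
  exists s : Hom X X', p ∘ s = idm X.
Proof.
move=> iO cX [fp wp]; have [Z iZ] := initial_pair iO.
have [u _] := initial_ex X iZ; have [u' _] := initial_ex X' iZ.
have [|s [_ ps]] := cX Z u iZ _ _ p fp wp u' (idm X); first exact: initial_eq.
by exists s.
Qed.

Section CofibrantPair.
Variables (O0 : operad_cat V unit) (iO : is_initial O0) (O : Operad V unit) (A : Algebra O).
Hypothesis cOA : cofibrant (pairs_model M) ({| pair_op := O; pair_alg := A |} : pairs_cat V).

Lemma ocast_iso p d : is_iso (ocast O p d).
Proof. by exists (ocastV O p d); rewrite ocastK ocastVK. Qed.

Lemma cofibrant_pair_algebra : cofibrant M (A tt).
Proof.
have [Q [q [cQ tq]]] := cofibrant_replacement_ex hM (A tt).
have [L [pi [a [pi_map a_law a_compat _ tpi]]]] := lift_algebra q (flat_alg_law A).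
pose X' : pairs_cat V := {| pair_op := to_operad L; pair_alg := to_alg a_law |}.
pose f : Hom (pair_fam X') (pair_fam {| pair_op := O; pair_alg := A |}) :=
  fun z => match z with
  | inl z => ocast O z.1 z.2 ∘ pi (len z.1)
  | inr d => match d with tt => q end end.
have f_map : is_pair_map f.
  split; first exact: (operad_mapM (ocast_map O) (to_operad_mapP pi_map)).
  elim/uprof_ind => n [].
  apply: etrans (a_compat n (fun _ => tt) tt I) _.
  by rewrite -[pi n]comp1m -(ocast_uprof O n).
pose p : @Hom (pairs_cat V) X' {| pair_op := O; pair_alg := A |} :=
  exist (@is_pair_map V _ _) f f_map.
have tf z : TrivFib M (f z).
  case: z => [z|[]] /=; last exact: tq.
  by apply: (TrivFib_comp hM); [exact: tpi | apply: (TrivFib_iso hM); exact: ocast_iso].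
have [|s ps] := @pair_section O0 _ X' p iO cOA.
  by split=> z; [exact: (tf z).1 | exact: (tf z).2].
have := congr1 (fun g => sval g (inr tt)) ps => /= e.
exact: (cofibrant_retract hM e cQ).
Qed.
End CofibrantPair.
End Pairs.

Section FlatPullback.
Variables (V : SymMonCat) (K L : FlatOperad V) (g : forall n, Hom (K n) (L n)).
Hypothesis g_map : is_flat_map g.
Variables (S : SmallSet) (X : S -> V) (ok : forall n, ('I_n -> S) -> S -> Prop).
Variable act : forall n (x : 'I_n -> S) e, ok x e -> Hom (L n ⊗ ntens (fun i => X (x i))) (X e).
Hypothesis act_law : flat_action act.

Lemma flat_pullback :
  flat_action (L := K) (X := X) (fun n x e (h : ok x e) => act h ∘ (g n ⊗m idm _)).
Proof.
have [g1 g2 g3] := g_map; split.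
- move=> m n s bs x e h h'.
  rewrite -[LHS]compmA -tensmM g1 comp1m -{1}[idm _]comp1m tensmM [LHS]compmA.
  by rewrite (fact_equivariant act_law bs h h') -[LHS]compmA -[RHS]compmA tensm_r tensm_l.
- move=> e h; have eh : (act h ∘ (g 1 ⊗m idm _)) ∘ (funit K ⊗m runitV (X e))
  = act h ∘ (funit L ⊗m runitV (X e)).
    by rewrite -[LHS]compmA; congr (_ ∘ _); rewrite -[LHS]tensmM g2 comp1m.
  by rewrite eh; exact: (fact_unit act_law h).
move=> n k x y e h hq h'.
rewrite -[LHS]compmA tensm_l.
have -> : ntens_map (fun i => act (hq i) ∘ (g (k i) ⊗m idm _))
  = ntens_map (fun i => act (hq i)) ∘ ntens_map (fun i => g (k i) ⊗m ntens_map (fun j =>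
    idm (X (x i j)))).
  rewrite -ntens_mapM; congr ntens_map; apply: functional_extensionality_dep => i.
  by rewrite ntens_map1.
rewrite -[g n]comp1m tensmM [LHS]compmA (fact_assoc act_law h hq h').
rewrite (rwc _ (ntens_unzip_nat _ _ _)) [LHS]compmA; congr (_ ∘ _).
rewrite -[LHS]compmA -[RHS]compmA -!tensmM g3 comp1m; congr (_ ∘ (_ ⊗m _)).
rewrite (_ : ntens_map _ = idm _) ?compm1 // -ntens_map1; congr ntens_map.
by apply: functional_extensionality_dep => i; rewrite ntens_map1.
Qed.
End FlatPullback.

(** * Patterns with at most one marked input *)

Section Linear.
Lemma count_ords n (x : 'I_n -> bool) : count id (map x (ords n)) = \sum_(i < n) x i.
Proof.
rewrite ords_enum count_map -sum1_count big_enum_cond /= big_mkcond.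
by apply: eq_bigr => i _; case: (x i).
Qed.

Lemma linearE n (x : 'I_n -> bool) e : linear (Prof n x) e <-> \sum_(i < n) x i = e.
Proof. by rewrite /linear count_ords. Qed.

Lemma sum_sig n (k : 'I_n -> nat) (f : forall i, 'I_(k i) -> nat) :
  \sum_(m < \sum_i k i) f (tagnat.sig1 m) (tagnat.sig2 m) = \sum_i \sum_j f i j.
Proof.
rewrite (@sig_big_dep nat 0 addn 'I_n (fun i => 'I_(k i)) xpredT (fun i j => true) f).
rewrite (reindex (@tagnat.rank n k)) /=; last exact: (onW_bij _ tagnat.rank_bij).
by apply: eq_bigr => z _; rewrite /tagnat.sig1 /tagnat.sig2 tagnat.rankK.
Qed.

Definition lin n (x : 'I_n -> bool) (e : bool) : Prop := linear (Prof n x) e.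

Lemma lin_fun n (x : 'I_n -> bool) e e' : lin x e -> lin x e' -> e = e'.
Proof.
by move=> /linearE a /linearE; rewrite a; case: e e' {a} => [] [].
Qed.

Lemma lin_unit e : lin (fun _ : 'I_1 => e) e.
Proof. by apply/linearE; rewrite big_ord1. Qed.

Lemma lin_perm m n (s : 'I_m -> 'I_n) (bs : bijective s) (x : 'I_n -> bool) e :
  lin (fun i => x (s i)) e -> lin x e.
Proof.
move=> /linearE a; apply/linearE; rewrite -a (reindex s) //; exact: onW_bij.
Qed.

(** At most one input is marked altogether, so every block contains at most one; [y] records which
    block does. *)
Lemma lin_split n (k : 'I_n -> nat) (x : forall i, 'I_(k i) -> bool) e :
  lin (fun m => x (tagnat.sig1 m) (tagnat.sig2 m)) e ->
  exists y : 'I_n -> bool, (forall i, lin (x i) (y i)) /\ lin y e.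
Proof.
move=> /linearE; rewrite (sum_sig (fun i j => x i j)) => h.
have le i : \sum_j x i j <= 1.
  by apply: (@leq_trans (\sum_i \sum_j x i j)); [rewrite (bigD1 i) //= leq_addr | rewrite h leq_b1].
pose y i := 0 < \sum_j x i j.
have ey i : \sum_j x i j = y i by move: (le i); rewrite /y; case: (\sum_j _) => [|[]].
exists y; split=> [i|]; first by apply/linearE.
by apply/linearE; rewrite -h; apply: eq_bigr => i _; rewrite ey.
Qed.

Lemma lin_comp n (k : 'I_n -> nat) (x : forall i, 'I_(k i) -> bool) (y : 'I_n -> bool) e :
  (forall i, lin (x i) (y i)) -> lin y e -> lin (fun m => x (tagnat.sig1 m) (tagnat.sig2 m)) e.
Proof.
move=> h /linearE a; apply/linearE; rewrite -a (sum_sig (fun i j => x i j)).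
by apply: eq_bigr => i _; have /linearE := h i.
Qed.

Lemma lin_false n (x : 'I_n -> bool) : lin x false -> forall i, x i = false.
Proof.
move=> /linearE /eqP; rewrite sum_nat_eq0 => /forallP h i.
by have := h i; case: (x i).
Qed.
End Linear.

(** * Modules as actions on two sorts *)

Section ModuleActions.
Variables (V : SymMonCat) (O : Operad V unit) (A : Algebra O).

Definition flat_mod_act (N : Module A) n (x : 'I_n -> bool) e (h : lin x e) :
    Hom (flat_operad O n ⊗ ntens (fun i => mod_sort A (mod_ob N) (x i)))
        (mod_sort A (mod_ob N) e) := mod_act N h.

Lemma flat_mod_law (N : Module A) : flat_action (X := mod_sort A (mod_ob N)) (flat_mod_act N).
Proof.
have [a1 a2 a3] := mod_law N; split.
- move=> m n s bs x e h h'.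
  have e1 := a1 (Prof m (fun i => x (s i))) (Prof n x)
    (Build_ProfPerm (p' := Prof m (fun i => x (s i))) (p := Prof n x) bs (fun i => erefl)) e h' h.
  by apply: etrans e1 _; congr (_ ∘ (_ ⊗m _)); exact: reindex_irrel.
- by move=> e h; exact: (a2 e h).
move=> n k x y e h hq h'.
exact: (a3 (Prof n y) (fun i => Prof (k i) (x i)) e h hq h').
Qed.

Section To.
Variable P : V.
Variable act : forall n (x : 'I_n -> bool) e, lin x e ->
  Hom (flat_operad O n ⊗ ntens (fun i => mod_sort A P (x i))) (mod_sort A P e).
Hypothesis act_law : flat_action (X := mod_sort A P) act.

Definition to_mod_act (p : Profile bool) d (h : linear p d) :
    Hom (O (prof_map (fun _ => tt) p) tt ⊗ ntens (fun i => mod_sort A P (col p i)))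
        (mod_sort A P d) := @act (len p) (col p) d h.

Lemma to_mod_law : is_action (L := O) (c := fun _ => tt) to_mod_act.
Proof.
split.
- move=> p' p s d h' h.
  rewrite -(fact_reindex act_law (pperm_bij s) (pperm_col s) h h').
  congr (_ ∘ (_ ⊗m _)); rewrite /= /unit_perm; congr (cact O tt _); rewrite /pperm_map.
  by congr Build_ProfPerm; exact: Prop_irrelevance.
- by move=> d h; exact: (fact_unit act_law h).
move=> p q d h hq h'.
exact: (fact_assoc act_law (x := fun i => col (q i)) (y := col p) (e := d) h hq h').
Qed.
End To.
End ModuleActions.

(** * Module structures on cofibrant replacements *)

Section ModuleLift.
Variables (V : ClosedSymMonCat) (M : ModelData V).
Hypotheses (hM : is_model_category M) (hmon : is_monoidal_model M).
Hypothesis unit_cofibrant : cofibrant M unitI.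
Variables (O0 : operad_cat V unit) (iO : is_initial O0) (O : Operad V unit) (A : Algebra O).
Hypothesis cOA : cofibrant (pairs_model M) ({| pair_op := O; pair_alg := A |} : pairs_cat V).

(** The lifted operad forms a pair over [(O, A)] whose algebra is still [A], acted on through the
    projection. A section of this pair is an operad map from [O], and it makes [O] act on [P] and
    [A] together. *)
Lemma module_lift (N : Module A) (P : V) (q : Hom P (mod_ob N)) :
  cofibrant M P -> TrivFib M q ->
  exists (N' : Module A) (g : @Hom (mod_cat A) N' N) (i : Hom P (mod_ob N')),
    is_iso i /\ sval g ∘ i = q.
Proof.
move=> cP tq; pose c := mc_complete hM.
have cA := cofibrant_pair_algebra hM hmon unit_cofibrant iO cOA.
pose X := mod_sort A (mod_ob N); pose Y := mod_sort A P.
(* At the sort of the algebra the map to lift along is the identity, which forces the lifted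
   operations to act on [A] as their images in [O] do. *)
pose qs b : Hom (Y b) (X b) := mod_sort_map A q b.
have cY b : cofibrant M (Y b) by case: b.
have tqs b : TrivFib M (qs b).
  by case: b => //=; apply: (TrivFib_iso hM); exact: iso_id.
have act_law := flat_mod_law N.
pose L := @lifted_operad V c _ bool X Y qs lin _ act_law lin_fun lin_unit lin_perm lin_split
  lin_comp.
pose pi := @wpi V c (flat_operad O) bool X Y qs lin (flat_mod_act N).
have pi_map : is_flat_map (L := L) pi by exact: wpi_flat_map.
have a_law := lifted_action c qs act_law lin_fun lin_unit lin_perm lin_split lin_comp.
pose pi' : @Hom (operad_cat V unit) (to_operad L) O :=
  exist (@is_operad_map V unit (to_operad L) O) _
    (operad_mapM (ocast_map O) (to_operad_mapP pi_map)).
pose X' : pairs_cat V := {| pair_op := to_operad L; pair_alg := pullback_alg pi' A |}.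
pose f : Hom (pair_fam X') (pair_fam {| pair_op := O; pair_alg := A |}) :=
  fun z => match z with inl z => sval pi' z | inr d => idm (A d) end.
have f_map : is_pair_map f.
  split; first exact: (svalP pi').
  by move=> p d; rewrite /= comp1m ntens_map1.
pose p : @Hom (pairs_cat V) X' {| pair_op := O; pair_alg := A |} :=
  exist (@is_pair_map V _ _) f f_map.
have tf z : TrivFib M (f z).
  case: z => [z|d] /=; last by apply: (TrivFib_iso hM); exact: iso_id.
  apply: (TrivFib_comp hM); last by apply: (TrivFib_iso hM); exact: ocast_iso.
  exact: wpi_TrivFib.
have [|s ps] := pair_section hM hmon unit_cofibrant iO cOA (p := p).
  by split=> z; [exact: (tf z).1 | exact: (tf z).2].
pose g n := sval s (inl (uprof n, tt)).
have g_map : is_flat_map (L := flat_operad O) (L' := L) g.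
  exact: (flat_map_of (svalP s).1).
have pig n : pi n ∘ g n = idm _.
  have e := congr1 (fun h => sval h (inl (uprof n, tt))) ps.
  by apply: etrans e; rewrite -[LHS]comp1m -(ocast_uprof O n) compmA.
pose b n (x : 'I_n -> bool) e (h : lin x e) :
    Hom (flat_operad O n ⊗ ntens (fun i => mod_sort A P (x i))) (mod_sort A P e) :=
  @wact V c (flat_operad O) bool X Y qs lin (flat_mod_act N) n x e h ∘ (g n ⊗m idm _).
have b_law : flat_action (X := Y) b by exact: (flat_pullback g_map a_law).
have b_compat n (x : 'I_n -> bool) e (h : lin x e) :
    qs e ∘ b n x e h = flat_mod_act N h ∘ (idm _ ⊗m ntens_map (fun i => qs (x i))).
  rewrite compmA wact_compat -[LHS]compmA -tensmM compm1.
  by congr (_ ∘ (_ ⊗m _)); exact: pig.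
(* A linear operation with unmarked output has no marked input, so only identity components of [qs]
   occur and the compatibility with [N] gives back the structure map of [A]. *)
have b_alg : forall p (h : linear p false) (e : forall i, mod_sort A P (col p i) = A tt),
    to_mod_act b h = alg_act A (prof_map (fun _ => tt) p) tt
                     ∘ (idm _ ⊗m ntens_map (fun i => eqhom (e i))).
  move=> r h e; have h0 := lin_false (x := col r) h.
  have e' i : mod_sort A (mod_ob N) (col r i) = A tt by rewrite h0.
  apply: etrans (esym (comp1m _)) _; apply: etrans (b_compat _ _ _ h) _.
  rewrite /flat_mod_act (mod_act_alg h e') -[LHS]compmA -tensmM comp1m -ntens_mapM.
  congr (_ ∘ (_ ⊗m ntens_map _)); apply: functional_extensionality_dep => i.
  move: (e i) (e' i); rewrite /qs /mod_sort_map /mod_sort; rewrite h0 => e1 e2.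
  by rewrite !eqhom_id comp1m.
pose N' : Module A := {| mod_ob := P; mod_act := to_mod_act b; mod_act_alg := b_alg;
  mod_law := to_mod_law b_law |}.
have g'_map : is_mod_map (X := N') (Y := N) q by move=> r h; exact: (b_compat _ _ _ h).
exists N', (exist (@is_mod_map V O A N' N) q g'_map), (idm P).
by split; [exact: iso_id | rewrite compm1].
Qed.
End ModuleLift.

(** * Homotopy extension for Kan complexes *)

Section MonotoneMaps.
Lemma mono_of_spec m n (f : nat -> nat) (hf : forall i j, i <= j -> f i <= f j) :
  {g : monotone m n | forall i, sval g i = minn (f i) n :> nat}.
Proof.
have gE (i : 'I_m.+1) : (inord (minn (f i) n) : 'I_n.+1) = minn (f i) n :> nat.
  by rewrite inordK // ltnS geq_minr.
have gm : is_monotone (fun i : 'I_m.+1 => inord (minn (f i) n) : 'I_n.+1).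
  by move=> i j /hf; rewrite !gE; lia.
by exists (exist (@is_monotone m n) _ gm).
Qed.

(** The bound is enforced by truncation, so that only monotonicity is an obligation. *)
Definition mono_of m n f hf : monotone m n := sval (@mono_of_spec m n f hf).

Lemma mono_ofE m n f hf (i : 'I_m.+1) : sval (@mono_of m n f hf) i = minn (f i) n :> nat.
Proof. exact: (svalP (mono_of_spec m n hf)). Qed.

Lemma mono_eq m n (f g : monotone m n) :
  (forall i : 'I_m.+1, sval f i = sval g i :> nat) -> f = g.
Proof. by move=> h; apply: mono_ext => i; apply: val_inj; exact: h. Qed.

Lemma sdeg_mono k i j : i <= j -> i - (k < i) <= j - (k < j).
Proof. lia. Qed.
Definition sdeg n k : monotone n.+1 n := mono_of n.+1 n (@sdeg_mono k).
Lemma dface_mono k i j : i <= j -> i + (k <= i) <= j + (k <= j).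
Proof. lia. Qed.
Definition dface n k : monotone n n.+1 := mono_of n n.+1 (@dface_mono k).
Lemma thr_mono k i j : i <= j -> (k <= i : nat) <= (k <= j).
Proof. lia. Qed.
(** The simplices of the interval: [k] is the number of vertices sent to [0], so [k = 0] is constant
    at the top end and [k = n.+1] constant at the bottom end. *)
Definition thr n k : monotone n 1 := mono_of n 1 (@thr_mono k).

Lemma sdegE n k (i : 'I_n.+2) : sval (sdeg n k) i = minn (i - (k < i)) n :> nat.
Proof. exact: mono_ofE. Qed.
Lemma dfaceE n k (i : 'I_n.+1) : sval (dface n k) i = i + (k <= i) :> nat.
Proof. rewrite mono_ofE; have := ltn_ord i; lia. Qed.
Lemma thrE n k (i : 'I_n.+1) : sval (thr n k) i = (k <= i) :> nat.
Proof. rewrite mono_ofE; lia. Qed.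

Lemma thr_ex n (z : monotone n 1) : exists2 k, k <= n.+1 & z = thr n k.
Proof.
have bz i : sval z i <= 1 by have := ltn_ord (sval z i); lia.
have [[i zi]|no] := pselect (exists i, sval z i = 1 :> nat).
  case: (arg_minnP (P := fun i => sval z i == 1 :> nat) (fun i => i : nat) (i0 := i)).
    by rewrite zi.
  move=> k /eqP zk mink; exists k; first by have := ltn_ord k; lia.
  apply: mono_eq => j; rewrite thrE; case: (leqP k j) => h.
    by have := svalP z _ _ h; have := bz j; rewrite zk; lia.
  have := mink j; have := bz j; case: (sval z j) => -[|[]] //= *; lia.
exists n.+1 => //; apply: mono_eq => j; rewrite thrE; have := ltn_ord j.
have := bz j; case: (nat_of_ord (sval z j) =P 1) => [e|]; [by case: no; exists j | lia].
Qed.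

Lemma strict_mono_id n (g : monotone n n) : injective (sval g) -> forall i, sval g i = i.
Proof.
move=> ig; have lt (i j : 'I_n.+1) : i < j -> sval g i < sval g j.
  move=> h; have := svalP g i j (ltnW h); rewrite leq_eqVlt => /orP[/eqP e|//].
  by have := ig _ _ (val_inj e) => e'; move: h; rewrite e' ltnn.
have up m (i : 'I_n.+1) : i = m :> nat -> m <= sval g i.
  elim: m i => // m IH i e; have hm : m < n.+1 by have := ltn_ord i; lia.
  have := IH (Ordinal hm) erefl; have := lt (Ordinal hm) i; rewrite /= e ltnSn; lia.
have dn m (i : 'I_n.+1) : n - i = m -> m <= n - sval g i.
  elim: m i => // m IH i e; have hm : i.+1 < n.+1 by have := ltn_ord i; lia.
  have := IH (Ordinal hm); have := lt i (Ordinal hm); have := ltn_ord (sval g (Ordinal hm)).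
  rewrite /=; lia.
move=> i; apply: val_inj; have := up i i erefl; have := dn _ i erefl.
by have := ltn_ord i; have := ltn_ord (sval g i); rewrite /=; lia.
Qed.

(** The complement of the horn: these are the simplices that do not lie in [Lambda^k[n]]. *)
Definition hits m n k (s : monotone m n) : Prop :=
  forall j : 'I_n.+1, j != k :> nat -> exists i, sval s i = j.

(** Over the face opposite [k] a simplex outside the horn has a section; any choice of preimages is
    monotone because [s] is, so one may also prescribe that it passes through [i]. *)
Lemma hits_section m n k (s : monotone m n.+1) (i : 'I_m.+1) : k <= n.+1 -> hits k s ->
  exists a : monotone n m,
  mono_comp s a = dface n k /\ (sval s i != k :> nat -> exists y, sval a y = i).
Proof.
move=> kn hs.
have pre y : exists x, sval s x = sval (dface n k) y /\ (sval (dface n k) y = sval s i -> x = i).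
  have [e|ne] := pselect (sval (dface n k) y = sval s i); first by exists i.
  have [|x ex] := hs (sval (dface n k) y); first by rewrite dfaceE; lia.
  by exists x.
pose a y := sval (cid (pre y)); have pa y := svalP (cid (pre y)).
have am : is_monotone a.
  move=> y y'; rewrite leq_eqVlt => /orP[/eqP/val_inj ->|h]; first exact: leqnn.
  rewrite leqNgt; apply/negP => /ltnW/(svalP s); rewrite (pa y).1 (pa y').1 !dfaceE.
  by move: h; rewrite /=; lia.
exists (exist (@is_monotone n m) a am); split; first by apply: mono_ext => y; rewrite /= (pa y).1.
move=> si; have le := ltn_ord (sval s i).
pose y : 'I_n.+1 := inord (sval s i - (k < sval s i)).
exists y; apply: (pa y).2; apply: val_inj; rewrite /= dfaceE /y inordK; last first.
  by case: (ltnP k (sval s i)) => h; move: si le; case: (sval s i) h => [] /= *; lia.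
case: (ltngtP k (sval s i)) => h /=; [ lia | lia | by rewrite -h eqxx in si].
Qed.

Lemma hits_dface n k (f : monotone n n.+1) : k <= n.+1 -> hits k f -> f = dface n k.
Proof.
move=> kn hf; have [b [fb _]] := hits_section ord0 kn hf.
have ib : injective (sval b).
  move=> y y' e; have : sval (mono_comp f b) y = sval (mono_comp f b) y' by rewrite /= e.
  by rewrite fb => /(congr1 val); rewrite /= !dfaceE => h; apply: val_inj => /=; lia.
have eb : b = mono_id n by apply: mono_ext => y; exact: strict_mono_id.
by rewrite -fb eb; apply: mono_ext.
Qed.

(** Sections through every vertex not sent to [k] exist, so the operators [a] that restrict [s] to
    the face opposite [k] detect its values there. *)
Lemma hits_inj m n k (s t : monotone m n.+1) : k <= n.+1 -> hits k s ->
  (forall a : monotone n m, mono_comp s a = dface n k -> mono_comp t a = dface n k) ->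
  forall i, sval s i != k :> nat -> sval t i = sval s i.
Proof.
move=> kn hs h i si; have [a [sa /(_ si)[y ay]]] := hits_section i kn hs.
by have := congr1 (fun f => sval f y) (h a sa); rewrite -sa /= ay.
Qed.

Lemma misses_dface m n j (s : monotone m n.+1) : j <= n.+1 -> (forall i, sval s i != j :> nat) ->
  mono_comp (dface n j) (mono_comp (sdeg n j) s) = s.
Proof.
move=> jn h; apply: mono_eq => i; rewrite dfaceE /= sdegE; move: (h i) (ltn_ord (sval s i)).
by move: (nat_of_ord (sval s i)) => x; lia.
Qed.

Lemma not_hits m n k (s : monotone m n) :
  ~ hits k s -> exists2 j : 'I_n.+1, j != k :> nat & forall i, sval s i != j :> nat.
Proof.
move=> /existsNP[j /not_implyP[jk no]]; exists j => // i; apply/eqP => e.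
by apply: no; exists i; apply: val_inj.
Qed.
End MonotoneMaps.

(** * Simplicial maps on subcomplexes, and the filling of one horn *)

Section PartialMaps.
Variables (P K : SSet).

(** A simplicial map on a subcomplex, encoded by its graph. Extension becomes inclusion, and unions
    of chains are available at once for Zorn's lemma. *)
Record partial_map (G : forall n, P n -> K n -> Prop) : Prop := {
  pm_fun : forall n x y y', G n x y -> G n x y' -> y = y';
  pm_act : forall m n (a : monotone m n) x y, G n x y -> G m (sact a x) (sact a y) }.

Definition pm_dom (G : forall n, P n -> K n -> Prop) n (x : P n) : Prop := exists y, G n x y.

Lemma pm_dom_act G m n (a : monotone m n) (x : P n) :
  partial_map G -> pm_dom G x -> pm_dom G (sact a x).
Proof. by move=> hG [y h]; exists (sact a y); exact: pm_act. Qed.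

Lemma kan_horn n (k : 'I_n.+2) (u : SMap (horn k) K) : Kan_complex (K : sSets) ->
  exists l : SMap (simplex n.+1) K, forall m x, sval l m (sval x) = sval u m x.
Proof.
move=> kK.
have tp : is_terminal (spoint : sSets).
  move=> X; have h : is_simplicial (X := X) (Y := spoint) (fun _ _ => tt) by [].
  by exists (exist _ _ h); split=> // g _; apply: smap_ext => m x; case: (sval g m x).
have [t _] := terminal_ex (K : sSets) tp; have [t' _] := terminal_ex (simplex n.+1 : sSets) tp.
have [|l [lu _]] := kK _ t tp n k u t'; first exact: terminal_eq.
by exists l => m x; rewrite -lu.
Qed.

(** The filler of the horn gives values on [T] and on its missing face. They are consistent although
    [T] may be glued to itself: since the face opposite [k] is outside the domain, a new simplex
    comes from a single operator. This takes the place of a decomposition into nondegenerate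
    simplices. *)
Lemma horn_extend G n (T : P n.+1) k : Kan_complex (K : sSets) -> partial_map G -> k <= n.+1 ->
  (forall j, j <= n.+1 -> j != k -> pm_dom G (sact (dface n j) T)) ->
  ~ pm_dom G (sact (dface n k) T) ->
  exists G', [/\ partial_map G', forall m x y, G m x y -> G' m x y,
    forall m (s : monotone m n.+1), pm_dom G' (sact s T)
  & forall m x, pm_dom G' x -> pm_dom G x \/ exists s : monotone m n.+1, hits k s /\ x = sact s T].
Proof.
move=> kK hG kn faces no.
have miss m (s : monotone m n.+1) : ~ hits k s -> pm_dom G (sact s T).
  move=> /not_hits[j jk sj]; rewrite -(misses_dface _ sj); last by have := ltn_ord j; lia.
  rewrite sact_comp; apply: pm_dom_act => //; apply: faces => //; have := ltn_ord j; lia.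
have hit m (s : monotone m n.+1) : hits k s -> ~ pm_dom G (sact s T).
  move=> hs h; have [a [sa _]] := hits_section ord0 kn hs.
  by apply: no; rewrite -sa sact_comp; exact: pm_dom_act.
(* If [s] and [t] give the same simplex and [a] restricts [s] to the missing face, then [t] followed
   by [a] cannot miss a vertex other than [k], as that simplex would be in the domain. So [a]
   restricts [t] to the same face, and [hits_inj] applies in both directions. *)
have inj m (s t : monotone m n.+1) : hits k s -> hits k t -> sact s T = sact t T -> s = t.
  have key (s' t' : monotone m n.+1) : hits k s' -> sact s' T = sact t' T ->
      forall i, sval s' i != k :> nat -> sval t' i = sval s' i.
    move=> hs e; apply: (hits_inj kn hs) => a sa; apply: (hits_dface kn).
    apply: contrapT => /miss; rewrite sact_comp -e -sact_comp sa; exact: no.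
  move=> hs ht e; apply: mono_ext => i.
  have [si|si] := eqVneq (sval s i : nat) k; last by rewrite (key _ _ hs e).
  have [ti|ti] := eqVneq (sval t i : nat) k; last by rewrite (key _ _ ht (esym e)).
  by apply: val_inj; rewrite /= si ti.
pose k' : 'I_n.+2 := inord k; have ek : k' = k :> nat by rewrite inordK.
have hmiss m (x : horn k' m) : pm_dom G (sact (sval x) T).
  apply: miss => h; case: (svalP x) => j jk; have [|i si] := h j.
    by apply/eqP => e; apply: jk; apply: val_inj; rewrite /= ek.
  by move=> /(_ i); rewrite si.
pose u m (x : horn k' m) := sval (cid (hmiss m x)).
have us : is_simplicial u.
  move=> m m' a x; apply: (pm_fun hG (svalP (cid (hmiss m (sact a x))))).
  rewrite sact_comp; apply: (pm_act hG); exact: (svalP (cid (hmiss _ x))).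
have [l lu] := kan_horn (exist _ u us) kK.
pose y := sval l _ (mono_id n.+1).
have ly m (s : monotone m n.+1) : sval l m s = sact s y.
  by rewrite /y -(svalP l); congr (sval l m _); apply: mono_ext.
(* Only simplices outside the horn are added; on the horn itself the filler agrees with the values
   already present, which is part of [new]. *)
pose G' m x z := G m x z \/ exists s : monotone m n.+1, [/\ hits k s, x = sact s T & z = sact s y].
have new m (s : monotone m n.+1) : G' m (sact s T) (sact s y).
  have [hs|ns] := pselect (hits k s); first by right; exists s.
  have [j jk sj] := not_hits ns; left.
  have hx : exists2 j : 'I_n.+2, j <> k' & forall i, sval s i <> j.
    exists j; first by move=> e; move: jk; rewrite e ek eqxx.
    by move=> i e; move: (sj i); rewrite e eqxx.
  rewrite -ly (lu m (exist _ s hx)); exact: (svalP (cid (hmiss m (exist _ s hx)))).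
exists G'; split.
- split=> [m x z z'|m m' a x z].
    case=> [g|[s [hs -> ->]]] [g'|[t [ht e ->]]].
    - exact: (pm_fun hG g g').
    - by case: (hit _ t ht); exists z; rewrite -e.
    - by case: (hit _ s hs); exists z'.
    - by rewrite (inj _ s t hs ht e).
  case=> [g|[s [hs -> ->]]]; first by left; exact: pm_act.
  by rewrite -!sact_comp; exact: new.
- by move=> m x z g; left.
- by move=> m s; exists (sact s y); exact: new.
move=> m x [z [g|[s [hs e _]]]]; first by left; exists z.
by right; exists s.
Qed.
End PartialMaps.

(** * Extension over a cylinder *)

Section HomotopyExtension.
Variables (B K : SSet).
Hypothesis kK : Kan_complex (K : sSets).
Let P := sprod B (simplex 1).

(** The prism over a simplex of the domain that meets the bottom of the cylinder is in
    the domain: this is what makes the other faces of a missing prism available. *)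
Definition prism_closed (G : forall n, P n -> K n -> Prop) : Prop :=
  forall n (b : B n) k, k <= n -> pm_dom (P := P) G (b, thr n k) ->
    pm_dom (P := P) G (sact (sdeg n k) b, thr n.+1 k.+1).

(** Keeps the domain prism-closed after an extension: the prism over a newly added simplex is itself
    obtained by an operator [s'] from the filled prism, so it has been added as well. *)
Lemma thr_comp_hits n k m (s : monotone m n.+1) : k <= n -> hits k s ->
  forall k', mono_comp (thr n.+1 k.+1) s = thr m k' -> k' <= m ->
  exists s' : monotone m.+1 n.+1,
    mono_comp (sdeg n k) s' = mono_comp (mono_comp (sdeg n k) s) (sdeg m k') /\
    mono_comp (thr n.+1 k.+1) s' = thr m.+1 k'.+1.
Proof.
move=> kn hs k' e k'm.
have et (i : 'I_m.+1) : (k < sval s i) = (k' <= i).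
  have := congr1 (fun f => nat_of_ord (sval f i)) e; rewrite thrE /= thrE.
  by case: (k < _); case: (k' <= i).
have k'm1 : k' < m.+1 by [].
have sk : sval s (Ordinal k'm1) = k.+1 :> nat.
  have [|i si] := hs (inord k.+1); first by rewrite inordK; lia.
  have h := et i; rewrite si inordK in h; last lia.
  have := svalP s (Ordinal k'm1) i; rewrite si inordK; last lia.
  by have := et (Ordinal k'm1); rewrite /=; lia.
(* The vertex [k'] is doubled. Its second copy keeps the value [k.+1], and the first goes to [k],
   the bottom copy of the same vertex of [b]. *)
pose g (i : 'I_m.+2) : 'I_n.+2 := if i == k' :> nat then inord k else sval s (sval (sdeg m k') i).
have gE (i : 'I_m.+2) : g i = (if i == k' :> nat then k else sval s (sval (sdeg m k') i)) :> nat.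
  by rewrite /g; case: eqP => //; rewrite inordK //; lia.
have dE (i : 'I_m.+2) : sval (sdeg m k') i = i - (k' < i) :> nat.
  by rewrite sdegE; have := ltn_ord i; lia.
have gm : is_monotone g.
  move=> i j ij; rewrite !gE; have ei := et (sval (sdeg m k') i).
  have ej := et (sval (sdeg m k') j); rewrite !dE in ei ej.
  have := svalP s _ _ (svalP (sdeg m k') _ _ ij).
  by case: eqP; case: eqP; lia.
exists (exist (@is_monotone _ _) g gm); split; apply: mono_eq => i.
  rewrite /= !sdegE gE; case: eqP => // ik.
  have -> : sval (sdeg m k') i = Ordinal k'm1 by apply: val_inj; rewrite /= dE ik; lia.
  by rewrite sk; lia.
by rewrite /= !thrE gE; case: eqP => ik; rewrite ?et ?dE; lia.
Qed.

(** A face of the prism other than the two that pass between top and bottom at [k] is a prism over a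
    face of [b], hence over a simplex of lower dimension. *)
Lemma prism_face n (b : B n) k j : k <= n -> j <= n.+1 -> j != k -> j != k.+1 ->
  exists n' (a : monotone n' n) k', [/\ n' < n, k' <= n' &
    forall G : forall n, P n -> K n -> Prop, prism_closed G ->
      pm_dom (P := P) G (sact a b, thr n' k') ->
      pm_dom (P := P) G (sact (dface n j) ((sact (sdeg n k) b, thr n.+1 k.+1) : P n.+1))].
Proof.
case: n b => [|n] b kn jn jk jk1; first by exfalso; lia.
(* Deleting a vertex below [k] lowers the passage from bottom to top by one; a vertex above [k.+1]
   corresponds to vertex [j.-1] of [b], because [k] and [k.+1] lie over the same vertex. *)
pose i := if j < k then j else j.-1; pose k' := if j < k then k.-1 else k.
exists n, (dface n i), k'; split=> [|| G cG h]; [by [] | by rewrite /k'; case: ifP; lia |].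
have := cG n (sact (dface n i) b) k'; case => [||y].
- by rewrite /k'; case: ifP; lia.
- exact: h.
move=> hy; exists y; move: hy; congr (G _ _ _); congr pair.
  rewrite -!sact_comp; congr sact; apply: mono_eq => x.
  rewrite /= !dfaceE !sdegE !dfaceE /i /k'; have := ltn_ord x; case: ifP; lia.
by apply: mono_eq => x; rewrite /= !thrE !dfaceE /k'; have := ltn_ord x; case: ifP; lia.
Qed.

Let rel := forall n, P n -> K n -> Prop.
Let good (G : rel) := partial_map G /\ prism_closed G.

(** If nothing could be added, induction would put every simplex into the domain: [(b, thr n k)] is
    the face opposite [k] of a prism whose face opposite [k.+1] is [(b, thr n k.+1)], treated
    before, and whose other faces are handled by the induction on dimension. *)
Lemma prism_extend (G : rel) : good G -> (forall n (b : B n), pm_dom G ((b, thr n n.+1) : P n)) ->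
  ~ (forall n (x : P n), pm_dom G x) ->
  exists G' : rel, [/\ good G', forall n x y, G n x y -> G' n x y
                    & exists n (x : P n), pm_dom G' x /\ ~ pm_dom G x].
Proof.
move=> [hG cG] bot no; apply: contrapT => hno; apply: no => n.
elim/ltn_ind: n => n IH [b z]; have [k kn ->] := thr_ex z.
(* Downward induction on [k] from [n.+1], the simplices on the bottom; [d] counts the vertices on
   the top. *)
move: kn; rewrite -subn_eq0; move e : (n.+1 - k) => d kn; have {}kn : k <= n.+1 by lia.
elim: d k e kn => [|d IHd] k e kn; first by have -> : k = n.+1 by lia.
have {}kn : k <= n by lia.
apply: contrapT => hw; apply: hno.
(* The simplex of the triangulated prism over [b] with vertices [0, ..., k] on the bottom and
   [k, ..., n] on the top. *)
pose T : P n.+1 := (sact (sdeg n k) b, thr n.+1 k.+1).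
have Tk : sact (dface n k) T = (b, thr n k).
  congr pair; rewrite /= -?sact_comp -1?[RHS]sact_id; [congr sact|]; apply: mono_eq => i.
    by rewrite /= sdegE dfaceE; have := ltn_ord i; lia.
  by rewrite /= !thrE dfaceE; lia.
have Tk1 : sact (dface n k.+1) T = (b, thr n k.+1).
  congr pair; rewrite /= -?sact_comp -1?[RHS]sact_id; [congr sact|]; apply: mono_eq => i.
    by rewrite /= sdegE dfaceE; have := ltn_ord i; lia.
  by rewrite /= !thrE dfaceE; lia.
have [|j jn jk||G' [hG' sub new dom']] := @horn_extend P K G n T k kK hG.
- by lia.
- have [->|jk1] := eqVneq j k.+1; first by rewrite Tk1; apply: IHd; lia.
  have [n' [a [k' [n'n k'n h]]]] := prism_face b kn jn jk jk1.
  by apply: h => //; apply: IH.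
- by rewrite Tk.
exists G'; split=> //; last by exists n, (b, thr n k); split=> //; rewrite -Tk.
split=> // m c k' k'm /dom'[h|[s [hs es]]].
  by have [y hy] := cG m c k' k'm h; exists y; exact: sub.
have [e1 e2] : c = sact (mono_comp (sdeg n k) s) b /\ mono_comp (thr n.+1 k.+1) s = thr m k'.
  by case: es => -> ->; rewrite sact_comp.
have [s' [e3 e4]] := thr_comp_hits kn hs e2 k'm.
have := new _ s'; congr (pm_dom _ _); congr pair; last exact: e4.
by rewrite /= e1 -!sact_comp; congr sact; rewrite e3.
Qed.

(** Zorn's lemma on graphs; by [prism_extend] a maximal one is defined everywhere. *)
Lemma homotopy_extension (G0 : rel) : partial_map G0 -> prism_closed G0 ->
  (forall n (b : B n), pm_dom G0 ((b, thr n n.+1) : P n)) ->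
  exists F : SMap P K, forall n x y, G0 n x y -> sval F n x = y.
Proof.
move=> h0 c0 bot; pose E := {n & (P n * K n)%type}.
(* The initial graph is adjoined to every member instead of being required as a subset, so the empty
   chain has [G0] itself as its union. *)
pose join (S : E -> Prop) : rel := fun n x y => S (existT _ n (x, y)) \/ G0 n x y.
have [F Fgood Ftot|A [gA maxA]] := @classical_sets.Zorn_bigcup E (fun S => good (join S)).
  pose U := join (classical_sets.bigcup F id).
  have sub S n x y : F S -> join S n x y -> U n x y.
    by move=> FS [h|h]; [left; exists S | right].
  have two m x y n x' y' : U m x y -> U n x' y' ->
      exists G : rel, [/\ good G, G m x y, G n x' y' & forall n x y, G n x y -> U n x y].
    move=> [[S FS h]|h] [[S' FS' h']|h'].
    - case: (Ftot _ _ FS FS') => SS.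
        by exists (join S'); split; [exact: Fgood | left; exact: SS | left | move=> *;
          exact: (sub S')].
      by exists (join S); split; [exact: Fgood | left | left; exact: SS | move=> *; exact: (sub S)].
    - by exists (join S); split; [exact: Fgood | left | right | move=> *; exact: (sub S)].
    - by exists (join S'); split; [exact: Fgood | right | left | move=> *; exact: (sub S')].
    - by exists G0; split=> // *; right.
  split; first split.
  - move=> n x y y' u u'; have [G [[hG _] g g' _]] := two _ _ _ _ _ _ u u'.
    exact: (pm_fun hG g g').
  - move=> m n a x y u; have [G [[hG _] g _ s]] := two _ _ _ _ _ _ u u.
    by apply: s; exact: pm_act.
  move=> n b k kn [y u]; have [G [[_ cG] g _ s]] := two _ _ _ _ _ _ u u.
  by have [|z hz] := cG n b k kn; [exists y | exists z; exact: s].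
have tot n (x : P n) : pm_dom (join A) x.
  apply: contrapT => hx; have [||G' [gG' sub [m [z [[y hy] hz]]]]] := @prism_extend (join A) gA.
  - by move=> k b; have [y hy] := bot k b; exists y; right.
  - by move=> h; exact: hx.
  apply: (maxA (fun e => G' (projT1 e) (projT2 e).1 (projT2 e).2)).
    split=> [[k [a b]] h|h]; first by apply: sub; left.
    by apply: hz; exists y; left; exact: (h (existT _ m (z, y)) hy).
  rewrite (_ : join _ = G') //; apply: functional_extensionality_dep => k.
  apply: funext => a; apply: funext => b; apply: propext; split=> [[|h]|] //; last by left.
  by apply: sub; right.
pose f n x := sval (cid (tot n x)); have fP n x := svalP (cid (tot n x)).
have fs : is_simplicial f.
  by move=> m n a x; apply: (pm_fun gA.1 (fP m _)); apply: (pm_act gA.1); exact: fP.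
by exists (exist _ f fs) => n x y h; apply: (pm_fun gA.1 (fP n x)); right.
Qed.
End HomotopyExtension.

Definition vertex n (b : 'I_2) : monotone n 1 :=
  exist (@is_monotone n 1) (fun _ => b) (fun _ _ _ => leqnn b).

Lemma vertex_act m n b (a : monotone m n) : mono_comp (vertex n b) a = vertex m b.
Proof. exact: mono_ext. Qed.

Lemma vertex_ne n : vertex n ord0 <> vertex n ord_max.
Proof. by move=> /(congr1 (fun f => sval f ord0)). Qed.

Lemma thr_top n : thr n n.+1 = vertex n ord0.
Proof. by apply: mono_eq => i; rewrite thrE /=; have := ltn_ord i; lia. Qed.

Lemma thr_not_top n k : k <= n -> thr n k <> vertex n ord0.
Proof.
move=> kn /(congr1 (fun f => nat_of_ord (sval f (inord n)))); rewrite thrE inordK //=; lia.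
Qed.

(** * Simplicial homotopy of maps into a Kan complex *)

Section Homotopies.
Variables (X K : SSet).

Lemma simplicially_homotopicP (u v : @Hom sSets_mon X K) : simplicially_homotopic u v <->
  exists H : SMap (sprod X (simplex 1)) K, forall n (x : X n),
    sval H n (x, vertex n ord0) = sval u n x /\ sval H n (x, vertex n ord_max) = sval v n x.
Proof.
split=> [[H [hu hv]]|[H h]].
  by exists H => n x; rewrite -hu -hv.
by exists H; split; apply: smap_ext => n x; have [a b] := h n x.
Qed.

Lemma simplicially_homotopic_refl (u : @Hom sSets_mon X K) : simplicially_homotopic u u.
Proof.
apply/simplicially_homotopicP.
have h : is_simplicial (X := sprod X (simplex 1)) (fun n z => sval u n z.1).
  by move=> m n a z; rewrite -(svalP u).
by exists (exist _ _ h).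
Qed.

Hypothesis kK : Kan_complex (K : sSets).

(** On the square [X × Delta[1] × Delta[1]] put the two homotopies on opposite sides and the
    constant homotopy of [u] on the bottom; the top of an extension joins [v] to [w]. With
    reflexivity, this one extension yields both symmetry and transitivity. *)
Lemma simplicially_homotopic_euclidean (u v w : @Hom sSets_mon X K) :
  simplicially_homotopic u v -> simplicially_homotopic u w -> simplicially_homotopic v w.
Proof.
move=> /simplicially_homotopicP[H1 h1] /simplicially_homotopicP[H2 h2].
pose B := sprod X (simplex 1).
pose G n (p : sprod B (simplex 1) n) (y : K n) : Prop :=
  [\/ p.1.2 = vertex n ord0 /\ y = sval H1 n (p.1.1, p.2),
      p.1.2 = vertex n ord_max /\ y = sval H2 n (p.1.1, p.2)
    | p.2 = vertex n ord0 /\ y = sval u n p.1.1].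
have [|||F hF] := @homotopy_extension B K kK G.
- split=> [n [[x z] t] y y'|m n a [[x z] t] y].
    rewrite /G /= => -[] [e ->] [] [e' ->] //.
    - by case: (@vertex_ne n); rewrite -e.
    - by rewrite e' (h1 n x).1.
    - by case: (@vertex_ne n); rewrite -e'.
    - by rewrite e' (h2 n x).1.
    - by rewrite e (h1 n x).1.
    - by rewrite e (h2 n x).1.
  rewrite /G /= => -[] [e ->]; [apply: Or31 | apply: Or32 | apply: Or33].
  - by rewrite e vertex_act -(svalP H1).
  - by rewrite e vertex_act -(svalP H2).
  - by rewrite e vertex_act -(svalP u).
- move=> n [x z] k kn [y]; rewrite /G /= => -[] [e ey].
  - by eexists; apply: Or31; rewrite /= e vertex_act.
  - by eexists; apply: Or32; rewrite /= e vertex_act.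
  - by case: (thr_not_top kn).
- by move=> n [x z]; eexists; apply: Or33; rewrite thr_top.
have s0 n (x : X n) : sval F n ((x, vertex n ord0), vertex n ord_max) = sval v n x.
  by apply: hF; apply: Or31; split=> //; rewrite (h1 n x).2.
have s1 n (x : X n) : sval F n ((x, vertex n ord_max), vertex n ord_max) = sval w n x.
  by apply: hF; apply: Or32; split=> //; rewrite (h2 n x).2.
apply/simplicially_homotopicP.
have h : is_simplicial (X := sprod X (simplex 1)) (fun n z => sval F n (z, vertex n ord_max)).
  by move=> m n a z; rewrite -(svalP F) /= vertex_act.
by exists (exist _ _ h) => n x /=.
Qed.

Lemma simplicially_homotopic_sym (u v : @Hom sSets_mon X K) :
  simplicially_homotopic u v -> simplicially_homotopic v u.
Proof. by move=> h; apply: (simplicially_homotopic_euclidean h);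
  exact: simplicially_homotopic_refl. Qed.

Lemma simplicially_homotopic_trans (u v w : @Hom sSets_mon X K) :
  simplicially_homotopic u v -> simplicially_homotopic v w -> simplicially_homotopic u w.
Proof. by move=> /simplicially_homotopic_sym h; exact: (simplicially_homotopic_euclidean h). Qed.
End Homotopies.

Lemma simplicially_homotopic_pre (X Y K : sSets_mon) (f : Hom X Y) (u v : Hom Y K) :
  simplicially_homotopic u v -> simplicially_homotopic (u ∘ f) (v ∘ f).
Proof.
move=> /simplicially_homotopicP[H h]; apply/simplicially_homotopicP.
exists (smap_comp H (sprodm f (smap_id _))) => n x; exact: h.
Qed.

Lemma simplicially_homotopic_post (X K K' : sSets_mon) (g : Hom K K') (u v : Hom X K) :
  simplicially_homotopic u v -> simplicially_homotopic (g ∘ u) (g ∘ v).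
Proof.
move=> /simplicially_homotopicP[H h]; apply/simplicially_homotopicP.
by exists (smap_comp g H) => n x /=; have [-> ->] := h n x.
Qed.

(** * Weak equivalences of simplicial sets *)

Section KanWE.
Variables X Y Z : sSets.

Lemma Kan_WE_comp (f : Hom X Y) (g : Hom Y Z) : Kan_WE f -> Kan_WE g -> Kan_WE (g ∘ f).
Proof.
move=> hf hg K kK; have [f1 f2] := hf K kK; have [g1 g2] := hg K kK; split=> [u|v v'].
  have [v hv] := f1 u; have [w hw] := g1 v; exists w.
  by apply: (simplicially_homotopic_trans kK) hv; rewrite compmA; exact: simplicially_homotopic_pre.
by rewrite !compmA => /f2/g2.
Qed.

Lemma Kan_WE_left (f : Hom X Y) (g : Hom Y Z) : Kan_WE g -> Kan_WE (g ∘ f) -> Kan_WE f.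
Proof.
move=> hg hf K kK; have [f1 f2] := hf K kK; have [g1 g2] := hg K kK; split=> [u|v v' h].
  by have [w hw] := f1 u; exists (w ∘ g); rewrite -compmA.
have [w hw] := g1 v; have [w' hw'] := g1 v'.
apply: (simplicially_homotopic_trans kK (simplicially_homotopic_sym kK hw)).
apply: (simplicially_homotopic_trans kK _ hw'); apply: simplicially_homotopic_pre; apply: f2;
  rewrite !compmA.
apply: (simplicially_homotopic_trans kK (simplicially_homotopic_pre _ hw)).
apply: (simplicially_homotopic_trans kK h); apply: simplicially_homotopic_sym => //;
  exact: simplicially_homotopic_pre.
Qed.

Lemma Kan_WE_right (f : Hom X Y) (g : Hom Y Z) : Kan_WE f -> Kan_WE (g ∘ f) -> Kan_WE g.
Proof.
move=> hf hg K kK; have [f1 f2] := hf K kK; have [g1 g2] := hg K kK; split=> [u|v v' h].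
  have [w hw] := g1 (u ∘ f); exists w; apply: f2; by rewrite -compmA.
by apply: g2; rewrite !compmA; exact: simplicially_homotopic_pre.
Qed.
End KanWE.

Definition ssub (X : SSet) (P : forall n, X n -> Prop)
    (hP : forall m n (a : monotone m n) x, P n x -> P m (sact a x)) : SSet.
Proof.
unshelve refine {| sx := fun n => {x : X n | P n x};
                   sact := fun m n a x => exist _ (sact a (sval x)) (hP m n a _ (svalP x)) |}.
- by move=> n x; apply: sig_ext; rewrite /= sact_id.
- by move=> m n k g f x; apply: sig_ext; rewrite /= sact_comp.
Defined.

Definition ssub_incl X P hP : SMap (@ssub X P hP) X :=
  exist (@is_simplicial (@ssub X P hP) X) (fun n x => sval x) (fun m n a x => erefl).

(** Such a map is a homotopy equivalence: lifting against the empty subcomplex of [Y] gives a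
    section [s], and lifting against the two ends of [X × Delta[1]], with [s ∘ f] and the identity
    prescribed there, gives a homotopy. *)
Lemma Kan_WE_rlp (X Y : sSets) (f : Hom X Y) :
  (forall (A B : sSets) (i : Hom A B), (forall n, injective (sval i n)) -> lifts i f) ->
  Kan_WE f.
Proof.
move=> hf.
have inj (B : SSet) P hP : forall n, injective (sval (@ssub_incl B P hP) n).
  by move=> n x y; exact: sig_ext.
have [s fs] : exists s : Hom Y X, f ∘ s = idm Y.
  pose e := @ssub_incl Y (fun _ _ => False) (fun m n a x h => h).
  have u_s : is_simplicial (X := ssub (X := Y) (fun m n a x (h : False) => h)) (Y := X)
     (fun n x => match svalP x with end) by move=> m n a [].
  have [|s [_ hs]] := hf _ _ (e : Hom (_ : sSets) Y) (@inj _ _ _) (exist _ _ u_s) (idm Y).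
    by apply: smap_ext => n [].
  by exists s.
have h : simplicially_homotopic (s ∘ f) (idm X : @Hom sSets_mon X X).
  pose P n (z : sprod X (simplex 1) n) := z.2 = vertex n ord0 \/ z.2 = vertex n ord_max.
  have hP m n (a : monotone m n) z : P n z -> P m (sact a z).
    by rewrite /P /= => -[] ->; rewrite vertex_act; [left | right].
  pose u n (z : ssub hP n) : X n :=
    if pselect ((sval z).2 = vertex n ord0) then sval s n (sval f n (sval z).1) else (sval z).1.
  have u0 n (z : ssub hP n) : (sval z).2 = vertex n ord0 -> u n z = sval s n (sval f n (sval z).1).
    by rewrite /u; case: pselect.
  have u1 n (z : ssub hP n) : (sval z).2 = vertex n ord_max -> u n z = (sval z).1.
    by move=> e1; rewrite /u; case: pselect => // e0; case: (@vertex_ne n); rewrite -e0.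
  have us : is_simplicial (X := ssub hP) (Y := X) u.
    move=> m n a z; case: (svalP z) => e.
      by rewrite (u0 n) // (u0 m) /= ?e ?vertex_act // (svalP f) (svalP s).
    by rewrite (u1 n) // (u1 m) /= ?e ?vertex_act.
  pose pr : SMap (sprod X (simplex 1)) X := exist (@is_simplicial (sprod X (simplex 1))
    X) (fun n z => z.1) (fun m n a z => erefl).
  have [|H [hu _]] := hf _ _ (ssub_incl hP : Hom (_ : sSets) _) (@inj _ _ _) (exist _ _ us) (f ∘
    pr).
    apply: smap_ext => n z /=; case: (svalP z) => e; last by rewrite u1.
    by rewrite u0 //; have := congr1 (fun g => sval g n (sval f n (sval z).1)) fs.
  have hH n (z : ssub hP n) : sval H n (sval z) = u n z.
    by have := congr1 (fun g => sval g n z) hu.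
  apply/simplicially_homotopicP; exists H => n x; split.
    - by rewrite (hH n (exist _ (x, vertex n ord0) (or_introl erefl))) u0.
  - by rewrite (hH n (exist _ (x, vertex n ord_max) (or_intror erefl))) u1.
move=> K kK; split=> [u|v v' hv].
  exists (u ∘ s); rewrite -compmA -[X in simplicially_homotopic _ X]compm1.
  exact: (simplicially_homotopic_post u h).
by rewrite -[v]compm1 -[v']compm1 -fs !compmA; exact: simplicially_homotopic_pre.
Qed.

Lemma Kan_WE_iso (X Y : sSets) (f : Hom X Y) : is_iso f -> Kan_WE f.
Proof. by move=> fi; apply: Kan_WE_rlp => A B i _; exact: lifts_iso_r. Qed.

(** * Derived classes of maps *)

Section KenBrown.
Variables (D : Category) (M : ModelData D) (hM : is_model_category M).

Lemma TrivFib_pullback (A B X P : D) (f : Hom B A) (g : Hom X A) (u : Hom P B) (v : Hom P X) :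
  is_pullback f g u v -> TrivFib M g -> TrivFib M u.
Proof.
move=> [e pb] tg; apply: (TrivFib_rlp hM) => Y Z i ci a b eab.
have [|c [c1 c2]] := mc_lift_TrivFib hM ci tg (u := v ∘ a) (v := f ∘ b).
  by rewrite -compmA eab !compmA e.
have [h [[h1 h2] _]] := pb _ b c (esym c2); exists h; split=> //.
have [|k [_ ku]] := pb _ (u ∘ a) (v ∘ a); first by rewrite !compmA e.
by rewrite -(ku (h ∘ i)) ?(ku a) //; split=> //; rewrite compmA ?h1 ?h2.
Qed.

Lemma cofibrant_coproduct (X Y : D) : cofibrant M X -> cofibrant M Y ->
  exists (P : D) (u : Hom X P) (v : Hom Y P), [/\ Cof M u, Cof M v
    & forall (T : D) (a : Hom X T) (b : Hom Y T), exists h, h ∘ u = a /\ h ∘ v = b].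
Proof.
move=> cX cY; have [Z iZ] := cocomplete_initial (mc_cocomplete hM).
have [x _] := initial_ex X iZ; have [y _] := initial_ex Y iZ.
have [P [u [v [_ po]]]] := cocomplete_pushout x y (mc_cocomplete hM).
have uniq T (h h' : Hom P T) : h ∘ u = h' ∘ u -> h ∘ v = h' ∘ v -> h = h'.
  move=> e1 e2; have [|k [_ ku]] := po T (h ∘ u) (h ∘ v); first exact: initial_eq.
  by rewrite -(ku h) // -(ku h').
have ex T (a : Hom X T) (b : Hom Y T) : exists h, h ∘ u = a /\ h ∘ v = b.
  by have [|h [hh _]] := po T a b; [exact: initial_eq | exists h].
exists P, u, v; split=> //; apply: (Cof_llp hM) => A B p tp a b e.
- have [c ec] := cofibrant_lift hM (b ∘ v) cY tp; have [h [h1 h2]] := ex _ a c.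
  by exists h; split=> //; apply: uniq; rewrite -compmA ?h1 ?h2.
- have [c ec] := cofibrant_lift hM (b ∘ u) cX tp; have [h [h1 h2]] := ex _ c a.
  by exists h; split=> //; apply: uniq; rewrite -compmA ?h1 ?h2.
Qed.

Lemma fibrant_product (X Y : D) : fibrant M X -> fibrant M Y ->
  exists (P : D) (u : Hom P X) (v : Hom P Y), [/\ Fib M u, Fib M v
    & forall (T : D) (a : Hom T X) (b : Hom T Y), exists h, u ∘ h = a /\ v ∘ h = b].
Proof.
move=> cX cY; have [Z iZ] := complete_terminal (mc_complete hM).
have [x _] := terminal_ex X iZ; have [y _] := terminal_ex Y iZ.
have [P [u [v [_ po]]]] := complete_pullback x y (mc_complete hM).
have uniq T (h h' : Hom T P) : u ∘ h = u ∘ h' -> v ∘ h = v ∘ h' -> h = h'.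
  move=> e1 e2; have [|k [_ ku]] := po T (u ∘ h) (v ∘ h); first exact: terminal_eq.
  by rewrite -(ku h) // -(ku h').
have ex T (a : Hom T X) (b : Hom T Y) : exists h, u ∘ h = a /\ v ∘ h = b.
  by have [|h [hh _]] := po T a b; [exact: terminal_eq | exists h].
exists P, u, v; split=> //; apply: (Fib_rlp hM) => A B p tp a b e.
- have [c ec] := fibrant_ext hM (v ∘ a) cY tp; have [h [h1 h2]] := ex _ b c.
  by exists h; split=> //; apply: uniq; rewrite compmA ?h1 ?h2.
- have [c ec] := fibrant_ext hM (u ∘ a) cX tp; have [h [h1 h2]] := ex _ c b.
  by exists h; split=> //; apply: uniq; rewrite compmA ?h1 ?h2.
Qed.

Section Class.
Variable P : MorClass D.
Hypotheses (P_id : forall X, P (idm X))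
  (P_comp : forall X Y Z (f : Hom X Y) (g : Hom Y Z), P f -> P g -> P (g ∘ f)).

(** Ken Brown's lemma for a class of maps rather than a functor, so that it serves contravariant
    mapping spaces; composition and one cancellation law replace functoriality. *)
Lemma Ken_Brown_cofibrant :
  (forall X Y Z (f : Hom X Y) (g : Hom Y Z), P f -> P (g ∘ f) -> P g) ->
  (forall X Y (f : Hom X Y), cofibrant M X -> cofibrant M Y -> TrivCof M f -> P f) ->
  forall X Y (f : Hom X Y), cofibrant M X -> cofibrant M Y -> WE M f -> P f.
Proof.
move=> P_right PT X Y f cX cY wf.
have [S [u [v [cu cv ex]]]] := cofibrant_coproduct cX cY.
have [k [ku kv]] := ex Y f (idm Y).
have [Z [i [p [ci [fp wp] pi]]]] := mc_factor_TrivFib hM k.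
have cZ : cofibrant M Z by apply: (cofibrant_Cof hM) cX (Cof_comp hM cu ci).
have pj : p ∘ (i ∘ v) = idm Y by rewrite compmA pi.
have pf : p ∘ (i ∘ u) = f by rewrite compmA pi.
have Pj : P (i ∘ v).
  apply: PT => //; split; first exact: (Cof_comp hM cv ci).
  by apply: (mc_WE_left hM) wp _; rewrite pj; exact: WE_id.
have Pi : P (i ∘ u).
  apply: PT => //; split; first exact: (Cof_comp hM cu ci).
  by apply: (mc_WE_left hM) wp _; rewrite pf.
by rewrite -pf; apply: P_comp => //; apply: P_right Pj _; rewrite pj.
Qed.

Lemma Ken_Brown_fibrant :
  (forall X Y Z (f : Hom X Y) (g : Hom Y Z), P g -> P (g ∘ f) -> P f) ->
  (forall X Y (f : Hom X Y), fibrant M X -> fibrant M Y -> TrivFib M f -> P f) ->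
  forall X Y (f : Hom X Y), fibrant M X -> fibrant M Y -> WE M f -> P f.
Proof.
move=> P_left PT X Y f cX cY wf.
have [S [u [v [cu cv ex]]]] := fibrant_product cX cY.
have [k [ku kv]] := ex X (idm X) f.
have [Z [i [p [[ci wi] fp pi]]]] := mc_factor_TrivCof hM k.
have cZ : fibrant M Z by apply: (fibrant_Fib hM) cX (Fib_comp hM fp cu).
have pj : (u ∘ p) ∘ i = idm X by rewrite -compmA pi.
have pf : (v ∘ p) ∘ i = f by rewrite -compmA pi.
have Pj : P (u ∘ p).
  apply: PT => //; split; first exact: (Fib_comp hM fp cu).
  by apply: (mc_WE_right hM) wi _; rewrite pj; exact: WE_id.
have Pi : P (v ∘ p).
  apply: PT => //; split; first exact: (Fib_comp hM fp cv).
  by apply: (mc_WE_right hM) wi _; rewrite pf.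
by rewrite -pf; apply: P_comp => //; apply: P_left Pj _; rewrite pj.
Qed.
End Class.

Section Derived.
Variable P : MorClass D.
Hypotheses
  (P_comp : forall X Y Z (f : Hom X Y) (g : Hom Y Z), P f -> P g -> P (g ∘ f))
  (P_left : forall X Y Z (f : Hom X Y) (g : Hom Y Z), P g -> P (g ∘ f) -> P f)
  (P_right : forall X Y Z (f : Hom X Y) (g : Hom Y Z), P f -> P (g ∘ f) -> P g)
  (P_WE : forall X Y (f : Hom X Y), cofibrant M X -> cofibrant M Y -> WE M f -> P f).

(** Both projections of the fibre product of [p] with itself are trivial fibrations, and [u] and [v]
    are the two projections of one map into it. After a cofibrant replacement the projections lie in
    [P], and cancellation passes from [u] to [v]. *)
Lemma class_two_lifts (Q Y B : D) (p : Hom Y B) (u v : Hom Q Y) :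
  cofibrant M Q -> cofibrant M Y -> TrivFib M p -> p ∘ u = p ∘ v -> P u -> P v.
Proof.
move=> cQ cY tp e Pu.
have [E [a [b pb]]] := complete_pullback p p (mc_complete hM).
have ta := TrivFib_pullback pb tp.
have tb : TrivFib M b.
  have pb' : is_pullback p p b a.
    have [e' up] := pb; split=> // T u' v' e1; have [h [[h1 h2] hu]] := up T v' u' (esym e1).
    by exists h; split=> // h' [h1' h2']; exact: hu.
  exact: TrivFib_pullback pb' tp.
have [k [[ku kv] _]] := pb.2 _ u v e.
have [E' [q [cE' tq]]] := cofibrant_replacement_ex hM E.
have [k' kk] := cofibrant_lift hM k cQ tq.
have Pc (c : Hom E Y) : TrivFib M c -> P (c ∘ q).
  by move=> tc; apply: P_WE => //; exact: (TrivFib_comp hM tq tc).2.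
have Pk : P k' by apply: P_left (Pc a ta) _; rewrite -compmA kk ku.
by rewrite -kv -kk compmA; apply: P_comp => //; exact: Pc.
Qed.

(** Derived notions quantify over all replacements of a map; this independence of the choice allows
    them to be checked on a single one. *)
Lemma class_replacement (X Y QX QY QX' QY' : D) (f : Hom X Y) (g : Hom QX QY) (g' : Hom QX' QY') :
  cofibrant_replacement_map M f g -> cofibrant_replacement_map M f g' -> P g -> P g'.
Proof.
move=> [q [p [[cQ tq] [cP tp] e]]] [q' [p' [[cQ' tq'] [cP' tp'] e']]] Pg.
have lift A B T (s : Hom A T) (t : Hom B T) : cofibrant M A -> cofibrant M B ->
    TrivFib M s -> TrivFib M t -> exists2 a : Hom A B, t ∘ a = s & P a.
  move=> cA cB [_ ws] tt; have [a ea] := cofibrant_lift hM s cA tt; exists a => //.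
  by apply: P_WE => //; apply: (mc_WE_left hM) tt.2 _; rewrite ea.
have [a ea Pa] := lift _ _ _ q q' cQ cQ' tq tq'.
have [b eb Pb] := lift _ _ _ p p' cP cP' tp tp'.
apply: P_right Pa _; apply: (class_two_lifts cQ cP' tp' (u := b ∘ g)).
  by rewrite !compmA eb e e' -compmA ea.
exact: P_comp.
Qed.

Definition derived_class : MorClass D := fun X Y f =>
  forall QX QY (f' : Hom QX QY), cofibrant_replacement_map M f f' -> P f'.

Lemma derivedI (X Y QX QY : D) (f : Hom X Y) (f' : Hom QX QY) :
  cofibrant_replacement_map M f f' -> P f' -> derived_class f.
Proof. by move=> r Pf QX' QY' f'' r'; exact: class_replacement r r' Pf. Qed.

Lemma replacement_triangle (X Y Z : D) (f : Hom X Y) (g : Hom Y Z) :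
  exists QX QY QZ (f' : Hom QX QY) (g' : Hom QY QZ), [/\ cofibrant_replacement_map M f f',
    cofibrant_replacement_map M g g' & cofibrant_replacement_map M (g ∘ f) (g' ∘ f')].
Proof.
have [QX [x hx]] := cofibrant_replacement_ex hM X;
  have [QY [y hy]] := cofibrant_replacement_ex hM Y.
have [QZ [z hz]] := cofibrant_replacement_ex hM Z.
have [f' ef] := cofibrant_replacement_map_ex hM f hx hy.
have [g' eg] := cofibrant_replacement_map_ex hM g hy hz.
exists QX, QY, QZ, f', g'; split; [by exists x, y | by exists y, z | exists x, z; split=> //].
by rewrite compmA eg -compmA ef compmA.
Qed.

Lemma derived_comp X Y Z (f : Hom X Y) (g : Hom Y Z) :
  derived_class f -> derived_class g -> derived_class (g ∘ f).
Proof.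
move=> df dg; have [QX [QY [QZ [f' [g' [rf rg rgf]]]]]] := replacement_triangle f g.
by apply: derivedI rgf _; apply: P_comp; [exact: df | exact: dg].
Qed.

Lemma derived_left X Y Z (f : Hom X Y) (g : Hom Y Z) :
  derived_class g -> derived_class (g ∘ f) -> derived_class f.
Proof.
move=> dg dgf; have [QX [QY [QZ [f' [g' [rf rg rgf]]]]]] := replacement_triangle f g.
by apply: derivedI rf _; apply: P_left (dg _ _ _ rg) _; exact: dgf.
Qed.

Lemma derived_right X Y Z (f : Hom X Y) (g : Hom Y Z) :
  derived_class f -> derived_class (g ∘ f) -> derived_class g.
Proof.
move=> df dgf; have [QX [QY [QZ [f' [g' [rf rg rgf]]]]]] := replacement_triangle f g.
by apply: derivedI rg _; apply: P_right (df _ _ _ rf) _; exact: dgf.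
Qed.

Lemma derived_WE X Y (f : Hom X Y) : WE M f -> derived_class f.
Proof.
move=> wf QX QY f' [q [p [[cQ [_ wq]] [cP [_ wp]] e]]]; apply: P_WE => //.
by apply: (mc_WE_left hM) wp _; rewrite e; exact: mc_WE_comp.
Qed.
End Derived.
End KenBrown.

Lemma untransp_nat (C D : Category) (F : Functor C D) (G : Functor D C) (adj : Adjunction F G)
    (X' X : C) (Y Y' : D) (a : Hom X' X) (g : Hom X (G Y)) (b : Hom Y Y') :
  untransp adj (fmap G b ∘ g ∘ a) = b ∘ untransp adj g ∘ fmap F a.
Proof. by rewrite -(transpK adj (b ∘ _ ∘ _)) transp_nat untranspK. Qed.

Lemma smap_iso (X Y : sSets) (f : Hom X Y) (g : forall n, Y n -> X n) :
  (forall n, cancel (sval f n) (g n)) -> (forall n, cancel (g n) (sval f n)) -> is_iso f.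
Proof.
move=> fg gf; have gs : is_simplicial g.
  by move=> m n a y; rewrite -{1}(gf n y) -(svalP f) fg.
by exists (exist _ g gs); split; apply: smap_ext => n x /=; rewrite ?fg ?gf.
Qed.

Lemma Kan_WE_square (X Y X' Y' : sSets) (f : Hom X Y) (g : Hom X' Y')
    (a : Hom X X') (b : Hom Y Y') :
  Kan_WE a -> Kan_WE b -> b ∘ f = g ∘ a -> (Kan_WE f <-> Kan_WE g).
Proof.
move=> wa wb e; split=> w.
  by apply: (Kan_WE_right wa); rewrite -e; exact: Kan_WE_comp.
by apply: (Kan_WE_left wb); rewrite e; exact: Kan_WE_comp.
Qed.

(** * Mapping spaces *)

Section Sing.
Variable V : SimplicialSymMonModelCat.

Definition iD n : V := ssm_i V (simplex n : sSets_mon).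
Definition iDm m n (a : monotone m n) : Hom (iD m) (iD n) :=
  fmap (ssm_i V) (simplex_map a : @Hom sSets_mon _ _).

Lemma iDm_id n : iDm (mono_id n) = idm (iD n).
Proof.
rewrite /iDm (_ : simplex_map _ = idm (simplex n : sSets_mon)) ?fmap1 //.
by apply: smap_ext => k x; apply: mono_ext.
Qed.

Lemma iDm_comp m n k (g : monotone n k) (f : monotone m n) :
  iDm (mono_comp g f) = iDm g ∘ iDm f.
Proof. by rewrite /iDm -fmapM; congr fmap; apply: smap_ext => l x; apply: mono_ext. Qed.

(** A concrete copy of [r X]: by Yoneda and the adjunction its [n]-simplices are the maps from
    [i(Delta[n])] to [X]. *)
Definition sing (X : V) : SSet.
Proof.
unshelve refine {| sx := fun n => Hom (iD n) X; sact := fun m n a h => h ∘ iDm a |}.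
- by move=> n h; rewrite iDm_id compm1.
- by move=> m n k g f h; rewrite iDm_comp compmA.
Defined.

Definition sing_map (X Y : V) (f : Hom X Y) : SMap (sing X) (sing Y) :=
  exist (@is_simplicial (sing X) (sing Y)) (fun n h => f ∘ h) (fun m n a h => compmA _ _ _).

Definition yoneda (Y : SSet) n (y : Y n) : SMap (simplex n) Y.
Proof.
by exists (fun m (s : simplex n m) => sact s y) => m k a s /=; rewrite sact_comp.
Defined.

Lemma yoneda_ext (Y : SSet) n (f g : SMap (simplex n) Y) :
  sval f n (mono_id n) = sval g n (mono_id n) -> f = g.
Proof.
move=> e; apply: smap_ext => m s; have es : s = sact s (mono_id n : simplex n n).
  exact: mono_ext.
by rewrite es (svalP f) (svalP g) e.
Qed.

Lemma yoneda_act (Y : SSet) m n (a : monotone m n) (y : Y n) :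
  yoneda (sact a y) = smap_comp (yoneda y) (simplex_map a).
Proof. by apply: yoneda_ext; rewrite /= sact_id; congr (sact _ y); apply: mono_ext. Qed.

Lemma yoneda_map (Y Z : SSet) (f : SMap Y Z) n (y : Y n) :
  yoneda (sval f n y) = smap_comp f (yoneda y).
Proof. by apply: yoneda_ext; rewrite /= !sact_id. Qed.

Definition r_sing (X : V) : SMap (ssm_r V X) (sing X).
Proof.
exists (fun n x => untransp (ssm_adj V) (yoneda x : Hom (_ : sSets_mon) _) : sing X n).
move=> m n a x; rewrite yoneda_act.
have := untransp_nat (ssm_adj V) (simplex_map a : @Hom sSets_mon _ _)
   (yoneda x : Hom (_ : sSets_mon) (ssm_r V X)) (idm X).
by rewrite fmap1 !comp1m.
Defined.

Lemma r_sing_iso (X : V) : is_iso (r_sing X : Hom (_ : sSets) _).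
Proof.
pose g n (h : sing X n) : ssm_r V X n :=
  sval (transp (ssm_adj V) (h : Hom (ssm_i V (simplex n : sSets_mon)) X)) n (mono_id n).
apply: (@smap_iso (ssm_r V X) (sing X) (r_sing X) g) => n x; rewrite /g /=.
  by rewrite untranspK /= sact_id.
rewrite -[RHS](transpK (ssm_adj V)); congr untransp.
by apply: yoneda_ext; rewrite /= sact_id.
Qed.

Lemma r_sing_nat (X Y : V) (f : Hom X Y) :
  (r_sing Y : Hom (_ : sSets) _) ∘ fmap (ssm_r V) f = (sing_map f : Hom (_ : sSets) _) ∘ r_sing X.
Proof.
apply: smap_ext => n x /=; rewrite yoneda_map.
have := untransp_nat (ssm_adj V) (idm (simplex n : sSets_mon))
   (yoneda x : Hom (_ : sSets_mon) (ssm_r V X)) f.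
by rewrite fmap1 !compm1.
Qed.

Lemma Kan_WE_sing (X Y : V) (f : Hom X Y) :
  Kan_WE (fmap (ssm_r V) f : Hom (_ : sSets) _) <-> Kan_WE (sing_map f : Hom (_ : sSets) _).
Proof.
apply: (Kan_WE_square _ _ (r_sing_nat f)); apply: Kan_WE_iso; exact: r_sing_iso.
Qed.

(** By adjunction [r p] lifts against all monomorphisms, since [i] preserves cofibrations. *)
Lemma sing_TrivFib (X Y : V) (p : Hom X Y) :
  TrivFib (ssm_model V) p -> Kan_WE (sing_map p : Hom (_ : sSets) _).
Proof.
move=> tp; apply/Kan_WE_sing; apply: Kan_WE_rlp => A B i ci u v e.
have hM := ssm_is_model V; have [qc _] := ssm_Quillen V.
have [|h [h1 h2]] := mc_lift_TrivFib hM (qc A B i ci) tp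
  (u := untransp (ssm_adj V) u) (v := untransp (ssm_adj V) v).
  have := untransp_nat (ssm_adj V) i v (idm Y); rewrite fmap1 !comp1m => <-.
  have := untransp_nat (ssm_adj V) (idm A) u p; rewrite fmap1 !compm1 => <-.
  by congr untransp.
exists (transp (ssm_adj V) h); split.
  have := transp_nat (ssm_adj V) i h (idm X); rewrite fmap1 !comp1m => e1.
  by apply: etrans (esym e1) _; rewrite h1 untranspK.
have := transp_nat (ssm_adj V) (idm B) h p; rewrite fmap1 !compm1 => e1.
by apply: etrans (esym e1) _; rewrite h2 untranspK.
Qed.
End Sing.

(** * Homotopy invariance of mapping spaces, and local equivalences *)

Section MappingSpaces.
Variable V : SimplicialSymMonModelCat.
Let M := ssm_model V.
Let hM := ssm_is_model V.
Let hmon := ssm_is_monoidal V.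

(** A copy of [Map X Y] in which pre- and postcomposition are compositions in [V]. *)
Definition hmap (X Y : V) : SSet.
Proof.
unshelve refine {| sx := fun n => Hom (iD V n ⊗ X) Y;
                   sact := fun m n a h => h ∘ (iDm V a ⊗m idm X) |}.
- by move=> n h; rewrite iDm_id tensm1 compm1.
- by move=> m n k g f h; rewrite iDm_comp tens_compl compmA.
Defined.

Definition hmap_pre (X Y Z : V) (f : Hom X Y) : SMap (hmap Y Z) (hmap X Z).
Proof.
exists (fun n (h : hmap Y Z n) => h ∘ (idm _ ⊗m f) : hmap X Z n).
by move=> m n a h; rewrite /= -!compmA tensm_l tensm_r.
Defined.

Definition hmap_post (X Y Z : V) (f : Hom Y Z) : SMap (hmap X Y) (hmap X Z) :=
  exist (@is_simplicial (hmap X Y) (hmap X Z)) (fun n h => f ∘ h) (fun m n a h => compmA _ _ _).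

Definition sing_hmap (X Y : V) : SMap (sing (ihom X Y)) (hmap X Y).
Proof.
exists (fun n (h : sing (ihom X Y) n) => uncurry h : hmap X Y n).
by move=> m n a h; rewrite /= uncurry_nat.
Defined.

Lemma sing_hmap_iso (X Y : V) : is_iso (sing_hmap X Y : Hom (_ : sSets) _).
Proof.
apply: (@smap_iso (sing (ihom X Y)) (hmap X Y) (sing_hmap X Y) (fun n h => curry h)) => n x /=.
  exact: uncurryK.
exact: curryK.
Qed.

Lemma Kan_WE_Map_pre (X Y Z : V) (f : Hom X Y) :
  Kan_WE (Map_pre (ssm_maps V) Z f) <-> Kan_WE (hmap_pre Z f : Hom (_ : sSets) _).
Proof.
apply: iff_trans (Kan_WE_sing (ihom_pre Z f)) _.
apply: (Kan_WE_square (Kan_WE_iso (sing_hmap_iso Y Z)) (Kan_WE_iso (sing_hmap_iso X Z))).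
by apply: smap_ext => n h /=; rewrite uncurry_pre.
Qed.

Lemma Kan_WE_hmap_post (X Y Z : V) (f : Hom Y Z) :
  Kan_WE (sing_map (ihom_post X f) : Hom (_ : sSets) _)
  <-> Kan_WE (hmap_post X f : Hom (_ : sSets) _).
Proof.
apply: (Kan_WE_square (Kan_WE_iso (sing_hmap_iso X Y)) (Kan_WE_iso (sing_hmap_iso X Z))).
by apply: smap_ext => n h /=; rewrite uncurry_post.
Qed.

Lemma ihom_post_lifts (A B X Y Z : V) (i : Hom A B) (p : Hom Y Z) :
  lifts (i ⊗m idm X) p -> lifts i (ihom_post X p).
Proof.
move=> l u v e; have [|h [h1 h2]] := l (uncurry u) (uncurry v).
  by rewrite -uncurry_nat e uncurry_post.
exists (curry h); split; first by rewrite -curry_nat h1 uncurryK.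
by rewrite -curry_post h2 uncurryK.
Qed.

Lemma ihom_post_TrivFib (X Y Z : V) (p : Hom Y Z) :
  cofibrant M X -> TrivFib M p -> TrivFib M (ihom_post X p).
Proof.
move=> cX tp; apply: (TrivFib_rlp hM) => A B i ci; apply: ihom_post_lifts.
by apply: (mc_lift_TrivFib hM) tp; exact: Cof_tens.
Qed.

Lemma ihom_fibrant (X Y : V) : cofibrant M X -> fibrant M Y -> fibrant M (ihom X Y).
Proof.
move=> cX fY; apply: (fibrantI hM) => A B i a ti.
have [b hb] := fibrant_ext hM (uncurry a) fY (TrivCof_tens hM hmon ti cX).
by exists (curry b); rewrite -curry_nat hb uncurryK.
Qed.

(** The pushout-product property applied to the map from [R] to a terminal object; the conditions
    over the terminal object hold automatically. *)
Lemma ihom_pre_TrivFib (X Y R : V) (f : Hom X Y) :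
  TrivCof M f -> fibrant M R -> TrivFib M (ihom_pre R f).
Proof.
move=> [cf wf] fR; apply: (TrivFib_rlp hM) => A B i ci u v e.
have [T tT] := complete_terminal (mc_complete hM); have [p _] := terminal_ex R tT.
have [w _] := terminal_ex (B ⊗ Y) tT.
have [||||h [h1 h2 _]] := @pushout_product_lift V M hM hmon _ _ _ _ _ _ i f p
  (uncurry u) (uncurry v) w ci cf (fR T p tT).
- by right; left.
- by rewrite -uncurry_pre -e uncurry_nat.
- exact: terminal_eq.
- exact: terminal_eq.
exists (curry h); split; first by rewrite -curry_nat h1 uncurryK.
by apply: uncurry_inj; rewrite uncurry_pre curryK.
Qed.

Lemma hmap_pre_comp (X Y Z R : V) (f : Hom X Y) (g : Hom Y Z) :
  (hmap_pre R (g ∘ f) : @Hom sSets _ _) = (hmap_pre R f : @Hom sSets _ _) ∘ hmap_pre R g.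
Proof. by apply: smap_ext => n h /=; rewrite tens_compr compmA. Qed.

Lemma hmap_post_comp (X Y Z R : V) (f : Hom X Y) (g : Hom Y Z) :
  (hmap_post R (g ∘ f) : @Hom sSets _ _) = (hmap_post R g : @Hom sSets _ _) ∘ hmap_post R f.
Proof. by apply: smap_ext => n h /=; rewrite compmA. Qed.

Definition Kan_pre (R : V) : MorClass V := fun X Y f => Kan_WE (hmap_pre R f : @Hom sSets _ _).

Section Fibrant.
Variable R : V.

Lemma Kan_pre_comp X Y Z (f : Hom X Y) (g : Hom Y Z) :
  Kan_pre R f -> Kan_pre R g -> Kan_pre R (g ∘ f).
Proof. by rewrite /Kan_pre hmap_pre_comp => wf wg; exact: Kan_WE_comp. Qed.

Lemma Kan_pre_left X Y Z (f : Hom X Y) (g : Hom Y Z) :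
  Kan_pre R g -> Kan_pre R (g ∘ f) -> Kan_pre R f.
Proof. by rewrite /Kan_pre hmap_pre_comp => wf wg; exact: Kan_WE_right wf wg. Qed.

Lemma Kan_pre_right X Y Z (f : Hom X Y) (g : Hom Y Z) :
  Kan_pre R f -> Kan_pre R (g ∘ f) -> Kan_pre R g.
Proof. by rewrite /Kan_pre hmap_pre_comp => wf wg; exact: Kan_WE_left wf wg. Qed.

Lemma Kan_pre_iso X Y (f : Hom X Y) : is_iso f -> Kan_pre R f.
Proof.
move=> [g [gf fg]]; apply: Kan_WE_iso; exists (hmap_pre R g).
by split; rewrite -hmap_pre_comp ?gf ?fg; apply: smap_ext => n h /=; rewrite tensm1 compm1.
Qed.

(** By Ken Brown's lemma [f] may be taken to be a trivial cofibration, and then precomposition is a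
    trivial fibration of internal homs. *)
Lemma Kan_pre_WE X Y (f : Hom X Y) :
  fibrant M R -> cofibrant M X -> cofibrant M Y -> WE M f -> Kan_pre R f.
Proof.
move=> fR; apply: (Ken_Brown_cofibrant hM (P := Kan_pre R)).
- by move=> Z; exact: Kan_pre_iso (iso_id Z).
- exact: Kan_pre_comp.
- exact: Kan_pre_right.
move=> {}X {}Y {}f cX cY tf; apply/Kan_WE_Map_pre/Kan_WE_sing; apply: sing_TrivFib.
exact: ihom_pre_TrivFib.
Qed.
End Fibrant.

Lemma hmap_post_WE (X Y Z : V) (f : Hom Y Z) :
  cofibrant M X -> fibrant M Y -> fibrant M Z -> WE M f ->
  Kan_WE (hmap_post X f : @Hom sSets _ _).
Proof.
move=> cX; pose P Y Z (f : Hom Y Z) := Kan_WE (hmap_post X f : @Hom sSets _ _).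
apply: (Ken_Brown_fibrant hM (P := P)); rewrite /P.
- move=> T; apply: Kan_WE_iso; rewrite (_ : (hmap_post X _ : @Hom sSets _ _) = idm _).
    exact: iso_id.
  by apply: smap_ext => n h /=; rewrite comp1m.
- by move=> A B C g h wg wh; rewrite hmap_post_comp; exact: Kan_WE_comp.
- by move=> A B C g h wg wh; rewrite hmap_post_comp in wh; exact: Kan_WE_left wg wh.
move=> A B g cA cB tg; apply/Kan_WE_hmap_post; apply: sing_TrivFib; exact: ihom_post_TrivFib.
Qed.

Lemma hmap_pre_post (X Y Z W : V) (f : Hom X Y) (g : Hom Z W) :
  (hmap_post X g : @Hom sSets _ _) ∘ hmap_pre Z f
  = (hmap_pre W f : @Hom sSets _ _) ∘ hmap_post Y g.
Proof. by apply: smap_ext => n h /=; rewrite compmA. Qed.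

Lemma Kan_pre_target (X Y Z W : V) (f : Hom X Y) (g : Hom Z W) :
  cofibrant M X -> cofibrant M Y -> fibrant M Z -> fibrant M W -> WE M g ->
  (Kan_pre Z f <-> Kan_pre W f).
Proof.
move=> cX cY fZ fW wg; apply: (Kan_WE_square _ _ (hmap_pre_post f g)); exact: hmap_post_WE.
Qed.

Lemma derived_pre_isoP (X Y Z R : V) (f : Hom X Y) (r : Hom Z R) :
  derived_pre_iso M (ssm_maps V) f Z -> fibrant_replacement M r -> derived_class M (Kan_pre R) f.
Proof. by move=> h hr QX QY f' rf; apply/Kan_WE_Map_pre; exact: h rf hr. Qed.

Section Local.
Variable S : MorClass V.
Local Notation equiv := (local_equivalence M (ssm_maps V) S).

(** Local equivalences are an intersection of derived classes, from which they inherit composition,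
    cancellation and weak equivalences. *)
Lemma local_equivalenceP (X Y : V) (f : Hom X Y) : equiv f <->
  forall Z, local_object M (ssm_maps V) S Z -> forall R (r : Hom Z R), fibrant_replacement M r ->
    derived_class M (Kan_pre R) f.
Proof.
split=> h Z lZ; first by move=> R r hr; exact: derived_pre_isoP (h Z lZ) hr.
by move=> QX QY R f' r rf hr; apply/Kan_WE_Map_pre; exact: h lZ _ _ hr _ _ _ rf.
Qed.

Lemma local_equivalence_comp X Y Z (f : Hom X Y) (g : Hom Y Z) :
  equiv f -> equiv g -> equiv (g ∘ f).
Proof.
move=> /local_equivalenceP hf /local_equivalenceP hg; apply/local_equivalenceP => T lT R r hr.
apply: (derived_comp hM (@Kan_pre_comp R) (@Kan_pre_left R) (@Kan_pre_right R)).
- by move=> *; apply: Kan_pre_WE => //; exact: hr.1.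
- exact: hf hr.
- exact: hg hr.
Qed.

Lemma local_equivalence_left X Y Z (f : Hom X Y) (g : Hom Y Z) :
  equiv g -> equiv (g ∘ f) -> equiv f.
Proof.
move=> /local_equivalenceP hf /local_equivalenceP hg; apply/local_equivalenceP => T lT R r hr.
apply: (derived_left hM (@Kan_pre_comp R) (@Kan_pre_left R) (@Kan_pre_right R)).
- by move=> *; apply: Kan_pre_WE => //; exact: hr.1.
- exact: hf hr.
- exact: hg hr.
Qed.

Lemma local_equivalence_right X Y Z (f : Hom X Y) (g : Hom Y Z) :
  equiv f -> equiv (g ∘ f) -> equiv g.
Proof.
move=> /local_equivalenceP hf /local_equivalenceP hg; apply/local_equivalenceP => T lT R r hr.
apply: (derived_right hM (@Kan_pre_comp R) (@Kan_pre_left R) (@Kan_pre_right R)).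
- by move=> *; apply: Kan_pre_WE => //; exact: hr.1.
- exact: hf hr.
- exact: hg hr.
Qed.

Lemma local_equivalence_WE X Y (f : Hom X Y) : WE M f -> equiv f.
Proof.
move=> wf; apply/local_equivalenceP => T lT R r hr; apply: (derived_WE hM) => //.
by move=> *; apply: Kan_pre_WE => //; exact: hr.1.
Qed.

Lemma local_equivalence_base X Y (f : Hom X Y) : S f -> equiv f.
Proof. by move=> sf Z lZ; exact: lZ. Qed.
End Local.
End MappingSpaces.

(** * Modules over a monoid *)

Section LeftCurry.
Variable V : ClosedSymMonCat.

(** Currying in the left factor, obtained from the given one through the braiding; evaluations of
    cotensors and cofree modules have their parameter on the left. *)
Definition lcurry (X Y Z : V) (f : Hom (Y ⊗ X) Z) : Hom X (ihom Y Z) := curry (f ∘ braid X Y).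
Definition lun (X Y Z : V) (k : Hom X (ihom Y Z)) : Hom (Y ⊗ X) Z := uncurry k ∘ braid Y X.

Lemma lcurryK (X Y Z : V) (f : Hom (Y ⊗ X) Z) : lun (lcurry f) = f.
Proof. by rewrite /lun curryK -compmA braidK compm1. Qed.

Lemma lunK (X Y Z : V) (k : Hom X (ihom Y Z)) : lcurry (lun k) = k.
Proof. by rewrite /lcurry /lun -compmA braidK compm1 uncurryK. Qed.

Lemma lun_inj (X Y Z : V) (f g : Hom X (ihom Y Z)) : lun f = lun g -> f = g.
Proof. by move=> e; rewrite -(lunK f) e lunK. Qed.

Lemma lun_nat (X X' Y Z : V) (k : Hom X (ihom Y Z)) (a : Hom X' X) :
  lun (k ∘ a) = lun k ∘ (idm Y ⊗m a).
Proof. by rewrite /lun uncurry_nat -compmA -braid_nat compmA. Qed.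

Lemma lun_id (X Y Z : V) (k : Hom X (ihom Y Z)) : lun k = lun (idm (ihom Y Z)) ∘ (idm Y ⊗m k).
Proof. by rewrite -lun_nat comp1m. Qed.

Lemma lun_post (W X Y Z : V) (f : Hom Y Z) (h : Hom W (ihom X Y)) :
  lun (ihom_post X f ∘ h) = f ∘ lun h.
Proof. by rewrite /lun uncurry_post compmA. Qed.

Lemma lun_pre (W X Y Z : V) (f : Hom X Y) (h : Hom W (ihom Y Z)) :
  lun (ihom_pre Z f ∘ h) = lun h ∘ (f ⊗m idm W).
Proof. by rewrite /lun uncurry_pre -!compmA braid_nat. Qed.
End LeftCurry.

Section EModules.
Variables (V : ClosedSymMonCat) (E : Monoid V).
Local Notation e := (mon_ob E).

Definition eta (X : V) : Hom X (e ⊗ X) := (mon_one E ⊗m idm X) ∘ lunitV X.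

Lemma eta_nat (X Y : V) (f : Hom X Y) : eta Y ∘ f = (idm e ⊗m f) ∘ eta X.
Proof. by rewrite /eta -compmA lunitV_nat [LHS]compmA [RHS]compmA tensm_l tensm_r. Qed.

Lemma eta_act (W : LModule E) : lmod_act W ∘ eta _ = idm _.
Proof. by rewrite /eta [LHS]compmA lmod_unit lunitVK. Qed.

Lemma free_act_eta (X : V) : lmod_act (free_lmod E X) ∘ (idm e ⊗m eta X) = idm _.
Proof.
rewrite /= /eta tens_compr; lassoc; rewrite (rwc2 _ (assocV_nat _ _ _)); lassoc.
rewrite -tens_compl mon_runit -triangle (rwc _ (assocVK _ _ _)) compm1 -tens_compr lunitVK.
exact: tensm1.
Qed.

Lemma left_swap_unit (X Y : V) : left_swap X unitI Y ∘ (idm X ⊗m lunitV Y) = lunitV (X ⊗ Y).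
Proof.
apply: (iso_epi (lunit_iso _)); rewrite lunitK -left_swap_I [LHS]compmA.
by rewrite (rwc _ (esym (tens_compr _ _ _))) lunitK tensm1 compm1 left_swapK.
Qed.

Lemma left_swap_eta (X Y : V) : left_swap X e Y ∘ (idm X ⊗m eta Y) = eta (X ⊗ Y).
Proof.
rewrite /eta tens_compr; lassoc; rewrite left_swap_nat -[LHS]compmA left_swap_unit.
by rewrite tensm1.
Qed.

Lemma free_ext (X : V) (W : LModule E) (f g : @Hom (lmod_cat E) (free_lmod E X) W) :
  sval f ∘ eta X = sval g ∘ eta X -> f = g.
Proof.
move=> h; apply: sig_ext; rewrite -[LHS]compm1 -[RHS]compm1 -(free_act_eta X) [LHS]compmA
  [RHS]compmA.
by rewrite (svalP f) (svalP g) -[LHS]compmA -[RHS]compmA -!tens_compr h.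
Qed.

Lemma free_ex (X : V) (W : LModule E) (x : Hom X (lmod_ob W)) :
  exists f : @Hom (lmod_cat E) (free_lmod E X) W, sval f ∘ eta X = x.
Proof.
have h : is_lmod_map (X := free_lmod E X) (Y := W) (lmod_act W ∘ (idm _ ⊗m x)).
  rewrite /is_lmod_map /= tens_compr; lassoc.
  rewrite -[X in X ∘ assocV _ _ _]compmA tensm_r -tensm_l [X in X ∘ assocV _ _ _]compmA.
  rewrite lmod_assoc -tensm1 -[X in X ∘ assocV _ _ _]compmA assoc_nat; lassoc.
  by rewrite -[LHS]compmA assocVK compm1.
by exists (exist _ _ h); rewrite /= -compmA -eta_nat compmA eta_act comp1m.
Qed.

(** The cotensor [X^L]; its action is characterised by the evaluation [L ⊗ X^L -> X]
    being linear. *)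
Definition coten_act (L : V) (W : LModule E) : Hom (e ⊗ ihom L (lmod_ob W)) (ihom L (lmod_ob W)) :=
  lcurry (lmod_act W ∘ (idm e ⊗m lun (idm _)) ∘ left_swap L e _).

Lemma coten_ev (L : V) (W : LModule E) :
  lun (idm _) ∘ (idm L ⊗m coten_act L W)
  = lmod_act W ∘ (idm e ⊗m lun (idm _)) ∘ left_swap L e _.
Proof. by rewrite -lun_nat comp1m lcurryK. Qed.

Lemma left_swap_tens_assoc (L X : V) :
  (idm e ⊗m left_swap L e X) ∘ left_swap L e (e ⊗ X) ∘ (idm L ⊗m assoc e e X)
  = assoc e e (L ⊗ X) ∘ left_swap L (e ⊗ e) X.
Proof.
by rewrite left_swap_tens -[LHS]compmA -tens_compr assocK tensm1 compm1.
Qed.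

Lemma tensm_lr (X X' Y Y' : V) (f : Hom X X') (g : Hom Y Y') :
  (f ⊗m idm _) ∘ (idm _ ⊗m g) = (idm _ ⊗m g) ∘ (f ⊗m idm _).
Proof. by rewrite tensm_l tensm_r. Qed.

Definition coten (L : V) (W : LModule E) : LModule E.
Proof.
refine {| lmod_ob := ihom L (lmod_ob W); lmod_act := coten_act L W |}; apply: lun_inj.
- set ev := lun (idm (ihom L (lmod_ob W))); have evE := coten_ev L W; rewrite -/ev in evE.
  have -> : lun (coten_act L W ∘ (idm e ⊗m coten_act L W) ∘ assoc e e _)
    = lmod_act W ∘ (idm e ⊗m lmod_act W) ∘ (idm e ⊗m (idm e ⊗m ev))
      ∘ ((idm e ⊗m left_swap L e _) ∘ left_swap L e _ ∘ (idm L ⊗m assoc e e _)).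
    rewrite lun_id -/ev; tcompr; lassoc; rewrite evE (rwc2 _ (left_swap_nat _ _ _)).
    lassoc; rewrite (rwc _ (esym (tens_compr _ _ _))) -/ev evE.
    by tcompr; lassoc.
  rewrite left_swap_tens_assoc; lassoc; rewrite (rwc2 _ (esym (assoc_nat _ _ _))); lassoc.
  rewrite -lmod_assoc tensm1 (rwc2 _ (tensm_lr _ _)); lassoc.
  rewrite lun_id -/ev; tcompr; lassoc; rewrite evE -[LHS]compmA left_swap_nat; lassoc.
  by rewrite tensm1.
- rewrite lun_nat lcurryK -[LHS]compmA left_swap_nat; lassoc.
  rewrite tensm1 (rwc2 _ (esym (tensm_lr _ _))); lassoc; rewrite lmod_unit lunit_nat.
  rewrite -[LHS]compmA (_ : lunit _ ∘ _ = idm L ⊗m lunit _); last first.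
    by rewrite -left_swap_I -[LHS]compmA left_swapK compm1.
  by rewrite -lun_id.
Defined.

Lemma is_lmod_map_coten (L : V) (N W : LModule E) (k : Hom (lmod_ob N) (ihom L (lmod_ob W))) :
  is_lmod_map (X := N) (Y := coten L W) k <-> lmod_linear (X := N) (X' := W) (lun k).
Proof.
have e2 : lun (coten_act L W ∘ (idm _ ⊗m k)) = lmod_act W ∘ (idm _ ⊗m lun k) ∘ left_swap L _ _.
  rewrite lun_nat lcurryK -[LHS]compmA left_swap_nat; lassoc.
  by rewrite -[X in X ∘ _]compmA -tens_compr -lun_id.
rewrite /is_lmod_map /lmod_linear -e2 -lun_nat; split=> [->//|]; exact: lun_inj.
Qed.

(** The forgetful functor creates pullbacks: the action is induced on the underlying pullback, and
    its laws hold because they hold after both projections. *)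
Lemma lmod_pullback (X Y Z : LModule E) (f : @Hom (lmod_cat E) X Z) (g : @Hom (lmod_cat E) Y Z) :
  complete V -> exists (F : LModule E) (u : @Hom (lmod_cat E) F X) (v : @Hom (lmod_cat E) F Y),
    is_pullback (sval f : Hom (lmod_ob X) (lmod_ob Z)) (sval g : Hom (lmod_ob Y) (lmod_ob Z))
      (sval u) (sval v).
Proof.
move=> cV; have [P [u [v pb]]] := complete_pullback (sval f : Hom (lmod_ob X) _) (sval g : Hom
  (lmod_ob Y) _) cV.
have [uv up] := pb.
have uniq T (a b : Hom T P) : u ∘ a = u ∘ b -> v ∘ a = v ∘ b -> a = b.
  move=> e1 e2; have [|h [_ hu]] := up T (u ∘ a) (v ∘ a); first by rewrite !compmA uv.
  by rewrite -(hu a) // (hu b).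
have [|a [[a1 a2] _]] := up _ (lmod_act X ∘ (idm e ⊗m u)) (lmod_act Y ∘ (idm e ⊗m v)).
  rewrite !compmA (svalP f : sval f ∘ _ = _) (svalP g : sval g ∘ _ = _).
  by rewrite -!compmA -!tens_compr uv.
have laws (T : LModule E) (w : Hom P (lmod_ob T)) : w ∘ a = lmod_act T ∘ (idm e ⊗m w) ->
    w ∘ (a ∘ (mon_mul E ⊗m idm _)) = w ∘ (a ∘ (idm _ ⊗m a) ∘ assoc _ _ _) /\
    w ∘ (a ∘ (mon_one E ⊗m idm _)) = w ∘ lunit _.
  move=> wa; split; lassoc; rewrite wa.
    rewrite -[LHS]compmA tensm_r -tensm_l [LHS]compmA lmod_assoc.
    rewrite (rwc _ (esym (tens_compr _ _ _))) wa; tcompr; lassoc.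
    by rewrite -[LHS]compmA -tensm1 assoc_nat; lassoc.
  by rewrite -[LHS]compmA tensm_r -tensm_l [LHS]compmA lmod_unit lunit_nat.
have [u1 u2] := laws X u a1; have [v1 v2] := laws Y v a2.
exists {| lmod_ob := P; lmod_act := a; lmod_assoc := uniq _ _ _ u1 v1;
  lmod_unit := uniq _ _ _ u2 v2 |}.
by exists (exist _ u a1), (exist _ v a2).
Qed.

(** The cofree module [Hom(E, R)], with [ev(x, a.phi) = ev(xa, phi)]. *)
Definition cofree_act (R : V) : Hom (e ⊗ ihom e R) (ihom e R) :=
  lcurry (lun (idm _) ∘ (mon_mul E ⊗m idm _) ∘ assocV e e (ihom e R)).

Lemma pentagonV (X Y Z W : V) : (assocV X Y Z ⊗m idm W) ∘ assocV X (Y ⊗ Z) W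
  = assocV (X ⊗ Y) Z W ∘ assocV X Y (Z ⊗ W) ∘ (idm X ⊗m assoc Y Z W).
Proof.
apply: (iso_epi (assoc_iso X (Y ⊗ Z) W)).
apply: (iso_epi (tensm_iso (assoc_iso X Y Z) (iso_id W))).
rewrite (rwc _ (assocK _ _ _)) compm1 -tens_compl assocK tensm1.
by rewrite (rwc32 _ (pentagon X Y Z W)) (rwc _ (assocK _ _ _)) compm1 assocK.
Qed.

Lemma assocV_triangle (X Y : V) : (runit X ⊗m idm Y) ∘ assocV X unitI Y = idm X ⊗m lunit Y.
Proof. by rewrite -triangle -[LHS]compmA assocVK compm1. Qed.

Lemma cofree_nat (T R : V) (k : Hom T (ihom e R)) :
  lun (cofree_act R ∘ (idm e ⊗m k)) = lun k ∘ (mon_mul E ⊗m idm T) ∘ assocV e e T.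
Proof.
rewrite lun_nat lcurryK -[LHS]compmA assocV_nat tensm1; lassoc.
by rewrite (rwc2 _ (tensm_lr _ _)); lassoc; rewrite -lun_id.
Qed.

Definition cofree (R : V) : LModule E.
Proof.
refine {| lmod_ob := ihom e R; lmod_act := cofree_act R |}; apply: lun_inj.
- rewrite lun_nat lcurryK -[LHS]compmA assocV_nat; lassoc.
  rewrite (rwc _ (esym (tens_compl _ _ _))).
  have -> : mon_mul E ∘ (idm e ⊗m mon_mul E) = mon_mul E ∘ (mon_mul E ⊗m idm e) ∘ assocV _ _ _.
    by rewrite mon_assoc -[RHS]compmA assocVK compm1.
  rewrite lun_nat cofree_nat lcurryK; tcompl; lassoc.
  rewrite -[LHS]compmA pentagonV; lassoc; congr (_ ∘ _ ∘ _).
  by rewrite -tensm1 (rwc2 _ (assocV_nat _ _ _)); lassoc.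
- rewrite lun_nat lcurryK -[LHS]compmA assocV_nat; lassoc.
  by rewrite (rwc _ (esym (tens_compl _ _ _))) mon_runit -[LHS]compmA assocV_triangle -lun_id.
Defined.

Definition eps (R : V) : Hom (ihom e R) R := lun (idm _) ∘ eta _.

Lemma eps_act (R : V) : eps R ∘ cofree_act R = lun (idm _).
Proof.
rewrite /eps -[LHS]compmA eta_nat [LHS]compmA -lun_nat comp1m lcurryK /eta; lassoc.
rewrite -tensm1 (rwc2 _ (assocV_nat _ _ _)); lassoc.
rewrite (rwc _ (esym (tens_compl _ _ _))) mon_lunit.
by rewrite -lunit_tens -!compmA (compmA (assoc _ _ _)) assocVK comp1m lunitVK compm1.
Qed.

Lemma eps_comp (T R : V) (k : Hom T (ihom e R)) : eps R ∘ k = lun k ∘ eta T.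
Proof. by rewrite /eps -[LHS]compmA eta_nat [LHS]compmA -lun_id. Qed.

Lemma cofree_lun (N : LModule E) (R : V) (f : @Hom (lmod_cat E) N (cofree R)) :
  lun (sval f) = eps R ∘ sval f ∘ lmod_act N.
Proof. by rewrite -[RHS]compmA (svalP f : sval f ∘ _ = _) [RHS]compmA eps_act -lun_id. Qed.

Lemma cofree_ext (N : LModule E) (R : V) (f g : @Hom (lmod_cat E) N (cofree R)) :
  eps R ∘ sval f = eps R ∘ sval g -> f = g.
Proof. by move=> h; apply: sig_ext; apply: lun_inj; rewrite !cofree_lun h. Qed.

Lemma cofree_ex (N : LModule E) (R : V) (x : Hom (lmod_ob N) R) :
  exists f : @Hom (lmod_cat E) N (cofree R), eps R ∘ sval f = x.
Proof.
have h : is_lmod_map (X := N) (Y := cofree R) (lcurry (x ∘ lmod_act N)).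
  apply: lun_inj; rewrite cofree_nat lun_nat lcurryK -[LHS]compmA.
  rewrite -[X in X ∘ assocV _ _ _]compmA lmod_assoc; lassoc.
  by rewrite -[RHS]compmA assocVK compm1.
by exists (exist _ _ h); rewrite /= eps_comp lcurryK -[LHS]compmA eta_act compm1.
Qed.

Lemma cofree_map_ex (R R' : V) (p : Hom R R') :
  exists f : @Hom (lmod_cat E) (cofree R) (cofree R'), sval f = ihom_post e p.
Proof.
have h : is_lmod_map (X := cofree R) (Y := cofree R') (ihom_post e p).
  apply: lun_inj; rewrite cofree_nat lun_post lcurryK -[ihom_post e p]compm1 lun_post.
  by lassoc.
by exists (exist _ _ h).
Qed.

(** With this module structure on [K ⊗ N] a map linear in [N] is just a map of modules, so the
    universal properties of free and cofree modules extend to maps with a parameter. *)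
Definition tens_lmod (K : V) (N : LModule E) : LModule E.
Proof.
refine {| lmod_ob := K ⊗ lmod_ob N;
          lmod_act := (idm K ⊗m lmod_act N) ∘ left_swap e K (lmod_ob N) |}.
- rewrite -tensm1 -[LHS]compmA left_swap_nat [LHS]compmA -tens_compr lmod_assoc.
  tcompr; lassoc; rewrite (rwc2 _ (left_swap_nat _ _ _)); lassoc.
  rewrite (rwc2 _ (left_swap_tens_inv _ _ _ _)); lassoc.
  by rewrite (rwc _ (assocK _ _ _)) compm1.
- rewrite -tensm1 -[LHS]compmA left_swap_nat [LHS]compmA -tens_compr lmod_unit.
  exact: left_swap_I.
Defined.

Lemma lmod_linearP (K : V) (N W : LModule E) (h : Hom (K ⊗ lmod_ob N) (lmod_ob W)) :
  lmod_linear h <-> is_lmod_map (X := tens_lmod K N) (Y := W) h.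
Proof.
rewrite /lmod_linear /is_lmod_map /=; split=> q.
  by rewrite [LHS]compmA q -[LHS]compmA left_swapK compm1.
by rewrite -q -[RHS]compmA -[X in _ = _ ∘ X]compmA left_swapK compm1.
Qed.

Lemma linear_cofree_ext (N : LModule E) (K R : V) (h h' : Hom (K ⊗ lmod_ob N) (ihom e R)) :
  lmod_linear (X := N) (X' := cofree R) h -> lmod_linear (X := N) (X' := cofree R) h' ->
  eps R ∘ h = eps R ∘ h' -> h = h'.
Proof.
move=> /lmod_linearP l /lmod_linearP l' q.
exact: (congr1 sval (@cofree_ext (tens_lmod K N) R (exist _ h l) (exist _ h' l') q)).
Qed.

Lemma linear_cofree_ex (N : LModule E) (K R : V) (k : Hom (K ⊗ lmod_ob N) R) :
  exists2 h, lmod_linear (X := N) (X' := cofree R) h & eps R ∘ h = k.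
Proof.
have [f fk] := @cofree_ex (tens_lmod K N) R k.
by exists (sval f) => //; apply/lmod_linearP; exact: (svalP f).
Qed.

(** The unique extension of [k] to a map linear in the free module; restriction along the unit [eta]
    is the inverse operation. *)
Definition linear_free (K X : V) (W : LModule E) (k : Hom (K ⊗ X) (lmod_ob W)) :
  Hom (K ⊗ (e ⊗ X)) (lmod_ob W) := lmod_act W ∘ (idm e ⊗m k) ∘ left_swap K e X.

Lemma linear_freeP (K X : V) (W : LModule E) (k : Hom (K ⊗ X) (lmod_ob W)) :
  lmod_linear (X := free_lmod E X) (X' := W) (linear_free k).
Proof.
rewrite /lmod_linear /linear_free; tcompr; lassoc.
rewrite (rwc2 _ (left_swap_tens _ _ _ _)); lassoc.
rewrite (rwc2 _ (esym (assoc_nat _ _ _))) tensm1; lassoc; rewrite -lmod_assoc.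
rewrite (rwc2 _ (tensm_lr _ _)); lassoc; rewrite /= tens_compr; lassoc.
by rewrite (rwc2 _ (left_swap_nat _ _ _)) tensm1; lassoc.
Qed.

Lemma linear_free_eta (K X : V) (W : LModule E) (k : Hom (K ⊗ X) (lmod_ob W)) :
  linear_free k ∘ (idm K ⊗m eta X) = k.
Proof.
by rewrite -[LHS]compmA left_swap_eta -[LHS]compmA -eta_nat [LHS]compmA eta_act comp1m.
Qed.

Lemma linear_freeK (K X : V) (W : LModule E) (h : Hom (K ⊗ (e ⊗ X)) (lmod_ob W)) :
  lmod_linear (X := free_lmod E X) (X' := W) h -> linear_free (h ∘ (idm K ⊗m eta X)) = h.
Proof.
move=> hl; rewrite /linear_free tens_compr; lassoc; rewrite (rwc2 _ (esym (left_swap_nat _ _ _))).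
lassoc; rewrite -hl -[LHS]compmA -tens_compr free_act_eta; by rewrite tensm1 compm1.
Qed.
End EModules.

Section Equalizers.
Variables (C : Category) (X Y : C) (s t : Hom X Y).

Definition parallel_edge (i j : bool) : SmallSet := if i && ~~ j then bool else void.
Definition parallel_map (i j : bool) : parallel_edge i j ->
  Hom (if i then X else Y) (if j then X else Y) :=
  match i, j return parallel_edge i j -> Hom (if i then X else Y) (if j then X else Y) with
  | true, false => fun b => if b then s else t
  | true, true => fun a => match a with end
  | false, _ => fun a => match a with end
  end.
Definition parallel_diagram : Diagram C :=
  {| dvert := bool; dedge := parallel_edge; dob := fun i => if i then X else Y;
     dmap := parallel_map |}.

Lemma complete_equalizer : complete C -> exists (Q : C) (q : Hom Q X), s ∘ q = t ∘ q /\
  forall T (a : Hom T X), s ∘ a = t ∘ a -> exists! h : Hom T Q, q ∘ h = a.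
Proof.
move=> /(_ parallel_diagram)[Q [c [cc u]]].
have e1 := cc true false true; have e2 := cc true false false; rewrite /= in e1 e2.
exists Q, (c true); split; first by rewrite e1 e2.
move=> T a e.
pose w (i : dvert parallel_diagram) : Hom T (dob parallel_diagram i) :=
  match i return Hom T (if i then X else Y) with true => a | false => s ∘ a end.
have [|h [hw hu]] := u T w; first by case=> -[] //= [].
exists h; split; first exact: (hw true).
by move=> h' h'a; apply: hu => -[] //=; rewrite -e1 -compmA h'a.
Qed.
End Equalizers.

(** * Mapping spaces of modules *)

Section ModuleMaps.
Variables (V : SimplicialSymMonModelCat) (E : Monoid V).
Let M := ssm_model V.
Let hM := ssm_is_model V.
Let hmon := ssm_is_monoidal V.
Local Notation e := (mon_ob E).
Implicit Types N W : LModule E.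

(** The object of module maps, as the equalizer of the two ways of acting before and after a map,
    from [Hom(N, W)] to [Hom(E ⊗ N, W)]. *)
Lemma lmod_hom_ex N W : exists (H : V) (ev : Hom (H ⊗ lmod_ob N) (lmod_ob W)),
  lmod_linear ev /\ forall K (h : Hom (K ⊗ lmod_ob N) (lmod_ob W)), lmod_linear h ->
    exists! k : Hom K H, ev ∘ (k ⊗m idm _) = h.
Proof.
pose s := ihom_pre (lmod_ob W) (lmod_act N).
pose t := curry (lmod_act W ∘ (idm e ⊗m uncurry (idm (ihom (lmod_ob N) (lmod_ob W))))
  ∘ left_swap _ e _).
have eqP K (k : Hom K (ihom (lmod_ob N) (lmod_ob W))) : s ∘ k = t ∘ k <-> lmod_linear (uncurry k).
  rewrite /lmod_linear -uncurry_pre -/s.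
  have -> : lmod_act W ∘ (idm e ⊗m uncurry k) ∘ left_swap K e _ = uncurry (t ∘ k).
    rewrite uncurry_nat curryK -tensm1 -[RHS]compmA left_swap_nat [RHS]compmA.
    by rewrite -[in RHS](compmA (lmod_act W)) -tens_compr -uncurry_nat comp1m.
  by split=> [->//|]; exact: uncurry_inj.
have [H [q [sq up]]] := complete_equalizer s t (mc_complete hM).
exists H, (uncurry q); split; first exact/eqP.
move=> K h hl; have [|k [qk ku]] := up K (curry h); first by apply/eqP; rewrite curryK.
exists k; split; first by rewrite -uncurry_nat qk curryK.
by move=> k' ek; apply: ku; apply: uncurry_inj; rewrite uncurry_nat ek curryK.
Qed.

Lemma lmod_linear_post N W W' (p : @Hom (lmod_cat E) W W') K (h : Hom (K ⊗ lmod_ob N) (lmod_ob W)) :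
  lmod_linear h -> lmod_linear (X' := W') (sval p ∘ h).
Proof. by move=> /lmod_linearP lh; apply/lmod_linearP; exact: lmod_mapM (svalP p) lh. Qed.

Definition lmod_post N W W' (p : @Hom (lmod_cat E) W W') : SMap (lmod_Map N W) (lmod_Map N W').
Proof.
exists (fun n (h : lmod_Map N W n) =>
  exist _ (sval p ∘ sval h) (lmod_linear_post p (svalP h)) : lmod_Map N W' n).
by move=> m n a h; apply: sig_ext; rewrite /= compmA.
Defined.

(** The lifting form of cofibrancy for modules over the monoid. It is phrased without a model
    structure on them; the model structure lives on modules over the algebra and is carried over by
    the equivalence. *)
Definition lmod_projective N := forall (W W' : LModule E) (p : @Hom (lmod_cat E) W W')
  (b : @Hom (lmod_cat E) N W'), TrivFib M (sval p : Hom (lmod_ob W) (lmod_ob W')) ->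
  exists a : @Hom (lmod_cat E) N W, p ∘ a = b.

Lemma coten_post_ex L W W' (p : @Hom (lmod_cat E) W W') :
  exists f : @Hom (lmod_cat E) (coten L W) (coten L W'), sval f = ihom_post L (sval p).
Proof.
have h : is_lmod_map (X := coten L W) (Y := coten L W') (ihom_post L (sval p)).
  apply/is_lmod_map_coten; rewrite -[ihom_post _ _]compm1 lun_post; apply/lmod_linearP.
  apply: (lmod_mapM (Y := W) (svalP p)); apply/lmod_linearP.
  have /is_lmod_map_coten := lmod_map1 (coten L W); exact.
by exists (exist _ _ h).
Qed.

Lemma coten_pre_ex K L (f : Hom K L) W :
  exists g : @Hom (lmod_cat E) (coten L W) (coten K W), sval g = ihom_pre (lmod_ob W) f.
Proof.
have h : is_lmod_map (X := coten L W) (Y := coten K W) (ihom_pre (lmod_ob W) f).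
  apply/is_lmod_map_coten; rewrite -[ihom_pre _ _]compm1 lun_pre; apply: lmod_linear_l.
  have /is_lmod_map_coten := lmod_map1 (coten L W); exact.
by exists (exist _ _ h).
Qed.

(** A mapping-space form of the pushout-product property. By the cotensor adjunction it says that
    [N] lifts against the map from [W^L] to the fibre product of [W^K] and [W'^L] over [W'^K], which
    is a trivial fibration. *)
Lemma linear_lift N (W W' : LModule E) (p : @Hom (lmod_cat E) W W') K L (f : Hom K L)
    (u : Hom (K ⊗ lmod_ob N) (lmod_ob W)) (v : Hom (L ⊗ lmod_ob N) (lmod_ob W')) :
  lmod_projective N -> TrivFib M (sval p : Hom (lmod_ob W) (lmod_ob W')) -> Cof M f ->
  lmod_linear u -> lmod_linear v -> v ∘ (f ⊗m idm _) = sval p ∘ u ->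
  exists h : Hom (L ⊗ lmod_ob N) (lmod_ob W),
    [/\ lmod_linear h, h ∘ (f ⊗m idm _) = u & sval p ∘ h = v].
Proof.
move=> pN tp cf lu lv sq.
have [pK epK] := coten_post_ex K p; have [pL epL] := coten_post_ex L p.
have [fW efW] := coten_pre_ex f W; have [fW' efW'] := coten_pre_ex f W'.
have [F [a [b pb]]] := lmod_pullback pK fW' (mc_complete hM).
have [ab up] := pb.
have uniq T (h h' : Hom T (lmod_ob F)) :
    sval a ∘ h = sval a ∘ h' -> sval b ∘ h = sval b ∘ h' -> h = h'.
  move=> e1 e2; have [|k [_ ku]] := up T (sval a ∘ h) (sval b ∘ h); first by rewrite !compmA ab.
  by rewrite -(ku h) // (ku h').
have mapF (T : LModule E) (h : Hom (lmod_ob T) (lmod_ob F)) :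
    is_lmod_map (X := T) (Y := coten K W) (sval a ∘ h) ->
    is_lmod_map (X := T) (Y := coten L W') (sval b ∘ h) -> is_lmod_map h.
  move=> ha hb; apply: uniq.
    by rewrite [LHS]compmA ha [RHS]compmA (svalP a : sval a ∘ _ = _) tens_compr compmA.
  by rewrite [LHS]compmA hb [RHS]compmA (svalP b : sval b ∘ _ = _) tens_compr compmA.
have [|c [[c1 c2] _]] := up _ (sval fW) (sval pL).
  by rewrite epK efW' efW epL; apply: uncurry_inj; rewrite uncurry_post uncurry_pre
    -[ihom_pre _ _]compm1 -[ihom_post _ _]compm1 uncurry_pre uncurry_post compmA.
have cm : is_lmod_map (X := coten L W) (Y := F) c.
  by apply: mapF; rewrite ?c1 ?c2; [exact: (svalP fW) | exact: (svalP pL)].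
(* Only the underlying objects matter here, and for them this is the pushout-product axiom in the
   base category. *)
have tc : TrivFib M c.
  apply: (TrivFib_rlp hM) => A B i ci x y exy.
  have [||||h [h1 h2 h3]] := @pushout_product_lift V M hM hmon _ _ _ _ _ _ i f (sval p)
    (uncurry x) (uncurry (sval a ∘ y)) (uncurry (sval b ∘ y)) ci cf tp.1.
  - by right; right; exact: tp.2.
  - by rewrite -uncurry_pre -uncurry_nat -efW -c1 -[in LHS]compmA -exy !compmA.
  - by rewrite -uncurry_post -uncurry_nat -epL -c2 -[in LHS]compmA -exy !compmA.
  - by rewrite -uncurry_post -uncurry_pre -epK -efW' !compmA ab.
  exists (curry h); split; first by rewrite -curry_nat h1 uncurryK.
  apply: uniq; rewrite [LHS]compmA ?c1 ?c2 ?efW ?epL; apply: uncurry_inj.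
    by rewrite uncurry_pre curryK h2.
  by rewrite uncurry_post curryK h3.
pose u' : Hom (lmod_ob N) (ihom K (lmod_ob W)) := lcurry u.
pose v' : Hom (lmod_ob N) (ihom L (lmod_ob W')) := lcurry v.
have mu : is_lmod_map (X := N) (Y := coten K W) u' by apply/is_lmod_map_coten; rewrite lcurryK.
have mv : is_lmod_map (X := N) (Y := coten L W') v' by apply/is_lmod_map_coten; rewrite lcurryK.
have [|d [[d1 d2] _]] := up _ u' v'.
  by rewrite epK efW'; apply: lun_inj; rewrite lun_post lun_pre !lcurryK.
have dm : is_lmod_map (X := N) (Y := F) d by apply: mapF; rewrite ?d1 ?d2.
have [k ck] := pN (coten L W) F (exist _ c cm) (exist _ d dm) tc.
have ck' : c ∘ sval k = d by have := congr1 sval ck.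
exists (lun (sval k)); split.
- by apply/is_lmod_map_coten; exact: (svalP k).
- by rewrite -lun_pre -efW -c1 -[X in lun X]compmA ck' d1 lcurryK.
- by rewrite -lun_post -epL -c2 -[X in lun X]compmA ck' d2 lcurryK.
Qed.

Definition sing_lmod N W (H : V) (ev : Hom (H ⊗ lmod_ob N) (lmod_ob W)) (l : lmod_linear ev) :
  SMap (sing H) (lmod_Map N W).
Proof.
exists (fun n (k : sing H n) => exist _ (ev ∘ (k ⊗m idm _)) (lmod_linear_l k l) : lmod_Map N W n).
by move=> m n a h; apply: sig_ext; rewrite /= tens_compl compmA.
Defined.

Lemma sing_lmod_iso N W (H : V) (ev : Hom (H ⊗ lmod_ob N) (lmod_ob W)) (l : lmod_linear ev) :
  (forall K (h : Hom (K ⊗ lmod_ob N) (lmod_ob W)), lmod_linear h ->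
    exists! k : Hom K H, ev ∘ (k ⊗m idm _) = h) -> is_iso (sing_lmod l : @Hom sSets _ _).
Proof.
move=> up; have ex n (h : lmod_Map N W n) : exists k : sing H n, sval (sing_lmod l) n k = h.
  by have [k [hk _]] := up _ _ (svalP h); exists k; exact: sig_ext.
apply: (@smap_iso _ (lmod_Map N W) _ (fun n h => sval (cid (ex n h)))) => n x; last first.
  exact: (svalP (cid (ex n x))).
have [k [hk ku]] := up _ _ (svalP (sval (sing_lmod l) n x)).
apply: etrans (ku x erefl); apply/esym/ku.
exact: (congr1 sval (svalP (cid (ex n (sval (sing_lmod l) n x))))).
Qed.

(** Both mapping spaces are singular complexes of objects of module maps, and by [linear_lift] the
    map between these objects is a trivial fibration. *)
Lemma lmod_post_TrivFib N W W' (p : @Hom (lmod_cat E) W W') :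
  lmod_projective N -> TrivFib M (sval p : Hom (lmod_ob W) (lmod_ob W')) ->
  Kan_WE (lmod_post N p : @Hom sSets _ _).
Proof.
move=> pN tp; have [H [ev [l up]]] := lmod_hom_ex N W; have [H' [ev' [l' up']]] := lmod_hom_ex N W'.
have [q [eq uq]] := up' _ _ (lmod_linear_post p l).
have tq : TrivFib M q.
  apply: (TrivFib_rlp hM) => A B i ci u v sq.
  have [|h [lh h1 h2]] := linear_lift pN tp ci (lmod_linear_l u l) (lmod_linear_l v l').
    by rewrite -[LHS]compmA -tens_compl sq tens_compl [LHS]compmA eq compmA.
  have [k [ek ku]] := up _ _ lh; exists k; split.
    have [z [_ zu]] := up _ _ (lmod_linear_l u l); rewrite -(zu u) // -(zu (k ∘ i)) //.
    by rewrite tens_compl compmA ek.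
  have [z [_ zu]] := up' _ _ (lmod_linear_l v l'); rewrite -(zu v) // -(zu (q ∘ k)) //.
  by rewrite tens_compl compmA eq -compmA ek.
have sq : (lmod_post N p : @Hom sSets _ _) ∘ (sing_lmod l : @Hom sSets _ _)
    = (sing_lmod l' : @Hom sSets _ _) ∘ (sing_map q : @Hom sSets _ _).
  apply: smap_ext => n k; apply: sig_ext; rewrite /=.
  by rewrite compmA -eq -compmA -tens_compl.
apply: (proj1 (Kan_WE_square _ _ (esym sq)) (sing_TrivFib tq)); apply: Kan_WE_iso.
- exact: sing_lmod_iso.
- exact: sing_lmod_iso.
Qed.

Lemma lmod_post_comp N W W' W'' (p : @Hom (lmod_cat E) W W') (p' : @Hom (lmod_cat E) W' W'') :
  (lmod_post N (p' ∘ p) : @Hom sSets _ _) = (lmod_post N p' : @Hom sSets _ _) ∘ lmod_post N p.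
Proof. by apply: smap_ext => n h; apply: sig_ext; rewrite /= compmA. Qed.

Lemma lmod_post_id N W : (lmod_post N (idm (W : lmod_cat E)) : @Hom sSets _ _) = idm _.
Proof. by apply: smap_ext => n h; apply: sig_ext; rewrite /= comp1m. Qed.

Lemma lmod_pre_comp N N' N'' W (f : @Hom (lmod_cat E) N N') (g : @Hom (lmod_cat E) N' N'') :
  (lmod_Map_pre W (g ∘ f) : @Hom sSets _ _) = (lmod_Map_pre W f : @Hom sSets _ _) ∘ lmod_Map_pre
    W g.
Proof. by apply: smap_ext => n h; apply: sig_ext; rewrite /= tens_compr compmA. Qed.

Lemma lmod_pre_iso N N' W (f : @Hom (lmod_cat E) N N') :
  is_iso f -> is_iso (lmod_Map_pre W f : @Hom sSets _ _).
Proof.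
move=> [g [gf fg]]; exists (lmod_Map_pre W g); split; rewrite -lmod_pre_comp ?gf ?fg;
  by apply: smap_ext => n h; apply: sig_ext; rewrite /= tensm1 compm1.
Qed.

Lemma lmod_post_iso N W W' (f : @Hom (lmod_cat E) W W') :
  is_iso f -> is_iso (lmod_post N f : @Hom sSets _ _).
Proof.
move=> [g [gf fg]]; exists (lmod_post N g); split; rewrite -lmod_post_comp ?gf ?fg;
  exact: lmod_post_id.
Qed.

Lemma lmod_pre_post N N' W W' (f : @Hom (lmod_cat E) N N') (p : @Hom (lmod_cat E) W W') :
  (lmod_post N p : @Hom sSets _ _) ∘ lmod_Map_pre W f
  = (lmod_Map_pre W' f : @Hom sSets _ _) ∘ lmod_post N' p.
Proof. by apply: smap_ext => n h; apply: sig_ext; rewrite /= compmA. Qed.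

Definition free_hmap (X : V) W : SMap (lmod_Map (free_lmod E X) W) (hmap X (lmod_ob W)).
Proof.
exists (fun n (h : lmod_Map (free_lmod E X) W n) =>
  sval h ∘ (idm _ ⊗m eta E X) : hmap X (lmod_ob W) n).
by move=> m n a h; rewrite /= -[LHS]compmA -[RHS]compmA tensm_lr.
Defined.

Lemma free_hmap_iso (X : V) W : is_iso (free_hmap X W : @Hom sSets _ _).
Proof.
apply: (@smap_iso (lmod_Map (free_lmod E X) W) (hmap X (lmod_ob W)) (free_hmap X W)
  (fun n (k : hmap X (lmod_ob W) n) => exist _ (linear_free k) (linear_freeP k))) => n x.
  by apply: sig_ext; apply: linear_freeK; exact: (svalP x).
exact: linear_free_eta.
Qed.

Lemma free_hmap_nat (X Y : V) W (f : Hom X Y) :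
  (free_hmap X W : @Hom sSets _ _) ∘ lmod_Map_pre W (free_lmod_map E f)
  = (hmap_pre (lmod_ob W) f : @Hom sSets _ _) ∘ free_hmap Y W.
Proof. by apply: smap_ext => n h; rewrite /= -[LHS]compmA -[RHS]compmA -!tens_compr eta_nat. Qed.

Lemma Kan_WE_free (X Y : V) W (f : Hom X Y) :
  Kan_WE (lmod_Map_pre W (free_lmod_map E f) : @Hom sSets _ _) <-> Kan_pre (lmod_ob W) f.
Proof.
apply: (Kan_WE_square _ _ (free_hmap_nat W f)); apply: Kan_WE_iso; exact: free_hmap_iso.
Qed.

Definition cofree_hmap N (R : V) : SMap (lmod_Map N (cofree E R)) (hmap (lmod_ob N) R).
Proof.
exists (fun n (h : lmod_Map N (cofree E R) n) => eps E R ∘ sval h : hmap (lmod_ob N) R n).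
by move=> m n a h; rewrite /= compmA.
Defined.

Lemma cofree_hmap_iso N (R : V) : is_iso (cofree_hmap N R : @Hom sSets _ _).
Proof.
pose g n (k : hmap (lmod_ob N) R n) : lmod_Map N (cofree E R) n :=
  let h := cid2 (linear_cofree_ex k) in exist _ (s2val h) (s2valP h).
have gP n (k : hmap (lmod_ob N) R n) : eps E R ∘ sval (g n k) = k.
  exact: (s2valP' (cid2 (linear_cofree_ex k))).
apply: (@smap_iso (lmod_Map N (cofree E R)) (hmap (lmod_ob N) R) (cofree_hmap N R) g) => n x.
  apply: sig_ext; apply: (linear_cofree_ext (N := N)); [exact: (svalP (g _ _))
    | exact: (svalP x) |].
  exact: gP.
exact: gP.
Qed.

Lemma Kan_WE_cofree N N' (R : V) (f : @Hom (lmod_cat E) N N') :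
  Kan_WE (lmod_Map_pre (cofree E R) f : @Hom sSets _ _)
  <-> Kan_pre R (sval f : Hom (lmod_ob N) (lmod_ob N')).
Proof.
apply: (Kan_WE_square (Kan_WE_iso (cofree_hmap_iso N' R)) (Kan_WE_iso (cofree_hmap_iso N R))).
by apply: smap_ext => n h; rewrite /= compmA.
Qed.
End ModuleMaps.

(** * Localization of modules *)

Section ModelIso.
Variables (D : Category) (M : ModelData D) (hM : is_model_category M).

Lemma TrivFib_square (X Y X' Y' : D) (f : Hom X Y) (g : Hom X' Y') (a : Hom X X') (b : Hom Y Y') :
  is_iso a -> is_iso b -> b ∘ f = g ∘ a -> TrivFib M f <-> TrivFib M g.
Proof.
move=> [a' [aa aa']] [b' [bb bb']] h; split=> t.
  have -> : g = b ∘ f ∘ a' by rewrite h -compmA aa' compm1.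
  apply: (TrivFib_comp hM); first by apply: (TrivFib_iso hM); exists a.
  by apply: (TrivFib_comp hM t); apply: (TrivFib_iso hM); exists b'.
have -> : f = b' ∘ g ∘ a by rewrite -compmA -h compmA bb comp1m.
apply: (TrivFib_comp hM); first by apply: (TrivFib_iso hM); exists a'.
by apply: (TrivFib_comp hM t); apply: (TrivFib_iso hM); exists b.
Qed.

Lemma cofibrant_iso (X Y : D) (f : Hom X Y) : is_iso f -> cofibrant M X -> cofibrant M Y.
Proof. by move=> [g [_ fg]]; exact: (cofibrant_retract hM fg). Qed.

Lemma fibrant_iso (X Y : D) (f : Hom X Y) : is_iso f -> fibrant M X -> fibrant M Y.
Proof. by move=> [g [_ fg]]; exact: (fibrant_retract hM fg). Qed.

Lemma fibrant_terminal (X : D) : is_terminal X -> fibrant M X.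
Proof.
move=> tX; apply: (fibrantI hM) => A B i a _; have [b _] := terminal_ex B tX.
by exists b; exact: terminal_eq.
Qed.
End ModelIso.

Section UnitCofibrant.
Variable V : SimplicialSymMonModelCat.

(** The unit is isomorphic to the image of the point. The inclusion of the empty simplicial set goes
    to a cofibration, and by adjunction parallel maps out of the image of the empty set agree. *)
Lemma ssm_unit_cofibrant : cofibrant (ssm_model V) (unitI : V).
Proof.
have hM := ssm_is_model V; have [qc _] := ssm_Quillen V; pose adj := ssm_adj V.
have [g [g1 g2]] := smon_unit_iso (ssm_smon V).
apply: (cofibrant_iso hM (f := g)); first by exists (smon_unit (ssm_smon V)).
pose empty : sSets_mon := ssub (X := spoint) (P := fun _ _ => False) (fun m n a x h => h).
pose j : Hom empty unitI := ssub_incl (X := spoint) (P := fun _ _ => False) (fun m n a x h => h).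
have empty_ex (X : sSets_mon) : exists f : Hom empty X, True.
  have h : is_simplicial (X := empty) (Y := X) (fun n x =>
    match svalP x with end) by move=> m n a [].
  by exists (exist _ _ h).
have cj : Cof (ssm_model V) (fmap (ssm_i V) j).
  by apply: qc => n x y; exact: sig_ext.
apply: (cofibrantI hM) => X Y p b tp; have [u _] := empty_ex (ssm_r V X).
have [|h [_ ph]] := mc_lift_TrivFib hM cj tp (u := untransp adj u) (v := b); last by exists h.
rewrite -(transpK adj (b ∘ _)) -(transpK adj (p ∘ _)); congr untransp.
by apply: smap_ext => n [].
Qed.
End UnitCofibrant.

(** * Passage between modules over the algebra and over its enveloping monoid *)

Section Transport.
Variables (V : SimplicialSymMonModelCat) (O : Operad V unit) (A : Algebra O).
Variable Env : EnvelopingAlgebra A.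
Let M := ssm_model V.
Let hM := ssm_is_model V.
Let hmon := ssm_is_monoidal V.
Let Mm := mod_model A M.
Hypothesis hm : is_model_category Mm.
Local Notation Phi := (env_equiv Env).
Local Notation U N := (mod_ob (N : Module A)).

Lemma Phi_lift (N N' : mod_cat A) (g : Hom (Phi N) (Phi N')) : exists f : Hom N N', fmap Phi f = g.
Proof. by have [f [e _]] := env_ff g; exists f. Qed.

Lemma Phi_inj (N N' : mod_cat A) (f g : Hom N N') : fmap Phi f = fmap Phi g -> f = g.
Proof. by move=> e; have [h [_ u]] := env_ff (fmap Phi g); rewrite -(u f e) -(u g). Qed.

Lemma lmod_iso_ob (N N' : LModule Env) (f : @Hom (lmod_cat Env) N N') :
  is_iso f -> is_iso (sval f : Hom (lmod_ob N) (lmod_ob N')).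
Proof. by move=> [g [gf fg]]; exists (sval g); split;
  [exact: (congr1 sval gf) | exact: (congr1 sval fg)]. Qed.

Lemma Phi_TrivFib (N N' : mod_cat A) (p : Hom N N') :
  TrivFib M (sval (fmap Phi p) : Hom (lmod_ob (Phi N)) (lmod_ob (Phi N'))) <-> TrivFib Mm p.
Proof.
exact: (TrivFib_square hM (env_forget_iso Env N) (env_forget_iso Env N') (env_forget_nat Env p)).
Qed.

(** A lifting problem over the monoid is replaced by an isomorphic one in the image of the
    equivalence, where it can be solved among modules over the algebra. *)
Lemma cofibrant_projective (N : mod_cat A) : cofibrant Mm N ->
  lmod_projective (Phi N : LModule Env).
Proof.
move=> cN W W' p b tp; have [X [x ix]] := env_eso (e := Env) W;
  have [Y [y iy]] := env_eso (e := Env) W'.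
have [y' [yy yy']] := iy.
have [p' ep] := Phi_lift (y' ∘ p ∘ x); have [b' eb] := Phi_lift (y' ∘ b).
have sq : y ∘ fmap Phi p' = p ∘ x by rewrite ep -(compmA y') compmA yy' comp1m.
have tp' : TrivFib Mm p'.
  apply/Phi_TrivFib; apply/(TrivFib_square hM (lmod_iso_ob ix) (lmod_iso_ob iy)); last exact: tp.
  exact: (congr1 sval sq).
have [a ea] := cofibrant_lift hm b' cN tp'.
by exists (x ∘ fmap Phi a); rewrite compmA -sq -compmA -fmapM ea eb compmA yy' comp1m.
Qed.

Lemma free_cofibrant (X : V) (N : mod_cat A) (a : Hom (Phi N) (free_lmod Env X : lmod_cat Env)) :
  is_iso a -> cofibrant M X -> cofibrant Mm N.
Proof.
move=> [a' [aa aa']] cX; apply: (cofibrantI hm) => B C p b /Phi_TrivFib tp.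
have [x ex] := cofibrant_lift hM (sval (fmap Phi b ∘ a') ∘ eta Env X) cX tp.
have [f ef] := free_ex (W := Phi B : LModule Env) x.
have [g eg] := Phi_lift ((f : @Hom (lmod_cat Env) _ _) ∘ a).
exists g; apply: Phi_inj; rewrite fmapM eg compmA.
have -> : fmap Phi p ∘ f = fmap Phi b ∘ a'.
  by apply: free_ext; rewrite -ex -ef [RHS]compmA.
by rewrite -compmA aa compm1.
Qed.

(** Maps from [X] to the underlying object are module maps from the free module on [X]. This lets
    fibrancy, which speaks of terminal modules, be compared with fibrancy of underlying objects. *)
Lemma terminal_mod_ob (Z : mod_cat A) : is_terminal Z -> is_terminal (U Z : V).
Proof.
move=> tZ X; have [N [a [a' [aa aa']]]] := env_eso (e := Env) (free_lmod Env X : lmod_cat Env).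
have [f _] := terminal_ex N tZ.
have ext (g h : Hom X (lmod_ob (Phi Z : LModule Env))) : g = h.
  have [g' <-] := free_ex (W := Phi Z : LModule Env) g;
    have [h' <-] := free_ex (W := Phi Z : LModule Env) h.
  suff -> : g' = h' by [].
  have [g'' eg] := Phi_lift ((g' : @Hom (lmod_cat Env) _ _) ∘ a).
  have [h'' eh] := Phi_lift ((h' : @Hom (lmod_cat Env) _ _) ∘ a).
  have : (g' : @Hom (lmod_cat Env) _ _) ∘ a = h' ∘ a by rewrite -eg -eh (terminal_eq g'' h'' tZ).
  by apply: iso_epi; exists a'.
have [i [i1 i2]] := env_forget_iso Env Z.
exists (env_forget Env Z ∘ (sval (fmap Phi f ∘ a') ∘ eta Env X)); split=> // h _.
by rewrite -[RHS]comp1m -i2 -[RHS]compmA; congr (_ ∘ _); exact: ext.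
Qed.

Lemma mod_ob_fibrant (T : mod_cat A) : fibrant Mm T -> fibrant M (U T).
Proof.
move=> fT; have [Z tZ] := complete_terminal (mc_complete hm); have [u _] := terminal_ex T tZ.
apply: (fibrant_Fib hM (fibrant_terminal hM (terminal_mod_ob tZ))); exact: (fT Z u tZ).
Qed.

Lemma fibrant_mod_ob (T : mod_cat A) : fibrant M (U T) -> fibrant Mm T.
Proof. by move=> fT Z u tZ; exact: (fT _ (sval u) (terminal_mod_ob tZ)). Qed.

Section CofibrantPair.
Variable O0 : operad_cat V unit.
Hypothesis iO : is_initial O0.
Hypothesis cOA : cofibrant (pairs_model M) ({| pair_op := O; pair_alg := A |} : pairs_cat V).

(** The free module on the unit is cofibrant, so it is a retract of a module lifting a
    cofibrant replacement of its underlying object. *)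
Lemma env_cofibrant : cofibrant M (mon_ob Env : V).
Proof.
have cI := @ssm_unit_cofibrant V.
have [N [a ia]] := env_eso (e := Env) (free_lmod Env unitI : lmod_cat Env).
have cN := free_cofibrant ia cI.
have [P [q [cP tq]]] := cofibrant_replacement_ex hM (U N).
have [N' [g [i [ii gi]]]] := module_lift hM hmon cI iO cOA cP tq.
have tg : TrivFib Mm g.
  apply: (proj1 (TrivFib_square hM ii (iso_id _) _) tq); by rewrite comp1m gi.
have [s gs] := cofibrant_lift hm (idm N) cN tg.
have cUN : cofibrant M (U N).
  apply: (cofibrant_retract hM (s := sval s) (r := sval g)); first exact: (congr1 sval gs).
  exact: (cofibrant_iso hM ii cP).
have [j [j1 j2]] := env_forget_iso Env N.
apply: (cofibrant_iso hM (f := runit _ ∘ sval a ∘ j)) cUN.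
by apply: iso_comp; [apply: iso_comp; [exact: runit_iso | exact: (lmod_iso_ob ia)] | exists
  (env_forget Env N)].
Qed.
End CofibrantPair.

Hypothesis cE : cofibrant M (mon_ob Env : V).

(** Lifting [U N] against [p] is lifting [N] against the map of cofree modules induced by [p], a
    trivial fibration because [E] is cofibrant. *)
Lemma mod_ob_cofibrant (N : mod_cat A) : cofibrant Mm N -> cofibrant M (U N).
Proof.
move=> /cofibrant_projective pN; apply: (cofibrantI hM) => X Y p b tp.
have [i [i1 i2]] := env_forget_iso Env N.
have [f ef] := cofree_ex (E := Env) (N := Phi N : LModule Env) (b ∘ env_forget Env N).
have [c ec] := cofree_map_ex Env p.
have [|g eg] := pN _ _ c f; first by rewrite ec; exact: ihom_post_TrivFib.
exists (eps Env X ∘ sval g ∘ i).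
have ep : p ∘ eps Env X = eps Env Y ∘ sval c.
  by rewrite ec eps_comp -[ihom_post _ _]compm1 lun_post -[RHS]compmA.
rewrite compmA [p ∘ _]compmA ep -[eps _ _ ∘ _ ∘ _]compmA (congr1 sval eg : sval c ∘ sval g = _) ef.
by rewrite -compmA i2 compm1.
Qed.

Lemma cofree_fibrant (R : V) (W : mod_cat A) (a : Hom (Phi W) (cofree Env R : lmod_cat Env)) :
  is_iso a -> fibrant M R -> fibrant Mm W.
Proof.
move=> ia fR; apply: fibrant_mod_ob; apply: (fibrant_iso hM (env_forget_iso Env W)).
have [a' [a1 a2]] := lmod_iso_ob ia.
apply: (fibrant_iso hM (f := a')); first by exists (sval a).
exact: ihom_fibrant.
Qed.

Lemma Phi_post_WE (N W W' : mod_cat A) (r : Hom W W') :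
  cofibrant Mm N -> fibrant Mm W -> fibrant Mm W' -> WE Mm r ->
  Kan_WE (lmod_post (Phi N : LModule Env) (fmap Phi r) : @Hom sSets _ _).
Proof.
move=> cN; pose P W W' (r : @Hom (mod_cat A) W W') :=
  Kan_WE (lmod_post (Phi N : LModule Env) (fmap Phi r) : @Hom sSets _ _).
apply: (Ken_Brown_fibrant hm (P := P)); rewrite /P.
- by move=> T; rewrite fmap1 lmod_post_id; exact: Kan_WE_iso (iso_id _).
- by move=> B C D g h wg wh; rewrite fmapM lmod_post_comp; exact: Kan_WE_comp.
- by move=> B C D g h wg; rewrite fmapM lmod_post_comp; exact: Kan_WE_left.
move=> B C g _ _ /Phi_TrivFib; apply: lmod_post_TrivFib; exact: cofibrant_projective.
Qed.

Lemma replacement_mod_ob (N N' Q Q' : mod_cat A) (f : Hom N N') (f' : Hom Q Q') :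
  cofibrant_replacement_map Mm f f' ->
  cofibrant_replacement_map M (sval f : Hom (U N) (U N')) (sval f' : Hom (U Q) (U Q')).
Proof.
move=> [q [q' [[cQ tq] [cQ' tq'] h]]]; exists (sval q), (sval q').
split; [split=> //; exact: mod_ob_cofibrant | split=> //; exact: mod_ob_cofibrant |].
exact: (congr1 sval h).
Qed.

Lemma Kan_pre_forget (N N' : mod_cat A) (f : Hom N N') (R : V) :
  Kan_pre R (sval (fmap Phi f) : Hom (lmod_ob (Phi N)) (lmod_ob (Phi N'))) <->
  Kan_pre R (sval f : Hom (U N) (U N')).
Proof.
have w X := Kan_pre_iso R (env_forget_iso Env X).
have h := env_forget_nat Env f; split=> k.
  apply: (Kan_pre_right (w N)); rewrite -h; exact: Kan_pre_comp.
apply: (Kan_pre_left (w N')); rewrite h; exact: Kan_pre_comp.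
Qed.

Lemma Kan_WE_mod_cofree (N N' W : mod_cat A) (f : Hom N N') (R : V)
    (a : Hom (Phi W) (cofree Env R : lmod_cat Env)) : is_iso a ->
  (Kan_WE (Map_pre (mod_maps Env) W f) <-> Kan_pre R (sval f : Hom (U N) (U N'))).
Proof.
move=> ia; apply: iff_trans (Kan_pre_forget f R).
apply: iff_trans (Kan_WE_cofree R (fmap Phi f)).
have i B := Kan_WE_iso (lmod_post_iso (Phi B : LModule Env) ia).
exact: (Kan_WE_square (i N') (i N) (lmod_pre_post (fmap Phi f) a)).
Qed.
End Transport.

(** * The forgetful functor and localization *)

Section Main.
Variables (V : SimplicialSymMonModelCat) (O : Operad V unit) (A : Algebra O).
Variable Env : EnvelopingAlgebra A.
Let M := ssm_model V.
Let hM := ssm_is_model V.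
Let hmon := ssm_is_monoidal V.
Let Mm := mod_model A M.
Hypothesis hm : is_model_category Mm.
Hypothesis cE : cofibrant M (mon_ob Env : V).
Variable S : MorClass V.
Local Notation Phi := (env_equiv Env).
Local Notation U N := (mod_ob (N : Module A)).
Local Notation equiv := (local_equivalence M (ssm_maps V) S).
Local Notation SA := (env_tensor Env S).

(** A replacement [f'] of [f] is turned into the module map [E ⊗ f'], which is tested against a
    fibrant replacement [T'] of the module; freeness translates the result back to [f']. *)
Lemma forget_local (T : mod_cat A) :
  local_object Mm (mod_maps Env) SA T -> local_object M (ssm_maps V) S (U T : V).
Proof.
move=> lT X Y f sf QX QY R f' r rf [fR [cr wr]]; apply/Kan_WE_Map_pre.
have [q [q' [[cQX tq] [cQY tq'] qf]]] := rf.
have [N [a ia]] := env_eso (e := Env) (free_lmod Env QX : lmod_cat Env).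
have [N' [b ib]] := env_eso (e := Env) (free_lmod Env QY : lmod_cat Env).
have [b' [bb bb']] := ib.
have [g eg] := Phi_lift (b' ∘ (free_lmod_map Env f' : @Hom (lmod_cat Env) _ _) ∘ a).
have sq : b ∘ fmap Phi g = (free_lmod_map Env f' : @Hom (lmod_cat Env) _ _) ∘ a.
  by rewrite eg -(compmA b') [LHS]compmA bb' comp1m.
have sg : SA g by apply: EnvTensor sf rf ia ib sq _; exact: homotopic_refl.
have [T' [t [fT' [ct wt]]]] := fibrant_replacement_ex hm T.
have cN := free_cofibrant hm ia cQX; have cN' := free_cofibrant hm ib cQY.
have kg : Kan_WE (lmod_Map_pre (Phi T' : LModule Env) (fmap Phi g) : @Hom sSets _ _).
  apply: (lT _ _ _ sg _ _ T' g t) => //; exists (idm N), (idm N').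
  by split; [exact: cofibrant_replacement_id | exact: cofibrant_replacement_id | rewrite compm1
    comp1m].
have kf : Kan_pre (lmod_ob (Phi T' : LModule Env)) f'.
  apply: (proj1 (Kan_WE_free (Phi T' : LModule Env) f')).
  apply: (proj2 (Kan_WE_square (Kan_WE_iso (lmod_pre_iso (Phi T' : LModule Env) ib))
    (Kan_WE_iso (lmod_pre_iso (Phi T' : LModule Env) ia)) _)) kg.
  by rewrite -!lmod_pre_comp sq.
have fUT := mod_ob_fibrant Env hm fT'.
have [i [i1 i2]] := env_forget_iso Env T'.
(* The given replacement [R] of [U T] and the underlying object of [T'] may differ; extending along
   [r] yields a weak equivalence between these fibrant objects. *)
have [k kr] := fibrant_ext hM (i ∘ (sval t : Hom (U T) (U T'))) (fibrant_iso hM (f := i)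
  (ex_intro _ (env_forget Env T') (conj i2 i1)) fUT) (conj cr wr).
have fPT : fibrant M (lmod_ob (Phi T' : LModule Env)).
  by apply: (fibrant_iso hM (f := i)) fUT; exists (env_forget Env T').
apply: (proj2 (Kan_pre_target (g := k) f' cQX cQY fR fPT _)) kf.
apply: (mc_WE_right hM wr); rewrite kr; apply: (mc_WE_comp hM); first exact: wt.
by apply: (WE_iso hM); exists (env_forget Env T').
Qed.

Hypothesis S_tensor_closed : derived_tensor_closed equiv.

(** The class [env_tensor] contains every map homotopic to some [E ⊗ f']. The two ends of a cylinder
    are weak equivalences, so the property passes through the homotopy by cancellation. *)
Lemma local_equivalence_homotopic (N N' : mod_cat A) (g h : Hom N N') :
  homotopic Mm g h -> equiv (sval g : Hom (U N) (U N')) -> equiv (sval h : Hom (U N) (U N')).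
Proof.
move=> [Q [R [q [r [[_ [_ wq]] [_ [_ wr]] [Cyl [i0 [i1 [p [H [wp e0 e1 h0 h1]]]]]]]]]]] eg.
have W (X Y : mod_cat A) (f : @Hom (mod_cat A) X Y) : WE Mm f -> equiv (sval f : Hom (U X) (U Y)).
  by move=> wf; apply: local_equivalence_WE; exact: wf.
have wi i : p ∘ i = idm Q -> equiv (sval i : Hom (U Q) (U Cyl)).
  move=> e; apply: W; apply: (mc_WE_left hm wp); rewrite e; exact: WE_id.
have eH : equiv (sval H : Hom (U Cyl) (U R)).
  apply: (local_equivalence_right (wi i0 e0)); rewrite (congr1 sval h0 : sval H ∘ sval i0 = _).
  apply: (local_equivalence_comp (W _ _ q wq)).
  exact: (local_equivalence_comp eg (W _ _ r wr)).
have : equiv (sval r ∘ sval h ∘ sval q : Hom (U Q) (U R)).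
  have eh : sval H ∘ sval i1 = sval r ∘ sval h ∘ sval q := congr1 sval h1.
  rewrite -eh; exact: (local_equivalence_comp (wi i1 e1) eH).
move=> /(local_equivalence_right (W _ _ q wq)); exact: (local_equivalence_left (W _ _ r wr)).
Qed.

Lemma env_tensor_equivalence (N N' : mod_cat A) (h : Hom N N') :
  SA h -> equiv (sval h : Hom (U N) (U N')).
Proof.
case=> X Y QX QY f f' {}N {}N' a b g {}h sf rf ia ib sq hgh.
apply: (local_equivalence_homotopic hgh).
have W (B B' : V) (k : Hom B B') : is_iso k -> equiv k.
  by move=> ik; apply: local_equivalence_WE; exact: (WE_iso hM).
(* As [E] is cofibrant, [E ⊗ f'] is the derived tensor product of the identity of [E] with [f], both
   of which are local equivalences. *)
have et : equiv (idm (mon_ob Env) ⊗m f').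
  apply: S_tensor_closed (rf); first exact: (W _ _ _ (iso_id (mon_ob Env))).
    exact: (local_equivalence_base sf).
  exists (idm _), (idm _); split; rewrite ?compm1 //; exact: cofibrant_replacement_id.
have eP : equiv (sval (fmap Phi g) : Hom (lmod_ob (Phi N)) (lmod_ob (Phi N'))).
  apply: (local_equivalence_left (W _ _ _ (lmod_iso_ob ib))).
  rewrite (congr1 sval sq : sval b ∘ sval (fmap Phi g) = _).
  exact: (local_equivalence_comp (W _ _ _ (lmod_iso_ob ia)) et).
apply: (local_equivalence_right (W _ _ _ (env_forget_iso Env N))); rewrite -env_forget_nat.
exact: (local_equivalence_comp eP (W _ _ _ (env_forget_iso Env N'))).
Qed.

(** Maps into the cofree module are maps of underlying objects into [R], so locality follows from
    [env_tensor_equivalence]. The module [W] is already fibrant, and passing to an arbitrary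
    replacement [RW] is a weak equivalence on mapping spaces. *)
Lemma cofree_local (Z R : V) (z : Hom Z R) (W : mod_cat A)
    (a : Hom (Phi W) (cofree Env R : lmod_cat Env)) : is_iso a ->
  local_object M (ssm_maps V) S Z -> fibrant_replacement M z ->
  local_object Mm (mod_maps Env) SA W.
Proof.
move=> ia lZ hz N N' h sh QN QN' RW h' r rh [fRW [_ wr]].
have fW := cofree_fibrant cE ia hz.1.
have [q [q' [[cQ _] [cQ' _] _]]] := rh.
have k : Kan_WE (Map_pre (mod_maps Env) W h').
  apply: (proj2 (Kan_WE_mod_cofree h' ia)).
  have /local_equivalenceP es := env_tensor_equivalence sh.
  exact: (es Z lZ R z hz _ _ _ (replacement_mod_ob hm cE rh)).
have w B (cB : cofibrant Mm B) := Phi_post_WE Env hm cB fW fRW wr.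
exact: (proj1 (Kan_WE_square (w QN' cQ') (w QN cQ) (lmod_pre_post (fmap Phi h') (fmap Phi r)))) k.
Qed.

(** For each local [Z] with fibrant replacement [R], the cofree module on [R] is a fibrant local
    test object that sees exactly the maps of underlying objects into [R]. *)
Lemma forget_equivalence (N N' : mod_cat A) (f : Hom N N') :
  local_equivalence Mm (mod_maps Env) SA f -> equiv (sval f : Hom (U N) (U N')).
Proof.
move=> ef; apply/local_equivalenceP => Z lZ R z hz.
have [W [a ia]] := env_eso (e := Env) (cofree Env R : lmod_cat Env).
have lW := cofree_local ia lZ hz.
have [Q [q hq]] := cofibrant_replacement_ex hm N;
  have [Q' [q' hq']] := cofibrant_replacement_ex hm N'.
have [f' ef'] := cofibrant_replacement_map_ex hm f hq hq'.
have rf : cofibrant_replacement_map Mm f f' by exists q, q'.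
apply: (derivedI hM (@Kan_pre_comp V R) (@Kan_pre_left V R) (@Kan_pre_right V R) _
  (replacement_mod_ob hm cE rf)).
  by move=> *; apply: Kan_pre_WE => //; exact: hz.1.
apply: (proj1 (Kan_WE_mod_cofree f' ia)).
exact: (ef W lW _ _ W f' (idm W) rf (fibrant_replacement_id hm (cofree_fibrant cE ia hz.1))).
Qed.
End Main.

Theorem corollary4p17
  (C : SimplicialSymMonModelCat)
  (* colored operads in [C] have the underlying model structure *)
  (operads_model : forall K : SmallSet,
     is_model_category (operad_model (V := C) K (ssm_model C)) /\
     cofibrantly_generated (operad_model (V := C) K (ssm_model C)))
  (C_cofibrantly_generated : cofibrantly_generated (ssm_model C))
  (C_small : forall X : C, small_object (C := C) X)
  (S : MapSet C)
  (S_tensor_closed : derived_tensor_closed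
     (local_equivalence (ssm_model C) (ssm_maps C) (representative (ssm_model C) S)))
  (OO : Operad C nat) (OO_trees : is_operad_O OO)
  (PP : Operad C (option nat)) (PP_trees : is_operad_P PP)
  (OO_strongly_admissible : strongly_admissible (ssm_model C) OO)
  (PP_strongly_admissible : strongly_admissible (ssm_model C) PP)
  (O : Operad C unit) (A : Algebra O)
  (OA_cofibrant : cofibrant (pairs_model (ssm_model C))
     ({| pair_op := O; pair_alg := A |} : pairs_cat C))
  (A_preserves : derived_tensor_preserves (A tt)
     (local_equivalence (ssm_model C) (ssm_maps C) (representative (ssm_model C) S)))
  (Env : EnvelopingAlgebra (V := C) A)
  (modules_model : is_model_category (mod_model A (ssm_model C)))
  (modules_good : has_good_localization (mod_model A (ssm_model C)) (mod_maps Env)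
     (env_tensor Env (representative (ssm_model C) S)))
  (M M' : mod_cat A) (f : Hom M M')
  (f_localization : is_localization (mod_model A (ssm_model C)) (mod_maps Env)
     (env_tensor Env (representative (ssm_model C) S)) f) :
  is_localization (ssm_model C) (ssm_maps C) (representative (ssm_model C) S)
    (sval f : Hom (mod_ob M) (mod_ob M')).
Proof.
(* Cocompleteness of the category of one-coloured operads provides the initial operad from which the
   initial pair is built. *)
have [O0 iO] := cocomplete_initial (mc_cocomplete (operads_model unit).1).
have cE := env_cofibrant (Env := Env) modules_model iO OA_cofibrant.
have [ef lM'] := f_localization; split; first exact: (forget_equivalence modules_model cE S_tensor_closed ef).
exact: (forget_local modules_model lM').
Qed.
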